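(* Let $G$ be a finite group and let $\underline{\mathcal C}$ be a $G$-category with finite indexed products. There is a canonical equivalence $$\mathrm{CMon}_G(\underline{\mathcal C})\simeq\mathrm{CAlg}_G(\underline{\mathcal C}^{\underline\times}).$$
   Context: ''Category'' means $\infty$-category. A $G$-category is a functor $\mathcal O_G^{op}\to\mathrm{Cat}_\infty$ on the opposite of the orbit category, equivalently a cocartesian fibration over $\mathcal O_G^{op}$; $\mathcal C_V$ is the value of $\underline{\mathcal C}$ at $V\in\mathcal O_G$, $\mathcal C_H=\mathcal C_{G/H}$, and $\underline{\mathcal C}_H$ is the $H$-category obtained by restriction along $\mathcal O_H\simeq(\mathcal O_G)_{/(G/H)}\to\mathcal O_G$. $G$-functors are natural transformations (equivalently, functors over $\mathcal O_G^{op}$ preserving cocartesian edges); $\mathrm{Fun}_G$ denotes the category of $G$-functors. For $f\colon V\to W$ in $\mathcal O_G$, $f^*\colon\mathcal C_W\to\mathcal C_V$ is restriction. $\underline{\mathcal C}$ has finite indexed products if all $\mathcal C_V$ have finite products preserved by the $f^*$, and each $f^*$ has a right adjoint $f_*$ (the indexed product along $f$) satisfying the base-change (Beck–Chevalley) condition along pullbacks of finite $G$-sets. $\underline{\mathrm{Fin}}_*$ is the $G$-category $G/H\mapsto\mathrm{Fun}(BH,\mathrm{Fin}_* )$. Equivalently, objects over $G/H$ are maps of finite $G$-sets $[U\to G/H]$, and a morphism $[U\to G/H]\to[W\to G/K]$ is a span $U\leftarrow Z\to W$ over $G/H\leftarrow G/K=G/K$ with $Z\to U\times_{G/H}G/K$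 a summand inclusion. It is inert if $Z\to W$ is an isomorphism; fibrewise means lying over an identity of $\mathcal O_G^{op}$; inert maps are written $\rightarrowtail$. For an orbit $W\subseteq U$ the characteristic morphism $\chi_{[W\subseteq U]}\colon[U\to G/H]\to[W=W]$ is the inert map given by $U\leftarrow W=W$ over $G/H\leftarrow W=W$. $\mathrm{CMon}_G(\underline{\mathcal C})$ is the full subcategory of $\mathrm{Fun}_G(\underline{\mathrm{Fin}}_*,\underline{\mathcal C})$ on those $F$ such that for every $[U\to G/H]$ with orbit decomposition $U=\coprod_{j=1}^nU_j$, $u_j\colon U_j\to G/H$, the map $F([U\to G/H])\to\prod_{j=1}^nu_{j*}F([U_j=U_j])$ in $\mathcal C_H$ adjoint to the maps induced by $\chi_{[U_j\subseteq U]}$ is an equivalence. $G$-symmetric monoidal categories and algebras. A $G$-symmetric monoidal category is a ($G$-)cocartesian fibration $\underline{\mathcal D}^{\underline\otimes}\to\underline{\mathrm{Fin}}_*$ such that for every $[U\to G/H]$ with orbits $U_j$ the characteristic morphisms induce an equivalence $\mathcal D^{\underline\otimes}_{[U\to G/H]}\simeq\prod_j\mathcal D_{U_j}$, where $\mathcal D_{V}$ is the fibre over $[V=V]$. $\mathrm{CAlg}_G(\underline{\mathcal D}^{\underline\otimes})=\mathrm{Fun}^{\mathrm{int}}_{/\underline{\mathrm{Fin}}_*}(\underline{\mathrm{Fin}}_*,\underline{\mathcal D}^{\underline\otimes})$ is the category of sections that are $G$-functors sending (fibrewise) inert morphisms to cocartesian morphisms. The $G$-cartesian structure $\underline{\mathcal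 C}^{\underline\times}$. Let $\underline\Gamma^{\underline\times}$ be the full $G$-subcategory of the (fibrewise) arrow $G$-category $\underline{\mathrm{Fin}}_*^{\Delta^1}$ on fibrewise inert morphisms; write $[U\rightarrowtail V]_{G/H}$ for its objects over $G/H$, and $\mathrm{ev}_0\colon\underline\Gamma^{\underline\times}\to\underline{\mathrm{Fin}}_*$ for evaluation at the source. Let $\overline{\underline{\mathcal C}}^{\underline\times}\to\underline{\mathrm{Fin}}_*$ be the $G$-cocartesian fibration characterised by natural equivalences $\mathrm{Fun}_{G,/\underline{\mathrm{Fin}}_*}(\underline{\mathcal K},\overline{\underline{\mathcal C}}^{\underline\times})\simeq\mathrm{Fun}_G(\underline{\mathcal K}\times_{\underline{\mathrm{Fin}}_*}\underline\Gamma^{\underline\times},\underline{\mathcal C})$ for $G$-categories $\underline{\mathcal K}$ over $\underline{\mathrm{Fin}}_*$ (pullback along $\mathrm{ev}_0$). Its objects over $[U\to G/H]$ are $H$-functors $F\colon\underline\Gamma^{\underline\times}_{[U\to G/H]}\to\underline{\mathcal C}_H$, where $\underline\Gamma^{\underline\times}_{[U\to G/H]}$ is the $H$-category of fibrewise inert maps out of (restrictions of) $U$. Then $\underline{\mathcal C}^{\underline\times}\subseteq\overline{\underline{\mathcal C}}^{\underline\times}$ is the full subcategory on those $F$ such that for all $K\le H$ and all $K$-objects $[U\rightarrowtail V]_{G/K}$, with orbits $v_j\colon V_j\to G/K$ of $V$, the map $F([U\rightarrowtail V]_{G/K})\to\prod_jv_{j*}F([U\rightarrowtail V\rightarrowtail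 V_j]_{V_j})$ induced by the characteristic maps $\chi_{[V_j\subseteq V]}$ is an equivalence. The composite $\underline{\mathcal C}^{\underline\times}\to\underline{\mathrm{Fin}}_*$ is a $G$-symmetric monoidal structure on $\underline{\mathcal C}$. *)

(* Defs.v *)
From mathcomp Require Import all_boot all_fingroup boolp.

Set Implicit Arguments.
Unset Strict Implicit.
Unset Printing Implicit Defensive.

(* Infinity-categories are quasi-categories; the 1-categories of the statement
   (orbits, finite pointed G-sets, fibrewise inert arrows) enter through their
   nerves.  References of the form HTT are to Lurie, Higher Topos Theory. *)

Record category := Category {
  Ob :> Type;
  Hom : Ob -> Ob -> Type;
  idc : forall a, Hom a a;
  cmp : forall a b c, Hom b c -> Hom a b -> Hom a c;
  cmp_idl : forall a b (f : Hom a b), cmp (idc b) f = f;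
  cmp_idr : forall a b (f : Hom a b), cmp f (idc a) = f;
  cmpA : forall a b c d (h : Hom c d) (g : Hom b c) (f : Hom a b),
    cmp h (cmp g f) = cmp (cmp h g) f }.

Arguments idc {_} a.
Arguments cmp {_ a b c} g f.

Record functor (A B : category) := Functor {
  fo :> A -> B;
  fm : forall a b, Hom a b -> Hom (fo a) (fo b);
  fm_id : forall a, fm (idc a) = idc (fo a);
  fm_cmp : forall a b c (g : Hom b c) (f : Hom a b),
    fm (cmp g f) = cmp (fm g) (fm f) }.

Arguments fm {A B} F {a b} f : rename.

Lemma functor_eq (A B : category) (o : A -> B)
    (m : forall a b, Hom a b -> Hom (o a) (o b)) i i' c c' :
  @Functor A B o m i c = @Functor A B o m i' c'.
Proof. by rewrite (Prop_irrelevance i i') (Prop_irrelevance c c'). Qed.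

Program Definition functor_comp (A B C : category) (F : functor B C)
    (E : functor A B) : functor A C :=
  @Functor A C (fun a => F (E a)) (fun a b f => fm F (fm E f)) _ _.
Next Obligation. by rewrite !fm_id. Qed.
Next Obligation. by rewrite !fm_cmp. Qed.

Program Definition op (A : category) : category :=
  @Category A (fun a b => @Hom A b a) (fun a => idc a)
    (fun a b c g f => @cmp A c b a f g) _ _ _.
Next Obligation. by rewrite cmp_idr. Qed.
Next Obligation. by rewrite cmp_idl. Qed.
Next Obligation. by rewrite cmpA. Qed.

Record simp m n := Simp {
  sf :> 'I_m.+1 -> 'I_n.+1;
  sf_mono : forall i j : 'I_m.+1, i <= j -> sf i <= sf j }.

Lemma simp_eq m n (f g : simp m n) : f =1 g -> f = g.
Proof.
case: f g => [f f'] [g g'] /= /funext fg; rewrite fg in f' *.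
by rewrite (Prop_irrelevance f' g').
Qed.

Definition simp_id n : simp n n := @Simp n n (fun i => i) (fun _ _ l => l).

Definition simp_comp m n k (g : simp n k) (f : simp m n) : simp m k :=
  @Simp m k (fun i => g (f i)) (fun i j l => sf_mono g (sf_mono f l)).

Definition simp_cst m n (i : 'I_n.+1) : simp m n :=
  @Simp m n (fun=> i) (fun _ _ _ => leqnn i).

Program Definition simp_face n (i : 'I_n.+2) : simp n n.+1 :=
  @Simp n n.+1 (lift i) _.
Next Obligation. by rewrite leq_bump2. Qed.

(* [simp_cone f] is the join of [f] with the identity of the point, the cone
   point being the last vertex. *)
Definition simp_cone_fun m n (f : simp m n) (i : 'I_m.+2) : 'I_n.+2 :=
  if unlift ord_max i is Some i' then lift ord_max (f i') else ord_max.

Program Definition simp_cone m n (f : simp m n) : simp m.+1 n.+1 :=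
  @Simp m.+1 n.+1 (simp_cone_fun f) _.
Next Obligation.
rewrite /simp_cone_fun; case: (unliftP ord_max j) => [j'|] ej; last exact: leq_ord.
have lmax k (i' : 'I_k.+1) : lift ord_max i' = i' :> nat.
  by rewrite /= /bump leqNgt ltn_ord.
case: (unliftP ord_max i) => [i'|] ei; move: H; rewrite ei ej !lmax.
  exact: sf_mono.
by rewrite leqNgt ltn_ord.
Qed.

Record sSet := SSet {
  sob :> nat -> Type;
  sact : forall m n, simp m n -> sob n -> sob m;
  sact_id : forall n (x : sob n), sact (simp_id n) x = x;
  sact_comp : forall m n k (g : simp n k) (f : simp m n) (x : sob k),
    sact (simp_comp g f) x = sact f (sact g x) }.

Arguments sact {_ m n} f x.

Record smap (X Y : sSet) := SMap {
  sm :> forall n, X n -> Y n;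
  sm_nat : forall m n (f : simp m n) (x : X n), sm (sact f x) = sact f (sm x) }.

Lemma smap_eq (X Y : sSet) (f g : smap X Y) :
  (forall n x, f n x = g n x) -> f = g.
Proof.
case: f g => [f f'] [g g'] /= e.
have {}e : f = g by apply: functional_extensionality_dep => n; apply/funext/e.
by rewrite e in f' *; rewrite (Prop_irrelevance f' g').
Qed.

Definition smap_id (X : sSet) : smap X X :=
  @SMap X X (fun n x => x) (fun _ _ _ _ => erefl).

Program Definition smap_comp (X Y Z : sSet) (g : smap Y Z) (f : smap X Y) :
    smap X Z :=
  @SMap X Z (fun n x => g n (f n x)) _.
Next Obligation. by rewrite !sm_nat. Qed.

Program Definition simplex n : sSet :=
  @SSet (fun m => simp m n) (fun m k f x => simp_comp x f) _ _.
Next Obligation. exact: simp_eq. Qed.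

Program Definition yoneda (X : sSet) n (x : X n) : smap (simplex n) X :=
  @SMap (simplex n) X (fun m f => sact f x) _.
Next Obligation. exact: sact_comp. Qed.

Program Definition sprod (X Y : sSet) : sSet :=
  @SSet (fun n => (X n * Y n)%type) (fun m n f x => (sact f x.1, sact f x.2)) _ _.
Next Obligation. by rewrite !sact_id. Qed.
Next Obligation. by rewrite !sact_comp. Qed.

Lemma sig_eq (T : Type) (P : T -> Prop) (x y : sig P) : sval x = sval y -> x = y.
Proof. by case: x y => [x x'] [y y'] /= e; apply: eq_exist. Qed.

Definition stable (X : sSet) (P : forall n, X n -> Prop) :=
  forall m n (f : simp m n) (x : X n), P n x -> P m (sact f x).

Program Definition ssub (X : sSet) (P : forall n, X n -> Prop)
    (HP : stable P) : sSet :=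
  @SSet (fun n => {x : X n | P n x})
    (fun m n f x => exist _ (sact f (sval x)) (HP _ _ f _ (svalP x))) _ _.
Next Obligation. by apply: sig_eq; rewrite /= sact_id. Qed.
Next Obligation. by apply: sig_eq; rewrite /= sact_comp. Qed.

Definition sincl (X : sSet) (P : forall n, X n -> Prop) (HP : stable P) :
    smap (ssub HP) X :=
  @SMap (ssub HP) X (fun n x => sval x) (fun _ _ _ _ => erefl).

Definition vertex (X : sSet) n (x : X n) (i : 'I_n.+1) : X 0 :=
  sact (simp_cst 0 i) x.
Definition src (X : sSet) (e : X 1) : X 0 := vertex e ord0.
Definition tgt (X : sSet) (e : X 1) : X 0 := vertex e ord_max.
Definition cst (X : sSet) n (x : X 0) : X n := sact (simp_cst n ord0) x.

Lemma pullback_stable (X Y S : sSet) (f : smap X S) (g : smap Y S) :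
  stable (fun n (z : sprod X Y n) => f n z.1 = g n z.2).
Proof. by move=> m n a z /= e; rewrite !sm_nat e. Qed.

Definition pullback (X Y S : sSet) (f : smap X S) (g : smap Y S) : sSet :=
  ssub (@pullback_stable X Y S f g).

Program Definition pr1 (X Y S : sSet) (f : smap X S) (g : smap Y S) :
    smap (pullback f g) X :=
  @SMap (pullback f g) X (fun n z => (sval z).1) _.
Program Definition pr2 (X Y S : sSet) (f : smap X S) (g : smap Y S) :
    smap (pullback f g) Y :=
  @SMap (pullback f g) Y (fun n z => (sval z).2) _.

Lemma fibre_stable (X S : sSet) (p : smap X S) (s : S 0) :
  stable (fun n (x : X n) => p n x = cst n s).
Proof. by move=> m n a x e; rewrite sm_nat e /cst -sact_comp. Qed.

Definition fibre (X S : sSet) (p : smap X S) (s : S 0) : sSet :=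
  ssub (@fibre_stable X S p s).

Lemma full_stable (X : sSet) (P : X 0 -> Prop) :
  stable (fun n (x : X n) => forall i : 'I_n.+1, P (vertex x i)).
Proof.
move=> m n a x Px i; rewrite /vertex -sact_comp.
have -> : simp_comp a (simp_cst 0 i) = simp_cst 0 (a i) by exact: simp_eq.
exact: Px.
Qed.

Definition full (X : sSet) (P : X 0 -> Prop) : sSet := ssub (@full_stable X P).

Program Definition Fun (A B : sSet) : sSet :=
  @SSet (fun n => smap (sprod A (simplex n)) B)
    (fun m n f h => @SMap (sprod A (simplex m)) B
       (fun k x => h k (x.1, simp_comp f x.2)) _) _ _.
Next Obligation.
by rewrite -sm_nat /=; congr (h _ (_, _)); apply: simp_eq.
Qed.
Next Obligation.
by apply: smap_eq => k [a t] /=; congr (x _ (_, _)); apply: simp_eq.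
Qed.
Next Obligation.
by apply: smap_eq => i [a t] /=; congr (x _ (_, _)); apply: simp_eq.
Qed.

Lemma FunOver_stable (A B S : sSet) (r : smap A S) (q : smap B S) :
  stable (fun n (h : Fun A B n) => forall m x, q m (h m x) = r m x.1).
Proof. by move=> m n a h e k x /=; rewrite e. Qed.

Definition FunOver (A B S : sSet) (r : smap A S) (q : smap B S) : sSet :=
  ssub (@FunOver_stable A B S r q).

Definition app (A B S : sSet) (r : smap A S) (q : smap B S)
    (h : FunOver r q 0) n (a : A n) : B n :=
  sval h n (a, simp_cst n ord0).

Program Definition fun_vertex (A B : sSet) (f : smap A B) : Fun A B 0 :=
  @SMap (sprod A (simplex 0)) B (fun n x => f n x.1) _.
Next Obligation. exact: sm_nat. Qed.

Lemma horn_stable n (k : 'I_n.+1) :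
  stable (fun m (f : simplex n m) => exists2 i, i != k & forall j, f j != i).
Proof. by move=> m l a f [i ik fi]; exists i => // j; apply: fi. Qed.

Definition horn n (k : 'I_n.+1) : sSet := ssub (@horn_stable n k).

Lemma boundary_stable n :
  stable (fun m (f : simplex n m) => exists i, forall j, f j != i).
Proof. by move=> m l a f [i fi]; exists i => j; apply: fi. Qed.

Definition boundary n : sSet := ssub (@boundary_stable n).

(* d_2 t = f, d_0 t = g and d_1 t = h: the edge h is a composite of g after f. *)
Definition composite (X : sSet) (f g h : X 1) :=
  exists t : X 2, [/\ sact (simp_face ord_max) t = f,
    sact (simp_face ord0) t = g & sact (simp_face (inord 1)) t = h].

Definition is_equiv (X : sSet) (e : X 1) :=
  exists e' : X 1, composite e e' (cst 1 (src e)) /\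
                   composite e' e (cst 1 (tgt e)).

Definition cat_equivalence (X Y : sSet) (f : smap X Y) :=
  exists g : smap Y X,
    (exists e : Fun X X 1, [/\ src e = fun_vertex (smap_comp g f),
       tgt e = fun_vertex (smap_id X) & is_equiv e]) /\
    (exists e : Fun Y Y 1, [/\ src e = fun_vertex (smap_comp f g),
       tgt e = fun_vertex (smap_id Y) & is_equiv e]).

(* F restricts to an equivalence between the full subcategories P and Q;
   in particular it maps the first to the second. *)
Definition restricts_to_equivalence (X Y : sSet) (F : smap X Y)
    (P : X 0 -> Prop) (Q : Y 0 -> Prop) :=
  exists Phi : smap (full P) (full Q),
    (forall n x, sval (Phi n x) = F n (sval x)) /\ cat_equivalence Phi.

(* Every lifting problem of the horn inclusion against p has a solution, among
   the problems whose restriction to the horn satisfies P. *)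
Definition horn_lifting (X S : sSet) (p : smap X S) n (k : 'I_n.+1)
    (P : smap (horn k) X -> Prop) :=
  forall (h : smap (horn k) X) (t : smap (simplex n) S),
    P h -> (forall m y, p m (h m y) = t m (sval y)) ->
    exists l : smap (simplex n) X,
      (forall m y, l m (sval y) = h m y) /\ (forall m y, p m (l m y) = t m y).

Definition inner_fibration (X S : sSet) (p : smap X S) :=
  forall n (k : 'I_n.+1), 0 < k < n -> horn_lifting p (fun _ : smap (horn k) X => True).

(* HTT 2.4.1.4: the horn maps whose edge {0,1}, respectively {n-1,n}, is e. *)
Definition cocartesian (X S : sSet) (p : smap X S) (e : X 1) :=
  forall n, horn_lifting p (fun h : smap (@horn n.+2 ord0) X =>
    forall y : @horn n.+2 ord0 1,
      (forall i : 'I_2, sval y i = i :> nat) -> h 1 y = e).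

Definition cartesian (X S : sSet) (p : smap X S) (e : X 1) :=
  forall n, horn_lifting p (fun h : smap (@horn n.+2 ord_max) X =>
    forall y : @horn n.+2 ord_max 1,
      (forall i : 'I_2, sval y i = n.+1 + i :> nat) -> h 1 y = e).

Definition cocartesian_fibration (X S : sSet) (p : smap X S) :=
  inner_fibration p /\
  forall (f : S 1) (x : X 0), p 0 x = src f ->
    exists e : X 1, [/\ p 1 e = f, src e = x & cocartesian p e].

Definition cartesian_fibration (X S : sSet) (p : smap X S) :=
  inner_fibration p /\
  forall (f : S 1) (x : X 0), p 0 x = tgt f ->
    exists e : X 1, [/\ p 1 e = f, tgt e = x & cartesian p e].

(* The slice of Z over the discrete diagram Y: an m-simplex is a map to Z from
   the join of the m-simplex with the discrete set 'I_n, restricting to Y. *)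
Definition slice_raw (Z : sSet) n m : Type := (Z m * ('I_n -> Z m.+1))%type.

Definition in_slice (Z : sSet) n (Y : 'I_n -> Z 0) m (x : slice_raw Z n m) :=
  forall j, sact (simp_face ord_max) (x.2 j) = x.1 /\
            vertex (x.2 j) ord_max = Y j.

Lemma simp_cone_face m n (f : simp m n) :
  simp_comp (simp_cone f) (simp_face ord_max) =
  simp_comp (simp_face ord_max) f.
Proof. by apply: simp_eq => i /=; rewrite /simp_cone_fun liftK. Qed.

Lemma simp_cone_max m n (f : simp m n) : simp_cone f ord_max = ord_max.
Proof. by rewrite /= /simp_cone_fun unlift_none. Qed.

Program Definition slice (Z : sSet) n (Y : 'I_n -> Z 0) : sSet :=
  @SSet (fun m => {x : slice_raw Z n m | in_slice Y x})
    (fun m k f x => exist _ (sact f (sval x).1,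
       fun j => sact (simp_cone f) ((sval x).2 j)) _) _ _.
Next Obligation.
move=> j /=; case: (H j) => <- <-; rewrite -!sact_comp simp_cone_face.
split=> //; rewrite /vertex -sact_comp; congr (sact _ _).
by apply: simp_eq => i; apply: simp_cone_max.
Qed.
Next Obligation.
apply: sig_eq; rewrite /= sact_id [RHS]surjective_pairing; congr (_, _).
apply/funext => j; rewrite /= -[RHS]sact_id; congr (sact _ _).
by apply: simp_eq => i /=; rewrite /simp_cone_fun; case: unliftP.
Qed.
Next Obligation.
apply: sig_eq; rewrite /= sact_comp; congr (_, _).
apply/funext => j; rewrite /= -sact_comp; congr (sact _ _).
apply: simp_eq => i /=; rewrite {1 3}/simp_cone_fun; case: unliftP => [i' _|_].
  by rewrite /simp_cone_fun liftK.
by rewrite /simp_cone_fun unlift_none.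
Qed.

(* HTT 1.2.12.3 and 1.2.12.5: the slice over z projects to Z by a trivial
   fibration. *)
Definition final (Z : sSet) (z : Z 0) :=
  forall m (b : smap (boundary m.+1) Z),
    (forall y : boundary m.+1 0, sval y ord0 = ord_max -> b 0 y = z) ->
    exists l : smap (simplex m.+1) Z, forall k y, l k (sval y) = b k y.

(* The edges pi j out of P exhibit P as a product of their targets. *)
Definition product_cone (Z : sSet) n (P : Z 0) (pi : 'I_n -> Z 1) :=
  exists x : slice (fun j => tgt (pi j)) 0, sval x = (P, pi) /\ final x.

Definition has_finite_products (Z : sSet) :=
  forall n (Y : 'I_n -> Z 0), exists P (pi : 'I_n -> Z 1),
    product_cone P pi /\ forall j, tgt (pi j) = Y j.

Program Definition ordcat n : category :=
  @Category 'I_n.+1 (fun i j => i <= j) (fun i => leqnn i)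
    (fun i j k jk ij => leq_trans ij jk) _ _ _.

Program Definition simp_functor m n (f : simp m n) :
    functor (ordcat m) (ordcat n) :=
  @Functor (ordcat m) (ordcat n) f (fun i j l => sf_mono f l) _ _.

Program Definition nerve (A : category) : sSet :=
  @SSet (fun n => functor (ordcat n) A)
    (fun m n f x => functor_comp x (simp_functor f)) _ _.
Next Obligation. by case: x => *; apply: functor_eq. Qed.
Next Obligation. by case: x => *; apply: functor_eq. Qed.

Program Definition nmap (A B : category) (F : functor A B) :
    smap (nerve A) (nerve B) :=
  @SMap (nerve A) (nerve B) (fun n x => functor_comp F x) _.
Next Obligation. exact: functor_eq. Qed.

Program Definition nvert (A : category) (a : A) : nerve A 0 :=
  @Functor (ordcat 0) A (fun=> a) (fun _ _ _ => idc a) _ _.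
Next Obligation. by rewrite cmp_idl. Qed.

Section NerveEdge.
Variables (A : category) (a b : A) (f : Hom a b).

Definition edge_ob (i : nat) : A := if i is 0 then a else b.

Definition edge_hom (i j : nat) : i <= j -> Hom (edge_ob i) (edge_ob j) :=
  match i, j return i <= j -> Hom (edge_ob i) (edge_ob j) with
  | 0, 0 => fun=> idc a
  | 0, _.+1 => fun=> f
  | _.+1, _.+1 => fun=> idc b
  | _.+1, 0 => fun l => match notF l with end
  end.

Program Definition nedge : nerve A 1 :=
  @Functor (ordcat 1) A (fun i : 'I_2 => edge_ob i)
    (fun i j l => @edge_hom i j l) _ _.
Next Obligation. by case: a0 => -[]. Qed.
Next Obligation.
move: (leq_trans _ _) => l.
move: a0 b0 c g f0 l => [[|i] /= _] [[|j] /= _] [[|k] /= _] //= *;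
  by rewrite ?cmp_idl ?cmp_idr.
Qed.

End NerveEdge.

Section Indexed.
Variables (C S : sSet) (p : smap C S).

(* c is a cartesian edge of the pullback of p along the edge p c.  When p is a
   cocartesian fibration and f = p c, c : f_* Y -> Y is the edge over f which
   corresponds to the counit f^* f_* Y -> Y. *)
Definition counit_edge (c : C 1) :=
  exists w : pullback p (yoneda (p 1 c)) 1,
    sval w = (c, simp_id 1) /\ cartesian (pr2 p (yoneda (p 1 c))) w.

(* The family m of edges out of X, over the edges u_j of S, induces an
   equivalence h : X -> P = prod_j u_j_* (tgt m_j) in the fibre over p X. *)
Definition indexed_product n (X : C 0) (m : 'I_n -> C 1) :=
  exists (P : fibre p (p 0 X) 0) (pi : 'I_n -> fibre p (p 0 X) 1)
         (c : 'I_n -> C 1) (g : 'I_n -> fibre p (p 0 X) 1)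
         (h : fibre p (p 0 X) 1),
  [/\ product_cone P pi,
      sval (src h) = X, tgt h = P, is_equiv h &
      forall j, [/\ counit_edge (c j), p 1 (c j) = p 1 (m j),
        sval (tgt (pi j)) = src (c j), composite (sval (g j)) (c j) (m j) &
        composite h (pi j) (g j)]].

(* A square with top f, left g, right g' and bottom f'. *)
Definition square (f g g' f' : C 1) :=
  exists d, composite f g' d /\ composite g f' d.

Definition pushforward_preserves_products :=
  forall (phi : S 1) n (P : fibre p (src phi) 0) (pi : 'I_n -> fibre p (src phi) 1)
         (P' : fibre p (tgt phi) 0) (pi' : 'I_n -> fibre p (tgt phi) 1)
         (d : C 1) (e : 'I_n -> C 1),
    product_cone P pi ->
    [/\ cocartesian p d, p 1 d = phi, src d = sval P & tgt d = sval P'] ->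
    (forall j, [/\ cocartesian p (e j), p 1 (e j) = phi,
       src (e j) = sval (tgt (pi j)), src (pi' j) = P' &
       square (sval (pi j)) d (e j) (sval (pi' j))]) ->
    product_cone P' pi'.

(* HTT 5.2.2.1: the adjunction f^* -| f_* is the pullback of p along the edge f
   of the base being a cartesian, besides cocartesian, fibration. *)
Definition pushforwards_have_right_adjoints :=
  forall phi : S 1, cartesian_fibration (pr2 p (yoneda phi)).

End Indexed.

Section GSets.
Variable G : finGroupType.

(* G acts on the right. *)
Record gset := GSet { gcar :> finType; gact : {action G &-> gcar} }.

Record gmap (U V : gset) := GMap {
  gf :> U -> V;
  gf_eq : forall x a, gf (gact U x a) = gact V (gf x) a }.

Lemma gmap_ext (U V : gset) (f g : gmap U V) : f =1 g -> f = g.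
Proof.
case: f g => [f f'] [g g'] /= /funext fg; rewrite fg in f' *.
by rewrite (Prop_irrelevance f' g').
Qed.

Definition gmap_id (U : gset) : gmap U U := @GMap U U id (fun _ _ => erefl).

Program Definition gmap_comp (U V W : gset) (g : gmap V W) (f : gmap U V) :
    gmap U W :=
  @GMap U W (fun x => g (f x)) _.
Next Obligation. by rewrite !gf_eq. Qed.

Record orbit := Orbit {
  oset :> gset;
  otrans : [transitive [set: G], on [set: oset] | gact oset] }.

Program Definition orbit_cat : category :=
  @Category orbit (fun V W => gmap V W) (fun V => gmap_id V)
    (fun U V W g f => gmap_comp g f) _ _ _.
Next Obligation. exact: gmap_ext. Qed.
Next Obligation. exact: gmap_ext. Qed.
Next Obligation. exact: gmap_ext. Qed.

Definition orbits_op : sSet := nerve (op orbit_cat).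

(* The edge of [orbits_op] from W to V given by f : V -> W. *)
Definition oedge (V W : orbit) (f : gmap V W) : orbits_op 1 :=
  @nedge (op orbit_cat) W V f.

(* U is the disjoint union of the orbits V j, included by i j. *)
Definition orbit_decomposition (U : gset) n (V : 'I_n -> orbit)
    (i : forall j, gmap (V j) U) :=
  forall u : U, exists! z : {j : 'I_n & V j}, i (tag z) (tagged z) = u.

(* The orbits P k, with projections a k and b k, are those of the pullback of
   the cospan f, g. *)
Definition pullback_decomposition (V V' W : orbit) (f : gmap V W)
    (g : gmap V' W) n (P : 'I_n -> orbit) (a : forall k, gmap (P k) V)
    (b : forall k, gmap (P k) V') :=
  (forall k z, f (a k z) = g (b k z)) /\
  forall x y, f x = g y ->
    exists! z : {k : 'I_n & P k},
      a (tag z) (tagged z) = x /\ b (tag z) (tagged z) = y.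

Record over (V : orbit) := Over { otot :> gset; ostr : gmap otot V }.

#[projections(primitive)]
Record fobj := FObj { fbase : orbit; ftot :> over fbase }.

(* A morphism [U -> V] -> [W -> V'] is a G-map fb : V' -> V with a span
   U <- Z -> W over V <- V' = V' for which Z -> U x_V V' is a summand
   inclusion.  Up to isomorphism of spans Z is a G-stable subset of U x_V V',
   and fp is the partial map with domain Z given by Z -> W; composition of
   spans by pullback becomes composition of partial maps. *)
Record fhom (X Y : fobj) := FHom {
  fb : gmap (fbase Y) (fbase X);
  fp : X -> fbase Y -> option Y;
  fp_eq : forall u v a,
    fp (gact X u a) (gact (fbase Y) v a) = omap (fun w => gact Y w a) (fp u v);
  fp_over : forall u v w, fp u v = Some w ->
    ostr X u = fb v /\ ostr Y w = v }.

Lemma fhom_ext (X Y : fobj) (f g : fhom X Y) :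
  fb f =1 fb g -> (forall u v, fp f u v = fp g u v) -> f = g.
Proof.
case: f g => [f f' f1 f2] [g g' g1 g2] /= /gmap_ext fg fg'.
have {}fg' : f' = g' by apply/funext => u; apply/funext.
rewrite fg fg' in f1 f2 *.
by rewrite (Prop_irrelevance f1 g1) (Prop_irrelevance f2 g2).
Qed.

Program Definition fhom_id (X : fobj) : fhom X X :=
  @FHom X X (gmap_id _) (fun u v => if ostr X u == v then Some u else None) _ _.
Next Obligation.
by rewrite gf_eq (inj_eq (act_inj _ _)); case: ifP.
Qed.
Next Obligation. by move: H; case: eqP => // <- [<-]. Qed.

Program Definition fhom_comp (X Y Z : fobj) (g : fhom Y Z) (f : fhom X Y) :
    fhom X Z :=
  @FHom X Z (gmap_comp (fb f) (fb g))
    (fun u v => obind (fun w => fp g w v) (fp f u (fb g v))) _ _.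
Next Obligation.
by rewrite gf_eq fp_eq; case: (fp f _ _) => //= w; rewrite fp_eq.
Qed.
Next Obligation.
move: H; case e: (fp f _ _) => [w'|//] /= /fp_over [e1 e2].
by case/fp_over: e => -> _.
Qed.

Lemma fhom_idl (X Y : fobj) (f : fhom X Y) : fhom_comp (fhom_id Y) f = f.
Proof.
apply: fhom_ext => //= u v; case e: (fp f u v) => [w|] //=.
by case/fp_over: e => _ ->; rewrite eqxx.
Qed.

Lemma fhom_idr (X Y : fobj) (f : fhom X Y) : fhom_comp f (fhom_id X) = f.
Proof.
apply: fhom_ext => //= u v; case: eqP => //= ne.
by case e: (fp f u v) => [w|] //; case/fp_over: e.
Qed.

Lemma fhom_compA (X Y Z T : fobj) (h : fhom Z T) (g : fhom Y Z) (f : fhom X Y) :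
  fhom_comp h (fhom_comp g f) = fhom_comp (fhom_comp h g) f.
Proof. by apply: fhom_ext => //= u v; case: (fp f _ _). Qed.

Definition fin_cat : category :=
  Category fhom_idl fhom_idr fhom_compA.

Definition fin_base : functor fin_cat (op orbit_cat) :=
  @Functor fin_cat (op orbit_cat) fbase fb (fun _ => erefl)
    (fun _ _ _ _ _ => erefl).

(* The second leg Z -> W of the span is an isomorphism. *)
Definition inert (X Y : fobj) (f : fhom X Y) :=
  forall w : Y, exists! z : X * fbase Y, fp f z.1 z.2 = Some w.

Definition fibrewise_inert (V : orbit) (U W : over V)
    (f : fhom (FObj U) (FObj W)) :=
  fb f = gmap_id V /\ inert f.

Definition fobj1 (W : orbit) : fobj := FObj (Over (gmap_id W)).

(* The characteristic morphism [U -> V] -> [W = W] of an orbit i : W -> U. *)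
Program Definition chi (X : fobj) (W : orbit) (i : gmap W X)
    (i_inj : injective i) : fhom X (fobj1 W) :=
  @FHom X (fobj1 W) (gmap_comp (ostr X) i)
    (fun u w => if u == i w then Some w else None) _ _.
Next Obligation. by rewrite gf_eq (inj_eq (act_inj _ _)); case: ifP. Qed.
Next Obligation. by move: H; case: eqP => // -> [<-]. Qed.

Lemma orbit_decomposition_inj (U : gset) n (V : 'I_n -> orbit)
    (i : forall j, gmap (V j) U) :
  orbit_decomposition i -> forall j, injective (i j).
Proof.
move=> dec j x y e; have [z [_ zU]] := dec (i j y).
have e2 := zU (Tagged (fun j => V j : Type) y) erefl.
have e1 := zU (Tagged (fun j => V j : Type) x) e.
by rewrite e1 in e2; apply: eq_from_Tagged e2.
Qed.

Record gamma := Gamma {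
  gbase : orbit;
  gsrc : over gbase;
  gtgt : over gbase;
  garr : fhom (FObj gsrc) (FObj gtgt);
  gam_inert : fibrewise_inert garr }.

(* Commutative squares; the top and bottom morphisms automatically lie over the
   same map of orbits. *)
Record gam_hom (x y : gamma) := GamHom {
  gtop : fhom (FObj (gsrc x)) (FObj (gsrc y));
  gbot : fhom (FObj (gtgt x)) (FObj (gtgt y));
  gsq : fhom_comp (garr y) gtop = fhom_comp gbot (garr x) }.

Lemma gam_hom_ext (x y : gamma) (f g : gam_hom x y) :
  gtop f = gtop g -> gbot f = gbot g -> f = g.
Proof.
case: f g => [f f' f1] [g g' g1] /= fg fg'; rewrite fg fg' in f1 *.
by rewrite (Prop_irrelevance f1 g1).
Qed.

Program Definition gam_id (x : gamma) : gam_hom x x :=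
  @GamHom x x (fhom_id _) (fhom_id _) _.
Next Obligation.
by rewrite fhom_idr fhom_idl.
Qed.

Program Definition gam_comp (x y z : gamma) (g : gam_hom y z)
    (f : gam_hom x y) : gam_hom x z :=
  @GamHom x z (fhom_comp (gtop g) (gtop f)) (fhom_comp (gbot g) (gbot f)) _.
Next Obligation.
rewrite fhom_compA gsq -fhom_compA gsq.
by rewrite fhom_compA.
Qed.

Program Definition gam_cat : category :=
  @Category gamma gam_hom gam_id gam_comp _ _ _.
Next Obligation. by apply: gam_hom_ext; exact: fhom_idl. Qed.
Next Obligation. by apply: gam_hom_ext; exact: fhom_idr. Qed.
Next Obligation. by apply: gam_hom_ext; exact: fhom_compA. Qed.

Definition gam_ev0 : functor gam_cat fin_cat :=
  @Functor gam_cat fin_cat (fun x => FObj (gsrc x)) gtop (fun _ => erefl)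
    (fun _ _ _ _ _ => erefl).

Definition gam_ev1 : functor gam_cat fin_cat :=
  @Functor gam_cat fin_cat (fun x => FObj (gtgt x)) gbot (fun _ => erefl)
    (fun _ _ _ _ _ => erefl).

Lemma fhom_id_inert (V : orbit) (U : over V) :
  fibrewise_inert (fhom_id (FObj U)).
Proof.
split=> // w; exists (w, ostr U w); split=> [|[u v]] /=; first by rewrite eqxx.
by case: eqP => // <- [->].
Qed.

Program Definition gam_diag : functor fin_cat gam_cat :=
  @Functor fin_cat gam_cat (fun X => Gamma (fhom_id_inert X))
    (fun X Y f => @GamHom (Gamma (fhom_id_inert X)) (Gamma (fhom_id_inert Y))
      f f _) _ _.
Next Obligation.
by rewrite fhom_idr fhom_idl.
Qed.
Next Obligation. exact: gam_hom_ext. Qed.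
Next Obligation. exact: gam_hom_ext. Qed.

Definition fin : sSet := nerve fin_cat.
Definition fin_proj : smap fin orbits_op := nmap fin_base.
Definition gam : sSet := nerve gam_cat.
Definition ev0 : smap gam fin := nmap gam_ev0.
Definition ev1 : smap gam fin := nmap gam_ev1.
Definition diag : smap fin gam := nmap gam_diag.

Definition fedge (X Y : fobj) (f : fhom X Y) : fin 1 := @nedge fin_cat X Y f.

(* A G-category is a cocartesian fibration p over [orbits_op]; the fibre over an
   orbit V is C_V, and f^* is pushforward along the edge [oedge f]. *)
Section GCategory.
Variables (C : sSet) (p : smap C orbits_op).

(* For a square of orbits f a_k = g b_k exhibiting the P_k as the orbits of the
   pullback, c : f_* X -> X is the counit, d : f_* X -> g^* f_* X and
   e_k : X -> a_k^* X are restrictions, and m_k : g^* f_* X -> a_k^* X over b_k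
   is the edge with m_k d = e_k c.  The edges m_k correspond to the components
   of the Beck-Chevalley map g^* f_* X -> prod_k b_k_* a_k^* X. *)
Definition base_change :=
  forall (V V' W : orbit) (f : gmap V W) (g : gmap V' W) n (P : 'I_n -> orbit)
         (a : forall k, gmap (P k) V) (b : forall k, gmap (P k) V')
         (c d : C 1) (e m : 'I_n -> C 1),
    pullback_decomposition f g a b ->
    counit_edge p c -> p 1 c = oedge f ->
    [/\ cocartesian p d, p 1 d = oedge g & src d = src c] ->
    (forall k, [/\ cocartesian p (e k), p 1 (e k) = oedge (a k),
       src (e k) = tgt c, p 1 (m k) = oedge (b k) &
       square c d (e k) (m k)]) ->
    indexed_product p (tgt d) m.

Definition has_finite_indexed_products :=
  [/\ forall v : orbits_op 0, has_finite_products (fibre p v),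
      pushforward_preserves_products p,
      pushforwards_have_right_adjoints p & base_change].

Definition preserves_cocartesian (A B S T T' : sSet) (r : smap A S)
    (q : smap B S) (a : smap A T) (b : smap B T') (h : FunOver r q 0) :=
  forall e : A 1, cocartesian a e -> cocartesian b (app h e).

Definition segal (F : FunOver fin_proj p 0) :=
  forall (X : fobj) n (U : 'I_n -> orbit) (i : forall j, gmap (U j) X)
         (dec : orbit_decomposition i),
    indexed_product p (app F (nvert (A := fin_cat) X))
      (fun j => app F (fedge (chi (orbit_decomposition_inj dec (j := j))))).

Definition CMon : sSet :=
  full (fun F : FunOver fin_proj p 0 =>
    preserves_cocartesian fin_proj p F /\ segal F).

Section Evaluation.
Variables (D : sSet) (q : smap D fin) (ev : smap (pullback q ev0) C).
Hypothesis ev_over :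
  forall n z, p n (ev n z) = fin_proj n (q n (sval z).1).

Definition base_of (K : sSet) (r : smap K fin) : smap K orbits_op :=
  smap_comp fin_proj r.

Definition gam_base (K : sSet) (r : smap K fin) :
    smap (pullback r ev0) orbits_op :=
  smap_comp (base_of r) (pr1 r ev0).

(* A functor h : K -> D over Fin_* is sent to the functor
   (k, gamma) |-> ev (h k, gamma). *)
Program Definition ev_comp (K : sSet) (r : smap K fin) :
    smap (FunOver r q) (FunOver (gam_base r) p) :=
  @SMap (FunOver r q) (FunOver (gam_base r) p)
    (fun n h => exist _
      (@SMap (sprod (pullback r ev0) (simplex n)) C
        (fun m z => ev m
          (exist _ (sval h m ((sval z.1).1, z.2), (sval z.1).2) _)) _) _) _.
Next Obligation. by rewrite H0. Qed.
Next Obligation.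
rewrite -sm_nat; congr (ev _ _); apply: sig_eq => /=.
by rewrite -sm_nat.
Qed.
Next Obligation. by rewrite ev_over /= H0. Qed.
Next Obligation.
by apply: sig_eq; apply: smap_eq => k z; congr (ev _ _); apply: sig_eq.
Qed.

End Evaluation.

(* The G-cocartesian fibration D -> Fin_* characterised by the equivalences
   Fun_{G,/Fin_*}(K, D) = Fun_G(K x_{Fin_*} Gamma, C), natural in the G-category
   K over Fin_*.  By naturality these are given by the universal G-functor
   ev : D x_{Fin_*} Gamma -> C, the image of the identity for K = D. *)
Record cotensor := Cotensor {
  ct :> sSet;
  ctq : smap ct fin;
  ctev : smap (pullback ctq ev0) C;
  ct_cocart : cocartesian_fibration ctq;
  ctev_over : forall n z, p n (ctev n z) = fin_proj n (ctq n (sval z).1);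
  ctev_G : forall e : pullback ctq ev0 1,
    cocartesian (gam_base ctq) e -> cocartesian p (ctev 1 e);
  ct_univ : forall (K : sSet) (r : smap K fin),
    cocartesian_fibration (base_of r) ->
    (forall e : K 1, cocartesian (base_of r) e -> cocartesian fin_proj (r 1 e)) ->
    restricts_to_equivalence (ev_comp ctev_over r)
      (preserves_cocartesian (base_of r) (base_of ctq))
      (preserves_cocartesian (gam_base r) p) }.

Section Cartesian.
Variable D : cotensor.

(* An object x over [U -> G/H] corresponds to the H-functor
   F : Gamma_[U -> G/H] -> C_H with F([U >-> V]_{G/K}) = ev (x', [U >-> V]),
   where e : x -> x' is the restriction of x along G/K -> G/H.  An edge of
   D x Gamma given by a restriction in D along V_j -> G/K and by a square whose
   bottom is the characteristic morphism of V_j in V has as target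
   [U >-> V >-> V_j]_{V_j}, and ev sends it to the map induced by the
   characteristic morphism. *)
Definition cartesian_object (x : D 0) :=
  forall (e : D 1) (g : gamma) (z : pullback (ctq D) ev0 0) n
         (V : 'I_n -> orbit) (i : forall j, gmap (V j) (otot (gtgt g)))
         (dec : orbit_decomposition i)
         (zj : 'I_n -> pullback (ctq D) ev0 1),
    src e = x -> cocartesian (base_of (ctq D)) e ->
    sval z = (tgt e, nvert (A := gam_cat) g) ->
    (forall j, [/\ src (zj j) = z,
       cocartesian (base_of (ctq D)) (sval (zj j)).1 &
       ev1 1 (sval (zj j)).2 =
         fedge (chi (X := FObj (gtgt g)) (orbit_decomposition_inj dec (j := j)))]) ->
    indexed_product p (ctev D 0 z) (fun j => ctev D 1 (zj j)).

Definition cart : sSet := full cartesian_object.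
Definition cartq : smap cart fin :=
  smap_comp (ctq D) (sincl (@full_stable D cartesian_object)).

Definition inert_to_cocartesian (s : FunOver (smap_id fin) cartq 0) :=
  forall (V : orbit) (U W : over V) (f : fhom (FObj U) (FObj W)),
    fibrewise_inert f -> cocartesian cartq (app s (fedge f)).

Definition CAlg : sSet :=
  full (fun s : FunOver (smap_id fin) cartq 0 =>
    preserves_cocartesian fin_proj (base_of cartq) s /\ inert_to_cocartesian s).

(* A section s is sent to the functor U |-> ev (s U, id_U), the value of the
   H-functor s U at the identity of U. *)
Program Definition underlying :
    smap (FunOver (smap_id fin) cartq) (FunOver fin_proj p) :=
  @SMap (FunOver (smap_id fin) cartq) (FunOver fin_proj p)
    (fun n h => exist _
      (@SMap (sprod fin (simplex n)) C
        (fun m z => ctev D m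
          (exist _ (sval (sval h m z), diag m z.1) _)) _) _) _.
Next Obligation.
by rewrite H; case: f => *; apply: functor_eq.
Qed.
Next Obligation.
rewrite -sm_nat; congr (ctev D _ _); apply: sig_eq => /=; congr (_, _).
  by rewrite -[RHS](congr1 sval (sm_nat h f (f0, s))).
exact: functor_eq.
Qed.
Next Obligation. by rewrite ctev_over /= H. Qed.
Next Obligation.
by apply: sig_eq; apply: smap_eq => k z; congr (ctev D _ _); apply: sig_eq.
Qed.

End Cartesian.
End GCategory.
End GSets.

(* Main.v *)
Require Import Defs.
From mathcomp Require Import all_boot all_fingroup boolp zify.
Require Import Defs.

Set Implicit Arguments.
Unset Strict Implicit.
Unset Printing Implicit Defensive.

(** By the universal property of the cotensor D, a G-functor s : Fin_* -> D over
    Fin_* is the same as a G-functor F : Gamma -> C, F (f : U >-> V) = s U (f),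
    and the comparison functor is restriction along the diagonal Fin_* -> Gamma.
    Its inverse is N |-> N o ev1: one composite is the identity on the nose, and
    for the other one the adjunction ev1 -| diag gives eta : F -> F o diag o ev1.
    So everything rests on the claim that eta_F is an equivalence if and only if
    s sends fibrewise inert maps to cocartesian edges.

    Let y : D x_{Fin_*} Gamma -> D be the functor over ev1 which represents
    ((d, f), gamma) |-> d (gamma o f).  Then y (d, id) = d, the edge
    y (d, id) -> y (d, f) given by f is cocartesian, and s f is the composite of
    this edge for d = s U with tau_f : y (s U, f) -> y (s V, id) = s V.  Hence
    s f is cocartesian if and only if tau_f is an equivalence, and the values of
    tau_f are values of F at maps of Gamma which ev1 sends to identities, among
    them eta_F.  The cartesian condition on s U is the Segal condition for F o diag
    once eta_F is an equivalence.

    All naturality is handled by the conservativity and fullness of the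
    equivalences Fun (K, D) = Fun (K x Gamma, C), together with the fact that a
    transformation of functors into the total space of an inner fibration is
    cocartesian when its components are; the latter is proved by filling the
    cylinder over a horn simplex by simplex along a matching of its nondegenerate
    simplices. *)

(** * Simplices and horns *)

(** A [cotensor] is given only by [ct_univ]: neither its simplices nor its cocartesian edges have a
    formula. So [y] exists by essential surjectivity, its values are known only up to [th], and
    claims about edges of [D] are carried along squares with invertible sides to edges of [C].
    Cocartesian edges of [D] over restrictions are under control because [D] is a G-category; those
    over inert maps are the ones that [y] makes visible. A second obstacle: an algebra sends inert
    maps to edges cocartesian in the full subcategory [cart D], which says nothing about [D] until
    the pushforward of a cartesian object is seen to be cartesian. This is [Y_cartesian]; lifts are
    then compared inside [cart D]. Lastly, [cat_equivalence] asks for a homotopy inverse with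
    invertible transformations, over all simplices of the functor categories at once. Pointwise
    equivalences must be inverted naturally, and that is where cocartesian edges of functor
    categories, and the filling of cylinders over simplicial sets of arbitrary size, come in. *)

Lemma simp_compA m n k l (h : simp k l) (g : simp n k) (f : simp m n) :
  simp_comp h (simp_comp g f) = simp_comp (simp_comp h g) f.
Proof. exact: simp_eq. Qed.

Lemma simp_compI m n (f : simp m n) : simp_comp f (simp_id m) = f.
Proof. exact: simp_eq. Qed.

Lemma simp_compIl m n (f : simp m n) : simp_comp (simp_id n) f = f.
Proof. exact: simp_eq. Qed.

Lemma simp_comp_cst m n k (f : simp n k) i :
  simp_comp f (simp_cst m i) = simp_cst m (f i).
Proof. exact: simp_eq. Qed.

Lemma simp_cst_comp m n k (f : simp m n) (i : 'I_k.+1) :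
  simp_comp (simp_cst n i) f = simp_cst m i.
Proof. exact: simp_eq. Qed.

(** The default [ord0] is taken only at a vertex sent to [i], a case excluded in [simp_factor]. *)
Definition simp_inv m n (i : 'I_n.+2) (f : simp m n.+1) (j : 'I_m.+1) : 'I_n.+1 :=
  odflt ord0 (unlift i (f j)).

Lemma simp_factor m n (i : 'I_n.+2) (f : simp m n.+1) :
  (forall j, f j != i) -> exists f', f = simp_comp (simp_face i) f'.
Proof.
move=> fi.
have key j : lift i (simp_inv i f j) = f j.
  rewrite /simp_inv; case: unliftP => [k -> //|e].
  by move: (fi j); rewrite e eqxx.
have mono : forall j k : 'I_m.+1, j <= k -> simp_inv i f j <= simp_inv i f k.
  by move=> j k jk; rewrite -(leq_bump2 i); move: (sf_mono f jk); rewrite -!key.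
by exists (Simp mono); apply: simp_eq => j /=; rewrite key.
Qed.

Lemma face_inj m n (i : 'I_n.+2) (f g : simp m n) :
  simp_comp (simp_face i) f = simp_comp (simp_face i) g -> f = g.
Proof.
move=> e; apply: simp_eq => j; apply: (@lift_inj _ i).
by move: (congr1 (fun h : simp m n.+1 => h j) e).
Qed.

(** The prescribed value at [f j0] is what makes sections useful: once a composite [h s] is known to
    be the identity, evaluating it at [f j0] gives [h j0 = f j0], and letting [j0] vary gives
    [h = f]. *)
Lemma simp_section m n (f : simp m n) (j0 : 'I_m.+1) :
  (forall i, exists j, f j = i) ->
  exists2 s : simp n m, simp_comp f s = simp_id n & s (f j0) = j0.
Proof.
move=> fs; pose s i := if i == f j0 then j0 else sval (cid (fs i)).
have sK i : f (s i) = i.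
  by rewrite /s; case: eqP => [-> //|_]; case: cid.
have mono : forall i j : 'I_n.+1, i <= j -> s i <= s j.
  move=> i j; rewrite leq_eqVlt => /orP [/eqP/val_inj -> //|ij].
  rewrite leqNgt; apply/negP => /ltnW /(sf_mono f); rewrite !sK leqNgt.
  by rewrite ij.
exists (Simp mono); first exact: simp_eq.
by rewrite /= /s eqxx.
Qed.

(** By finiteness a section of [t] is a two-sided inverse, so [t] is strictly monotone; induction
    from the top gives [t i <= i], induction from the bottom gives [i <= t i]. *)
Lemma simp_endo n (t : simp n n) : (forall i, exists j, t j = i) -> t = simp_id n.
Proof.
move=> ts.
have [s sK _] := simp_section ord0 ts.
have sK' i : t (s i) = i by move: (congr1 (fun h : simp n n => h i) sK).
have tinj : injective t.
  exact: bij_inj (bij_can_bij (injF_bij (can_inj sK')) sK').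
have tmono (i j : 'I_n.+1) : i < j -> t i < t j.
  move=> ij; rewrite ltn_neqAle sf_mono ?(ltnW ij) // andbT.
  by apply: contraTneq ij => /val_inj/tinj ->; rewrite ltnn.
apply: simp_eq => i; apply: val_inj => /=; apply/eqP; rewrite eqn_leq.
apply/andP; split.
  have H k : forall i : 'I_n.+1, n - i = k -> t i <= i.
    elim: k => [|k IH] {}i e.
      have -> : i = ord_max.
        apply: val_inj => /=; apply/eqP; rewrite eqn_leq -ltnS ltn_ord.
        by rewrite -subn_eq0 e.
      by rewrite -ltnS ltn_ord.
    have lt : i.+1 < n.+1 by rewrite ltnS -subn_gt0 e.
    have := IH (Ordinal lt); rewrite /= subnS e => /(_ erefl) le.
    by rewrite -ltnS; apply: leq_trans le; apply: tmono => /=.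
  exact: H.
case: i => k; elim: k => [|k IH] lt //=.
have lt' : k < n.+1 by apply: ltnW.
by apply: leq_ltn_trans (IH lt') _; apply: tmono => /=.
Qed.

Lemma simp_surjP m n (f : simp m n) :
  (exists i, forall j, f j != i) \/ (forall i, exists j, f j = i).
Proof.
case: (pselect (exists i, forall j, f j != i)) => [|H]; [by left|right].
move=> i; apply: contrapT => H'; apply: H; exists i => j; apply/eqP => e.
by apply: H'; exists j.
Qed.

(** Maps out of horns and cylinders are produced as graphs: values are chosen simplex by simplex,
    and naturality follows from functionality of a relation that is stable under the simplicial
    action. *)
Lemma graph_smap (Y X : sSet) (R : forall n, Y n -> X n -> Prop) :
  (forall n y, exists x, R n y x) ->
  (forall n y x x', R n y x -> R n y x' -> x = x') ->
  (forall m n (f : simp m n) y x, R n y x -> R m (sact f y) (sact f x)) ->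
  exists l : smap Y X, forall n y, R n y (l n y).
Proof.
move=> tot fct stab.
pose l n y := sval (cid (tot n y)).
have lR n y : R n y (l n y) by rewrite /l; case: cid.
have nat m n (f : simp m n) y : l m (sact f y) = sact f (l n y).
  by apply: fct (lR _ _) _; apply: stab.
by exists (SMap nat).
Qed.

(** A horn is recorded by its faces; the entry [y k] at the omitted face is a dummy. Agreement is
    asked on every common subface, which reads the same in all dimensions; [compat_of] reduces it to
    the simplicial identities in codimension two. *)
Definition faces_compat (X : sSet) n (k : 'I_n.+2) (y : 'I_n.+2 -> X n) :=
  forall i j, i != k -> j != k -> forall m (f g : simp m n),
  simp_comp (simp_face i) f = simp_comp (simp_face j) g ->
  sact f (y i) = sact g (y j).

Definition fillable (X S : sSet) (p : smap X S) n (k : 'I_n.+2)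
    (Q : ('I_n.+2 -> X n) -> Prop) :=
  forall y t, faces_compat k y -> Q y ->
  (forall i, i != k -> p n (y i) = sact (simp_face i) t) ->
  exists x, p n.+1 x = t /\ forall i, i != k -> sact (simp_face i) x = y i.

Lemma face_in_horn n (k i : 'I_n.+2) : i != k ->
  exists2 i', i' != k & forall j, simp_face i j != i'.
Proof. by move=> ik; exists i => // j /=; rewrite eq_sym neq_lift. Qed.

Lemma horn_build (X : sSet) n (k : 'I_n.+2) (y : 'I_n.+2 -> X n) :
  faces_compat k y ->
  exists h : smap (horn k) X, forall m (z : horn k m) i f,
    i != k -> sval z = simp_comp (simp_face i) f -> h m z = sact f (y i).
Proof.
move=> yc.
pose R m (z : horn k m) x := exists i f,
  [/\ i != k, sval z = simp_comp (simp_face i) f & x = sact f (y i)].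
have [|||h hR] := @graph_smap (horn k) X R.
- move=> m [z [i ik zi]]; have [f e] := simp_factor zi.
  by exists (sact f (y i)), i, f.
- move=> m z x x' [i [f [ik e ->]]] [j [g [jk e' ->]]].
  by apply: yc => //; rewrite -e.
- move=> m l f z x [i [g [ik e ->]]]; exists i, (simp_comp g f).
  by split=> //; rewrite ?sact_comp //= e; exact: simp_eq.
exists h => m z i f ik e; have [j [g [jk e' ->]]] := hR m z.
by apply: yc => //; rewrite -e.
Qed.

Section HornFaces.
Variables (X S : sSet) (p : smap X S) (n : nat) (k : 'I_n.+2).

Lemma fillable_of_lifting (P : smap (horn k) X -> Prop)
    (Q : (_ -> X n) -> Prop) :
  (forall (h : smap (horn k) X) y, Q y -> (forall m (z : horn k m) i f,
    i != k -> sval z = simp_comp (simp_face i) f -> h m z = sact f (y i)) ->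
    P h) ->
  horn_lifting p P -> fillable p k Q.
Proof.
move=> QP lift y t yc Qy py.
have [h hy] := horn_build yc.
have [||l [l1 l2]] := lift h (yoneda t); first exact: QP hy.
  move=> m z; case: (svalP z) => i ik zi; have [f e] := simp_factor zi.
  by rewrite (hy _ _ _ _ ik e) sm_nat py //= e sact_comp.
exists (l _ (simp_id _)); rewrite l2 /= sact_id; split=> // i ik.
have := l1 _ (exist _ (simp_face i) (face_in_horn ik)).
rewrite (hy _ _ i (simp_id _)) ?sact_id // ?simp_compI // => <-.
by rewrite -sm_nat; congr (l _ _); exact: simp_eq.
Qed.

Lemma lifting_of_fillable (P : smap (horn k) X -> Prop)
    (Q : (_ -> X n) -> Prop) :
  (forall (h : smap (horn k) X) y, P h -> (forall m (z : horn k m) i f,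
    i != k -> sval z = simp_comp (simp_face i) f -> h m z = sact f (y i)) ->
    Q y) ->
  fillable p k Q -> horn_lifting p P.
Proof.
move=> PQ fill h t Ph ph.
have [i0 i0k] : exists i0 : 'I_n.+2, i0 != k.
  by case: (eqVneq k ord0) => [->|]; [exists ord_max|exists ord0; rewrite eq_sym].
(* At the omitted face any value will do; the face [i0] provides one. *)
pose y i := match pselect (i != k) with
  | left u => h _ (exist _ (simp_face i) (face_in_horn u))
  | right _ => h _ (exist _ (simp_face i0) (face_in_horn i0k)) end.
have hy i (ik : i != k) : y i = h _ (exist _ (simp_face i) (face_in_horn ik)).
  by rewrite /y; case: pselect => // u; congr (h _ _); apply: sig_eq.
have hyf m (z : horn k m) i f : i != k -> sval z = simp_comp (simp_face i) f ->
    h m z = sact f (y i).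
  move=> ik e; rewrite (hy i ik) -sm_nat; congr (h _ _).
  by apply: sig_eq.
have yc : faces_compat k y.
  move=> i j ik jk m f g e.
  have H : exists2 i', i' != k & forall j, (simp_comp (simp_face i) f) j != i'.
    by exists i => // a /=; rewrite eq_sym neq_lift.
  rewrite -(hyf _ (exist _ (simp_comp (simp_face i) f) H) i) //.
  by apply: hyf.
have [|x [px xy]] := fill y (t _ (simp_id _)) yc (PQ _ _ Ph hyf).
  move=> i ik; rewrite (hy i ik) ph /= -sm_nat; congr (t _ _); exact: simp_eq.
exists (yoneda x); split=> m z /=.
  case: (svalP z) => i ik zi; have [f e] := simp_factor zi.
  by rewrite (hyf _ _ _ _ ik e) e sact_comp xy.
rewrite sm_nat px -sm_nat; congr (t _ _); exact: simp_eq.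
Qed.

End HornFaces.

Lemma inner_fill (X S : sSet) (p : smap X S) :
  inner_fibration p <->
  forall n (k : 'I_n.+2), 0 < k < n.+1 -> fillable p k (fun=> True).
Proof.
split=> H; last first.
  case=> [|n] k kn; first by case/andP: kn => ?; rewrite ltn0.
  exact: lifting_of_fillable (H n k kn).
by move=> n k kn; apply: fillable_of_lifting (H _ k kn).
Qed.

Definition edge01 n : simp 1 n.+1 :=
  @Simp 1 n.+1 (fun i => inord i) (fun i j ij =>
    ltac:(by rewrite !inordK // (leq_trans (ltn_ord _)))).

Lemma ltn_add_ord2 n (i : 'I_2) : n + i < n.+2.
Proof. by rewrite -addnS (leq_trans (leq_add (leqnn n) (ltn_ord i))) // addn2. Qed.

Definition edge_last n : simp 1 n.+1 :=
  @Simp 1 n.+1 (fun i => inord (n + i)) (fun i j ij =>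
    ltac:(by rewrite !inordK ?leq_add2l // ltn_add_ord2)).

Lemma edge01E n (i : 'I_2) : edge01 n i = i :> nat.
Proof. by rewrite inordK // (leq_trans (ltn_ord i)). Qed.

Lemma edge_lastE n (i : 'I_2) : edge_last n i = n + i :> nat.
Proof. by rewrite inordK // ltn_add_ord2. Qed.

(** The edge {0,1} lies in the last face of the simplex, so the condition on the horn is read off
    from [y ord_max]. *)
Lemma cocart_fill (X S : sSet) (p : smap X S) (e : X 1) :
  cocartesian p e <->
  forall n, fillable p (n := n.+1) ord0 (fun y => sact (edge01 n) (y ord_max) = e).
Proof.
have key n : simp_comp (simp_face (@ord_max n.+2)) (edge01 n) = edge01 n.+1.
  apply: simp_eq => i; apply: val_inj.
  change (bump n.+2 (edge01 n i) = edge01 n.+1 i); rewrite !edge01E /bump.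
  by rewrite leqNgt (leq_trans (ltn_ord i)).
have H n : exists2 i', i' != ord0 :> 'I_n.+3 & forall j, (edge01 n.+1) j != i'.
  exists ord_max => // j; apply/eqP => ej; have := edge01E n.+1 j.
  by rewrite ej /= => ej'; move: (ltn_ord j); rewrite -ej'.
split=> H' n.
  apply: fillable_of_lifting (H' n) => h y <- hy z z01.
  apply: hy => //; rewrite key; apply: simp_eq => i; apply: val_inj.
  by change (sval z i = edge01 n.+1 i :> nat); rewrite z01 edge01E.
apply: lifting_of_fillable (H' n) => h y h01 hy.
rewrite -(hy _ (exist _ (edge01 n.+1) (H n))) ?key //.
by apply: h01 => i; rewrite edge01E.
Qed.

Lemma cart_fill (X S : sSet) (p : smap X S) (e : X 1) :
  cartesian p e <->
  forall n, fillable p (n := n.+1) ord_max (fun y => sact (edge_last n) (y ord0) = e).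
Proof.
have key n : simp_comp (simp_face (@ord0 n.+2)) (edge_last n) = edge_last n.+1.
  apply: simp_eq => i; apply: val_inj.
  by change (bump 0 (edge_last n i) = edge_last n.+1 i); rewrite !edge_lastE.
have H n : exists2 i', i' != ord_max :> 'I_n.+3 & forall j, (edge_last n.+1) j != i'.
  exists ord0 => // j; apply/eqP => ej; have := edge_lastE n.+1 j.
  by rewrite ej.
split=> H' n.
  apply: fillable_of_lifting (H' n) => h y <- hy z z01.
  apply: hy => //; rewrite key; apply: simp_eq => i; apply: val_inj.
  by change (sval z i = edge_last n.+1 i :> nat); rewrite z01 edge_lastE.
apply: lifting_of_fillable (H' n) => h y h01 hy.
rewrite -(hy _ (exist _ (edge_last n.+1) (H n))) ?key //.
by apply: h01 => i; rewrite edge_lastE.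
Qed.

Lemma face_face n (i j : 'I_n.+3) (i' j' : 'I_n.+2) : i < j -> i' = i :> nat ->
  j'.+1 = j :> nat ->
  simp_comp (simp_face i) (simp_face j') = simp_comp (simp_face j) (simp_face i').
Proof.
move=> ij ei ej; apply: simp_eq => x; apply: val_inj; rewrite /= /bump -ej ei; lia.
Qed.

(** A simplex common to the faces [i < j] misses both vertices, so both maps factor through the same
    codimension-two face. *)
Lemma compat_of (X : sSet) n (k : 'I_n.+3) (y : 'I_n.+3 -> X n.+1) :
  (forall (i j : 'I_n.+3) (i' j' : 'I_n.+2), i < j -> i != k -> j != k ->
     i' = i :> nat -> j'.+1 = j :> nat ->
     sact (simp_face i') (y j) = sact (simp_face j') (y i)) ->
  faces_compat k y.
Proof.
move=> H.
have main (i j : 'I_n.+3) : i < j -> i != k -> j != k -> forall m (f g : simp m n.+1),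
  simp_comp (simp_face i) f = simp_comp (simp_face j) g ->
  sact f (y i) = sact g (y j).
  move=> ij ik jk m f g e.
  have e' x : bump i (f x) = bump j (g x).
    by move: (congr1 (fun h : simp m n.+2 => nat_of_ord (h x)) e).
  have ilt : i < n.+2 by apply: leq_trans ij _; rewrite -ltnS ltn_ord.
  have jlt : j.-1 < n.+2 by rewrite prednK ?(leq_trans _ ij) // -ltnS ltn_ord.
  pose i' := Ordinal ilt; pose j' := Ordinal jlt.
  have ej : j'.+1 = j :> nat by rewrite /= prednK ?(leq_trans _ ij).
  have ij' : i <= j' by rewrite -ltnS ej.
  have [|f' ef] := @simp_factor m n j' f.
    move=> x; apply/eqP => ex; have := e' x; rewrite ex /bump ij' add1n ej.
    by rewrite /bump; lia.
  have [|g' eg] := @simp_factor m n i' g.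
    move=> x; apply/eqP => ex; have := e' x; rewrite ex /= [RHS]/bump leqNgt ij add0n.
    by rewrite /bump; lia.
  have ff := face_face ij (erefl : i' = i :> nat) ej.
  suff eh : f' = g' by rewrite ef eg !sact_comp eh (H i j i' j').
  apply: (@face_inj _ _ i'); apply: (@face_inj _ _ j).
  rewrite -eg -e ef !simp_compA; congr simp_comp; exact: esym.
move=> i j ik jk m f g e; case: (ltngtP i j) => ij.
- exact: main.
- by apply/esym/main.
- by move/val_inj: ij e => <- /face_inj ->.
Qed.

(** * Composites of edges in a quasi-category *)

Program Definition pt : sSet := @SSet (fun=> unit) (fun _ _ _ x => x) _ _.
Definition to_pt (X : sSet) : smap X pt := @SMap X pt (fun _ _ => tt) (fun _ _ _ _ => erefl).
Definition quasicat (X : sSet) := inner_fibration (to_pt X).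

Lemma quasicat_fill (X : sSet) : quasicat X <->
  forall n (k : 'I_n.+2) (y : 'I_n.+2 -> X n), 0 < k < n.+1 -> faces_compat k y ->
  exists x, forall i, i != k -> sact (simp_face i) x = y i.
Proof.
rewrite /quasicat inner_fill; split=> H n k.
  move=> y kn yc; have [||x [_ xy]] := H n k kn y tt yc; [by []|by []|by exists x].
by move=> kn y [] yc _ _; have [x xy] := H n k y kn yc; exists x.
Qed.

Lemma quasicat_total (X S : sSet) (p : smap X S) :
  inner_fibration p -> quasicat S -> quasicat X.
Proof.
move=> /inner_fill pin /quasicat_fill Sq; apply/quasicat_fill => n k y kn yc.
have [|t tp] := Sq n k (fun i => p n (y i)) kn.
  by move=> i j ik jk m f g e; rewrite -!sm_nat (yc i j ik jk m f g e).
have [||x [_ xy]] := pin n k kn y t yc; [by []| |by exists x].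
by move=> i ik; rewrite tp.
Qed.

Lemma sedge_mono n (a b : 'I_n.+1) (i j : 'I_2) : i <= j ->
  (if i == ord0 then a else if a <= b then b else a) <=
  (if j == ord0 then a else if a <= b then b else a).
Proof.
by rewrite -!val_eqE; case: i j => [[|i] ?] [[|j] ?] //= _; case: ifP.
Qed.

(** For [a > b] the result is the constant edge at [a], a default that keeps the function total. *)
Definition sedge n (a b : 'I_n.+1) : simp 1 n :=
  @Simp 1 n (fun i => if i == ord0 then a else if a <= b then b else a)
    (fun i j ij => sedge_mono a b ij).

Lemma sedge0 n (a b : 'I_n.+1) : sedge a b ord0 = a.
Proof. by []. Qed.

Lemma sedge1 n (a b : 'I_n.+1) : a <= b -> sedge a b ord_max = b.
Proof. by rewrite /= => ->. Qed.

Lemma ord2P (i : 'I_2) : i = ord0 \/ i = ord_max.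
Proof. by case: i => [[|[|//]] ?]; [left|right]; apply: val_inj. Qed.

Lemma ord3P (i : 'I_3) : [\/ i = ord0, i = inord 1 | i = ord_max].
Proof.
by case: i => [[|[|[|//]]] ?]; [constructor 1|constructor 2|constructor 3];
  apply: val_inj; rewrite //= inordK.
Qed.

Lemma sedgeP n (f : simp 1 n) : f = sedge (f ord0) (f ord_max).
Proof.
apply: simp_eq => i; case: (ord2P i) => ->; rewrite ?sedge0 // sedge1 //.
exact: sf_mono.
Qed.

Lemma sedge_comp m n (f : simp m n) (a b : 'I_m.+1) : a <= b ->
  simp_comp f (sedge a b) = sedge (f a) (f b).
Proof. by move=> ab; rewrite [LHS]sedgeP /= ab. Qed.

Lemma sedge_diag n (a : 'I_n.+1) : sedge a a = simp_cst 1 a.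
Proof. by apply: simp_eq => i; rewrite /= leqnn if_same. Qed.

Lemma stri_ex n (a b c : 'I_n.+1) : a <= b -> b <= c -> exists t : simp 2 n,
  [/\ simp_comp t (simp_face ord_max) = sedge a b,
      simp_comp t (simp_face ord0) = sedge b c,
      simp_comp t (simp_face (inord 1)) = sedge a c &
      [/\ t ord0 = a, t (inord 1) = b & t ord_max = c]].
Proof.
move=> ab bc.
pose f (i : 'I_3) := if i == ord0 then a else if i == inord 1 then b else c.
have mono : forall i j : 'I_3, i <= j -> f i <= f j.
  have n1 : nat_of_ord (inord 1 : 'I_3) = 1 by rewrite inordK.
  move=> i j; rewrite /f -!val_eqE /= n1.
  by case: i j => [[|[|[|//]]] ?] [[|[|[|//]]] ?] //= _; apply: leq_trans bc.
have F0 (i : 'I_3) : i = 0 :> nat -> f i = a by move=> e; rewrite /f -val_eqE /= e.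
have F1 (i : 'I_3) : i = 1 :> nat -> f i = b.
  by move=> e; rewrite /f -!val_eqE /= e inordK.
have F2 (i : 'I_3) : i = 2 :> nat -> f i = c.
  by move=> e; rewrite /f -!val_eqE /= e inordK.
exists (Simp mono); split.
1-3: rewrite [LHS]sedgeP; congr sedge.
all: try split.
all: by [apply: F0; rewrite /= ?inordK|apply: F1; rewrite /= ?inordK
        |apply: F2; rewrite /= ?inordK].
Qed.

Definition eg (X : sSet) n (x : X n) (a b : 'I_n.+1) : X 1 := sact (sedge a b) x.

Lemma eg_composite (X : sSet) n (x : X n) (a b c : 'I_n.+1) : a <= b -> b <= c ->
  composite (eg x a b) (eg x b c) (eg x a c).
Proof.
move=> ab bc; have [t [t2 t0 t1 _]] := stri_ex ab bc.
by exists (sact t x); rewrite -!sact_comp t2 t0 t1.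
Qed.

Lemma eg_full (X : sSet) (e : X 1) : eg e ord0 ord_max = e.
Proof. by rewrite /eg -[RHS]sact_id [simp_id 1]sedgeP. Qed.

Lemma eg_diag (X : sSet) n (x : X n) a : eg x a a = cst 1 (vertex x a).
Proof. by rewrite /eg sedge_diag /cst /vertex -sact_comp; congr (sact _ _); apply: simp_eq. Qed.

Lemma vertex_act (X : sSet) m n (f : simp m n) (x : X n) a :
  vertex (sact f x) a = vertex x (f a).
Proof. by rewrite /vertex -sact_comp simp_comp_cst. Qed.

Lemma tgt_eg (X : sSet) n (x : X n) (a b : 'I_n.+1) : a <= b -> tgt (eg x a b) = vertex x b.
Proof. by move=> ab; rewrite /tgt vertex_act sedge1. Qed.

Lemma vertex_nat (X Y : sSet) (u : smap X Y) n (x : X n) a :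
  u 0 (vertex x a) = vertex (u n x) a.
Proof. by rewrite /vertex sm_nat. Qed.

Lemma src_nat (X Y : sSet) (u : smap X Y) (e : X 1) : u 0 (src e) = src (u 1 e).
Proof. exact: vertex_nat. Qed.

Lemma tgt_nat (X Y : sSet) (u : smap X Y) (e : X 1) : u 0 (tgt e) = tgt (u 1 e).
Proof. exact: vertex_nat. Qed.

Lemma cst_nat (X Y : sSet) (u : smap X Y) n (x : X 0) : u n (cst n x) = cst n (u 0 x).
Proof. by rewrite /cst sm_nat. Qed.

Lemma cst_act (X : sSet) m n (f : simp m n) (x : X 0) : sact f (cst n x) = cst m x.
Proof. by rewrite /cst -sact_comp simp_cst_comp. Qed.

Lemma vertex0 (X : sSet) (x : X 0) a : vertex x a = x.
Proof.
rewrite /vertex -[RHS]sact_id; congr (sact _ _); apply: simp_eq => i.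
by apply: val_inj; case: (a) (simp_id 0 i) => [[|//] ?] [[|//] ?].
Qed.

Lemma cst0 (X : sSet) (x : X 0) : cst 0 x = x.
Proof. exact: (vertex0 x ord0). Qed.

Lemma vertex_cst (X : sSet) n (x : X 0) a : vertex (cst n x) a = x.
Proof. by rewrite vertex_act vertex0. Qed.

Lemma src_cst (X : sSet) (x : X 0) : src (cst 1 x) = x.
Proof. exact: vertex_cst. Qed.

Lemma tgt_cst (X : sSet) (x : X 0) : tgt (cst 1 x) = x.
Proof. exact: vertex_cst. Qed.

Lemma composite_nat (X Y : sSet) (u : smap X Y) f g h :
  composite f g h -> composite (u 1 f) (u 1 g) (u 1 h).
Proof. by case=> t [<- <- <-]; exists (u 2 t); rewrite !sm_nat. Qed.

Lemma is_equiv_nat (X Y : sSet) (u : smap X Y) e : is_equiv e -> is_equiv (u 1 e).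
Proof.
case=> e' [/(composite_nat u) c1 /(composite_nat u) c2]; exists (u 1 e').
by rewrite -src_nat -tgt_nat -!cst_nat.
Qed.

Lemma composite_ends (X : sSet) (f g h : X 1) : composite f g h ->
  [/\ tgt f = src g, src h = src f & tgt h = tgt g].
Proof.
case=> t [<- <- <-]; rewrite /src /tgt !vertex_act.
split; congr (vertex t _); apply: val_inj; rewrite /= ?inordK //.
Qed.

Lemma composite_cst (X : sSet) (f g : X 1) x : composite f g (cst 1 x) ->
  [/\ tgt f = src g, src f = x & tgt g = x].
Proof. by case/composite_ends; rewrite src_cst tgt_cst. Qed.

Lemma composite_idl (X : sSet) (f : X 1) : composite (cst 1 (src f)) f f.
Proof.
have := @eg_composite X 1 f ord0 ord0 ord_max.
by rewrite eg_diag !eg_full; apply.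
Qed.

Lemma composite_idr (X : sSet) (f : X 1) : composite f (cst 1 (tgt f)) f.
Proof.
have := @eg_composite X 1 f ord0 ord_max ord_max.
by rewrite eg_diag !eg_full; apply.
Qed.

Definition fc (X : sSet) n (a : nat) (x : X n.+1) : X n := sact (simp_face (inord a)) x.

Lemma ord_max3 : ord_max = inord 2 :> 'I_3.
Proof. by apply: val_inj; rewrite /= inordK. Qed.
Lemma ord03 : ord0 = inord 0 :> 'I_3.
Proof. by apply: val_inj; rewrite /= inordK. Qed.

Lemma compositeE (X : sSet) (f g h : X 1) : composite f g h <->
  exists t : X 2, [/\ fc 2 t = f, fc 0 t = g & fc 1 t = h].
Proof. by rewrite /composite ord_max3 ord03. Qed.

Lemma compat_nat (X : sSet) n (k : 'I_n.+3) (y : nat -> X n.+1) :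
  (forall a b, a < b < n.+3 -> a != k -> b != k -> fc a (y b) = fc b.-1 (y a)) ->
  faces_compat k (fun i : 'I_n.+3 => y i).
Proof.
move=> H; apply: compat_of => i j i' j' ij ik jk ei ej.
have := H i j; rewrite ij ltn_ord => /(_ erefl ik jk).
rewrite /fc; have -> : inord i = i' by apply: val_inj; rewrite /= -ei inordK // ltn_ord.
by have -> : inord j.-1 = j' by apply: val_inj; rewrite /= -ej inordK //= ltn_ord.
Qed.

Definition nth4 (T : Type) (t0 t1 t2 t3 : T) (a : nat) :=
  match a with 0 => t0 | 1 => t1 | 2 => t2 | _ => t3 end.

Lemma fill_nat (X : sSet) n (y : nat -> X n) (k : 'I_n.+2) x :
  (forall i, i != k -> sact (simp_face i) x = y i) ->
  forall a, a < n.+2 -> a != k -> fc a x = y a.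
Proof.
move=> H a an ak; rewrite /fc H ?inordK //.
by apply: contraNneq ak => <-; rewrite inordK.
Qed.

Section Calculus.
Variables (X : sSet) (Xq : quasicat X).
Implicit Types (f g h k l m e : X 1).

Lemma composite_ex f g : tgt f = src g -> exists h, composite f g h.
Proof.
move=> fg.
have [||x xy] := proj1 (quasicat_fill X) Xq 1 (inord 1) (nth4 g g f f).
- by rewrite inordK.
- apply: compat_nat => -[|[|[|a]]] [|[|[|b]]] //=; rewrite ?inordK // => H _ _; last by exfalso; lia.
  move: fg; rewrite /src /tgt /vertex /fc => fg.
  suff [-> ->] : simp_face (inord 0) = simp_cst 0 ord_max :> simp 0 1 /\
    simp_face (inord 1) = simp_cst 0 ord0 :> simp 0 1 by [].
  by split; apply: simp_eq => i; apply: val_inj;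
    rewrite /= /bump inordK //; case: i => [[|//] ?].
exists (fc 1 x); apply/compositeE; exists x; split=> //.
  by rewrite (fill_nat xy) // ?inordK.
by rewrite (fill_nat xy) // ?inordK.
Qed.

(** Associativity is a 3-simplex: its face 2 is missing here and its face 1 in [assocR], so that the
    horn is inner in both cases. The entry of [nth4] at the missing index is a dummy. *)
Lemma assocL f g h k l m : composite f g h -> composite g k l ->
  composite h k m -> composite f l m.
Proof.
move=> /compositeE [t3 [<- <- <-]] /compositeE [t0 [e1 <- <-]] /compositeE [t1 [e2 e3 <-]].
have [||x xy] := proj1 (quasicat_fill X) Xq 2 (inord 2) (nth4 t0 t1 t1 t3).
- by rewrite inordK.
- apply: compat_nat => -[|[|[|[|a]]]] [|[|[|[|b]]]] //=; rewrite ?inordK // => H _ _; exfalso; lia.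
apply/compositeE; exists (fc 2 x).
have e a : a < 4 -> a != 2 -> fc a x = nth4 t0 t1 t1 t3 a.
  by move=> an a2; rewrite (fill_nat xy) // ?inordK.
have ff a b : a < b < 4 -> fc a (fc b x) = fc b.-1 (fc a x).
  move=> /andP [ab b4]; rewrite /fc -!sact_comp; congr (sact _ _); apply: esym.
  apply: face_face; rewrite !inordK //; lia.
by rewrite (ff 0 2) // (ff 1 2) // -(ff 2 3) // !e.
Qed.

Lemma assocR f g h k l m : composite f g h -> composite g k l ->
  composite f l m -> composite h k m.
Proof.
move=> /compositeE [t3 [<- <- <-]] /compositeE [t0 [e1 <- <-]] /compositeE [t2 [e2 e3 <-]].
have [||x xy] := proj1 (quasicat_fill X) Xq 2 (inord 1) (nth4 t0 t0 t2 t3).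
- by rewrite inordK.
- apply: compat_nat => -[|[|[|[|a]]]] [|[|[|[|b]]]] //=; rewrite ?inordK // => H _ _; exfalso; lia.
apply/compositeE; exists (fc 1 x).
have e a : a < 4 -> a != 1 -> fc a x = nth4 t0 t0 t2 t3 a.
  by move=> an a2; rewrite (fill_nat xy) // ?inordK.
have ff a b : a < b < 4 -> fc a (fc b x) = fc b.-1 (fc a x).
  move=> /andP [ab b4]; rewrite /fc -!sact_comp; congr (sact _ _); apply: esym.
  apply: face_face; rewrite !inordK //; lia.
by rewrite (ff 0 1) // -(ff 1 3) // -(ff 1 2) // !e.
Qed.

(** Equality in the homotopy category. Since [composite] is a relation, composites are unique only
    up to [htpy]. *)
Definition htpy f g := composite f (cst 1 (tgt f)) g.

Lemma composite_htpy f g h h' : composite f g h -> composite f g h' -> htpy h h'.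
Proof.
move=> c c'; have [_ _ e] := composite_ends c.
by rewrite /htpy e; apply: assocR c (composite_idr g) c'.
Qed.

Lemma htpy_sym f g : htpy f g -> htpy g f.
Proof. by move=> c; apply: composite_htpy c (composite_idr f). Qed.

Lemma htpy_comp f g h h' : htpy h h' -> composite f g h -> composite f g h'.
Proof.
move=> hh c; have [_ _ e] := composite_ends c.
by apply: assocL c (composite_idr g) _; rewrite -e.
Qed.

Lemma htpy_compl f f' g h : htpy f f' -> composite f g h -> composite f' g h.
Proof.
move=> hh c; have [e _ _] := composite_ends c.
by apply: assocR hh _ c; rewrite e; apply: composite_idl.
Qed.

Lemma idl_htpy f g x : composite (cst 1 x) f g -> htpy f g.
Proof.
move=> c; have [e _ _] := composite_ends c; rewrite tgt_cst in e.
by apply: (composite_htpy _ c); rewrite e; apply: composite_idl.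
Qed.

Lemma idr_htpy f g x : composite f (cst 1 x) g -> htpy f g.
Proof. by move=> c; have [e _ _] := composite_ends c; rewrite src_cst in e; rewrite /htpy e. Qed.

Lemma htpy_trans f g h : htpy f g -> htpy g h -> htpy f h.
Proof.
move=> fg gh; apply: htpy_compl (htpy_sym fg) _.
by have [_ _ e] := composite_ends fg; rewrite tgt_cst in e; rewrite -e.
Qed.

Lemma equiv_of_lr e a b x y : composite a e (cst 1 x) -> composite e b (cst 1 y) ->
  is_equiv e.
Proof.
move=> ae eb; have [e1 /esym e2 /esym e3] := composite_cst ae; have [e4 /esym e5 /esym e6] := composite_cst eb.
have ab : htpy a b.
  apply: composite_htpy (composite_idr a) _.
  rewrite e1 -e5; apply: assocL ae eb _.
  by rewrite e3 e4; apply: composite_idl.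
exists b; rewrite -e3 -e5; split=> //.
exact: htpy_compl ab ae.
Qed.

Lemma is_equiv_cst x : is_equiv (cst 1 x : X 1).
Proof.
exists (cst 1 x); rewrite src_cst tgt_cst.
by have := composite_idr (cst 1 x : X 1); rewrite tgt_cst.
Qed.

Lemma is_equiv_comp f g h : composite f g h -> is_equiv f -> is_equiv g -> is_equiv h.
Proof.
move=> c [f' [f1 f2]] [g' [g1 g2]].
have [e1 e2 e3] := composite_ends c.
have [e4 _ /esym e5] := composite_cst f1; have [e6 _ /esym e7] := composite_cst g1.
have [|h' c'] := @composite_ex g' f'; first by rewrite -e7 -e1 e4.
apply: (@equiv_of_lr h h' h' (tgt g) (src f)).
  apply: assocR c' _ g2; apply: assocL f2 c _; rewrite e1; exact: composite_idl.
apply: assocR c _ f1; apply: assocL g1 c' _; rewrite -e1 e4; exact: composite_idl.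
Qed.

Lemma is_equiv_left f g h : composite f g h -> is_equiv g -> is_equiv h -> is_equiv f.
Proof.
move=> c [g' [g1 g2]] [h' [h1 h2]].
have [e1 e2 e3] := composite_ends c.
have [e4 /esym e5 /esym e6] := composite_cst g1; have [e7 /esym e8 /esym e9] := composite_cst h1.
have [|a ca] := @composite_ex g h'; first by rewrite -e3 e7.
have fa : composite f a (cst 1 (src h)) by apply: assocL c ca h1.
have hg : composite h g' f.
  by apply: assocR c g1 _; rewrite -e1; apply: composite_idr.
have [|b cb] := @composite_ex h' f; first by rewrite -e2 e9.
apply: (@equiv_of_lr f a a (tgt f) (src h)) => //.
have hf : composite h' f g'.
  apply: assocL h2 hg _; rewrite e3 e4; exact: composite_idl.
by rewrite e1; apply: assocR ca hf g1.
Qed.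

Lemma is_equiv_right f g h : composite f g h -> is_equiv f -> is_equiv h -> is_equiv g.
Proof.
move=> c [f' [f1 f2]] [h' [h1 h2]].
have [e1 e2 e3] := composite_ends c.
have [e4 /esym e5 /esym e6] := composite_cst f1; have [e7 /esym e8 /esym e9] := composite_cst h1.
have fh : composite f' h g.
  by apply: assocL f2 c _; rewrite e1; apply: composite_idl.
have [|a ca] := @composite_ex h' f; first by rewrite -e2 e9.
have ag : composite a g (cst 1 (tgt h)) by apply: assocR ca c h2.
apply: (@equiv_of_lr g a a (tgt h) (tgt f)) => //.
have hf : composite h a f.
  by apply: assocL h1 ca _; rewrite e2; apply: composite_idl.
by apply: assocR fh hf f2.
Qed.

Lemma is_equiv_htpy f g : htpy f g -> is_equiv f -> is_equiv g.
Proof. by move=> fg fe; apply: is_equiv_comp fg fe (is_equiv_cst _). Qed.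

End Calculus.

Lemma square_equiv (X : sSet) (Xq : quasicat X) (f g g' f' : X 1) :
  square f g g' f' -> is_equiv g -> is_equiv g' -> (is_equiv f <-> is_equiv f').
Proof.
move=> [d [c c']] ge ge'; split=> fe.
  exact: is_equiv_right Xq _ _ _ c' ge (is_equiv_comp Xq c fe ge').
exact: is_equiv_left Xq _ _ _ c ge' (is_equiv_comp Xq c' ge fe).
Qed.

(** * Slices; equivalences are cocartesian *)

Lemma simp_cone_id n : simp_cone (simp_id n) = simp_id n.+1.
Proof. by apply: simp_eq => i /=; rewrite /simp_cone_fun; case: unliftP. Qed.

Lemma simp_cone_comp m n k (g : simp n k) (f : simp m n) :
  simp_cone (simp_comp g f) = simp_comp (simp_cone g) (simp_cone f).
Proof.
apply: simp_eq => i /=; rewrite {1 3}/simp_cone_fun; case: unliftP => [i' _|_].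
  by rewrite /simp_cone_fun liftK.
by rewrite /simp_cone_fun unlift_none.
Qed.

Lemma lift_maxE n (i : 'I_n.+1) : lift ord_max i = i :> nat.
Proof. by rewrite /= /bump leqNgt ltn_ord. Qed.

Lemma cone_face n (i : 'I_n.+2) : simp_cone (simp_face i) = simp_face (lift ord_max i).
Proof.
apply: simp_eq => j; apply: val_inj => /=; rewrite /simp_cone_fun.
case: unliftP => [j' ->|->]; rewrite /= /bump; [have := ltn_ord j'|]; have := ltn_ord i; lia.
Qed.

(** The slice over [x] as a decalage: an n-simplex is an (n+1)-simplex whose last vertex is [x], and
    [simp_cone] fixes that vertex. *)
Program Definition dec (X : sSet) (x : X 0) : sSet :=
  @SSet (fun n => {s : X n.+1 | vertex s ord_max = x})
    (fun m n f s => exist _ (sact (simp_cone f) (sval s)) _) _ _.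
Next Obligation. by rewrite vertex_act simp_cone_max. Qed.
Next Obligation. by apply: sig_eq; rewrite /= simp_cone_id sact_id. Qed.
Next Obligation. by apply: sig_eq; rewrite /= simp_cone_comp sact_comp. Qed.

Program Definition dec_proj (X : sSet) (x : X 0) : smap (dec x) X :=
  @SMap (dec x) X (fun n s => sact (simp_face ord_max) (sval s)) _.
Next Obligation. by rewrite /= -!sact_comp simp_cone_face. Qed.

Section Slice.
Variables (Y W : sSet) (q : smap Y W).

(** The target of the relative slice [slice_map q y], from Y_/y to the pullback of W_/qy and Y over
    W. A horn against this map is a horn of one dimension more against [q], with the same omitted
    vertex and last vertex [y]; this lowers the dimension in the inductions below. *)
Definition slice_base (y : Y 0) : sSet := pullback (dec_proj (q 0 y)) q.
Definition slice_pr (y : Y 0) : smap (slice_base y) Y := pr2 (dec_proj (q 0 y)) q.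

Program Definition slice_map (y : Y 0) : smap (dec y) (slice_base y) :=
  @SMap (dec y) (slice_base y) (fun n s => exist _
    (exist _ (q n.+1 (sval s)) _, sact (simp_face ord_max) (sval s)) _) _.
Next Obligation. by rewrite -vertex_nat. Qed.
Next Obligation. by rewrite sm_nat. Qed.
Next Obligation.
apply: sig_eq => /=; congr (_, _).
  by apply: sig_eq; rewrite /= sm_nat.
by rewrite -!sact_comp simp_cone_face.
Qed.

Definition fillR n (k : 'I_n.+2) (R : ('I_n.+2 -> Y n) -> W n.+1 -> Prop) :=
  forall y t, faces_compat k y -> R y t ->
  (forall i, i != k -> q n (y i) = sact (simp_face i) t) ->
  exists x, q n.+1 x = t /\ forall i, i != k -> sact (simp_face i) x = y i.

End Slice.

Definition apex_face (T : Type) n (z : 'I_n.+2 -> T) (x : T) (j : 'I_n.+3) : T :=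
  if unlift ord_max j is Some i then z i else x.

Lemma other_face n (k : 'I_n.+2) : exists i, i != k.
Proof.
by case: (eqVneq k ord0) => [->|]; [exists ord_max|exists ord0; rewrite eq_sym].
Qed.

Lemma dec_compat (Y : sSet) (y : Y 0) n (k : 'I_n.+2) (z : 'I_n.+2 -> dec y n) :
  faces_compat k z -> forall a b i j : 'I_n.+2, a < b -> a != k -> b != k ->
  i = a :> nat -> j.+1 = b :> nat ->
  sact (simp_face i) (sval (z b)) = sact (simp_face j) (sval (z a)).
Proof.
case: n k z => [|n] k z zc a b i j ab ak bk ei ej.
  by move: ak bk ab; rewrite -!val_eqE /=; have := ltn_ord a; have := ltn_ord b; have := ltn_ord k; lia.
have ia : a < n.+2 by have := ltn_ord b; lia.
have jb : b.-1 < n.+2 by have := ltn_ord b; lia.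
have ff : simp_comp (simp_face a) (simp_face (Ordinal jb)) =
          simp_comp (simp_face b) (simp_face (Ordinal ia)).
  by apply: face_face => //=; lia.
have := congr1 sval (zc a b ak bk _ _ _ ff); rewrite /= !cone_face.
have -> : lift ord_max (Ordinal jb) = j by apply: ord_inj; rewrite lift_maxE /=; lia.
by have -> : lift ord_max (Ordinal ia) = i by apply: ord_inj; rewrite lift_maxE /=; lia.
Qed.

Section SliceFill.
Variables (Y W : sSet) (q : smap Y W).

(** The last face of the larger simplex is the component in [Y] of the base simplex, the other faces
    are simplices of [dec y], and [apex_face] glues them. The condition [R] sees only the last face,
    which is where the edge {0,1} sits. *)
Lemma slice_down n (k : 'I_n.+2) (R : Y n.+1 -> W n.+2 -> Prop) :
  fillR q (n := n.+1) (lift ord_max k) (fun z w => R (z ord_max) w) ->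
  forall y, fillR (slice_map q y) k (fun _ t => R (sval t).2 (sval (sval t).1)).
Proof.
move=> H y z [[[w wy] x] e] zc Rt qz; have e' : sact (simp_face ord_max) w = q n.+1 x := e.
pose z' : 'I_n.+3 -> Y n.+1 := apex_face (fun i => sval (z i)) x.
have z'l i : z' (lift ord_max i) = sval (z i) by rewrite /z' /apex_face liftK.
have z'm : z' ord_max = x by rewrite /z' /apex_face unlift_none.
have qz1 i : i != k -> q n.+1 (sval (z i)) = sact (simp_face (lift ord_max i)) w.
  by move=> /qz /(congr1 (fun u => sval (sval u).1)) /=; rewrite cone_face.
have qz2 i : i != k -> sact (simp_face ord_max) (sval (z i)) = sact (simp_face i) x.
  by move=> /qz /(congr1 (fun u => (sval u).2)).
have zc' : faces_compat (lift ord_max k) z'.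
  apply: compat_of => i j i' j' ij ik jk ei ej.
  case: (unliftP ord_max i) => [a|] ea; last first.
    by move: ij (ltn_ord j); rewrite ea /=; lia.
  case: (unliftP ord_max j) => [b|] eb; last first.
    rewrite ea eb z'l z'm.
    have -> : j' = ord_max by apply: val_inj; move: ej; rewrite eb /=; lia.
    rewrite qz2; last by apply: contraNneq ik => <-; rewrite ea.
    by congr (sact (simp_face _) _); apply: ord_inj; move: ei; rewrite ea lift_maxE.
  rewrite ea eb !z'l; rewrite ea eb !lift_maxE in ij ei ej.
  have ak : a != k by apply: contraNneq ik => <-; rewrite ea.
  have bk : b != k by apply: contraNneq jk => <-; rewrite eb.
  exact: (dec_compat zc).
have [| |X [qX XF]] := H z' w zc'; first by rewrite z'm.
  move=> j jk; case: (unliftP ord_max j) jk => [a|] -> jk.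
    by rewrite z'l qz1 //; move: jk; rewrite (inj_eq lift_inj).
  by rewrite z'm -e'.
have Xf i : i != k -> sact (simp_face (lift ord_max i)) X = sval (z i).
  by move=> ik; rewrite XF ?z'l // (inj_eq lift_inj).
have Xm : sact (simp_face ord_max) X = x.
  by rewrite XF ?z'm // neq_lift.
have [i0 i0k] := other_face k.
have Xy : vertex X ord_max = y.
  rewrite -(svalP (z i0)) -Xf // vertex_act; congr (vertex X _).
  by apply: val_inj; rewrite /= /bump; have := ltn_ord i0; lia.
exists (exist _ X Xy); split; last by move=> i ik; apply: sig_eq; rewrite /= cone_face Xf.
by apply: sig_eq => /=; congr (_, _) => //; apply: sig_eq.
Qed.

Lemma slice_up n (k : 'I_n.+2) (R : Y n.+1 -> W n.+2 -> Prop) :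
  (forall y, fillR (slice_map q y) k (fun _ t => R (sval t).2 (sval (sval t).1))) ->
  fillR q (n := n.+1) (lift ord_max k) (fun z w => R (z ord_max) w).
Proof.
move=> H z w zc Rt qz.
have [i0 i0k] := other_face k.
(* Every face but the last contains the last vertex, and all of them agree there. *)
pose y := vertex (z (lift ord_max i0)) ord_max.
have lk i : i != k -> lift ord_max i != lift ord_max k by rewrite (inj_eq lift_inj).
have mk : ord_max != lift ord_max k by rewrite neq_lift.
have zy i : i != k -> vertex (z (lift ord_max i)) ord_max = y.
  move=> ik; apply: zc; rewrite ?lk //; apply: simp_eq => a; apply: val_inj.
  by rewrite /= /bump; have := ltn_ord i; have := ltn_ord i0; lia.
pose z' i : dec y n := match pselect (i != k) with
  | left u => exist _ (z (lift ord_max i)) (zy i u)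
  | right _ => exist _ (z (lift ord_max i0)) erefl end.
have z'E i : i != k -> sval (z' i) = z (lift ord_max i).
  by rewrite /z'; case: pselect.
have wy : vertex w ord_max = q 0 y.
  rewrite vertex_nat qz ?lk // vertex_act; congr (vertex w _).
  by apply: val_inj; rewrite /= /bump; have := ltn_ord i0; lia.
have xe : sact (simp_face ord_max) w = q n.+1 (z ord_max) by rewrite qz.
pose t : slice_base q y n.+1 := exist _ (exist _ w wy, z ord_max) xe.
have [|||X [qX XF]] := H y z' t.
- move=> i j ik jk m f g e; apply: sig_eq; rewrite /= !z'E //.
  by apply: zc; rewrite ?lk // -!cone_face -!simp_cone_comp e.
- by [].
- move=> i ik; apply: sig_eq => /=; congr (_, _).
    by apply: sig_eq; rewrite /= z'E // qz ?lk // cone_face.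
  rewrite z'E //; apply: zc; rewrite ?lk // -cone_face.
  exact: simp_cone_face.
exists (sval X); split; first by have := congr1 (fun u => sval (sval u).1) qX.
move=> j jk; case: (unliftP ord_max j) jk => [i|] -> jk.
  have ik : i != k by move: jk; rewrite (inj_eq lift_inj).
  by rewrite -z'E // -XF //= cone_face.
by have := congr1 (fun u => (sval u).2) qX.
Qed.

End SliceFill.

Definition right_fibration (Y W : sSet) (q : smap Y W) :=
  forall n (k : 'I_n.+2), 0 < k -> fillR q k (fun _ _ => True).

(** The condition is put on the edge {0,1} of the base simplex rather than of the horn, because for
    [n = 0] the horn is a point and does not contain that edge. This is the start of the
    inductions. *)
Definition edge_lifting (Y W : sSet) (q : smap Y W) (E : W 1 -> Prop) n :=
  fillR q (n := n) ord0 (fun _ t => E (sact (edge01 n) t)).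

Lemma face_edge01 n :
  simp_comp (simp_face (@ord_max n.+2)) (edge01 n) = edge01 n.+1.
Proof.
apply: simp_eq => i; apply: ord_inj.
change (bump n.+2 (edge01 n i) = edge01 n.+1 i); rewrite !edge01E /bump.
by rewrite leqNgt (leq_trans (ltn_ord i)).
Qed.

Lemma edge01_0 : edge01 0 = simp_id 1.
Proof. by apply: simp_eq => i; apply: ord_inj; rewrite edge01E. Qed.

Lemma lift_max0 n : lift ord_max ord0 = ord0 :> 'I_n.+3.
Proof. exact: val_inj. Qed.

Lemma fillR_ext (Y W : sSet) (q : smap Y W) n (k : 'I_n.+2)
    (R R' : ('I_n.+2 -> Y n) -> W n.+1 -> Prop) :
  (forall y t, R' y t -> R y t) -> fillR q k R -> fillR q k R'.
Proof. by move=> RR H y t yc /RR Rt; apply: H. Qed.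

Lemma edge_lifting_slice (Y W : sSet) (q : smap Y W) E n :
  edge_lifting q E n.+1 <-> forall y, edge_lifting (slice_map q y)
    (fun t => E (q 1 (slice_pr q y 1 t))) n.
Proof.
have eE y (t : slice_base q y n.+1) :
    q 1 (slice_pr q y 1 (sact (edge01 n) t)) = sact (edge01 n.+1) (sval (sval t).1).
  by rewrite /= sm_nat -(svalP t) /= -sact_comp face_edge01.
rewrite /edge_lifting -lift_max0; split=> H.
  move=> y; have := @slice_down _ _ q n ord0 (fun _ w => E (sact (edge01 n.+1) w)) H y.
  by apply: fillR_ext => z t; rewrite eE.
apply: (@slice_up _ _ q n ord0 (fun _ w => E (sact (edge01 n.+1) w))) => y.
by apply: fillR_ext (H y) => z t; rewrite eE.
Qed.

Lemma cocartesian_slice (X S : sSet) (p : smap X S) e :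
  cocartesian p e <-> forall y n, edge_lifting (slice_map p y)
    (fun t => slice_pr p y 1 t = e) n.
Proof.
rewrite cocart_fill; split=> H.
  move=> y n.
  apply: (@slice_down _ _ p n ord0 (fun z _ => sact (edge01 n) z = e)).
  by rewrite lift_max0; apply: H.
move=> n; rewrite -lift_max0.
by apply: (@slice_up _ _ p n ord0 (fun z _ => sact (edge01 n) z = e)) => y; apply: H.
Qed.

Lemma right_fibration_inner (Y W : sSet) (q : smap Y W) :
  right_fibration q -> inner_fibration q.
Proof.
by move=> H; apply/inner_fill => n k /andP [k0 _] y t yc _; apply: H.
Qed.

Lemma right_fibration_comp (Y W V : sSet) (q : smap Y W) (r : smap W V) :
  right_fibration q -> right_fibration r -> right_fibration (smap_comp r q).
Proof.
move=> Hq Hr n k k0 y t yc _ yt.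
have [|||x [xt xy]] := Hr n k k0 (fun i => q n (y i)) t.
- by move=> i j ik jk m f g e; rewrite -!sm_nat (yc i j ik jk m f g e).
- by [].
- exact: yt.
have [||z [zx zy]] := Hq n k k0 y x yc; [by []|by move=> i ik; rewrite xy|].
by exists z; rewrite /= zx.
Qed.

Lemma right_fibration_pullback (Y Z W : sSet) (f : smap Y W) (g : smap Z W) :
  right_fibration f -> right_fibration (pr2 f g).
Proof.
move=> H n k k0 y t yc _ yt.
have [|||x [xt xy]] := H n k k0 (fun i => (sval (y i)).1) (g _ t).
- by move=> i j ik jk m a b /(yc i j ik jk) /(congr1 (fun u => (sval u).1)).
- by [].
- by move=> i ik; rewrite (svalP (y i)) -sm_nat; congr (g n _); apply: yt.
exists (exist _ (x, t) xt); split=> // i ik.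
by apply: sig_eq; rewrite /= xy // -yt //= [RHS]surjective_pairing.
Qed.

Lemma slice_right_fibration (X S : sSet) (p : smap X S) y :
  inner_fibration p -> right_fibration (slice_map p y).
Proof.
move=> /inner_fill H n k k0.
apply: (@slice_down _ _ p n k (fun _ _ => True)) => z w zc _ zw.
apply: H => //; rewrite lift_maxE k0 /= ltnS; exact: ltn_ord k.
Qed.

Lemma dec_right_fibration (S : sSet) s : quasicat S -> right_fibration (@dec_proj S s).
Proof.
move=> Sq n k k0 y x yc _ yx.
pose t : slice_base (to_pt S) s n.+1 := exist _ (exist _ tt erefl, x) erefl.
have [||z [zt zy]] := @slice_right_fibration S pt (to_pt S) s Sq n k k0 y t yc.
- by [].
- move=> i ik; apply: sig_eq => /=; congr (_, _); first exact: sig_eq.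
  exact: yx.
by exists z; split=> //; move: (congr1 (fun u => (sval u).2) zt).
Qed.

Lemma slice_pr_right_fibration (X S : sSet) (p : smap X S) y :
  quasicat S -> right_fibration (slice_pr p y).
Proof. by move=> Sq; apply/right_fibration_pullback/dec_right_fibration. Qed.

Lemma fc_fc (X : sSet) n (x : X n.+2) a b : a < b < n.+3 -> fc a (fc b x) = fc b.-1 (fc a x).
Proof.
move=> /andP [ab b4]; rewrite /fc -!sact_comp; congr (sact _ _); apply: esym.
apply: face_face; rewrite !inordK //; lia.
Qed.

Lemma fc_src (X : sSet) (e : X 1) : fc 1 e = src e.
Proof.
rewrite /fc /src /vertex; congr (sact _ _); apply: simp_eq => i.
by apply: ord_inj; rewrite /= /bump inordK //; case: i => [[|//] ?].
Qed.

Lemma fc_tgt (X : sSet) (e : X 1) : fc 0 e = tgt e.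
Proof.
rewrite /fc /tgt /vertex; congr (sact _ _); apply: simp_eq => i.
by apply: ord_inj; rewrite /= /bump inordK //; case: i => [[|//] ?].
Qed.

Section Lift2.
Variables (Z Y : sSet) (q : smap Z Y) (qr : right_fibration q).

Lemma lift_edge_tgt (e : Y 1) (z : Z 0) : q 0 z = tgt e ->
  exists e', [/\ q 1 e' = e, tgt e' = z & src (q 1 e') = src e].
Proof.
move=> qz; have [||||x [xe xz]] := @qr 0 (inord 1) _ (fun=> z) e.
- by rewrite inordK.
- move=> i j; case: (ord2P i) (ord2P j) => -> [] -> // _ _ m f g _.
  - by congr (sact _ _); apply: simp_eq => a; apply: val_inj; case: (f a) (g a) => [[|//] ?] [[|//] ?].
  - by congr (sact _ _); apply: simp_eq => a; apply: val_inj; case: (f a) (g a) => [[|//] ?] [[|//] ?].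
  - by congr (sact _ _); apply: simp_eq => a; apply: val_inj; case: (f a) (g a) => [[|//] ?] [[|//] ?].
  - by congr (sact _ _); apply: simp_eq => a; apply: val_inj; case: (f a) (g a) => [[|//] ?] [[|//] ?].
- by [].
- move=> i; case: (ord2P i) => -> ne; last first.
    by case/eqP: ne; apply: ord_inj; rewrite inordK.
  rewrite qz -fc_tgt /fc; congr (sact _ _); congr simp_face.
  by apply: ord_inj; rewrite inordK.
exists x; split; rewrite ?xe // -fc_tgt; apply: xz.
by rewrite -(inj_eq val_inj) /= !inordK.
Qed.

Lemma lift_tri_right (g h : Z 1) (t : Y 2) : tgt g = tgt h ->
  q 1 g = fc 0 t -> q 1 h = fc 1 t ->
  exists T, [/\ q 2 T = t, fc 0 T = g & fc 1 T = h].
Proof.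
move=> gh qg qh.
have [||||x [xe xz]] := @qr 1 (inord 2) _ (fun i => nth4 g h h h i) t.
- by rewrite inordK.
- apply: compat_nat => -[|[|a]] [|[|[|b]]] //=; rewrite ?inordK // => H _ _; try (exfalso; lia).
  by rewrite !fc_tgt.
- by [].
- move=> i; case: (ord3P i) => -> /=; rewrite ?inordK //.
  - by rewrite qg /fc ord03.
  - by rewrite -ord_max3 eqxx.
by exists x; split=> //; rewrite (fill_nat xz) // inordK.
Qed.

End Lift2.

Lemma lift_tri_inner (Z Y : sSet) (q : smap Z Y) (g f : Z 1) (t : Y 2) :
  inner_fibration q -> tgt f = src g -> q 1 f = fc 2 t -> q 1 g = fc 0 t ->
  exists T, [/\ q 2 T = t, fc 2 T = f & fc 0 T = g].
Proof.
move=> /inner_fill qi gf qf qg.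
have [||||x [xe xz]] := @qi 1 (inord 1) _ (fun i => nth4 g g f f i) t.
- by rewrite inordK.
- apply: compat_nat => -[|[|a]] [|[|[|b]]] //=; rewrite ?inordK // => H _ _; try (exfalso; lia).
  by rewrite fc_tgt fc_src.
- by [].
- move=> i; case: (ord3P i) => -> /=; rewrite ?inordK //.
  - by rewrite qg /fc ord03.
  - by rewrite eqxx.
  - by rewrite qf /fc ord_max3.
by exists x; split=> //; rewrite (fill_nat xz) // inordK.
Qed.

(** Lifting gives an edge [e1] which followed by [e] is the identity, then an edge which followed by
    [e1] is the identity; so [e1] is invertible, and with it [e]. *)
Lemma right_fibration_conservative (Z Y : sSet) (q : smap Z Y) e :
  right_fibration q -> quasicat Y -> is_equiv (q 1 e) -> is_equiv e.
Proof.
move=> qr Yq.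
have Zq : quasicat Z by apply: quasicat_total Yq; apply: right_fibration_inner qr.
case=> e' [/compositeE [t1 [t12 t10 t11]] /compositeE [t2 [t22 t20 t21]]].
have [|||T2 [T2t T20 T21]] := lift_tri_right qr (g := e) (h := cst 1 (tgt e)) (t := t2).
- by rewrite tgt_cst.
- by [].
- by rewrite cst_nat tgt_nat.
pose e1 := fc 2 T2.
have qe1 : q 1 e1 = e' by rewrite /e1 /fc sm_nat T2t.
have c1 : composite e1 e (cst 1 (tgt e)) by apply/compositeE; exists T2.
have [E1 E2 E3] := composite_cst c1.
have [|||T1 [T1t T10 T11]] := lift_tri_right qr (g := e1) (h := cst 1 (src e)) (t := t1).
- by rewrite tgt_cst.
- by rewrite qe1.
- by rewrite cst_nat src_nat.
have c2 : composite (fc 2 T1) e1 (cst 1 (src e)) by apply/compositeE; exists T1.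
apply: (is_equiv_right Zq c1 (equiv_of_lr Zq c2 c1)).
exact: is_equiv_cst.
Qed.

Lemma edge_lifting0 (Y W : sSet) (q : smap Y W) (E : W 1 -> Prop) :
  edge_lifting q E 0 <->
  forall w y, E w -> q 0 y = src w -> exists e, q 1 e = w /\ src e = y.
Proof.
have f1 : ord_max = inord 1 :> 'I_2 by apply: ord_inj; rewrite inordK.
split=> H.
  move=> w y Ew yw; have [|||e [qe ey]] := H (fun=> y) w.
  - move=> i j; case: (ord2P i) (ord2P j) => -> [] -> // _ _ m f g _.
    by congr (sact _ _); apply: simp_eq => a; apply: val_inj; case: (f a) (g a) => [[|//] ?] [[|//] ?].
  - by rewrite edge01_0 sact_id.
  - by move=> i; case: (ord2P i) => -> // _; rewrite yw -fc_src f1.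
  by exists e; split=> //; rewrite -fc_src /fc -f1 ey.
move=> z w zc; rewrite edge01_0 sact_id => Ew zw.
have [|e [qe ey]] := H w (z ord_max) Ew; first by rewrite zw // -fc_src f1.
exists e; split=> // i; case: (ord2P i) => -> // _.
by rewrite -ey -fc_src f1.
Qed.

(** Joyal's theorem on special outer horns. The statement quantifies over all [q] since the
    induction passes to the relative slice; its base still maps to [W] by a right fibration, so an
    edge over an invertible one is invertible there by conservativity. *)
Lemma equiv_edge_lifting n : forall (Y W : sSet) (q : smap Y W),
  right_fibration q -> quasicat W -> edge_lifting q (fun w => is_equiv w) n.
Proof.
elim: n => [|n IH] Y W q qr Wq.
  apply/edge_lifting0 => w y [w' [/compositeE [t [t2 t0 t1]] /composite_cst [e1 _ e3]]] yw.
  have [|G [qG Gy _]] := lift_edge_tgt qr (e := w') (z := y); first by rewrite yw e1.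
  have [|||T [Tt T0 T1]] := lift_tri_right qr (g := G) (h := cst 1 y) (t := t).
  - by rewrite tgt_cst.
  - by rewrite qG.
  - by rewrite cst_nat yw.
  exists (fc 2 T); rewrite /fc sm_nat Tt; split=> //.
  by rewrite -fc_src -/(fc 2 T) (@fc_fc _ 0 _ 1 2) // T1 fc_src src_cst.
apply/edge_lifting_slice => y.
have pr := @slice_pr_right_fibration _ _ q y Wq.
have Yq : quasicat Y by apply: quasicat_total Wq; apply: right_fibration_inner qr.
have qi := right_fibration_inner qr.
have Bq : quasicat (slice_base q y).
  by apply: quasicat_total Yq; apply: right_fibration_inner pr.
apply: fillR_ext (IH _ _ _ (@slice_right_fibration _ _ _ y qi) Bq) => z t.
exact: (right_fibration_conservative (q := smap_comp q (slice_pr q y))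
  (right_fibration_comp pr qr) Wq).
Qed.

Theorem equiv_cocartesian (X S : sSet) (p : smap X S) e :
  inner_fibration p -> quasicat S -> is_equiv e -> cocartesian p e.
Proof.
move=> pin Sq ee; apply/cocartesian_slice => y n.
have pr := @slice_pr_right_fibration _ _ p y Sq.
have Xq : quasicat X by apply: quasicat_total pin Sq.
have Bq : quasicat (slice_base p y).
  by apply: quasicat_total Xq; apply: right_fibration_inner pr.
have := @equiv_edge_lifting n _ _ _ (@slice_right_fibration _ _ _ y pin) Bq.
apply: fillR_ext => z t et.
by apply: (right_fibration_conservative pr Xq); rewrite et.
Qed.

(** The same induction for a composite; [r] remembers the projection of the iterated slices to [X],
    along which the triangle is lifted first. In dimension zero an edge over [f] and then one over
    [g] are lifted through [q] and composed by an inner horn. *)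
Lemma edge_lifting_comp (X : sSet) (f g h : X 1) n : composite f g h ->
  forall (Y W : sSet) (q : smap Y W) (r : smap W X),
  right_fibration q -> right_fibration r -> quasicat X ->
  (forall n, edge_lifting q (fun w => r 1 w = f) n) ->
  (forall n, edge_lifting q (fun w => r 1 w = g) n) ->
  edge_lifting q (fun w => r 1 w = h) n.
Proof.
move=> c; elim: n => [|n IH] Y W q r qr rr Xq Hf Hg.
  case/compositeE: c => t [t2 t0 t1].
  apply/edge_lifting0 => w y rw yw.
  have th : tgt h = tgt g.
    by rewrite -t1 -t0 -!fc_tgt (@fc_fc _ 0).
  have [|g' [rg' gw _]] := lift_edge_tgt rr (e := g) (z := tgt w).
    by rewrite tgt_nat rw.
  have [||T [Tt T0 T1]] := lift_tri_right rr gw (t := t); rewrite ?t0 ?t1 //.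
  have [f' [f'T f'y]] := proj1 (edge_lifting0 _ _) (Hf 0) (fc 2 T) y
    (ltac:(by rewrite /fc sm_nat Tt)) (ltac:(by rewrite yw -(fc_src (fc 2 T)) (@fc_fc _ 0 _ 1 2) // T1 fc_src)).
  have [|g'' [g''T g''y]] := proj1 (edge_lifting0 _ _) (Hg 0) g' (tgt f') rg'.
    by rewrite tgt_nat f'T -fc_src -T0 -fc_tgt (@fc_fc _ 0).
  have [||T' [T't T'2 T'0]] := lift_tri_inner (right_fibration_inner qr)
    (esym g''y) (t := T); rewrite ?f'T ?g''T //.
  exists (fc 1 T'); split; first by rewrite /fc sm_nat T't.
  by rewrite -fc_src -(@fc_fc _ 0 _ 1 2) // T'2 fc_src.
apply/edge_lifting_slice => y.
have Wq : quasicat W by apply: quasicat_total Xq; apply: right_fibration_inner rr.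
have pr := @slice_pr_right_fibration _ _ q y Wq.
have Yq : quasicat Y by apply: quasicat_total Wq; apply: right_fibration_inner qr.
have qi := right_fibration_inner qr.
have H := IH _ _ (slice_map q y) (smap_comp r (smap_comp q (slice_pr q y))).
apply: H => //.
- exact: slice_right_fibration.
- by apply: right_fibration_comp => //; apply: right_fibration_comp.
- by move=> m; apply: (proj1 (edge_lifting_slice _ _ _) (Hf m.+1)).
- by move=> m; apply: (proj1 (edge_lifting_slice _ _ _) (Hg m.+1)).
Qed.

Theorem cocartesian_comp (X S : sSet) (p : smap X S) (f g h : X 1) :
  inner_fibration p -> quasicat S -> composite f g h ->
  cocartesian p f -> cocartesian p g -> cocartesian p h.
Proof.
move=> pin Sq c /cocartesian_slice Hf /cocartesian_slice Hg.
apply/cocartesian_slice => y n.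
apply: (@edge_lifting_comp _ _ _ _ n c _ _ (slice_map p y) (slice_pr p y)).
- exact: slice_right_fibration.
- exact: slice_pr_right_fibration.
- exact: quasicat_total pin Sq.
- exact: Hf.
- exact: Hg.
Qed.

(** * Pointwise cocartesian transformations are cocartesian *)

Definition sub_pred (T : Type) (A B : T -> Prop) := forall x, A x -> B x.

(** * Zorn's lemma for predicates *)

Section Zorn.
Variables (T : Type) (Good : (T -> Prop) -> Prop) (A0 : T -> Prop).
Hypothesis Good0 : Good A0.

Definition chain (F : (T -> Prop) -> Prop) :=
  forall A B, F A -> F B -> sub_pred A B \/ sub_pred B A.
Definition union (F : (T -> Prop) -> Prop) x := exists2 A, F A & A x.

Hypothesis GoodU : forall F, (exists A, F A) -> (forall A, F A -> Good A) -> chain F ->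
  Good (union F).

Lemma sub_anti (A B : T -> Prop) : sub_pred A B -> sub_pred B A -> A = B.
Proof. by move=> AB BA; apply/funext => x; apply/propext; split; [apply: AB|apply: BA]. Qed.

Section Tower.
Variable succ : (T -> Prop) -> T -> Prop.
Hypothesis succG : forall A, Good A -> Good (succ A).
Hypothesis succS : forall A, sub_pred A (succ A).

(** The least family containing [A0] and closed under [succ] and unions of chains. It is a chain by
    the Bourbaki-Witt argument, hence its union is a member and is fixed by [succ]. *)
Inductive tower : (T -> Prop) -> Prop :=
| tower0 : tower A0
| towerS A : tower A -> tower (succ A)
| towerU F : (exists A, F A) -> (forall A, F A -> tower A) -> chain F -> tower (union F).

Lemma tower_good A : tower A -> Good A.
Proof. by elim=> [|B _|F F0 _ FG Fc]; [|apply: succG|apply: GoodU]. Qed.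

Lemma tower_ge A : tower A -> sub_pred A0 A.
Proof.
elim=> [|B _ IH|F [B FB] _ IH _] x x0 //; first by apply/succS/IH.
by exists B => //; apply: IH.
Qed.

Definition extreme A := forall B, tower B -> sub_pred B A -> ~ sub_pred A B ->
  sub_pred (succ B) A.

Lemma extreme_cmp A : tower A -> extreme A ->
  forall B, tower B -> sub_pred B A \/ sub_pred (succ A) B.
Proof.
move=> tA eA B; elim=> [|C tC [CA|AC]|F F0 tF IH Fc].
- by left; apply: tower_ge.
- case: (pselect (sub_pred A C)) => [AC|nAC]; last by left; apply: eA.
  by right; rewrite (sub_anti CA AC).
- by right => x /AC; apply: succS.
- case: (pselect (exists2 C, F C & sub_pred (succ A) C)) => [[C FC AC]|nF].
    by right => x /AC Cx; exists C.
  left => x [C FC Cx]; case: (IH C FC) => [|AC]; first exact.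
  by case: nF; exists C.
Qed.

Lemma tower_extreme A : tower A -> extreme A.
Proof.
elim: A / => [|A tA IH|F F0 tF IH Fc] B tB BA nAB.
- by case: nAB; apply: tower_ge.
- case: (extreme_cmp tA IH tB) => // BA'.
  case: (pselect (sub_pred A B)) => [AB|nAB']; first by rewrite (sub_anti BA' AB).
  by move=> x /(IH B tB BA' nAB') /succS.
- have [A FA nA] : exists2 A, F A & ~ sub_pred A B.
    apply: contrapT => H; apply: nAB => x [A FA Ax].
    by apply: contrapT => nB; apply: H; exists A => // /(_ x Ax).
  case: (extreme_cmp (tF _ FA) (IH _ FA) tB) => [BA'|AB].
    by move=> x /(IH _ FA B tB BA' nA) Ax; exists A.
  by case: nA => x Ax; apply/AB/succS.
Qed.

Lemma tower_chain : chain tower.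
Proof.
move=> A B tA tB; case: (extreme_cmp tA (tower_extreme tA) tB) => [|AB]; first by right.
by left => x Ax; apply/AB/succS.
Qed.

Lemma tower_top : exists A, [/\ sub_pred A0 A, Good A & sub_pred (succ A) A].
Proof.
have tM : tower (union tower).
  by apply: towerU => //; [exists A0; apply: tower0|apply: tower_chain].
exists (union tower); split; [exact: tower_ge|exact: tower_good|].
by move=> x Mx; exists (succ (union tower)) => //; apply: towerS.
Qed.

End Tower.

(** If nothing above [A0] were maximal, choice would give a successor strictly larger at every good
    predicate above [A0], against the fixed point of the tower. *)
Theorem zorn_maximal : exists A, [/\ sub_pred A0 A, Good A &
  forall B, Good B -> sub_pred A B -> sub_pred B A].
Proof.
apply: contrapT => H.
have ex A : exists B, [/\ Good A -> Good B, sub_pred A B &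
    Good A -> sub_pred A0 A -> ~ sub_pred B A].
  case: (pselect (Good A /\ sub_pred A0 A)) => [[GA A0A]|nA]; last first.
    by exists A; split=> // GA A0A; case: nA.
  apply: contrapT => H'; apply: H; exists A; split=> // B GB AB.
  by apply: contrapT => nBA; apply: H'; exists B.
have [||A [A0A GA]] := @tower_top (fun A => sval (cid (ex A))).
- by move=> A GA /=; case: (cid (ex A)) => B /= [GB _ _]; apply: GB.
- by move=> A /=; case: (cid (ex A)) => B /= [].
by move=> /=; case: (cid (ex A)) => B /= [_ _ nB] BA; case: (nB GA A0A BA).
Qed.

End Zorn.

(** * Partial maps and their extension along a matching of simplices *)

Section PartialMaps.
Variables (Y X S : sSet) (p : smap X S) (g : smap Y S).

(** A partial map is a set of pairs of a simplex and its value, so that extensions are inclusions of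
    predicates on one type and Zorn's lemma applies. *)
Inductive cells := cell n of Y n & X n.
Definition cell_dim (c : cells) := let: @cell n _ _ := c in n.
Definition defined (A : cells -> Prop) n (y : Y n) := exists x, A (cell y x).

Record partial_map (A : cells -> Prop) : Prop := PartialMap {
  pm_fun : forall n (y : Y n) x x', A (cell y x) -> A (cell y x') -> x = x';
  pm_act : forall m n (f : simp m n) y x, A (cell y x) -> A (cell (sact f y) (sact f x));
  pm_over : forall n (y : Y n) x, A (cell y x) -> p n x = g n y }.

Lemma defined_act A m n (f : simp m n) y : partial_map A -> defined A y -> defined A (sact f y).
Proof. by move=> Ap [x Ax]; exists (sact f x); apply: pm_act Ap _ _ _ _ _ Ax. Qed.

Lemma partial_map_chain (F : (cells -> Prop) -> Prop) : (forall A, F A -> partial_map A) ->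
  chain F -> partial_map (union F).
Proof.
move=> Fp Ft; split.
- move=> n y x x' [A FA Ax] [B FB Bx].
  case: (Ft A B FA FB) => s.
    exact: (pm_fun (Fp B FB) (s _ Ax) Bx).
  exact: (pm_fun (Fp A FA) Ax (s _ Bx)).
- by move=> m n f y x [A FA Ax]; exists A => //; apply: pm_act (Fp A FA) _ _ _ _ _ Ax.
- by move=> n y x [A FA Ax]; apply: pm_over (Fp A FA) _ _ _ Ax.
Qed.

Definition attach (A : cells -> Prop) (V : sSet) (u : smap V Y) (psi : smap V X) (c : cells) :=
  A c \/ exists n (w : V n), c = cell (u n w) (psi n w).

Lemma cell_inj n (y y' : Y n) x x' : cell y x = cell y' x' -> y = y' /\ x = x'.
Proof.
pose P (c : cells) := let: @cell m a b := c in forall h : m = n,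
  eq_rect m Y a n h = y /\ eq_rect m X b n h = x.
move=> e; have : P (cell y x) by move=> h; rewrite (Prop_irrelevance h erefl).
by rewrite e => /(_ erefl) [/= -> ->].
Qed.

Lemma attachE A V u psi n (y : Y n) x : @attach A V u psi (cell y x) <->
  A (cell y x) \/ exists w, y = u n w /\ x = psi n w.
Proof.
split=> [[|[m [w e]]]|[|[w [-> ->]]]]; [by left| |by left|by right; exists n, w].
have em : n = m by have := congr1 cell_dim e.
by subst m; right; exists w; apply: cell_inj e.
Qed.

Lemma attach_partial_map A V (u : smap V Y) (psi : smap V X) : partial_map A ->
  (forall n (w w' : V n), u n w = u n w' -> psi n w = psi n w') ->
  (forall n (w : V n) x, A (cell (u n w) x) -> psi n w = x) ->
  (forall n (w : V n), p n (psi n w) = g n (u n w)) ->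
  partial_map (attach A u psi).
Proof.
move=> Ap uu uA up; split.
- move=> n y x x' /attachE [Ax|[w [-> ->]]] /attachE [Ax'|[w' [e ->]]].
  + exact: pm_fun Ap _ _ _ _ Ax Ax'.
  + by rewrite e in Ax; rewrite (uA _ _ _ Ax).
  + exact: uA.
  + exact: uu.
- move=> m n f y x /attachE [Ax|[w [-> ->]]]; apply/attachE.
    by left; apply: pm_act Ap _ _ _ _ _ Ax.
  by right; exists (sact f w); rewrite !sm_nat.
- move=> n y x /attachE [Ax|[w [-> ->]]] //.
  exact: pm_over Ap _ _ _ Ax.
Qed.

Lemma partial_map_total A : partial_map A -> (forall n (y : Y n), defined A y) ->
  exists l : smap Y X, (forall n y, p n (l n y) = g n y) /\
    forall n y x, A (cell y x) -> l n y = x.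
Proof.
move=> Ap At; have [|||l lA] := @graph_smap Y X (fun n y x => A (cell y x)).
- exact: At.
- by move=> n y x x'; apply: pm_fun Ap _ _ _ _.
- by move=> m n f y x; apply: pm_act Ap _ _ _ _ _.
exists l; split=> n y; first by apply: pm_over Ap _ _ _ (lA n y).
by move=> x; apply: pm_fun Ap _ _ _ _ (lA n y).
Qed.

Definition horn_fills (A : cells -> Prop) n (t : Y n.+1) (k : 'I_n.+2) :=
  forall y, faces_compat k y -> (forall i, i != k -> A (cell (sact (simp_face i) t) (y i))) ->
  exists x, p n.+1 x = g n.+1 t /\ forall i, i != k -> sact (simp_face i) x = y i.

Section Matching.
Variables (A0 : cells -> Prop) (T : forall n, Y n.+1 -> 'I_n.+2 -> Prop).
Variable wt : forall n, Y n -> nat.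
Hypothesis A0p : partial_map A0.
Hypothesis T_nondeg : forall n (t : Y n.+1) k (f : simp n.+1 n), T t k ->
  t <> sact f (sact (simp_face k) t).
Hypothesis T_cover : forall n (y : Y n), [\/ defined A0 y,
  exists m (f : simp n m) y', m < n /\ y = sact f y' |
  exists m (f : simp n m.+1) t k, T t k /\ y = sact f t].
Hypothesis T_faces : forall n (t : Y n.+1) k i, T t k -> i != k ->
  defined A0 (sact (simp_face i) t) \/
  exists m (f : simp n m.+1) t' k', [/\ T t' k', wt t' < wt t &
    sact (simp_face i) t = sact f t'].
Hypothesis T_missing : forall n (t : Y n.+1) k, T t k -> ~ defined A0 (sact (simp_face k) t).
Hypothesis T_matching : forall n (t : Y n.+1) k m (t' : Y m.+1) k' (f : simp n m.+1),
  T t k -> T t' k' -> sact (simp_face k) t = sact f t' ->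
  (exists2 i, i != k' & forall j, f j != i) \/ exists f' : simp n.+1 m.+1, t = sact f' t'.
Hypothesis T_fill : forall A n (t : Y n.+1) k, partial_map A -> sub_pred A0 A -> T t k ->
  horn_fills A t k.

(** No free face is ever defined without its partner; otherwise filling the horn of [t] could
    contradict a value already given to the face [k]. *)
Definition saturated (A : cells -> Prop) :=
  forall n (t : Y n.+1) k, T t k -> defined A (sact (simp_face k) t) -> defined A t.

(** The simplex [t] can be attached because [A] meets it exactly in its horn ([inA]), and outside of
    the horn the map from the standard simplex to [Y] is injective ([free]). *)
Lemma saturated_attach A n (t : Y n.+1) k : partial_map A -> saturated A -> T t k ->
  ~ defined A t -> (forall i, i != k -> defined A (sact (simp_face i) t)) ->
  horn_fills A t k ->
  exists psi : smap (simplex n.+1) X, partial_map (attach A (yoneda t) psi).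
Proof.
move=> Ap As Tt tA tf fill.
have tk : ~ defined A (sact (simp_face k) t) by move=> /(As _ _ _ Tt).
pose y i : X n := match pselect (i != k) with
  | left u => sval (cid (tf i u))
  | right _ => sval (cid (tf _ (svalP (cid (other_face k))))) end.
have yA i : i != k -> A (cell (sact (simp_face i) t) (y i)).
  by move=> ik; rewrite /y; case: pselect => // u; case: cid.
have yc : faces_compat k y.
  move=> i j ik jk m f h e; have := pm_act Ap f (yA i ik).
  rewrite -sact_comp e sact_comp => e1.
  exact: (pm_fun Ap e1 (pm_act Ap h (yA j jk))).
have [x [px xy]] := fill y yc yA.
have missA m (f : simp m n.+1) i : i != k -> (forall j, f j != i) ->
    A (cell (sact f t) (sact f x)).
  move=> ik /simp_factor [f' ->]; rewrite !sact_comp xy //.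
  by apply: pm_act Ap _ _ _ _ _ (yA i ik).
have inA m (f : simp m n.+1) : defined A (sact f t) -> exists2 i, i != k & forall j, f j != i.
  case: (simp_surjP f) => [[i fi] fA|fs fA].
    case: (eqVneq i k) => ik; last by exists i.
    rewrite {i}ik in fi.
    have [f' ef] := simp_factor fi; rewrite ef.
    case: (simp_surjP f') => [[i f'i]|f's].
      exists (lift k i); first by rewrite eq_sym neq_lift.
      by move=> j /=; rewrite (inj_eq lift_inj).
    case: tk; have [s sK _] := simp_section ord0 f's.
    have -> : sact (simp_face k) t = sact s (sact f t).
      by rewrite ef -sact_comp -simp_compA sK simp_compI.
    exact: defined_act.
  case: tA; have [s sK _] := simp_section ord0 fs.
  by rewrite -[t]sact_id -sK sact_comp; apply: defined_act.
(* An endomorphism fixing [t] cannot miss a vertex: missing [i != k] would put [t] inside the horn,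
   missing [k] would make [t] a degeneracy of its face [k]. *)
have endo (s : simp n.+1 n.+1) : t = sact s t -> s = simp_id _.
  move=> e; case: (simp_surjP s) => [[i si]|/simp_endo //].
  case: (eqVneq i k) => ik; last by case: tA; rewrite e; exists (sact s x); apply: missA ik si.
  have [s' es] := simp_factor si; case: (T_nondeg (f := s') Tt).
  by rewrite -sact_comp -ik -es.
have free m (f h : simp m n.+1) : sact f t = sact h t -> ~ defined A (sact f t) -> f = h.
  move=> e fA.
  have hit i : i != k -> exists j, f j = i.
    move=> ik; apply: contrapT => nj; apply: fA.
    exists (sact f x); apply: missA ik _ => j; apply/eqP => fj; apply: nj; by exists j.
  case: (simp_surjP f) => [[i fi]|fs]; last first.
    apply: simp_eq => j; have [s sK sj] := simp_section j fs.
    have : t = sact (simp_comp h s) t.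
      by rewrite sact_comp -e -sact_comp sK sact_id.
    move=> /endo /(congr1 (fun u : simp _ _ => u (f j))) /=.
    by rewrite sj => ->.
  have ik : i = k.
    by case: (eqVneq i k) => // /hit [j fj]; move: (fi j); rewrite fj eqxx.
  rewrite {i}ik in fi.
  have hk j : h j != k.
    case: (simp_surjP h) => [[i hi]|hs].
      case: (eqVneq i k) => [<-|ik]; first exact: hi.
      by case: fA; rewrite e; exists (sact h x); apply: missA ik hi.
    have [s sK _] := simp_section ord0 hs.
    have : t = sact (simp_comp f s) t.
      by rewrite sact_comp e -sact_comp sK sact_id.
    move=> /endo /(congr1 (fun u : simp _ _ => u k)) /= fk.
    by move: (fi (s k)); rewrite fk eqxx.
  (* Both maps land in the face [k]; the argument is repeated for that face, whose own faces belong
     to the horn. *)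
  have [f' ef] := simp_factor fi; have [h' eh] := simp_factor hk.
  rewrite ef eh; congr simp_comp.
  have f's i : exists j, f' j = i.
    have [|j fj] := hit (lift k i); first by rewrite eq_sym neq_lift.
    by exists j; apply: (@lift_inj _ k); rewrite -fj ef.
  apply: simp_eq => j; have [s sK sj] := simp_section j f's.
  pose z := sact (simp_face k) t.
  have ez : z = sact (simp_comp h' s) z.
    rewrite /z -[in LHS](simp_compI (simp_face k)) -sK simp_compA -ef.
    rewrite sact_comp e eh -!sact_comp; congr (sact _ t); exact: simp_eq.
  have : simp_comp h' s = simp_id n.
    case: (simp_surjP (simp_comp h' s)) => [[i si]|/simp_endo //].
    case: tk; rewrite -/z ez /z -sact_comp.
    exists (sact (simp_comp (simp_face k) (simp_comp h' s)) x).
    apply: (missA _ _ (lift k i)); first by rewrite eq_sym neq_lift.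
    by move=> a /=; rewrite (inj_eq lift_inj); apply: si.
  move=> /(congr1 (fun u : simp _ _ => u (f' j))) /=.
  by rewrite sj => ->.
exists (yoneda x); apply: attach_partial_map => //=.
- move=> m f h e; case: (pselect (defined A (sact f t))) => [fA|/(free _ _ _ e) -> //].
  have [i ik fi] := inA _ _ fA.
  have [|j jk hj] := inA _ h; first by rewrite -e.
  apply: pm_fun Ap _ _ _ _ (missA _ _ _ ik fi) _; rewrite e.
  exact: missA jk hj.
- move=> m f x' Ax; have [|i ik fi] := inA _ f; first by exists x'.
  exact: pm_fun Ap _ _ _ _ (missA _ _ _ ik fi) Ax.
- by move=> m f; rewrite !sm_nat px.
Qed.

(** [T t k] matches the nondegenerate simplex [t] with its free face [k], and attaching both at once
    is a horn filling. The matched cells needed for the other faces of [t] have smaller weight, so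
    an undefined matched cell of least weight has its whole horn defined. *)
Theorem extend_matching : exists l : smap Y X,
  (forall n y, p n (l n y) = g n y) /\ forall n y x, A0 (cell y x) -> l n y = x.
Proof.
have [|F F0 FG Ft|A [A0A [Ap As _] Amax]] :=
    @zorn_maximal cells (fun A => [/\ partial_map A, saturated A & sub_pred A0 A]) A0.
- by split=> // n t k Tt /(T_missing Tt).
- split.
  + by apply: partial_map_chain => // A /FG [].
  + move=> n t k Tt [x [A FA Ax]]; have [_ As _] := FG A FA.
    have [|z Az] := As n t k Tt; first by exists x.
    by exists z, A.
  + by case: F0 => A FA c c0; exists A => //; case: (FG A FA) => _ _; apply.
suff At n (y : Y n) : defined A y.
  have [l [l1 l2]] := partial_map_total Ap At; exists l; split=> // n y x Ax.
  by apply: l2; apply: A0A.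
apply: contrapT => yA.
(* An undefined simplex of least dimension is not degenerate, so it lies in a matched cell, which is
   then undefined as well. *)
have ex1 : exists m, `[< exists l (t : Y l.+1) k, [/\ T t k, ~ defined A t & wt t = m] >].
  have : exists m, `[< exists y : Y m, ~ defined A y >] by exists n; apply/asboolP; exists y.
  case/ex_minnP => m /asboolP [z zA] zmin.
  case: (T_cover z) => [[x /A0A Ax]|[l [f [z' [lm e]]]]|[l [f [t [k [Tt e]]]]]].
  - by case: zA; exists x.
  - case: zA; rewrite e; apply: defined_act => //; apply: contrapT => z'A.
    have : m <= l by apply: zmin; apply/asboolP; exists z'.
    by rewrite leqNgt lm.
  - exists (wt t); apply/asboolP; exists l, t, k; split=> // tA; apply: zA.
    by rewrite e; apply: defined_act.
case/ex_minnP: ex1 => m /asboolP [l [t [k [Tt tA tm]]]] tmin.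
have tf i : i != k -> defined A (sact (simp_face i) t).
  move=> ik; case: (T_faces Tt ik) => [[x /A0A Ax]|[l' [f [t' [k' [Tt' lt ->]]]]]].
    by exists x.
  apply: defined_act => //; apply: contrapT => t'A.
  have : m <= wt t' by apply: tmin; apply/asboolP; exists l', t', k'.
  by rewrite leqNgt -tm lt.
have [psi psiP] := saturated_attach Ap As Tt tA tf (T_fill Ap A0A Tt).
have AA : sub_pred A (attach A (yoneda t) psi) by move=> c Ac; left.
suff GB : [/\ partial_map (attach A (yoneda t) psi), saturated (attach A (yoneda t) psi)
    & sub_pred A0 (attach A (yoneda t) psi)].
  apply: tA; exists (psi _ (simp_id _)); apply: (Amax _ GB AA (cell t _)).
  by apply/attachE; right; exists (simp_id _); rewrite /= sact_id.
split=> //; last by move=> c /A0A Ac; left.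
  move=> l' t' k' Tt' [x /attachE [Ax|[w [e _]]]].
    have [|z Az] := As _ _ _ Tt'; first by exists x.
    by exists z; apply/attachE; left.
  (* The extension stays saturated: a free face of [t'] that is a simplex of [t] either lies in the
     horn of [t], or forces [t'] itself to be a simplex of [t]. *)
  case: (T_matching Tt' Tt e) => [[i ik wi]|[f' ->]].
    have [f' ef] := simp_factor wi.
    have [|z Az] := As _ _ _ Tt'; last by exists z; apply/attachE; left.
    by rewrite e /= ef sact_comp; apply: defined_act => //; apply: tf.
by exists (psi _ f'); apply/attachE; right; exists f'.
Qed.

End Matching.
End PartialMaps.

Lemma ord_of n k (lt : k < n.+1) : exists i : 'I_n.+1, i = k :> nat.
Proof. by exists (Ordinal lt). Qed.

Lemma lift_below n (k : 'I_n.+2) (j : 'I_n.+1) : j < k -> lift k j = j :> nat.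
Proof. by rewrite /= /bump; lia. Qed.

Lemma lift_above n (k : 'I_n.+2) (j : 'I_n.+1) : k <= j -> lift k j = j.+1 :> nat.
Proof. by rewrite /= /bump; lia. Qed.

Lemma lift_ltn n (k : 'I_n.+2) (i j : 'I_n.+1) : i < j -> lift k i < lift k j.
Proof. by rewrite /= /bump; lia. Qed.

Lemma unbump_lt n (a : 'I_n.+1) (i : 'I_n.+2) : unbump a i < n.+1.
Proof. by have := ltn_ord a; have := ltn_ord i; rewrite /unbump; lia. Qed.

Lemma degen_mono n (a : 'I_n.+1) (i j : 'I_n.+2) : i <= j ->
  Ordinal (unbump_lt a i) <= Ordinal (unbump_lt a j).
Proof. by rewrite /= /unbump; lia. Qed.

Definition simp_degen n (a : 'I_n.+1) : simp n.+1 n :=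
  @Simp n.+1 n (fun i => Ordinal (unbump_lt a i)) (fun i j ij => degen_mono a ij).

(** * Filling a prism relative to a boundary and a left horn *)

Section Prism.
Variables (m N : nat) (X S : sSet) (p : smap X S).
Let Y := sprod (simplex m) (simplex N.+2).
Variable g : smap Y S.
Hypothesis pin : inner_fibration p.

(** The union of the boundary of [simplex m] times [simplex N.+2] and of [simplex m] times the left
    horn. *)
Definition in_box l (y : Y l) :=
  (exists i, forall j, y.1 j != i) \/ (exists2 i, i != ord0 & forall j, y.2 j != i).

Variable A0 : cells Y X -> Prop.
Hypothesis A0p : partial_map p g A0.
Hypothesis A0dom : forall l (y : Y l), defined A0 y <-> in_box y.
Hypothesis A0cocart : forall e, A0 (@cell Y X 1 (simp_cst 1 ord0, edge01 N.+1) e) ->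
  cocartesian p e.

Definition not_in_box l (y : Y l) :=
  (forall i, exists j, y.1 j = i) /\ (forall i, i != ord0 -> exists j, y.2 j = i).

Lemma in_boxN l (y : Y l) : in_box y \/ not_in_box y.
Proof.
case: (pselect (in_box y)) => H; [by left|right; split=> [i|i i0]].
  apply: contrapT => nj; apply: H; left; exists i => j; apply/eqP => e.
  by apply: nj; exists j.
apply: contrapT => nj; apply: H; right; exists i => // j; apply/eqP => e.
by apply: nj; exists j.
Qed.

Lemma in_box_not l (y : Y l) : in_box y -> not_in_box y -> False.
Proof.
case=> [[i yi]|[i i0 yi]] [H1 H2].
  by case: (H1 i) => j e; move: (yi j); rewrite e eqxx.
by case: (H2 i i0) => j e; move: (yi j); rewrite e eqxx.
Qed.

Definition nondeg l (y : Y l) :=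
  forall i j : 'I_l.+1, i < j -> (y.1 i < y.1 j) || (y.2 i < y.2 j).

(* The vertex k of y is (j, 0), followed by the first vertex (j, 1) outside of
   the row 0; the horn at k omits the face which forgets (j, 0). *)
Definition top_cell l (y : Y l.+1) (k : 'I_l.+2) :=
  [/\ nondeg y, not_in_box y & exists k1 : 'I_l.+2,
    [/\ k1 = k.+1 :> nat, y.2 k = ord0, y.2 k1 = 1 :> nat & y.1 k = y.1 k1]].

(** Lexicographic: the dimension comes first, then the distance of the first vertex above row 0 from
    the end of [simplex m]. That distance is at most [m], so the factor [m.+2] separates
    dimensions. *)
Definition weight l (y : Y l) :=
  l * m.+2 + \max_(i < l.+1 | 0 < y.2 i) (m - y.1 i).

Lemma weight_top l (y : Y l.+1) (k k1 : 'I_l.+2) : k1 = k.+1 :> nat -> y.2 k = ord0 ->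
  y.2 k1 = 1 :> nat -> weight y = l.+1 * m.+2 + (m - y.1 k1).
Proof.
move=> ek yk yk1; congr (_ + _); apply/eqP; rewrite eqn_leq; apply/andP; split.
  apply/bigmax_leqP => i yi; apply: leq_sub2l; apply: sf_mono.
  rewrite ek ltnNge; apply/negP => /(sf_mono y.2); rewrite yk leqn0.
  by move: yi; rewrite lt0n => /negbTE ->.
by apply: (@leq_bigmax_cond _ (fun i => 0 < y.2 i) (fun i => m - y.1 i) k1); rewrite yk1.
Qed.

Lemma weight_bound l (y : Y l) : weight y <= l * m.+2 + m.
Proof. by rewrite leq_add2l; apply/bigmax_leqP => i _; apply: leq_subr. Qed.

Lemma below_row l (y : Y l) (k i : 'I_l.+1) : y.2 k = ord0 -> i <= k -> y.2 i = ord0.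
Proof.
move=> yk /(sf_mono y.2); rewrite yk leqn0 => /eqP e; exact: ord_inj.
Qed.

Lemma above_row l (y : Y l) (k1 i : 'I_l.+1) : y.2 k1 = 1 :> nat -> k1 <= i -> 0 < y.2 i.
Proof. by move=> yk /(sf_mono y.2); rewrite yk. Qed.

Lemma nondeg_inj l (y : Y l) (i j : 'I_l.+1) : nondeg y ->
  y.1 i = y.1 j -> y.2 i = y.2 j -> i = j.
Proof.
move=> yn e1 e2; apply: ord_inj; case: (ltngtP i j) => // /yn.
  by rewrite e1 e2 !ltnn.
by rewrite e1 e2 !ltnn.
Qed.

Lemma top_nondeg l (y : Y l.+1) k (f : simp l.+1 l) : top_cell y k ->
  y <> sact f (sact (simp_face k) y).
Proof.
move=> [yn _ _] e.
have : k = lift k (f k).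
  apply: (nondeg_inj yn).
    exact: (congr1 (fun z : Y l.+1 => z.1 k) e).
  exact: (congr1 (fun z : Y l.+1 => z.2 k) e).
by move/eqP; rewrite (negbTE (neq_lift _ _)).
Qed.

Lemma top_missing l (y : Y l.+1) k : top_cell y k -> ~ defined A0 (sact (simp_face k) y).
Proof.
move=> [_ [y1 y2] [k1 [ek yk yk1 yy]]] /A0dom /in_box_not; apply; split=> [i|i i0] /=.
  have [j0 <-] := y1 i.
  have [j kj -> ] : exists2 j, j != k & y.1 j0 = y.1 j.
    case: (eqVneq j0 k) => [->|]; last by exists j0.
    by exists k1 => //; rewrite -(inj_eq val_inj) /= ek neq_ltn ltnSn orbT.
  case: (unliftP k j) kj => [j' ->|->]; last by rewrite eqxx.
  by exists j'.
have [j yj] := y2 i i0.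
case: (unliftP k j) yj => [j' ->|->] yj; first by exists j'.
by rewrite -yj yk eqxx in i0.
Qed.

(** If [f] hits every vertex other than [k'], it extends to [y] by sending [k] to [k']: the rows
    keep the vertices before [k] at or below [k'] and the later ones above it, and both forgotten
    vertices lie under the first vertex outside row 0. *)
Lemma top_matching l (y : Y l.+1) k l' (y' : Y l'.+1) k' (f : simp l l'.+1) :
  top_cell y k -> top_cell y' k' -> sact (simp_face k) y = sact f y' ->
  (exists2 i, i != k' & forall j, f j != i) \/ exists f' : simp l.+1 l'.+1, y = sact f' y'.
Proof.
move=> [yn yb [k1 [ek yk yk1 yy]]] [yn' yb' [k1' [ek' yk' yk1' yy']]] e.
case: (pselect (exists2 i, i != k' & forall j, f j != i)) => [|hit]; [by left|right].
have e1 (j : 'I_l.+1) : y.1 (lift k j) = y'.1 (f j) := congr1 (fun z : Y l => z.1 j) e.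
have e2 (j : 'I_l.+1) : y.2 (lift k j) = y'.2 (f j) := congr1 (fun z : Y l => z.2 j) e.
have lo (j : 'I_l.+1) : j < k -> f j <= k'.
  move=> jk; rewrite leqNgt -ek'; apply/negP => /(above_row yk1').
  by rewrite -e2 (below_row yk) // lift_below // ltnW.
have hi (j : 'I_l.+1) : k <= j -> k' < f j.
  move=> kj; rewrite ltnNge; apply/negP => /(below_row yk') ej.
  have : 0 < y.2 (lift k j) by apply: (above_row yk1); rewrite lift_above // ek.
  by rewrite e2 ej.
pose f' i := if unlift k i is Some j then f j else k'.
have f'l (j : 'I_l.+1) : f' (lift k j) = f j by rewrite /f' liftK.
have f'k : f' k = k' by rewrite /f' unlift_none.
have mono : forall i j : 'I_l.+2, i <= j -> f' i <= f' j.
  move=> i j; case: (unliftP k i) => [a|] ->; case: (unliftP k j) => [b|] ->;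
    rewrite ?f'l ?f'k //.
  - by rewrite leq_bump2; apply: sf_mono.
  - by move=> H; apply: lo; move: H; rewrite /= /bump; lia.
  - by move=> H; apply/ltnW/hi; move: H; rewrite /= /bump; lia.
exists (Simp mono).
have yk'' : y.1 k = y'.1 k'.
  have [b fb] : exists b, f b = k1'.
    apply: contrapT => nb; apply: hit; exists k1'.
      by rewrite -(inj_eq val_inj) /= ek' neq_ltn ltnSn orbT.
    by move=> j; apply/eqP => fj; apply: nb; exists j.
  have kb : k <= b by rewrite leqNgt; apply/negP => /lo; rewrite fb ek' ltnn.
  have lt : k < l.+1 by rewrite -ltnS -ek ltn_ord.
  have [b0 eb0] := ord_of lt.
  have lk1 : lift k b0 = k1 by apply: ord_inj; rewrite lift_above ?eb0 ?ek.
  rewrite yy yy'; apply: ord_inj; apply/eqP; rewrite eqn_leq; apply/andP; split.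
    rewrite -fb -e1; apply: sf_mono; rewrite ek lift_above //.
  rewrite -lk1 e1; apply: sf_mono; rewrite ek'; apply: hi; by rewrite eb0.
rewrite [LHS]surjective_pairing /=; congr (_, _); apply: simp_eq => i /=.
  by case: (unliftP k i) => [j|] ->; rewrite ?f'l ?f'k.
by case: (unliftP k i) => [j|] ->; rewrite ?f'l ?f'k // yk yk'.
Qed.

Lemma top_fill A l (y : Y l.+1) k : partial_map p g A -> sub_pred A0 A -> top_cell y k ->
  horn_fills p g A y k.
Proof.
move=> Ap A0A [yn [y1 y2] [k1 [ek yk yk1 yy]]] z zc Az.
have zp i : i != k -> p l (z i) = sact (simp_face i) (g l.+1 y).
  by move=> /Az /(pm_over Ap); rewrite sm_nat.
(* For positive [k] the horn is inner. For [k = 0] its first edge stays over the vertex 0 of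
   [simplex m] and leads from row 0 to row 1: it is the edge assumed to be cocartesian. *)
case: (posnP k) => k0; last first.
  apply: (proj1 (inner_fill p) pin) => //.
  by rewrite k0 -ltnS -ek ltn_ord.
have {k0} k0 : k = ord0 by apply: ord_inj.
subst k; case: l => [|l] in y yn y1 y2 k1 ek yk yk1 yy z zc Az zp *.
  (* In dimension one the cell would have to reach both rows 1 and 2 from row 0. *)
  have [|j] := y2 (inord 2); first by rewrite -(inj_eq val_inj) /= inordK.
  case: (ord2P j) => -> yj; first by move: yj; rewrite yk => /(congr1 val); rewrite /= inordK.
  have ek1 : k1 = ord_max by apply: ord_inj.
  by move: yk1; rewrite ek1 yj inordK.
have [e Ae] : defined A0 ((simp_cst 1 ord0, edge01 N.+1) : Y 1).
  apply/A0dom; right; exists (inord 2) => [|j].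
    by rewrite -(inj_eq val_inj) /= inordK.
  apply/eqP => ej; have := edge01E N.+1 j; rewrite ej inordK // => j2.
  by have := ltn_ord j; rewrite -j2.
have ze : sact (edge01 l) (z ord_max) = e.
  have H := pm_act Ap (edge01 l) (Az ord_max isT).
  apply: (pm_fun Ap H); apply: A0A.
  have -> : sact (edge01 l) (sact (simp_face ord_max) y) =
            (simp_cst 1 ord0, edge01 N.+1) :> Y 1; last by [].
  have y10 : y.1 ord0 = ord0.
    apply: ord_inj; apply/eqP; rewrite -leqn0; have [j yj] := y1 ord0.
    by have : y.1 ord0 <= y.1 j; [apply: sf_mono|rewrite yj].
  have ey0 : edge01 l.+1 ord0 = ord0 by apply: ord_inj; rewrite edge01E.
  have ey1 : edge01 l.+1 ord_max = k1 by apply: ord_inj; rewrite edge01E ek.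
  rewrite /= -!simp_compA face_edge01; congr (_, _); apply: simp_eq => i.
    change (y.1 (edge01 l.+1 i) = ord0).
    by case: (ord2P i) => ->; rewrite ?ey0 ?ey1 -?yy.
  change (y.2 (edge01 l.+1 i) = edge01 N.+1 i); apply: ord_inj; rewrite edge01E.
  by case: (ord2P i) => ->; rewrite ?ey0 ?ey1 ?yk ?yk1.
exact: (proj1 (cocart_fill p e) (A0cocart Ae)).
Qed.

Lemma not_in_box_sub l l' (y : Y l) (y' : Y l') (u : 'I_l.+1 -> 'I_l'.+1) :
  (forall j, y.1 j = y'.1 (u j)) -> (forall j, y.2 j = y'.2 (u j)) ->
  not_in_box y -> not_in_box y'.
Proof.
move=> e1 e2 [H1 H2]; split=> [i|i i0].
  by have [j <-] := H1 i; exists (u j).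
by have [j <-] := H2 i i0; exists (u j).
Qed.

Lemma first_row l (y : Y l) : not_in_box y -> exists c : 'I_l.+1,
  y.2 c = 1 :> nat /\ forall i : 'I_l.+1, i < c -> y.2 i = ord0.
Proof.
move=> [_ H2].
have [|j yj] := H2 (inord 1); first by rewrite -(inj_eq val_inj) /= inordK.
have ex : exists n, [exists i : 'I_l.+1, (i == n :> nat) && (0 < y.2 i)].
  by exists j; apply/existsP; exists j; rewrite eqxx yj inordK.
case/ex_minnP: ex => n /existsP [c /andP [/eqP ec yc]] nmin.
have nle i : 0 < y.2 i -> n <= i.
  by move=> yi; apply: nmin; apply/existsP; exists i; rewrite eqxx.
exists c; split=> [|i ic].
  apply/eqP; rewrite eqn_leq yc andbT.
  have : y.2 c <= y.2 j by apply: sf_mono; rewrite ec nle // yj inordK.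
  by rewrite yj inordK.
apply: ord_inj; apply/eqP; rewrite -leqn0 leqNgt; apply/negP => /nle.
by rewrite -ec leqNgt ic.
Qed.

Lemma insert_mono l (y : Y l) (c : 'I_l.+1) (i j : 'I_l.+2) : i <= j ->
  (if i <= c then ord0 else y.2 (simp_degen c i)) <=
  (if j <= c then ord0 else y.2 (simp_degen c j)).
Proof.
move=> ij; case: ifP => // ic; case: ifP => jc; last by do 2 apply: sf_mono.
by move: ic; rewrite (leq_trans ij jc).
Qed.

(** Used when [c] is the first vertex outside row 0: the vertex of row 0 under it is inserted just
    before it, and forgetting the new vertex gives [y] back. *)
Definition insert_vertex l (y : Y l) (c : 'I_l.+1) : Y l.+1 :=
  (simp_comp y.1 (simp_degen c), Simp (insert_mono y c)).

Lemma insert_top l (y : Y l) (c : 'I_l.+1) : nondeg y -> not_in_box y ->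
  y.2 c = 1 :> nat -> (forall i : 'I_l.+1, i < c -> y.2 i = ord0) ->
  (forall i : 'I_l.+1, i < c -> y.1 i < y.1 c) ->
  exists k : 'I_l.+2, [/\ k = c :> nat, top_cell (insert_vertex y c) k &
    y = sact (simp_face k) (insert_vertex y c)].
Proof.
move=> yn yb yc lo lt.
have cl : c < l.+2 by have := ltn_ord c; lia.
have [k ek] := ord_of cl.
have e1 (j : 'I_l.+1) : y.1 j = (insert_vertex y c).1 (lift k j).
  rewrite /=; congr (y.1 _); apply: ord_inj.
  by rewrite /= /unbump /bump; lia.
have e2 (j : 'I_l.+1) : y.2 j = (insert_vertex y c).2 (lift k j).
  rewrite /=; case: ifP => [le|gt].
    by apply: lo; move: le; rewrite /= /bump; lia.
  by congr (y.2 _); apply: ord_inj; rewrite /= /unbump /bump; lia.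
exists k; split=> //; last by rewrite [LHS]surjective_pairing; congr (_, _); apply: simp_eq.
have [k1 ek1] := ord_of (ltn_ord c : c.+1 < l.+2).
split; last 1 first.
- exists k1; split; first by rewrite ek1 ek.
  + by rewrite /= ifT // ek.
  + rewrite /= ifF; last by rewrite ek1 ltnn.
    rewrite -yc; congr (nat_of_ord (y.2 _)).
    by apply: ord_inj; rewrite /= /unbump; lia.
  + by rewrite /=; congr (y.1 _); apply: ord_inj; rewrite /= /unbump; lia.
- move=> i j ij /=; case: (leqP j c) => jc.
    have ic : i < c by apply: leq_trans jc.
    rewrite (ltnW ic) ltnn orbF.
    move: jc; rewrite leq_eqVlt => /orP [/eqP jc|jc].
      have -> : Ordinal (unbump_lt c j) = c by apply: ord_inj; rewrite /= /unbump; lia.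
      by apply: lt; rewrite /= /unbump; lia.
    have := yn (Ordinal (unbump_lt c i)) (Ordinal (unbump_lt c j)).
    rewrite (lo (Ordinal (unbump_lt c j))); last by rewrite /= /unbump; lia.
    by rewrite ltn0 orbF; apply; rewrite /= /unbump; lia.
  case: (leqP i c) => ic.
    by apply/orP; right; apply: (above_row yc); rewrite /= /unbump; lia.
  by apply: yn; rewrite /= /unbump; lia.
- exact: not_in_box_sub e1 e2 yb.
Qed.

Lemma degenerate_cell l (y : Y l) : ~ nondeg y ->
  exists l' (f : simp l l') y', l' < l /\ y = sact f y'.
Proof.
move=> yn.
have [i [j [ij e1 e2]]] : exists i j : 'I_l.+1, [/\ i < j, y.1 j <= y.1 i & y.2 j <= y.2 i].
  apply: contrapT => H; apply: yn => i j ij; apply: contrapT => /negP.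
  by rewrite negb_or -!leqNgt => /andP [? ?]; apply: H; exists i, j.
case: l => [|l] in y yn i j ij e1 e2 *.
  by move: ij; case: (j) => [[|//] ?].
have il : i < l.+1 by apply: leq_trans ij _; rewrite -ltnS ltn_ord.
have [a ea] := ord_of il.
have yE x : lift i (simp_degen a x) = x \/
    (x = i /\ lift i (simp_degen a x) = i.+1 :> nat).
  case: (eqVneq x i) => [->|ne]; [right|left].
    by split=> //; rewrite /= /bump /unbump; lia.
  apply: ord_inj; move: ne; rewrite -(inj_eq val_inj).
  by rewrite /= /bump /unbump; lia.
exists l, (simp_degen a), (sact (simp_face i) y); split=> //.
rewrite [LHS]surjective_pairing /=; congr (_, _); apply: simp_eq => x /=.
  case: (yE x) => [-> //|[-> e]]; apply: ord_inj; apply/eqP; rewrite eqn_leq.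
  apply/andP; split; first by apply: sf_mono; rewrite e.
  by apply: leq_trans e1; apply: sf_mono; rewrite e.
case: (yE x) => [-> //|[-> e]]; apply: ord_inj; apply/eqP; rewrite eqn_leq.
apply/andP; split; first by apply: sf_mono; rewrite e.
by apply: leq_trans e2; apply: sf_mono; rewrite e.
Qed.

(** A nondegenerate cell outside the box either contains the vertex under its first vertex of row 1,
    and is then a top cell, or becomes the free face of a top cell once that vertex is inserted. *)
Lemma top_cover l (y : Y l) : [\/ defined A0 y,
  exists l' (f : simp l l') y', l' < l /\ y = sact f y' |
  exists l' (f : simp l l'.+1) t k, top_cell t k /\ y = sact f t].
Proof.
case: (in_boxN y) => [/A0dom|yb]; first by constructor 1.
case: (pselect (nondeg y)) => [yn|/degenerate_cell]; last by constructor 2.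
constructor 3; have [c [yc lo]] := first_row yb.
case: (pselect (forall i : 'I_l.+1, i < c -> y.1 i < y.1 c)) => [lt|nlt].
  have [k [_ Tk e]] := insert_top yn yb yc lo lt.
  by exists l, (simp_face k), (insert_vertex y c), k.
have [i ic le] : exists2 i : 'I_l.+1, i < c & y.1 c <= y.1 i.
  apply: contrapT => H; apply: nlt => i ic; rewrite ltnNge; apply/negP => le.
  by apply: H; exists i.
case: l => [|l] in y yb yn c yc lo nlt i ic le *.
  by move: ic; case: (c) => [[|//] ?].
have ck : c.-1 < l.+2 by have := ltn_ord c; lia.
have [k ek] := ord_of ck.
have kc : c = k.+1 :> nat by lia.
have yk0 : y.2 k = ord0 by apply: lo; lia.
exists l, (simp_id _), y, k; split; last by rewrite sact_id.
split=> //; exists c; split=> //.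
apply: ord_inj; apply/eqP; rewrite eqn_leq; apply/andP; split.
  by apply: sf_mono; lia.
by apply: leq_trans le _; apply: sf_mono; lia.
Qed.

Lemma top_faces l (y : Y l.+1) k i : top_cell y k -> i != k ->
  defined A0 (sact (simp_face i) y) \/
  exists l' (f : simp l l'.+1) y' k', [/\ top_cell y' k', weight y' < weight y &
    sact (simp_face i) y = sact f y'].
Proof.
move=> [yn yb [k1 [ek yk yk1 yy]]] ik.
case: (in_boxN (sact (simp_face i) y)) => [/A0dom|yb']; [by left|right].
have wy := weight_top ek yk yk1.
have := ik; rewrite neq_ltn => /orP [lt|lt].
  (* A face opposite a vertex before [k] lies in the box after all: along row 0 the first coordinate
     increases strictly, so its value at [i] is lost. *)
  case: yb' => /(_ (y.1 i)) [j /= ej] _.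
  have ne : lift i j != i by rewrite eq_sym neq_lift.
  case: (ltngtP (lift i j) i) => lij.
  - have := yn _ _ lij; rewrite ej ltnn (below_row yk (ltnW lt)) ltn0 //.
  - have : y.1 i < y.1 (lift i j); last by rewrite ej ltnn.
    have ik' : y.1 i < y.1 k.
      by have := yn _ _ lt; rewrite yk ltn0 orbF.
    case: (leqP k (lift i j)) => klj.
      by apply: leq_trans ik' _; apply: sf_mono.
    by have := yn _ _ lij; rewrite (below_row yk (ltnW klj)) ltn0 orbF.
  - by case/eqP: ne; apply: ord_inj.
case: (eqVneq i k1) => ik1.
  (* Without [k1], the first vertex of row 1 lies further to the right. The face is free in the cell
     obtained by inserting the vertex under it, which has the same dimension as [y] and smaller
     weight. *)
  subst i; have [c [yc lo]] := first_row yb'.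
  have ck : c = k.+1 :> nat.
    apply/eqP; rewrite eqn_leq; apply/andP; split.
      rewrite leqNgt; apply/negP => kc.
      have kl : k.+1 < l.+1 by have := ltn_ord c; lia.
      have [x ex] := ord_of kl.
      have := lo x; rewrite ex => /(_ kc) /= /(congr1 val) /=.
      have := above_row (i := lift k1 x) yk1; rewrite lift_above ?ek ?ex // => /(_ (leqnSn _)).
      by case: (nat_of_ord (y.2 _)).
    rewrite ltnNge; apply/negP => ck; move: yc => /=.
    by rewrite (below_row yk) // lift_below // ek ltnS.
  have lc : lift k1 c = c.+1 :> nat by rewrite lift_above // ek ck.
  have lt1 : y.1 k1 < y.1 (lift k1 c).
    have := yn k1 (lift k1 c); rewrite lc ck ek => /(_ (leqnn _)).
    by move: yc => /= ->; rewrite yk1 ltnn orbF.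
  have ync : nondeg (sact (simp_face k1) y).
    move=> a b ab; have := yn (lift k1 a) (lift k1 b) => /=; apply.
    exact: lift_ltn.
  have [a ac|k' [kc Tk' e']] := insert_top ync yb' yc lo.
    apply: leq_ltn_trans lt1; apply: sf_mono; rewrite lift_below ?ek; lia.
  exists l, (simp_face k'), (insert_vertex (sact (simp_face k1) y) c), k'; split=> //.
  case: (Tk') => _ _ [k2 [ek2 zk zk2 _]].
  rewrite (weight_top ek2 zk zk2) wy ltn_add2l.
  have -> : (insert_vertex (sact (simp_face k1) y) c).1 k2 = y.1 (lift k1 c).
    by rewrite /=; congr (y.1 (lift k1 _)); apply: ord_inj; rewrite /= /unbump; lia.
  by apply: ltn_sub2l => //; apply: leq_trans lt1 _; rewrite -ltnS ltn_ord.
(* Beyond [k1] the face keeps both [k] and [k1], hence is itself a top cell, of smaller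
   dimension. *)
have lt' : k1 < i by rewrite ltn_neqAle eq_sym ik1 ek.
case: l => [|l] in y k i yn yb k1 ek yk yk1 yy ik yb' wy lt ik1 lt' *.
  by have := ltn_ord i; lia.
have kl : k < l.+2 by have := ltn_ord i; lia.
have k1l : k1 < l.+2 by have := ltn_ord i; lia.
have [a ea] := ord_of kl; have [a1 ea1] := ord_of k1l.
have la : lift i a = k by apply: ord_inj; rewrite lift_below ea.
have la1 : lift i a1 = k1 by apply: ord_inj; rewrite lift_below ea1.
exists l, (simp_id _), (sact (simp_face i) y), a; rewrite sact_id; split=> //.
  split=> //.
    move=> b c bc; apply: yn.
    exact: lift_ltn.
  by exists a1; rewrite /= la la1 ea ea1.
rewrite wy; apply: leq_ltn_trans (weight_bound _) _.
by lia.
Qed.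

Theorem prism_extension : exists L : smap Y X,
  (forall n y, p n (L n y) = g n y) /\ forall n y x, A0 (@cell Y X n y x) -> L n y = x.
Proof.
apply: (@extend_matching _ _ _ p g A0 (@top_cell) (@weight)) => //.
- by move=> n t k f; apply: top_nondeg.
- exact: top_cover.
- exact: top_faces.
- exact: top_missing.
- exact: top_matching.
- exact: top_fill.
Qed.

End Prism.

(** * Filling a cylinder over an arbitrary simplicial set *)

Section Cylinder.
Variables (A X S : sSet) (N : nat) (p : smap X S).
Let Y := sprod A (simplex N.+2).
Variable g : smap Y S.
Hypothesis pin : inner_fibration p.
Variable A0 : cells Y X -> Prop.
Hypothesis A0p : partial_map p g A0.

Definition in_left_horn l (t : simp l N.+2) := exists2 i, i != ord0 & forall j, t j != i.

Hypothesis A0dom : forall l (y : Y l), defined A0 y <-> in_left_horn y.2.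
Hypothesis A0cocart : forall a e, A0 (@cell Y X 1 (cst 1 a, edge01 N.+1) e) ->
  cocartesian p e.

Program Definition cyl_cell m (a : A m) : smap (sprod (simplex m) (simplex N.+2)) Y :=
  @SMap (sprod (simplex m) (simplex N.+2)) Y (fun l w => (sact w.1 a, w.2)) _.
Next Obligation. by rewrite sact_comp. Qed.

Definition filled (B : cells Y X -> Prop) m (a : A m) :=
  forall l (w : sprod (simplex m) (simplex N.+2) l), defined B (cyl_cell a l w).

Lemma filled_act B m l (f : simp l m) (a : A m) : filled B a -> filled B (sact f a).
Proof.
by move=> Ba k w; have := Ba k (simp_comp f w.1, w.2); rewrite /= sact_comp.
Qed.

Lemma filled_nonsurj B m l (f : simp l m) (a : A m) i :
  (forall l (b : A l), l < m -> filled B b) -> (forall j, f j != i) ->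
  filled B (sact f a).
Proof.
case: m f a i => [|m] f a i small fi.
  by move: (fi ord0); case: (f ord0) (i) => [[|//] ?] [[|//] ?]; rewrite -(inj_eq val_inj).
by have [f' ->] := simp_factor fi; rewrite sact_comp; apply/filled_act/small.
Qed.

(** A cell outside the horn is only ever defined together with the whole prism over its simplex of
    [A]. So over an unfilled simplex of least dimension exactly the box is defined, and
    [prism_extension] applies. *)
Theorem cylinder_extension : exists L : smap Y X,
  (forall n y, p n (L n y) = g n y) /\ forall n y x, A0 (@cell Y X n y x) -> L n y = x.
Proof.
pose sat B := forall l (y : Y l), defined B y -> in_left_horn y.2 \/ filled B y.1.
have [||B [A0B [Bp Bs _] Bmax]] :=
    @zorn_maximal (cells Y X) (fun B => [/\ partial_map p g B, sat B & sub_pred A0 B]) A0.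
- by split=> // l y /A0dom; left.
- move=> F [B0 FB0] FG Fc; split.
  + by apply: partial_map_chain => // B /FG [].
  + move=> l y [x [B FB Bx]]; have [_ Bs _] := FG B FB.
    have [|//|fl] := Bs l y; [by exists x|by left|right=> k w].
    by have [z Bz] := fl k w; exists z, B.
  + by move=> c c0; exists B0 => //; case: (FG B0 FB0) => _ _; apply.
suff Bt n (y : Y n) : defined B y.
  have [L [L1 L2]] := partial_map_total Bp Bt; exists L; split=> // n y x Ax.
  by apply: L2; apply: A0B.
apply: contrapT => yB.
have ex : exists m, `[< exists a : A m, ~ filled B a >].
  exists n; apply/asboolP; exists y.1 => fl; apply: yB.
  by have := fl n (simp_id _, y.2); rewrite /= sact_id -surjective_pairing.
case/ex_minnP: ex => m /asboolP [a aB] amin.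
have small l (b : A l) : l < m -> filled B b.
  move=> lm; apply: contrapT => bB; have : m <= l by apply: amin; apply/asboolP; exists b.
  by rewrite leqNgt lm.
pose V := sprod (simplex m) (simplex N.+2).
pose B0 (c : cells V X) := let: @cell _ _ l w x := c in B (cell (cyl_cell a l w) x).
have B0dom l (w : V l) : defined B0 w <-> in_box w.
  split=> [/Bs [|fl]|]; first by right.
    case: (simp_surjP w.1) => [|ws]; first by left.
    case: aB; have [s sK _] := simp_section ord0 ws.
    have -> : a = sact s (sact w.1 a) by rewrite -sact_comp sK sact_id.
    exact: filled_act.
  case=> [[i wi]|wh].
    have := @filled_nonsurj B m l w.1 a i small wi.
    by move=> /(_ l (simp_id _, w.2)); rewrite /= sact_id.
  have [|x Ax] := proj2 (A0dom (cyl_cell a l w)); first exact: wh.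
  by exists x; apply: A0B.
have B0p : partial_map p (smap_comp g (cyl_cell a)) B0.
  split.
  - by move=> l w x x'; apply: (pm_fun Bp).
  - move=> l k f w x /= /(pm_act Bp f); by rewrite /= sact_comp.
  - by move=> l w x /(pm_over Bp).
have [|L [Lg LB]] := prism_extension pin B0p B0dom.
  move=> e; rewrite /B0 /= => Be; apply: (@A0cocart (vertex a ord0)).
  have ea : sact (simp_cst 1 ord0) a = cst 1 (vertex a ord0).
    by rewrite /cst /vertex -sact_comp; congr (sact _ _); apply: simp_eq.
  rewrite ea in Be.
  have [|x Ax] := proj2 (@A0dom 1 (cst 1 (vertex a ord0), edge01 N.+1)).
    exists ord_max => // j; apply/eqP => ej; have := edge01E N.+1 j.
    have -> : edge01 N.+1 j = ord_max := ej.
    by move=> /= ej'; have := ltn_ord j; rewrite -ej'.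
  by rewrite (pm_fun Bp Be (A0B _ Ax)).
have Ldef l (w : V l) x : B (cell (cyl_cell a l w) x) -> L l w = x by apply: LB.
have B'p : partial_map p g (attach B (cyl_cell a) L).
  apply: attach_partial_map => //.
  - move=> l w w' e; case: (pselect (defined B (cyl_cell a l w))) => [[x Bx]|wB].
      by rewrite (Ldef _ _ _ Bx); rewrite e in Bx; rewrite (Ldef _ _ _ Bx).
    have e1 : sact w.1 a = sact w'.1 a := congr1 fst e.
    have e2 : w.2 = w'.2 := congr1 snd e.
    (* Where the image is still undefined, the prism embeds: a section of [w.1] turns [w'.1] into an
       endomorphism fixing [a], and if it missed a vertex, [a] would be filled already. *)
    suff e3 : w.1 = w'.1.
      by congr (L _ _); rewrite [w]surjective_pairing e2 e3 -surjective_pairing.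
    have ws i : exists j, w.1 j = i.
      case: (simp_surjP w.1) => [wi|]; last exact.
      by case: wB; apply/B0dom; left.
    apply: simp_eq => j; have [s sK sj] := simp_section j ws.
    have ea : a = sact (simp_comp w'.1 s) a by rewrite sact_comp -e1 -sact_comp sK sact_id.
    case: (simp_surjP (simp_comp w'.1 s)) => [[i si]|/simp_endo].
      by case: aB; rewrite ea; apply: filled_nonsurj si.
    by move=> /(congr1 (fun u : simp _ _ => u (w.1 j))) /=; rewrite sj => ->.
have BB : sub_pred B (attach B (cyl_cell a) L) by move=> c Bc; left.
suff GB : [/\ partial_map p g (attach B (cyl_cell a) L), sat (attach B (cyl_cell a) L)
    & sub_pred A0 (attach B (cyl_cell a) L)].
  apply: aB => l w; exists (L l w); apply: (Bmax _ GB BB (cell _ _)).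
  by apply/attachE; right; exists w.
split=> //; last by move=> c /A0B Bc; left.
move=> l z [x /attachE [Bx|[w [e _]]]].
  have [|h|fl] := Bs l z; [by exists x|by left|right=> k w].
  by have [x' Bx'] := fl k w; exists x'; left.
right=> k w'; rewrite e; exists (L k (simp_comp w.1 w'.1, w'.2)); apply/attachE; right.
by exists (simp_comp w.1 w'.1, w'.2); rewrite /= sact_comp.
Qed.

End Cylinder.

(** A horn in the functor category is a map on [A] times a left horn, and its first edge at an
    object [a] is the component of [e] there. The base is a point because all simplices of
    [FunOver r p] lie over [r]. *)
Theorem fun_cocartesian (A X S : sSet) (r : smap A S) (p : smap X S) (e : FunOver r p 1) :
  inner_fibration p ->
  (forall a : A 0, cocartesian p (sval e 1 (cst 1 a, simp_id 1))) ->
  cocartesian (to_pt (FunOver r p)) e.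
Proof.
move=> pin ec; apply/cocart_fill => n y t yc ye _.
pose Y := sprod A (simplex n.+2).
pose g : smap Y S := smap_comp r (@SMap Y A (fun _ z => z.1) (fun _ _ _ _ => erefl)).
pose A0 (c : cells Y X) := let: @cell _ _ l z x := c in
  exists i s, [/\ i != ord0, z.2 = simp_comp (simp_face i) s & x = sval (y i) l (z.1, s)].
have yE i j l (a : A l) s s' : i != ord0 -> j != ord0 ->
    simp_comp (simp_face i) s = simp_comp (simp_face j) s' ->
    sval (y i) l (a, s) = sval (y j) l (a, s').
  move=> i0 j0 /(yc i j i0 j0) /(congr1 (fun h : FunOver r p l => sval h l (a, simp_id _))).
  by rewrite /= !simp_compI.
have A0p : partial_map p g A0.
  split.
  - move=> l z x x' [i [s [i0 e1 ->]]] [j [s' [j0 e2 ->]]].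
    by apply: yE => //; rewrite -e1.
  - move=> k l f z x [i [s [i0 e1 ->]]]; exists i, (simp_comp s f).
    split=> //; first by rewrite /= e1; apply: simp_eq.
    by rewrite -sm_nat.
  - by move=> l z x [i [s [i0 e1 ->]]]; rewrite (svalP (y i)).
have A0dom l (z : Y l) : defined A0 z <-> in_left_horn z.2.
  split=> [[x [i [s [i0 e1 _]]]]|[i i0 zi]].
    by exists i => // j; rewrite e1 /= eq_sym neq_lift.
  by have [s es] := simp_factor zi; exists (sval (y i) l (z.1, s)), i, s.
have [|L [Lg LA]] := cylinder_extension pin A0p A0dom.
  move=> a x [i [s [i0 /= e1 ->]]].
  rewrite (@yE i ord_max 1 (cst 1 a) s (edge01 n)) //; last by rewrite -e1 face_edge01.
  suff -> : sval (y ord_max) 1 (cst 1 a, edge01 n) = sval e 1 (cst 1 a, simp_id 1) by [].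
  by rewrite -ye /= simp_compI.
exists (exist _ L (fun m x => Lg m x)); split; first by case: (to_pt _ _ _) t => [] [].
move=> i i0; apply: sig_eq; apply: smap_eq => l [a s] /=.
by apply: LA; exists i, s.
Qed.

(** A left horn of dimension two gives [e'] and one of the two identities; a left horn of dimension
    three with two degenerate faces gives the other. *)
Lemma is_equiv_of_cocartesian (M : sSet) (e : M 1) :
  cocartesian (to_pt M) e -> is_equiv e.
Proof.
move=> /cocart_fill ec.
have [|||x [_ xy]] := ec 0 (nth4 e (cst 1 (src e)) e e) tt.
- by apply: compat_nat => -[|[|a]] [|[|[|b]]] //= H _ _; try (exfalso; lia);
    rewrite !fc_src src_cst.
- by rewrite edge01_0 sact_id.
- by [].
pose e' := fc 0 x.
have x2 : fc 2 x = e by rewrite (fill_nat xy).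
have x1 : fc 1 x = cst 1 (src e) by rewrite (fill_nat xy).
have ce : composite e e' (cst 1 (src e)) by apply/compositeE; exists x.
have [e1 _ e3] := composite_cst ce.
exists e'; split=> //.
have [td [td2 td0 td1]] : exists t, [/\ fc 2 t = e, fc 0 t = cst 1 (tgt e) & fc 1 t = e].
  exact/compositeE/composite_idr.
have [ti [ti2 ti0 ti1]] : exists t, [/\ fc 2 t = cst 1 (src e), fc 0 t = e & fc 1 t = e].
  exact/compositeE/composite_idl.
have [|||z [_ zy]] := ec 1 (nth4 x ti td x) tt.
- apply: compat_nat => -[|[|[|a]]] [|[|[|[|b]]]] //= H _ _; try (exfalso; lia).
  + by rewrite ti1 td1.
  + by rewrite ti2 x1.
  + by rewrite td2 x2.
- have -> : edge01 1 = simp_face ord_max.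
    apply: simp_eq => i; apply: ord_inj; rewrite edge01E /= /bump.
    by case: i => [[|[|i]] ?].
  by rewrite /= ord_max3 -/(fc 2 x).
- by [].
have z0 a : a < 4 -> a != 0 -> fc a z = nth4 x ti td x a.
  by move=> a4 a0; rewrite (fill_nat zy).
apply/compositeE; exists (fc 0 z).
rewrite -(@fc_fc _ 1 z 0 3) // -(@fc_fc _ 1 z 0 1) // -(@fc_fc _ 1 z 0 2) //.
by rewrite !z0.
Qed.

(** * Opposites *)

Lemma srev_mono m n (f : simp m n) (i j : 'I_m.+1) : i <= j ->
  rev_ord (f (rev_ord i)) <= rev_ord (f (rev_ord j)).
Proof.
move=> ij; have : f (rev_ord j) <= f (rev_ord i) by apply: sf_mono => /=; lia.
by move=> /=; lia.
Qed.

Definition srev m n (f : simp m n) : simp m n :=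
  @Simp m n (fun i => rev_ord (f (rev_ord i))) (fun i j ij => srev_mono f ij).

Lemma srevK m n (f : simp m n) : srev (srev f) = f.
Proof. by apply: simp_eq => i /=; rewrite !rev_ordK. Qed.

Lemma srev_id n : srev (simp_id n) = simp_id n.
Proof. by apply: simp_eq => i /=; rewrite rev_ordK. Qed.

Lemma srev_comp m n k (g : simp n k) (f : simp m n) :
  srev (simp_comp g f) = simp_comp (srev g) (srev f).
Proof. by apply: simp_eq => i /=; rewrite rev_ordK. Qed.

Lemma srev_face n (i : 'I_n.+2) : srev (simp_face i) = simp_face (rev_ord i).
Proof.
apply: simp_eq => j; apply: ord_inj; rewrite /= /bump.
by have := ltn_ord i; have := ltn_ord j; lia.
Qed.

Lemma srev_cst m n (i : 'I_n.+1) : srev (simp_cst m i) = simp_cst m (rev_ord i).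
Proof. exact: simp_eq. Qed.

Lemma rev_ord0 n : rev_ord (@ord0 n) = ord_max.
Proof. by apply: ord_inj => /=; lia. Qed.

Lemma rev_ord_max n : rev_ord (@ord_max n) = ord0.
Proof. by rewrite -rev_ord0 rev_ordK. Qed.

Lemma srev_edge01 n : srev (edge01 n) = edge_last n.
Proof.
apply: simp_eq => i; apply: ord_inj.
change (nat_of_ord (rev_ord (edge01 n (rev_ord i))) = edge_last n i).
rewrite edge_lastE; have := edge01E n (rev_ord i).
by case: (ord2P i) => -> /= ->; lia.
Qed.

Program Definition sop (X : sSet) : sSet :=
  @SSet X (fun m n f x => sact (srev f) x) _ _.
Next Obligation. by rewrite srev_id sact_id. Qed.
Next Obligation. by rewrite srev_comp sact_comp. Qed.

Program Definition sopm (X Y : sSet) (u : smap X Y) : smap (sop X) (sop Y) :=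
  @SMap (sop X) (sop Y) u _.
Next Obligation. by rewrite sm_nat. Qed.

Section Opposite.
Variables (X S : sSet) (q : smap X S).

Lemma rev_neq n (i k : 'I_n) : (rev_ord i != k) = (i != rev_ord k).
Proof. by rewrite -(inj_eq rev_ord_inj) rev_ordK. Qed.

Lemma op_fillable n (k : 'I_n.+2) Q : fillable q k Q ->
  fillable (sopm q) (rev_ord k) (fun y => Q (fun i => y (rev_ord i))).
Proof.
move=> H y t yc Qy yt.
have [||x [xt xy]] := H (fun i => y (rev_ord i)) t _ Qy.
- move=> i j ik jk m f g e.
  have := yc (rev_ord i) (rev_ord j); rewrite !(inj_eq rev_ord_inj).
  move=> /(_ ik jk _ (srev f) (srev g)); rewrite -!srev_face -!srev_comp e => /(_ erefl).
  by rewrite /= !srevK.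
- move=> i ik; have := yt (rev_ord i); rewrite (inj_eq rev_ord_inj) => /(_ ik).
  by rewrite /= srev_face rev_ordK.
exists x; split=> // i ik; rewrite /= srev_face xy ?rev_ordK //.
by rewrite rev_neq.
Qed.

Lemma fillable_of_op n (k : 'I_n.+2) Q :
  fillable (sopm q) (rev_ord k) (fun y => Q (fun i => y (rev_ord i))) -> fillable q k Q.
Proof.
move=> H y t yc Qy yt.
have ey : (fun i : 'I_n.+2 => y (rev_ord (rev_ord i))) = y.
  by apply/funext => i; rewrite rev_ordK.
have [|||x [xt xy]] := H (fun i => y (rev_ord i)) t.
- move=> i j ik jk m f g e; rewrite /=; apply: yc; rewrite ?rev_neq //.
  by rewrite -!srev_face -!srev_comp e.
- by rewrite ey.
- by move=> i ik; rewrite /= srev_face; apply: yt; rewrite rev_neq.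
exists x; split=> // i ik; have := xy (rev_ord i); rewrite (inj_eq rev_ord_inj).
by move=> /(_ ik); rewrite /= srev_face rev_ordK.
Qed.

Lemma op_inner : inner_fibration q -> inner_fibration (sopm q).
Proof.
move=> /inner_fill H; apply/inner_fill => n k kn; rewrite -[k]rev_ordK.
by apply: (@op_fillable n (rev_ord k) (fun=> True)); apply: H; move: kn => /=; lia.
Qed.

Lemma op_cartesian e : cartesian q e <-> cocartesian (sopm q) (e : sop X 1).
Proof.
rewrite cart_fill cocart_fill; split=> H n.
  have := op_fillable (H n); rewrite rev_ord_max.
  suff -> : (fun y : 'I_n.+3 -> X n.+1 => sact (edge_last n) (y (rev_ord ord0)) = e) =
    (fun y => @sact (sop X) _ _ (edge01 n) (y ord_max) = e) by [].
  by apply/funext => y; rewrite /= srev_edge01 rev_ord0.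
apply: fillable_of_op; have := H n; rewrite rev_ord_max.
suff -> : (fun y : 'I_n.+3 -> X n.+1 => sact (edge_last n) (y (rev_ord ord0)) = e) =
  (fun y => @sact (sop X) _ _ (edge01 n) (y ord_max) = e) by [].
by apply/funext => y; rewrite /= srev_edge01 rev_ord0.
Qed.

End Opposite.

Lemma op_quasicat (X : sSet) : quasicat X -> quasicat (sop X).
Proof.
move=> /op_inner /inner_fill H; apply/quasicat_fill => n k y kn yc.
by have [||x [_ xy]] := H n k kn y tt yc; [|by []|exists x].
Qed.

Lemma op_composite (X : sSet) (f g h : X 1) : composite f g h ->
  @composite (sop X) g f h.
Proof.
case=> t [<- <- <-]; exists t; rewrite /= !srev_face rev_ord0 rev_ord_max; split=> //.
by congr (sact (simp_face _) _); apply: ord_inj; rewrite /= !inordK.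
Qed.

Lemma op_cst (X : sSet) n (x : X 0) : @cst (sop X) n x = cst n x.
Proof.
rewrite /cst /= srev_cst; congr (sact _ _); apply: simp_eq => i.
by apply: ord_inj; rewrite /= subnn.
Qed.

Lemma op_src (X : sSet) (e : X 1) : @src (sop X) e = tgt e.
Proof. by rewrite /src /tgt /vertex /= srev_cst rev_ord0. Qed.

Lemma op_tgt (X : sSet) (e : X 1) : @tgt (sop X) e = src e.
Proof. by rewrite /src /tgt /vertex /= srev_cst rev_ord_max. Qed.

Lemma op_is_equiv (X : sSet) (e : X 1) : is_equiv e -> @is_equiv (sop X) e.
Proof.
case=> e' [/op_composite c1 /op_composite c2]; exists e'.
by rewrite op_src op_tgt !op_cst.
Qed.

(** The purpose of opposites: counits of the indexed products are cartesian edges, and replacing the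
    target of a counit by an equivalent object must keep them cartesian. *)
Theorem cartesian_comp_equiv (X S : sSet) (q : smap X S) (c e c' : X 1) :
  inner_fibration q -> quasicat S -> composite c e c' -> cartesian q c -> is_equiv e ->
  cartesian q c'.
Proof.
move=> qi Sq /op_composite cc /op_cartesian ccart /op_is_equiv ee; apply/op_cartesian.
apply: (cocartesian_comp (op_inner qi) (op_quasicat Sq) cc) => //.
exact: equiv_cocartesian (op_inner qi) (op_quasicat Sq) ee.
Qed.

(** * Nerves of categories *)

Section HCast.
Variable A : category.

(** Objects of simplices in a nerve agree only up to propositional equality, so morphisms are
    compared after transport at both ends. *)
Definition hcast (a a' b b' : A) (ea : a = a') (eb : b = b') (f : Hom a b) : Hom a' b' :=
  match ea in _ = x, eb in _ = y return Hom x y with erefl, erefl => f end.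

Lemma hcast_id (a b : A) (ea : a = a) (eb : b = b) (f : Hom a b) : hcast ea eb f = f.
Proof. by rewrite (Prop_irrelevance ea erefl) (Prop_irrelevance eb erefl). Qed.

Lemma hcast_comp (a1 a2 a3 b1 b2 b3 : A) (ea : a1 = a2) (ea' : a2 = a3)
    (eb : b1 = b2) (eb' : b2 = b3) (f : Hom a1 b1) :
  hcast ea' eb' (hcast ea eb f) = hcast (etrans ea ea') (etrans eb eb') f.
Proof. by case: _ / ea'; case: _ / eb'; rewrite /=. Qed.

Lemma hcast_irr (a a' b b' : A) (e1 e1' : a = a') (e2 e2' : b = b') (f : Hom a b) :
  hcast e1 e2 f = hcast e1' e2' f.
Proof. by rewrite (Prop_irrelevance e1 e1') (Prop_irrelevance e2 e2'). Qed.

Lemma hcast_cmp (a a' b b' c c' : A) (ea : a = a') (eb : b = b') (ec : c = c')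
    (g : Hom b c) (f : Hom a b) :
  hcast ea ec (cmp g f) = cmp (hcast eb ec g) (hcast ea eb f).
Proof. by case: _ / ea; case: _ / eb; case: _ / ec. Qed.

Lemma hcast_idc (a a' : A) (ea : a = a') : hcast ea ea (idc a) = idc a'.
Proof. by case: _ / ea. Qed.

Lemma functor_hcast (B : category) (F F' : functor B A) (e : F = F') x y (l : Hom x y)
    (e0 : F x = F' x) (e1 : F y = F' y) : hcast e0 e1 (fm F l) = fm F' l.
Proof. by case: _ / e e0 e1 => e0 e1; rewrite hcast_id. Qed.

Lemma functor_ext (B : category) (F F' : functor B A) (eo : forall x, F x = F' x) :
  (forall x y (l : Hom x y), hcast (eo x) (eo y) (fm F l) = fm F' l) -> F = F'.
Proof.
case: F F' eo => [o m i c] [o' m' i' c'] /= eo em.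
have e : o = o' by apply/funext.
case: _ / e in m' i' c' eo em *.
have e : m = m'.
  apply: functional_extensionality_dep => x; apply: functional_extensionality_dep => y.
  by apply/funext => l; rewrite -em hcast_id.
case: _ / e in i' c' em *; exact: functor_eq.
Qed.

Lemma fm_index n (x : functor (ordcat n) A) (i i' j j' : 'I_n.+1) (l : i <= j)
    (l' : i' <= j') (ei : x i = x i') (ej : x j = x j') : i = i' -> j = j' ->
  hcast ei ej (fm x (l : @Hom (ordcat n) i j)) = fm x (l' : @Hom (ordcat n) i' j').
Proof.
move=> e e'; case: _ / e in l' ei *; case: _ / e' in l' ej *.
by rewrite hcast_id; congr (fm x _); apply: bool_irrelevance.
Qed.

Lemma le01 : (@ord0 1 <= @ord_max 1)%N. Proof. by []. Qed.

Definition nhom (z : nerve A 1) : Hom (fo z ord0) (fo z ord_max) :=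
  fm z (le01 : @Hom (ordcat 1) ord0 ord_max).

Lemma nedge_eta (z : nerve A 1) : z = nedge (nhom z).
Proof.
have eo x : fo z x = fo (nedge (nhom z)) x.
  by case: (ord2P x) => ->.
apply: (functor_ext (eo := eo)) => x y l.
case: (ord2P x) => ex; case: (ord2P y) => ey; subst.
- have -> : l = idc (ord0 : ordcat 1) by apply: bool_irrelevance.
  by rewrite !fm_id hcast_idc.
- by rewrite (hcast_irr _ erefl _ erefl) /= /nhom; congr (fm z _); apply: bool_irrelevance.
- by [].
- have -> : l = idc (ord_max : ordcat 1) by apply: bool_irrelevance.
  by rewrite !fm_id hcast_idc.
Qed.

Lemma eg_hcast n (x y : nerve A n) (i j : 'I_n.+1) (l : i <= j) (ei : fo x i = fo y i)
    (ej : fo x j = fo y j) : eg x i j = eg y i j ->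
  hcast ei ej (fm x (l : @Hom (ordcat n) i j)) = fm y (l : @Hom (ordcat n) i j).
Proof.
move=> H.
have e1 : fo (eg x i j) ord_max = fo (eg y i j) ord_max by rewrite H.
have ex : fo (eg x i j) ord_max = x j.
  by rewrite -[j in RHS](@sedge1 _ i j l).
have ey : fo (eg y i j) ord_max = y j.
  by rewrite -[j in RHS](@sedge1 _ i j l).
have := functor_hcast H (le01 : @Hom (ordcat 1) ord0 ord_max) ei e1.
move=> /(congr1 (hcast erefl ey)); rewrite hcast_comp.
have <- : fm y l = hcast (erefl (fo y i)) ey (fm (eg y i j) (le01 : @Hom (ordcat 1) ord0 ord_max)).
  by apply/esym; apply: fm_index => //; apply: (@sedge1 _ i j l).
move=> <-.
have -> : fm x l = hcast (erefl (fo x i)) ex (fm (eg x i j) (le01 : @Hom (ordcat 1) ord0 ord_max)).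
  by apply/esym; apply: fm_index => //; apply: (@sedge1 _ i j l).
by rewrite hcast_comp; apply: hcast_irr.
Qed.

Lemma nerve_edge_ext n (x y : nerve A n) :
  (forall a b : 'I_n.+1, a <= b -> eg x a b = eg y a b) -> x = y.
Proof.
move=> H.
have eo i : fo x i = fo y i.
  exact: (congr1 (fun z : nerve A 1 => fo z ord0) (H i i (leqnn i))).
by apply: (functor_ext (eo := eo)) => i j l; apply/eg_hcast/H.
Qed.

Lemma nvert_eta (z : nerve A 0) : z = nvert (fo z ord0).
Proof.
have eo x : fo z x = fo (nvert (fo z ord0)) x.
  by congr (fo z _); case: x => [[|//] ?]; apply: val_inj.
apply: (functor_ext (eo := eo)) => x y l.
have ex : x = ord0 by case: (x) => [[|//] ?]; apply: val_inj.
have ey : y = ord0 by case: (y) => [[|//] ?]; apply: val_inj.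
subst x y.
have -> : l = idc (ord0 : ordcat 0) by apply: bool_irrelevance.
by rewrite !fm_id hcast_idc.
Qed.

Lemma src_nedge (a b : A) (f : Hom a b) : src (nedge f) = nvert a.
Proof. exact: nvert_eta. Qed.

Lemma tgt_nedge (a b : A) (f : Hom a b) : tgt (nedge f) = nvert b.
Proof. exact: nvert_eta. Qed.

Lemma nedge_inj (a b : A) (f g : Hom a b) : nedge f = nedge g -> f = g.
Proof. by move=> e; have := functor_hcast e (le01 : @Hom (ordcat 1) ord0 ord_max) erefl erefl. Qed.

(** * Maps to a nerve from a subcomplex of a simplex *)

Section SubSimplex.
Variables (n : nat) (P : forall m, simplex n m -> Prop) (HP : stable P).
Hypothesis Pv : forall i : 'I_n.+1, P (simp_cst 0 i).
Variable h : smap (ssub HP) (nerve A).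

Definition hob i : A := fo (h 0 (exist _ (simp_cst 0 i) (Pv i))) ord0.

Lemma hobE m (z : ssub HP m) i : fo (h m z) i = hob (sval z i).
Proof.
have e : sact (simp_cst 0 i) z = exist _ (simp_cst 0 (sval z i)) (Pv _).
  by apply: sig_eq; apply: simp_eq.
by rewrite /hob -e sm_nat.
Qed.

Lemma hhom_tgt (i j : 'I_n.+1) (l : i <= j) (Pe : P (sedge i j)) :
  fo (h 1 (exist _ (sedge i j) Pe)) ord_max = hob j.
Proof. by rewrite hobE; congr hob; rewrite sedge1. Qed.

Definition hhom (i j : 'I_n.+1) (l : i <= j) (Pe : P (sedge i j)) : Hom (hob i) (hob j) :=
  hcast (hobE (exist _ (sedge i j) Pe) ord0) (hhom_tgt l Pe)
    (fm (h 1 (exist _ (sedge i j) Pe)) (le01 : @Hom (ordcat 1) ord0 ord_max)).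

Lemma hhom_irr (i j : 'I_n.+1) (l l' : i <= j) (Pe Pe' : P (sedge i j)) : hhom l Pe = hhom l' Pe'.
Proof. by rewrite (bool_irrelevance l l') (Prop_irrelevance Pe Pe'). Qed.

Lemma hhomE m (z : ssub HP m) (i j : 'I_m.+1) (l : i <= j) (l' : sval z i <= sval z j)
    (Pe : P (sedge (sval z i) (sval z j))) :
  hcast (hobE z i) (hobE z j) (fm (h m z) (l : @Hom (ordcat m) i j)) = hhom l' Pe.
Proof.
have e : sact (sedge i j) z = exist _ (sedge (sval z i) (sval z j)) Pe.
  by apply: sig_eq; apply: sedge_comp.
have e' : functor_comp (h m z) (simp_functor (sedge i j)) =
          h 1 (exist _ (sedge (sval z i) (sval z j)) Pe) by rewrite -e sm_nat.
have ej : sedge i j ord_max = j by rewrite sedge1.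
have e1 : fo (functor_comp (h m z) (simp_functor (sedge i j))) ord_max =
  fo (h 1 (exist _ (sedge (sval z i) (sval z j)) Pe)) ord_max by rewrite e'.
have e0 : fo (functor_comp (h m z) (simp_functor (sedge i j))) ord0 =
  fo (h 1 (exist _ (sedge (sval z i) (sval z j)) Pe)) ord0 by rewrite e'.
rewrite /hhom -(functor_hcast e' (le01 : @Hom (ordcat 1) ord0 ord_max) e0 e1) hcast_comp.
have ez : fo (h m z) j = fo (h m z) (sedge i j ord_max) by rewrite ej.
have -> : fm (functor_comp (h m z) (simp_functor (sedge i j))) (le01 : @Hom (ordcat 1) ord0 ord_max)
  = hcast (erefl (fo (h m z) i)) ez (fm (h m z) (l : @Hom (ordcat m) i j)).
  exact: (esym (@fm_index m (h m z) i i j (sedge i j ord_max) l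
    (sf_mono (sedge i j) le01) erefl ez erefl (esym ej))).
by rewrite hcast_comp; apply: hcast_irr.
Qed.

Lemma Pdiag (i : 'I_n.+1) : P (sedge i i).
Proof.
have -> : sedge i i = simp_comp (simp_cst 0 i) (simp_cst 1 ord0).
  by rewrite sedge_diag; apply: simp_eq.
exact: HP.
Qed.

Lemma hhom_id (i : 'I_n.+1) (l : i <= i) (Pe : P (sedge i i)) : hhom l Pe = idc (hob i).
Proof.
have := @hhomE 0 (exist _ (simp_cst 0 i) (Pv i)) ord0 ord0 (leqnn _) l Pe.
move=> /= <-; have -> : (leqnn 0 : @Hom (ordcat 0) ord0 ord0) = idc (ord0 : ordcat 0).
  exact: bool_irrelevance.
by rewrite fm_id hcast_idc.
Qed.

Lemma hhom_cmp (i j k : 'I_n.+1) (lij : i <= j) (ljk : j <= k) (lik : i <= k) (t : simp 2 n)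
    (Pij : P (sedge i j)) (Pjk : P (sedge j k)) (Pik : P (sedge i k)) :
  P t -> [/\ t ord0 = i, t (inord 1) = j & t ord_max = k] ->
  cmp (hhom ljk Pjk) (hhom lij Pij) = hhom lik Pik.
Proof.
move=> Pt [ei ej ek]; subst i j k.
have l1 : (@ord0 2 <= (inord 1 : 'I_3))%N by [].
have l2 : ((inord 1 : 'I_3) <= @ord_max 2)%N by rewrite inordK.
have l3 : (@ord0 2 <= @ord_max 2)%N by [].
pose z : ssub HP 2 := exist _ t Pt.
rewrite -(@hhomE 2 z _ _ l1) -(@hhomE 2 z _ _ l2) -(@hhomE 2 z _ _ l3).
rewrite -hcast_cmp -fm_cmp; congr (hcast _ _ (fm _ _)); exact: bool_irrelevance.
Qed.

(** A map from a subcomplex containing all vertices is a partial functor on the chain [ordcat n],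
    with objects [hob] and with arrows [hhom] on the edges present. Extending it means supplying the
    missing arrows compatibly with composition. *)
Lemma nerve_extend (H : forall i j : 'I_n.+1, i <= j -> Hom (hob i) (hob j)) :
  (forall (i j : 'I_n.+1) (l : i <= j) (Pe : P (sedge i j)), H i j l = hhom l Pe) ->
  (forall (i j k : 'I_n.+1) (lij : i <= j) (ljk : j <= k) (lik : i <= k),
     cmp (H j k ljk) (H i j lij) = H i k lik) ->
  exists L : nerve A n, [/\ forall m (z : ssub HP m), sact (sval z) L = h m z,
    (forall i, fo L i = hob i) &
    forall (i j : 'I_n.+1) (l : i <= j) e0 e1, hcast e0 e1 (fm L (l : @Hom (ordcat n) i j)) = H i j l].
Proof.
move=> HH Hc.
have Hid i : H i i (leqnn i) = idc (hob i) by rewrite (HH _ _ _ (Pdiag i)) hhom_id.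
pose L := @Functor (ordcat n) A hob (fun i j (l : @Hom (ordcat n) i j) => H i j l) Hid
  (fun i j k (g : @Hom (ordcat n) j k) f => esym (Hc i j k f g _)).
exists L; split=> //; last by move=> i j l e0 e1; rewrite hcast_id.
move=> m z; have eo i : fo (functor_comp L (simp_functor (sval z))) i = fo (h m z) i.
  by rewrite hobE.
apply: (functor_ext (eo := eo)) => i j l.
have Pe : P (sedge (sval z i) (sval z j)).
  by rewrite -sedge_comp //; apply: HP; apply: svalP.
have := @hhomE m z i j l (sf_mono _ l) Pe; rewrite -HH.
move=> /(congr1 (hcast (esym (hobE z i)) (esym (hobE z j)))).
by rewrite hcast_comp hcast_id => ->; apply: hcast_irr.
Qed.

End SubSimplex.
End HCast.

Lemma sedge_miss n (i j x : 'I_n.+1) : i != x -> j != x -> forall b, sedge i j b != x.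
Proof. by move=> ix jx b /=; case: ifP => // _; case: ifP. Qed.

Section NerveInner.
Variables (A : category) (n : nat) (k : 'I_n.+1) (kn : 0 < k < n).
Variable h : smap (horn k) (nerve A).

Let P m (f : simplex n m) := exists2 i, i != k & forall j, f j != i.

Let k0 : ord0 != k. Proof. by rewrite -(inj_eq val_inj) /=; lia. Qed.
Let kmax : ord_max != k. Proof. by rewrite -(inj_eq val_inj) /=; lia. Qed.

Let Pv i : P (simp_cst 0 i).
Proof.
case: (eqVneq i ord0) => [->|i0]; last by exists ord0; [exact: k0|move=> ?].
by exists ord_max; [exact: kmax|move=> ?; rewrite -(inj_eq val_inj) /=; lia].
Qed.

Let Pe (i j : 'I_n.+1) : i <= j -> ~~ (i < k < j) -> P (sedge i j).
Proof.
move=> ij ikj; case: (leqP k i) => ki.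
  by exists ord0 => //; apply: sedge_miss; rewrite -(inj_eq val_inj) /=; lia.
by exists ord_max => //; apply: sedge_miss; rewrite -(inj_eq val_inj) /=; lia.
Qed.

Let Pek (i : 'I_n.+1) : i <= k -> P (sedge i k).
Proof. by move=> ik; apply: Pe => //; rewrite ltnn andbF. Qed.

Let Pke (i : 'I_n.+1) : k <= i -> P (sedge k i).
Proof. by move=> ik; apply: Pe => //; rewrite ltnn. Qed.

Let hh := @hhom A n P (@horn_stable n k) Pv h.

Let tri (i j l x : 'I_n.+1) (lij : i <= j) (ljl : j <= l) (lil : i <= l) p1 p2 p3 :
  x != k -> i != x -> j != x -> l != x ->
  cmp (hh ljl p1) (hh lij p2) = hh lil p3.
Proof.
move=> xk ix jx lx; have [t [_ _ _ [t0 t1 t2]]] := stri_ex lij ljl.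
apply: (@hhom_cmp A n P _ Pv h i j l lij ljl lil t) => //.
exists x => // b; case: (ord3P b) => ->; rewrite ?t0 ?t1 ?t2 //.
Qed.

(** An edge that jumps over [k] is defined as the composite through [k]. It is missing from the horn
    only when [n = 2]; where it is present, the two agree by [HP] below. *)
Let H (i j : 'I_n.+1) (l : i <= j) : Hom (hob Pv h i) (hob Pv h j) :=
  match pselect (i < k < j) with
  | left p => cmp (hh (ltnW (proj2 (andP p))) (Pke (ltnW (proj2 (andP p)))))
                    (hh (ltnW (proj1 (andP p))) (Pek (ltnW (proj1 (andP p)))))
  | right p => hh l (Pe l (introN idP p))
  end.

Let H_in (i j : 'I_n.+1) (l : i <= j) (ik : i <= k) (kj : k <= j) p1 p2 : i < k < j ->
  H l = cmp (hh kj p1) (hh ik p2).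
Proof.
move=> ikj; rewrite /H; case: pselect => // p.
by congr cmp; apply: hhom_irr.
Qed.

Let H_out (i j : 'I_n.+1) (l : i <= j) p : ~~ (i < k < j) -> H l = hh l p.
Proof.
by move=> /negP ikj; rewrite /H; case: pselect => // q; apply: hhom_irr.
Qed.

Lemma nerve_inner_lift : exists l : smap (simplex n) (nerve A),
  forall m (y : horn k m), l m (sval y) = h m y.
Proof.
have HP (i j : 'I_n.+1) (l : i <= j) p : H l = hh l p.
  case: (boolP (i < k < j)) => [ikj|]; last exact: H_out.
  have ik : i <= k by lia.
  have kj : k <= j by lia.
  rewrite (@H_in i j l ik kj (Pke kj) (Pek ik) ikj).
  case: (p) => x xk px.
  apply: (@tri i k j x) => //.
  - by have := px ord0; rewrite sedge0.
  - by rewrite eq_sym.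
  - by have := px ord_max; rewrite sedge1.
have [|L [LP _ _]] := nerve_extend HP.
  move=> i j l lij ljl lil.
  have out (x : 'I_n.+1) : x != k -> i != x -> j != x -> l != x ->
      ~~ (i < k < l) -> cmp (H ljl) (H lij) = H lil.
    move=> xk ix jx lx ikl.
    have ikj : ~~ (i < k < j) by lia.
    have jkl : ~~ (j < k < l) by lia.
    rewrite (@H_out i l lil (Pe lil ikl) ikl) (@H_out i j lij (Pe lij ikj) ikj).
    by rewrite (@H_out j l ljl (Pe ljl jkl) jkl); apply: (@tri i j l x).
  case: (boolP (i < k < l)) => ikl; last first.
    case: (leqP k i) => ki.
      by apply: (out ord0) => //; rewrite -(inj_eq val_inj) /=; lia.
    by apply: (out ord_max) => //; rewrite -(inj_eq val_inj) /=; lia.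
  have ik : i <= k by lia.
  have kl : k <= l by lia.
  rewrite (@H_in i l lil ik kl (Pke kl) (Pek ik) ikl).
  case: (ltngtP j k) => jk.
  - have jk' := ltnW jk.
    have ikj : ~~ (i < k < j) by lia.
    rewrite (@H_in j l ljl jk' kl (Pke kl) (Pek jk')); last by lia.
    rewrite (@H_out i j lij (Pe lij ikj) ikj).
    rewrite -cmpA; congr cmp; apply: (@tri i j k ord_max) => //;
      by rewrite -(inj_eq val_inj) /=; lia.
  - have jk' := ltnW jk.
    have jkl : ~~ (j < k < l) by lia.
    rewrite (@H_in i j lij ik jk' (Pke jk') (Pek ik)); last by lia.
    rewrite (@H_out j l ljl (Pe ljl jkl) jkl).
    rewrite cmpA; congr cmp; apply: (@tri k j l ord0) => //;
      by rewrite -(inj_eq val_inj) /=; lia.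
  - have jk' : j = k by apply: ord_inj.
    subst j; rewrite (@H_out i k lij (Pek ik)) ?ltnn ?andbF //.
    by rewrite (@H_out k l ljl (Pke kl)) ?ltnn //; congr cmp; apply: hhom_irr.
exists (yoneda L) => m y; exact: LP.
Qed.

End NerveInner.

Theorem nerve_quasicat (A : category) : quasicat (nerve A).
Proof.
move=> n k kn h t _ _; have [l lh] := nerve_inner_lift kn h.
by exists l; split=> // m y; case: (to_pt _ _ _) => //; case: (t m y).
Qed.

(** * Cocartesian edges of nerves *)

Definition cocart1 (A B : category) (F : functor A B) (a a' : A) (f : Hom a a') :=
  (forall a'' (h : Hom a a'') (b : Hom (F a') (F a'')), cmp b (fm F f) = fm F h ->
     exists k : Hom a' a'', cmp k f = h /\ fm F k = b) /\
  (forall a'' (k k' : Hom a' a''), cmp k f = cmp k' f -> fm F k = fm F k' -> k = k').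

Lemma cocart1_hcast (A B : category) (F : functor A B) (a a' b b' : A) (f : Hom a a')
    (ea : a = b) (eb : a' = b') : cocart1 F f -> cocart1 F (hcast ea eb f).
Proof. by case: _ / ea; case: _ / eb. Qed.

Lemma fm_hcast (A B : category) (F : functor A B) (a a' b b' : A) (f : Hom a a')
    (ea : a = b) (eb : a' = b') (ea' : F a = F b) (eb' : F a' = F b') :
  fm F (hcast ea eb f) = hcast ea' eb' (fm F f).
Proof. by case: _ / ea ea' => ea'; case: _ / eb eb' => eb'; rewrite !hcast_id. Qed.

Section NerveCocartesian.
Variables (A B : category) (F : functor A B) (a a' : A) (f : Hom a a').
Hypothesis fc1 : cocart1 F f.
Variables (n : nat) (h : smap (@horn n.+2 ord0) (nerve A)) (t : smap (simplex n.+2) (nerve B)).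
Hypothesis h01 : forall y : @horn n.+2 ord0 1,
  (forall i : 'I_2, sval y i = i :> nat) -> h 1 y = nedge f.
Hypothesis ht : forall m (y : @horn n.+2 ord0 m), nmap F m (h m y) = t m (sval y).

Let P m (s : simplex n.+2 m) := exists2 i, i != ord0 & forall j, s j != i.

Let Pv (i : 'I_n.+3) : P (simp_cst 0 i).
Proof.
case: (eqVneq i ord_max) => [->|i0]; last by exists ord_max => // ?.
by exists (inord 1) => [|?]; rewrite -(inj_eq val_inj) /= inordK.
Qed.

Let Pe (i j x : 'I_n.+3) : x != ord0 -> i != x -> j != x -> P (sedge i j).
Proof. by move=> x0 ix jx; exists x => //; apply: sedge_miss. Qed.

Let P0 (j : 'I_n.+3) : P (sedge ord0 j).
Proof.
case: (eqVneq j ord_max) => [->|j0]; last by apply: (@Pe _ _ ord_max).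
by apply: (@Pe _ _ (inord 1)); rewrite -(inj_eq val_inj) /= inordK.
Qed.

Let hh := @hhom A n.+2 P (@horn_stable n.+2 ord0) Pv h.

Let tri (i j l x : 'I_n.+3) (lij : i <= j) (ljl : j <= l) (lil : i <= l) p1 p2 p3 :
  x != ord0 -> i != x -> j != x -> l != x ->
  cmp (hh ljl p1) (hh lij p2) = hh lil p3.
Proof.
move=> xk ix jx lx; have [s [_ _ _ [t0 t1 t2]]] := stri_ex lij ljl.
apply: (@hhom_cmp A n.+2 P _ Pv h i j l lij ljl lil s) => //.
exists x => // b; case: (ord3P b) => ->; rewrite ?t0 ?t1 ?t2 //.
Qed.

Let T : nerve B n.+2 := t _ (simp_id _).

Let tE m (y : simp m n.+2) : t m y = sact y T.
Proof. by rewrite /T -sm_nat /= simp_compIl. Qed.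

Let ob := @hob A n.+2 P (@horn_stable n.+2 ord0) Pv h.

Let eT i : fo T i = F (ob i).
Proof.
have := ht (exist _ (simp_cst 0 i) (Pv i)); rewrite tE.
by move=> /(congr1 (fun z : nerve B 0 => fo z ord0)) /= <-.
Qed.

Let Th (i j : 'I_n.+3) (l : i <= j) : Hom (F (ob i)) (F (ob j)) :=
  hcast (eT i) (eT j) (fm T (l : @Hom (ordcat n.+2) i j)).

Let Th_cmp (i j k : 'I_n.+3) (lij : i <= j) (ljk : j <= k) (lik : i <= k) :
  cmp (Th ljk) (Th lij) = Th lik.
Proof.
by rewrite /Th -hcast_cmp -fm_cmp; congr (hcast _ _ (fm _ _)); apply: bool_irrelevance.
Qed.

Let Fh (i j : 'I_n.+3) (l : i <= j) (p : P (sedge i j)) : fm F (hh l p) = Th l.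
Proof.
rewrite /hh /hhom /Th.
set z := exist _ (sedge i j) p.
have e := ht z; rewrite tE in e.
have e0 : F (fo (h 1 z) ord0) = F (ob i) by rewrite hobE.
have e1 : F (fo (h 1 z) ord_max) = F (ob j) by rewrite (hhom_tgt Pv h l p).
rewrite (fm_hcast _ _ _ e0 e1).
have e0' : fo (nmap F 1 (h 1 z)) ord0 = fo (@sact (nerve B) _ _ (sedge i j) T) ord0 by rewrite e.
have e1' : fo (nmap F 1 (h 1 z)) ord_max = fo (@sact (nerve B) _ _ (sedge i j) T) ord_max by rewrite e.
have := functor_hcast e (le01 : @Hom (ordcat 1) ord0 ord_max) e0' e1'.
have ej : fo T (sedge i j ord_max) = F (ob j) by rewrite -eT sedge1.
move=> /(congr1 (hcast (eT i) ej)); rewrite hcast_comp => H.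
transitivity (hcast (etrans e0' (eT i)) (etrans e1' ej)
  (fm (nmap F 1 (h 1 z)) (le01 : @Hom (ordcat 1) ord0 ord_max))).
  exact: hcast_irr.
rewrite H.
have ej' : fo T (sedge i j ord_max) = fo T j by rewrite sedge1.
rewrite -(@fm_index B n.+2 T i i (sedge i j ord_max) j (sf_mono (sedge i j) le01) l
  erefl ej' erefl (sedge1 l)) hcast_comp.
exact: hcast_irr.
Qed.

(** Three conditions on an arrow: it extends the horn, it lies over the given simplex, and it is
    compatible with the arrows out of vertex 0. The last two determine it for [i = 1], as the arrow
    from 0 to 1 is cocartesian. *)
Let good (i j : 'I_n.+3) (l : i <= j) (u : Hom (ob i) (ob j)) :=
  [/\ forall p, u = hh l p, fm F u = Th l &
      0 < i -> cmp u (hh (leq0n i : ord0 <= i) (P0 i)) = hh (leq0n j : ord0 <= j) (P0 j)].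

Let v1 : 'I_n.+3 := inord 1.
Let v1E : v1 = 1 :> nat. Proof. by rewrite inordK. Qed.

Let f1 := hh (leq0n v1 : ord0 <= v1) (P0 v1).

Let f1c : cocart1 F f1.
Proof.
rewrite /f1 /hh /hhom.
set z := exist _ _ _.
have e : h 1 z = nedge f.
  by apply: h01 => i; case: (ord2P i) => ->; rewrite /z ?[sval _]/= ?sedge0 ?sedge1.
have e0 : a = fo (h 1 z) ord0 by rewrite e.
have e1 : a' = fo (h 1 z) ord_max by rewrite e.
have -> : fm (h 1 z) (le01 : @Hom (ordcat 1) ord0 ord_max) = hcast e0 e1 f.
  by rewrite -(functor_hcast (esym e) (le01 : @Hom (ordcat 1) ord0 ord_max) e0 e1).
by rewrite hcast_comp; apply: cocart1_hcast.
Qed.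

Let good_ex (i j : 'I_n.+3) (l : i <= j) : exists u, good l u.
Proof.
case: (pselect (P (sedge i j))) => [p|np].
  exists (hh l p); split=> // [p'|i0]; first exact: hhom_irr.
  case: (p) => x x0 px; apply: (@tri _ _ _ x) => //.
  - by rewrite eq_sym.
  - by have := px ord0; rewrite sedge0.
  - by have := px ord_max; rewrite sedge1.
(* Outside of the horn every vertex is 0, [i] or [j], which leaves only the edge {1,2} of a
   triangle; there the cocartesian property supplies the arrow. *)
have all_in (x : 'I_n.+3) : [\/ x = ord0, x = i | x = j].
  case: (eqVneq x ord0) => [->|x0]; first by constructor 1.
  case: (eqVneq i x) => [->|ix]; first by constructor 2.
  case: (eqVneq j x) => [->|jx]; first by constructor 3.
  by case: np; apply: (@Pe _ _ x).
have i0 : i != ord0 by apply/eqP => e; apply: np; rewrite e; apply: P0.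
have iv : i = v1.
  case: (all_in v1) => // e; first by have := v1E; rewrite e.
  apply: ord_inj; rewrite v1E; have := v1E; rewrite e.
  have i0' : 0 < i by rewrite lt0n.
  by move: l i0' => /=; lia.
have [|u [u1 u2]] := (proj1 f1c) _ (hh (leq0n j : ord0 <= j) (P0 j))
   (@Th v1 j (ltac:(by rewrite -iv))).
  by rewrite /f1 !Fh; apply: Th_cmp.
by subst i; exists u; split.
Qed.

Let H (i j : 'I_n.+3) (l : i <= j) : Hom (ob i) (ob j) := sval (cid (good_ex l)).
Let HP (i j : 'I_n.+3) (l : i <= j) : good l (H l).
Proof. by rewrite /H; case: cid. Qed.

Lemma nerve_cocartesian_lift : exists l : smap (simplex n.+2) (nerve A),
  (forall m (y : @horn n.+2 ord0 m), l m (sval y) = h m y) /\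
  (forall m y, nmap F m (l m y) = t m y).
Proof.
have HhP (i j : 'I_n.+3) (l : i <= j) p : H l = hh l p by case: (HP l).
have [|L [LP Lo Lm]] := nerve_extend HhP.
  move=> i j k lij ljk lik.
  case: (eqVneq i ord0) => [i0|i0].
    subst i; case: (eqVneq j ord0) => [j0|j0].
      subst j; rewrite (HhP _ _ lij (P0 ord0)) /hh hhom_id cmp_idr.
      by congr H; apply: bool_irrelevance.
    have [_ _] := HP ljk; rewrite (HhP _ _ lij (P0 j)) (HhP _ _ lik (P0 k)) => E.
    have -> : hh lij (P0 j) = hh (leq0n j : ord0 <= j) (P0 j) by apply: hhom_irr.
    rewrite E ?lt0n //; exact: hhom_irr.
  have i0' : 0 < i by rewrite lt0n.
  (* The two sides agree over the base and after the cocartesian arrow from 0 to 1, hence they are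
     equal. *)
  case: (eqVneq i v1) => [iv|iv].
    subst i; apply: (proj2 f1c); last first.
      by case: (HP ljk) (HP lij) (HP lik) => _ e1 _ [_ e2 _] [_ e3 _];
        rewrite fm_cmp e1 e2 e3 Th_cmp.
    have j0 : 0 < j by apply: leq_trans lij.
    case: (HP ljk) (HP lij) (HP lik) => _ _ e1 [_ _ e2] [_ _ e3].
    by rewrite -cmpA /f1 e2 // e3 // e1.
  have v10 : v1 != ord0 by rewrite -(inj_eq val_inj) /= v1E.
  have iv' : 1 < i.
    by move: iv i0'; rewrite -(inj_eq val_inj) /= v1E; lia.
  have jv : j != v1 by rewrite -(inj_eq val_inj) /= v1E; lia.
  have kv : k != v1 by rewrite -(inj_eq val_inj) /= v1E; lia.
  rewrite (HhP _ _ lij (Pe v10 iv jv)) (HhP _ _ ljk (Pe v10 jv kv)).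
  rewrite (HhP _ _ lik (Pe v10 iv kv)); exact: (@tri i j k v1).
exists (yoneda L); split=> m y; first exact: LP.
rewrite /= tE.
suff e : functor_comp F L = T.
  by rewrite -e; apply: functor_eq.
have eo i : fo (functor_comp F L) i = fo T i by rewrite eT /= Lo.
apply: (functor_ext (eo := eo)) => i j l.
have e0 : F (fo L i) = F (ob i) by rewrite Lo.
have e1 : F (fo L j) = F (ob j) by rewrite Lo.
have := fm_hcast (fm L l) (Lo i) (Lo j) e0 e1.
rewrite Lm; case: (HP l) => _ -> _.
move=> /(congr1 (hcast (esym (eT i)) (esym (eT j)))); rewrite /Th !hcast_comp hcast_id => ->.
exact: hcast_irr.
Qed.

End NerveCocartesian.

Theorem nerve_cocartesian (A B : category) (F : functor A B) (a a' : A) (f : Hom a a') :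
  cocart1 F f -> cocartesian (nmap F) (nedge f : nerve A 1).
Proof. by move=> fc n h t h01 ht; exact: (nerve_cocartesian_lift fc h01 ht). Qed.

Lemma eg_tri (X : sSet) (x : X 2) : [/\ eg x ord0 (inord 1) = fc 2 x,
  eg x ord0 ord_max = fc 1 x & eg x (inord 1) ord_max = fc 0 x].
Proof.
by rewrite /eg /fc; split; congr (sact _ x); apply/esym; rewrite [LHS]sedgeP;
  congr sedge; apply: ord_inj; rewrite /= /bump !inordK.
Qed.

Lemma nerve_tri_ext (A : category) (t t' : nerve A 2) :
  fc 2 t = fc 2 t' -> fc 0 t = fc 0 t' -> t = t'.
Proof.
have [x1 x2 x3] := eg_tri t; have [y1 y2 y3] := eg_tri t'.
rewrite -x1 -x3 -y1 -y3 => e01 e12.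
have o0 : fo t ord0 = fo t' ord0 := congr1 (fun z : nerve A 1 => fo z ord0) e01.
have o1 : fo t (inord 1) = fo t' (inord 1) := congr1 (fun z : nerve A 1 => fo z ord0) e12.
have l1 : (@ord0 2 <= (inord 1 : 'I_3))%N by [].
have l2 : ((inord 1 : 'I_3) <= @ord_max 2)%N by rewrite inordK.
have o2 : fo t ord_max = fo t' ord_max.
  have : vertex t ord_max = vertex t' ord_max by rewrite -(tgt_eg t l2) e12 tgt_eg.
  by move=> /(congr1 (fun z : nerve A 0 => fo z ord0)).
have eo i : fo t i = fo t' i by case: (ord3P i) => ->.
apply: (functor_ext (eo := eo)) => i j l.
have diag (k : 'I_3) (l' : k <= k) : hcast (eo k) (eo k) (fm t (l' : @Hom (ordcat 2) k k)) =
    fm t' (l' : @Hom (ordcat 2) k k).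
  have -> : (l' : @Hom (ordcat 2) k k) = idc (k : ordcat 2) by apply: bool_irrelevance.
  by rewrite !fm_id hcast_idc.
move: l; case: (ord3P i) => ->; case: (ord3P j) => -> l; rewrite ?diag //.
- exact: eg_hcast.
- have -> : l = cmp (l2 : @Hom (ordcat 2) (inord 1) ord_max) (l1 : @Hom (ordcat 2) ord0 (inord 1)).
    exact: bool_irrelevance.
  by rewrite !fm_cmp (hcast_cmp _ (eo (inord 1))); congr cmp; apply: eg_hcast.
- by exfalso; have : (inord 1 : 'I_3) <= @ord0 2 := l; rewrite inordK.
- exact: eg_hcast.
- by exfalso; have : @ord_max 2 <= (inord 1 : 'I_3) := l; rewrite inordK.
Qed.

Lemma nerve_composite (A : category) (f g h h' : nerve A 1) :
  composite f g h -> composite f g h' -> h = h'.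
Proof.
move=> /compositeE [t [t2 t0 <-]] /compositeE [t' [t2' t0' <-]].
by rewrite (@nerve_tri_ext A t t') ?t2 ?t0.
Qed.

Lemma nerve_htpy (A : category) (f g : nerve A 1) : htpy f g -> f = g.
Proof. by move=> c; apply: nerve_composite (composite_idr f) c. Qed.

Lemma eg_tgt_ob (A : category) n (t : nerve A n) (i j : 'I_n.+1) :
  i <= j -> fo (eg t i j) ord_max = fo t j.
Proof. by move=> l; rewrite -[j in RHS](@sedge1 _ i j l). Qed.

Lemma nhom_eg (A : category) n (t : nerve A n) (i j : 'I_n.+1) (l : i <= j) (a b : A)
    (f : Hom a b) (ei : fo t i = a) (ej : fo t j = b) : eg t i j = nedge f ->
  hcast ei ej (fm t (l : @Hom (ordcat n) i j)) = f.
Proof.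
move=> H; have e0 : fo (eg t i j) ord0 = fo (nedge f) ord0 by rewrite H.
have e1 : fo (eg t i j) ord_max = fo (nedge f) ord_max by rewrite H.
have H2 : hcast e0 e1 (fm t (sf_mono (sedge i j) le01 : @Hom (ordcat n) (sedge i j ord0) (sedge i j ord_max))) = f.
  exact: (functor_hcast H (le01 : @Hom (ordcat 1) ord0 ord_max) e0 e1).
have es : fo t j = fo t (sedge i j ord_max) by rewrite sedge1.
rewrite -[RHS]H2 -(@fm_index A n t i i j (sedge i j ord_max) l (sf_mono (sedge i j) le01)
   erefl es erefl (esym (sedge1 l))).
by rewrite hcast_comp; apply: hcast_irr.
Qed.

Lemma nedge_of_hom (A : category) (a b : A) (f : Hom a b) (z : nerve A 1)
    (ea : fo z ord0 = a) (eb : fo z ord_max = b) :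
  hcast ea eb (nhom z) = f -> z = nedge f.
Proof. by case: _ / ea in f *; case: _ / eb in f * => <-; apply: nedge_eta. Qed.

Lemma eg_of_hom (A : category) n (t : nerve A n) (i j : 'I_n.+1) (l : i <= j) (a b : A)
    (f : Hom a b) (ei : fo t i = a) (ej : fo t j = b) :
  hcast ei ej (fm t (l : @Hom (ordcat n) i j)) = f -> eg t i j = nedge f.
Proof.
move=> <-; have e : fo (eg t i j) ord_max = b by rewrite eg_tgt_ob.
apply: (@nedge_of_hom A a b (hcast ei ej (fm t l)) (eg t i j) ei e).
have es : fo t j = fo t (sedge i j ord_max) by rewrite sedge1.
change (hcast ei e (fm t (sf_mono (sedge i j) le01 : @Hom (ordcat n) (sedge i j ord0) (sedge i j ord_max)))
  = hcast ei ej (fm t l)).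
rewrite -(@fm_index A n t i i j (sedge i j ord_max) l (sf_mono (sedge i j) le01)
   erefl es erefl (esym (sedge1 l))).
by rewrite hcast_comp; apply: hcast_irr.
Qed.

Lemma nedge_composite (A : category) (a b c : A) (f : Hom a b) (g : Hom b c) :
  composite (nedge f) (nedge g) (nedge (cmp g f)).
Proof.
have [|h ch] := composite_ex (@nerve_quasicat A) (f := nedge f) (g := nedge g).
  by rewrite src_nedge tgt_nedge.
suff <- : h = nedge (cmp g f) by [].
case/compositeE: ch => t [t2 t0 <-].
have [x1 x2 x3] := eg_tri t; rewrite -x1 in t2; rewrite -x3 in t0; rewrite -x2.
have l1 : (@ord0 2 <= (inord 1 : 'I_3))%N by [].
have l2 : ((inord 1 : 'I_3) <= @ord_max 2)%N by rewrite inordK.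
have l3 : (@ord0 2 <= @ord_max 2)%N by [].
have e0 : fo t ord0 = a := congr1 (fun z : nerve A 1 => fo z ord0) t2.
have e1 : fo t (inord 1) = b := congr1 (fun z : nerve A 1 => fo z ord0) t0.
have e2 : fo t ord_max = c.
  have : vertex t ord_max = nvert c by rewrite -(tgt_eg t l2) t0 tgt_nedge.
  by move=> /(congr1 (fun z : nerve A 0 => fo z ord0)).
have E01 := @nhom_eg A 2 t _ _ l1 a b f e0 e1 t2.
have E12 := @nhom_eg A 2 t _ _ l2 b c g e1 e2 t0.
apply: (@eg_of_hom A 2 t _ _ l3 a c _ e0 e2).
have -> : (l3 : @Hom (ordcat 2) ord0 ord_max) = cmp (l2 : @Hom (ordcat 2) (inord 1) ord_max) (l1 : @Hom (ordcat 2) ord0 (inord 1)).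
  exact: bool_irrelevance.
by rewrite fm_cmp (hcast_cmp _ e1) E01 E12.
Qed.

(** * Factorization through cocartesian edges over a nerve *)

Section Factor.
Variables (X : sSet) (A : category) (p : smap X (nerve A)).
Hypothesis pin : inner_fibration p.

Let Xq : quasicat X := quasicat_total pin (@nerve_quasicat A).

Lemma cocart_factor (e h : X 1) (b : nerve A 1) : cocartesian p e -> src e = src h ->
  composite (p 1 e) b (p 1 h) -> exists k, p 1 k = b /\ composite e k h.
Proof.
move=> /cocart_fill ec eh /compositeE [t [t2 t0 t1]].
have [|||x [xt xy]] := ec 0 (nth4 e h e e) t.
- apply: compat_nat => -[|[|a]] [|[|[|b']]] //= H _ _; try (exfalso; lia).
  by rewrite !fc_src.
- by rewrite edge01_0 sact_id.
- move=> i; case: (ord3P i) => -> //= _; first by rewrite inordK // -t1.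
  by rewrite -t2 /fc ord_max3.
exists (fc 0 x); split; first by rewrite /fc sm_nat xt -/(fc 0 t) t0.
by apply/compositeE; exists x; split=> //; rewrite (fill_nat xy).
Qed.

(** The two triangles and a degenerate one on [h] form a left horn of dimension three, and face 0 of
    its filler is the homotopy. The base simplex [t] fits because a triangle of a nerve is
    determined by two of its edges. *)
Lemma cocart_unique (e h k k' : X 1) : cocartesian p e ->
  composite e k h -> composite e k' h -> p 1 k = p 1 k' -> htpy k k'.
Proof.
move=> /cocart_fill ec ck ck' pk.
pose d1 := sact (simp_degen (@ord_max 1)) h.
have [d12 d11 d10] : [/\ fc 2 d1 = h, fc 1 d1 = h & fc 0 d1 = cst 1 (tgt h)].
  have dI i : (i == 1) || (i == 2) ->
      simp_comp (simp_degen (@ord_max 1)) (simp_face (inord i)) = simp_id 1.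
    move=> i2; have i4 : i < 3 by lia.
    apply: simp_eq => x; apply: ord_inj; rewrite /= /unbump /bump inordK //.
    by have := ltn_ord x; lia.
  split; [by rewrite /fc /d1 -sact_comp dI ?sact_id..|].
  rewrite /fc /d1 /cst /tgt /vertex -!sact_comp; congr (sact _ h).
  apply: simp_eq => x; apply: ord_inj; rewrite /= /unbump /bump inordK //.
  by have := ltn_ord x; lia.
case/compositeE: ck => d3 [d32 d30 d31]; case/compositeE: ck' => d2 [d22 d20 d21].
pose t := sact (simp_degen (@ord_max 2)) (p 2 d3).
have sid i : (i == 2) || (i == 3) -> simp_comp (simp_degen (@ord_max 2)) (simp_face (inord i)) = simp_id 2.
  move=> i2; have i4 : i < 4 by lia.
  apply: simp_eq => x; apply: ord_inj; rewrite /= /unbump /bump inordK //.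
  by have := ltn_ord x; lia.
have s1 : simp_comp (simp_degen (@ord_max 2)) (simp_face (inord 1)) =
    simp_comp (simp_face (inord 1)) (simp_degen (@ord_max 1)).
  by apply: simp_eq => x; apply: ord_inj; rewrite /= /unbump /bump !inordK //;
    have := ltn_ord x; lia.
have t3 : fc 3 t = p 2 d3 by rewrite /fc /t -sact_comp sid // sact_id.
have t2 : fc 2 t = p 2 d2.
  rewrite /fc /t -sact_comp sid // sact_id; apply: nerve_tri_ext.
    by rewrite /fc -!sm_nat -/(fc 2 d3) -/(fc 2 d2) d32 d22.
  by rewrite /fc -!sm_nat -/(fc 0 d3) -/(fc 0 d2) d30 d20.
have t1 : fc 1 t = p 2 d1.
  rewrite /fc /t -sact_comp s1 sact_comp -/(fc 1 (p 2 d3)).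
  have -> : fc 1 (p 2 d3) = p 1 h by rewrite /fc -sm_nat -/(fc 1 d3) d31.
  by rewrite -sm_nat.
have [|||z [zt zy]] := ec 1 (nth4 d1 d1 d2 d3) t.
- apply: compat_nat => -[|[|[|a]]] [|[|[|[|b]]]] //= H _ _; try (exfalso; lia).
  + by rewrite d21 d11.
  + by rewrite d31 d12.
  + by rewrite d32 d22.
- have -> : edge01 1 = simp_face ord_max.
    apply: simp_eq => i; apply: ord_inj; rewrite edge01E /= /bump.
    by case: i => [[|[|i]] ?].
  by rewrite /= ord_max3 -/(fc 2 d3).
- move=> i i0; have e' : i = inord i :> 'I_4 by rewrite inord_val.
  case: i i0 e' => [[|[|[|[|i]]]] lt] // _ /= ->.
  + by rewrite -t1 /fc.
  + by rewrite -t2 /fc.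
  + by rewrite -t3 /fc.
have z0 a : a < 4 -> a != 0 -> fc a z = nth4 d1 d1 d2 d3 a.
  by move=> a4 a0; rewrite (fill_nat zy).
suff : composite k (cst 1 (tgt h)) k' by move=> c; exact: idr_htpy c.
apply/compositeE; exists (fc 0 z).
rewrite -(@fc_fc _ 1 z 0 3) // -(@fc_fc _ 1 z 0 1) // -(@fc_fc _ 1 z 0 2) //.
by rewrite !z0 //= d30 d20 d10.
Qed.
End Factor.

(** * Calculus of cocartesian edges *)

Lemma composite_inv (X : sSet) (Xq : quasicat X) (f g h f' : X 1) x :
  composite f g h -> composite f' f (cst 1 x) -> composite f' h g.
Proof.
move=> c c'; have [e1 _ _] := composite_ends c; have [_ _ e2] := composite_cst c'.
by apply: (assocL Xq) c' c _; rewrite -e2 e1; apply: composite_idl.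
Qed.

Section CocartCalculus.
Variables (X : sSet) (A : category) (p : smap X (nerve A)).
Hypothesis pin : inner_fibration p.

Let Xq : quasicat X := quasicat_total pin (@nerve_quasicat A).

Let Sq : quasicat (nerve A) := @nerve_quasicat A.

Lemma nerve_cst_comp (f g h : nerve A 1) x y : composite f g h ->
  f = cst 1 x -> g = cst 1 y -> h = cst 1 x.
Proof.
move=> c ef eg; have [e _ _] := composite_ends c; rewrite ef eg tgt_cst src_cst in e.
apply: (nerve_composite c); rewrite ef eg -e.
by have := composite_idr (cst 1 x : nerve A 1); rewrite tgt_cst.
Qed.

Lemma cocart_postcomp (e k h : X 1) : cocartesian p e -> is_equiv k ->
  composite e k h -> cocartesian p h.
Proof.
by move=> ec ke c; apply: cocartesian_comp c ec _ => //; apply: equiv_cocartesian.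
Qed.

Lemma cocart_precomp (e k h : X 1) : cocartesian p e -> is_equiv k ->
  composite k e h -> cocartesian p h.
Proof.
by move=> ec ke c; apply: cocartesian_comp c _ ec => //; apply: equiv_cocartesian.
Qed.

Lemma cocart_conj (e k k' e' : X 1) : square e k k' e' -> is_equiv k -> is_equiv k' ->
  cocartesian p e -> cocartesian p e'.
Proof.
move=> [d [c c']] [i [i1 i2]] ke' ec.
have dc := cocart_postcomp ec ke' c.
have ie : is_equiv i by exists k; have [_ -> _] := composite_cst i2;
  have [_ _ ->] := composite_cst i1.
exact: cocart_precomp dc ie (composite_inv Xq c' i2).
Qed.

Lemma cocart_equiv_factor (e e' : X 1) : cocartesian p e -> cocartesian p e' ->
  src e = src e' -> p 1 e = p 1 e' ->
  exists k, [/\ composite e k e', is_equiv k & p 1 k = cst 1 (tgt (p 1 e))].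
Proof.
move=> ec ec' ss pp.
have [|k [pk ck]] := @cocart_factor _ _ p e e' (cst 1 (tgt (p 1 e))) ec ss.
  by rewrite -pp; apply: composite_idr.
have [|k' [pk' ck']] := @cocart_factor _ _ p e' e (cst 1 (tgt (p 1 e))) ec' (esym ss).
  by rewrite -pp; apply: composite_idr.
have half a b c d : cocartesian p a -> p 1 c = cst 1 (tgt (p 1 e)) ->
    p 1 d = cst 1 (tgt (p 1 e)) -> tgt (p 1 a) = tgt (p 1 e) ->
    composite a c b -> composite b d a -> composite c d (cst 1 (tgt a)).
  move=> ac pc pd ae c1 c2.
  have [e1 e2 e3] := composite_ends c1; have [e4 e5 e6] := composite_ends c2.
  have [|m cm] := composite_ex Xq (f := c) (g := d); first by rewrite -e3.
  apply: (htpy_comp Xq _ cm); apply: (cocart_unique ac _ (composite_idr a)).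
    exact: (assocL Xq) c1 cm c2.
  rewrite cst_nat tgt_nat ae.
  exact: (nerve_cst_comp (composite_nat p cm) pc pd).
exists k; split=> //; apply: (equiv_of_lr Xq (a := k') (b := k')).
  by apply: half ck' ck => //; rewrite -pp.
exact: half ck ck'.
Qed.

End CocartCalculus.

(** Two cocartesian lifts with the same source differ by an equivalence, so one well-behaved lift
    for each edge and source suffices. *)
Lemma preserves_of_lifts (A : category) (X X' : sSet) (p : smap X (nerve A))
    (p' : smap X' (nerve A)) (u : smap X X') :
  inner_fibration p -> inner_fibration p' -> (forall n x, p' n (u n x) = p n x) ->
  (forall (f : nerve A 1) (x : X 0), p 0 x = src f ->
     exists e, [/\ p 1 e = f, src e = x, cocartesian p e & cocartesian p' (u 1 e)]) ->
  forall e, cocartesian p e -> cocartesian p' (u 1 e).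
Proof.
move=> pin pin' up H e ec.
have [|e0 [pe se ec0 uec]] := H (p 1 e) (src e); first exact: src_nat.
have [k [ck ke _]] := cocart_equiv_factor pin ec0 ec se pe.
exact: (cocart_postcomp pin' uec (is_equiv_nat u ke) (composite_nat u ck)).
Qed.

Lemma cocart_total (X Y S : sSet) (p : smap X Y) (r : smap Y S) (e : X 1) :
  cocartesian p e -> cocartesian r (p 1 e) -> cocartesian (smap_comp r p) e.
Proof.
move=> /cocart_fill pe /cocart_fill re; apply/cocart_fill => n y t yc y01 yt.
have [|||s [rs sy]] := re n (fun i => p n.+1 (y i)) t.
- by move=> i j ik jk m f g E; rewrite -!sm_nat (yc i j ik jk m f g E).
- by rewrite -sm_nat y01.
- by [].
have [|x [px xy]] := pe n y s yc y01; first by move=> i i0; rewrite sy.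
by exists x; rewrite /= px.
Qed.

(** Left horns of a nerve with cocartesian first edge have at most one filler over a given simplex.
    This turns a filler over a composite map into a filler over the intermediate nerve. *)
Lemma nerve_cocart_ext (A B : category) (r : smap (nerve B) (nerve A)) n
    (L L' : nerve B n.+2) :
  (forall i, i != ord0 -> sact (simp_face i) L = sact (simp_face i) L') ->
  r n.+2 L = r n.+2 L' -> cocartesian r (sact (edge01 n.+1) L) -> L = L'.
Proof.
case: n L L' => [|n] L L' LL rL ec.
  have f1 : fc 1 L = fc 1 L' by rewrite /fc LL // -(inj_eq val_inj) /= inordK.
  have f2 : fc 2 L = fc 2 L' by rewrite /fc LL // -(inj_eq val_inj) /= inordK.
  apply: nerve_tri_ext => //; apply: nerve_htpy.
  have ce : composite (fc 2 L) (fc 0 L) (fc 1 L) by apply/compositeE; exists L.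
  have ce' : composite (fc 2 L) (fc 0 L') (fc 1 L).
    by apply/compositeE; exists L'; rewrite f1 f2.
  have r0 : r 1 (fc 0 L) = r 1 (fc 0 L').
    by rewrite /fc !sm_nat; move: rL => /= ->.
  apply: (cocart_unique _ ce ce' r0).
  suff -> : fc 2 L = sact (edge01 1) L by [].
  rewrite /fc; congr (sact _ L); apply: simp_eq => i; apply: ord_inj; rewrite edge01E /=.
  by have := ltn_ord i; rewrite /bump inordK //; lia.
apply: nerve_edge_ext => a b ab.
(* Two vertices cannot meet all of 1, 2, 3, so the edge lies in a face of the horn. *)
have [i [i0 ia ib]] : exists i : 'I_n.+4, [/\ i != ord0, a != i & b != i].
  case: (boolP ((a != inord 1) && (b != inord 1))) => [/andP [? ?]|H1].
    by exists (inord 1); split=> //; rewrite -(inj_eq val_inj) /= inordK.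
  case: (boolP ((a != inord 2) && (b != inord 2))) => [/andP [? ?]|H2].
    by exists (inord 2); split=> //; rewrite -(inj_eq val_inj) /= inordK.
  exists (inord 3); move: H1 H2; rewrite -!(inj_eq val_inj) /= !inordK //; split; lia.
have [s es] := simp_factor (sedge_miss ia ib).
by rewrite /eg es !sact_comp LL.
Qed.

Lemma cocart_cancel (A B : category) (X : sSet) (p : smap X (nerve B))
    (r : smap (nerve B) (nerve A)) (e : X 1) :
  cocartesian (smap_comp r p) e -> cocartesian r (p 1 e) -> cocartesian p e.
Proof.
move=> /cocart_fill ec re; apply/cocart_fill => n y t yc y01 yt.
have [|x [rx xy]] := ec n y (r n.+2 t) yc y01.
  by move=> i i0; rewrite /= yt // sm_nat.
exists x; split=> //; apply: (@nerve_cocart_ext _ _ r) => //.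
  by move=> i i0; rewrite -sm_nat xy // yt.
by rewrite -sm_nat -face_edge01 sact_comp xy // y01.
Qed.

Section PullbackCocart.
Variables (A B : category) (X Z : sSet) (q : smap X (nerve B)) (z : smap Z (nerve B)).
Variable r : smap (nerve B) (nerve A).

Lemma pullback_cocart (e : pullback q z 1) :
  cocartesian (smap_comp r q) (sval e).1 -> cocartesian (smap_comp r z) (sval e).2 ->
  cocartesian r (q 1 (sval e).1) ->
  cocartesian (smap_comp r (smap_comp q (pr1 q z))) e.
Proof.
move=> /cocart_fill e1 /cocart_fill e2 re; apply/cocart_fill => n y t yc y01 yt.
have [|||x [rx xy]] := e1 n (fun i => (sval (y i)).1) t.
- by move=> i j ik jk m f g E; have := congr1 (fun w => (sval w).1) (yc i j ik jk m f g E).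
- by rewrite -y01.
- by [].
have [|||w [rw wy]] := e2 n (fun i => (sval (y i)).2) t.
- by move=> i j ik jk m f g E; have := congr1 (fun w => (sval w).2) (yc i j ik jk m f g E).
- by rewrite -y01.
- by move=> i i0; rewrite /= -(svalP (y i)); apply: yt.
have qz : q n.+2 x = z n.+2 w.
  apply: (@nerve_cocart_ext _ _ r).
  - by move=> i i0; rewrite -!sm_nat xy // wy // (svalP (y i)).
  - by move: rx rw => /= -> ->.
  - by rewrite -sm_nat -face_edge01 sact_comp xy // -y01 in re *.
exists (exist _ (x, w) qz); split=> //= i i0.
by apply: sig_eq; rewrite /= xy // wy // -surjective_pairing.
Qed.

Lemma pullback_inner : inner_fibration q -> inner_fibration z -> inner_fibration (pr1 q z).
Proof.
move=> qi /inner_fill zi; apply/inner_fill => n k kn y t yc _ yt.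
have [|||w [zw wy]] := zi n k kn (fun i => (sval (y i)).2) (q _ t).
- by move=> i j ik jk m f g E; have := congr1 (fun w => (sval w).2) (yc i j ik jk m f g E).
- by [].
- by move=> i i0; rewrite -(svalP (y i)) -sm_nat; congr (q _ _); apply: yt.
exists (exist _ (t, w) (esym zw)); split=> // i ik.
by apply: sig_eq; rewrite /= wy // -yt //= -surjective_pairing.
Qed.

End PullbackCocart.

Lemma full_inner (X S : sSet) (p : smap X S) (P : X 0 -> Prop) :
  inner_fibration p -> inner_fibration (smap_comp p (sincl (@full_stable X P))).
Proof.
move=> /inner_fill pin; apply/inner_fill => -[|n] k kn y t yc _ yt.
  by move: kn; rewrite andbC ltnNge; case: (k) => [[|[|k']] ?].
have [|||x [px xy]] := pin _ k kn (fun i => sval (y i)) t.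
- by move=> i j ik jk m f g E; have := congr1 sval (yc i j ik jk m f g E).
- by [].
- by [].
have xP i : P (vertex x i).
  have [j jk ij] : exists2 j, j != k & i != j.
    case: (boolP ((ord0 != k) && (i != ord0))) => [/andP [? ?]|H1]; first by exists ord0.
    case: (boolP ((ord_max != k) && (i != ord_max))) => [/andP [? ?]|H2]; first by exists ord_max.
    exists (inord 1); move: H1 H2 kn; rewrite -!(inj_eq val_inj) /= !inordK //; lia.
  case: (unliftP j i) ij => [i'|] ->; last by rewrite eqxx.
  by move=> _; have := svalP (y j) i'; rewrite -xy // vertex_act.
by exists (exist _ x xP); split=> // i ik; apply: sig_eq; rewrite /= xy.
Qed.

Lemma full_cocart (X S : sSet) (p : smap X S) (P : X 0 -> Prop) (e : full P 1) :
  cocartesian p (sval e) -> cocartesian (smap_comp p (sincl (@full_stable X P))) e.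
Proof.
move=> /cocart_fill ec; apply/cocart_fill => n y t yc y01 yt.
have [|||x [px xy]] := ec n (fun i => sval (y i)) t.
- by move=> i j ik jk m f g E; have := congr1 sval (yc i j ik jk m f g E).
- by rewrite -y01.
- by [].
have xP i : P (vertex x i).
  have [j jk ij] : exists2 j, j != ord0 & i != j.
    case: (eqVneq i ord_max) => [->|H]; last by exists ord_max.
    by exists (inord 1); rewrite -(inj_eq val_inj) /= inordK.
  case: (unliftP j i) ij => [i'|] ->; last by rewrite eqxx.
  by move=> _; have := svalP (y j) i'; rewrite -xy // vertex_act.
by exists (exist _ x xP); split=> // i ik; apply: sig_eq; rewrite /= xy.
Qed.

(** * Functors over a base *)

(** The square is cut along its diagonal; [a] and [b] are the two degenerate triangles on the edge
    of the interval. *)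
Lemma nat_square (A B : sSet) (T : smap (sprod A (simplex 1)) B) (k : A 1) :
  square (T 1 (k, simp_cst 1 ord0)) (T 1 (cst 1 (src k), simp_id 1))
         (T 1 (cst 1 (tgt k), simp_id 1)) (T 1 (k, simp_cst 1 ord_max)).
Proof.
have le := isT : @ord0 1 <= @ord_max 1.
have [a [a2 a0 a1 _]] := stri_ex le (leqnn (@ord_max 1)).
have [b [b2 b0 b1 _]] := stri_ex (leqnn (@ord0 1)) le.
have full : sedge (@ord0 1) ord_max = simp_id 1 by rewrite [RHS]sedgeP.
have E (s : simp 2 1) : sact (simp_face ord_max) (sact s k) = sact (simp_comp s (simp_face ord_max)) k
  by rewrite sact_comp.
have kE : sact (sedge ord0 ord_max) k = k := eg_full k.
have k0 : sact (sedge ord0 ord0) k = cst 1 (src k) := eg_diag k ord0.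
have k1 : sact (sedge ord_max ord_max) k = cst 1 (tgt k) := eg_diag k ord_max.
exists (T 1 (k, simp_id 1)); split.
  exists (T 2 (sact a k, b)); rewrite -!sm_nat /= -!sact_comp a2 a0 a1 b2 b0 b1 kE k1.
  by rewrite !sedge_diag full.
exists (T 2 (sact b k, a)); rewrite -!sm_nat /= -!sact_comp a2 a0 a1 b2 b0 b1 kE k0.
by rewrite !sedge_diag full.
Qed.

Lemma square_nat (X Y : sSet) (u : smap X Y) f g g' f' :
  square f g g' f' -> square (u 1 f) (u 1 g) (u 1 g') (u 1 f').
Proof. by case=> d [c c']; exists (u 1 d); split; apply: composite_nat. Qed.

Program Definition fapp (A B S : sSet) (r : smap A S) (q : smap B S) (h : FunOver r q 0) :
    smap A B := @SMap A B (fun n a => app h a) _.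
Next Obligation. by rewrite /app -sm_nat /= simp_cst_comp. Qed.

Lemma fapp_over (A B S : sSet) (r : smap A S) (q : smap B S) (h : FunOver r q 0) n (a : A n) :
  q n (fapp h n a) = r n a.
Proof. exact: (svalP h). Qed.

Program Definition fver (A B S : sSet) (r : smap A S) (q : smap B S) (u : smap A B)
    (uq : forall n a, q n (u n a) = r n a) : FunOver r q 0 :=
  exist _ (@SMap (sprod A (simplex 0)) B (fun n x => u n x.1) _) _.
Next Obligation. exact: sm_nat. Qed.

Lemma simp0_eq n (s s' : simp n 0) : s = s'.
Proof.
by apply: simp_eq => i; apply: val_inj; case: (s i) (s' i) => [[|//] ?] [[|//] ?].
Qed.

Lemma FunOver0_ext (A B S : sSet) (r : smap A S) (q : smap B S) (h h' : FunOver r q 0) :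
  (forall n a, fapp h n a = fapp h' n a) -> h = h'.
Proof.
move=> H; apply: sig_eq; apply: smap_eq => n [a s].
by rewrite (simp0_eq s (simp_cst n ord0)); apply: H.
Qed.

Definition ftr (A B S : sSet) (r : smap A S) (q : smap B S) (t : FunOver r q 1) (a : A 0) : B 1 :=
  sval t 1 (cst 1 a, simp_id 1).

Section FunTools.
Variables (A B S : sSet) (r : smap A S) (q : smap B S).
Hypotheses (qin : inner_fibration q) (Sq : quasicat S).

Program Definition feval (a : A 0) : smap (FunOver r q) B :=
  @SMap (FunOver r q) B (fun n h => sval h n (cst n a, simp_id n)) _.
Next Obligation. by rewrite -sm_nat /= simp_compI simp_compIl cst_act. Qed.

Lemma feval1 a (t : FunOver r q 1) : feval a 1 t = ftr t a.
Proof. by []. Qed.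

Lemma feval0 a (h : FunOver r q 0) : feval a 0 h = fapp h 0 a.
Proof. by rewrite /= /app cst0; congr (sval h 0 (_, _)); apply: simp0_eq. Qed.

Lemma src_ftr (t : FunOver r q 1) a : src (ftr t a) = fapp (src t) 0 a.
Proof. by rewrite -feval1 -src_nat feval0. Qed.

Lemma tgt_ftr (t : FunOver r q 1) a : tgt (ftr t a) = fapp (tgt t) 0 a.
Proof. by rewrite -feval1 -tgt_nat feval0. Qed.

Lemma ftr_over (t : FunOver r q 1) a : q 1 (ftr t a) = cst 1 (r 0 a).
Proof. by rewrite (svalP t) /= cst_nat. Qed.

Lemma fapp_src (t : FunOver r q 1) n (a : A n) :
  fapp (src t) n a = sval t n (a, simp_cst n ord0).
Proof. by rewrite /= /app /=; congr (sval t n (_, _)); apply: simp_eq. Qed.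

Lemma fapp_tgt (t : FunOver r q 1) n (a : A n) :
  fapp (tgt t) n a = sval t n (a, simp_cst n ord_max).
Proof. by rewrite /= /app /=; congr (sval t n (_, _)); apply: simp_eq. Qed.

Lemma ftr_square (t : FunOver r q 1) (k : A 1) :
  square (fapp (src t) 1 k) (ftr t (src k)) (ftr t (tgt k)) (fapp (tgt t) 1 k).
Proof. by rewrite fapp_src fapp_tgt; apply: nat_square. Qed.

Lemma ftr_equiv (t : FunOver r q 1) a : is_equiv t -> is_equiv (ftr t a).
Proof. by rewrite -feval1; apply: is_equiv_nat. Qed.

Lemma fun_equiv_cocart (t : FunOver r q 1) : (forall a, is_equiv (ftr t a)) ->
  cocartesian (to_pt (FunOver r q)) t.
Proof.
move=> te; apply: fun_cocartesian => // a.
exact: (equiv_cocartesian qin Sq (te a)).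
Qed.

(** Inverses chosen pointwise need not be natural; being cocartesian over a point is what assembles
    them. *)
Lemma fun_is_equiv (t : FunOver r q 1) : (forall a, is_equiv (ftr t a)) -> is_equiv t.
Proof. by move=> te; apply/is_equiv_of_cocartesian/fun_equiv_cocart. Qed.

Lemma cocart_span (M : sSet) (a b : M 1) : cocartesian (to_pt M) a -> src a = src b ->
  exists c, composite a c b.
Proof.
move=> /cocart_fill ac ab.
have [|||x [_ xy]] := ac 0 (nth4 a b a a) tt.
- apply: compat_nat => -[|[|c]] [|[|[|b']]] //= H _ _; try (exfalso; lia).
  by rewrite !fc_src.
- by rewrite edge01_0 sact_id.
- by [].
by exists (fc 0 x); apply/compositeE; exists x; split=> //; rewrite (fill_nat xy).
Qed.

(** Transformations are composed only by factoring through a pointwise equivalence. This suffices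
    below and avoids showing that [FunOver] is a quasi-category. *)
Lemma fun_span (a b : FunOver r q 1) : (forall x, is_equiv (ftr a x)) -> src a = src b ->
  exists c, composite a c b.
Proof. by move=> /fun_equiv_cocart ac; apply: cocart_span. Qed.

Lemma ftr_composite (a b c : FunOver r q 1) x : composite a b c ->
  composite (ftr a x) (ftr b x) (ftr c x).
Proof. by rewrite -!feval1; apply: composite_nat. Qed.

End FunTools.

Lemma full_composite (X : sSet) (P : X 0 -> Prop) (f g h : full P 1) :
  composite (sval f) (sval g) (sval h) -> composite f g h.
Proof.
case=> t [t2 t0 t1].
have Pt i : P (vertex t i).
  case: (ord3P i) => ->.
  - have := svalP f ord0; rewrite -t2 vertex_act.
    by have -> : simp_face ord_max ord0 = ord0 :> 'I_3 by apply: ord_inj.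
  - have := svalP f ord_max; rewrite -t2 vertex_act.
    by have -> : simp_face ord_max ord_max = inord 1 :> 'I_3 by apply: ord_inj; rewrite inordK.
  - have := svalP g ord_max; rewrite -t0 vertex_act.
    by have -> : simp_face ord0 ord_max = ord_max :> 'I_3 by apply: ord_inj.
by exists (exist _ t Pt); split; apply: sig_eq.
Qed.

Definition full_edge (X : sSet) (P : X 0 -> Prop) (e : X 1) (Ps : P (src e)) (Pt : P (tgt e)) :
    full P 1 :=
  exist _ e (fun i => match ord2P i with or_introl E => eq_ind_r (fun i => P (vertex e i)) Ps E
                                       | or_intror E => eq_ind_r (fun i => P (vertex e i)) Pt E end).

Lemma full_is_equiv (X : sSet) (P : X 0 -> Prop) (e : full P 1) :
  is_equiv (sval e) -> is_equiv e.
Proof.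
case=> e' [c1 c2]; have [E1 _ E2] := composite_cst c1.
have Ps : P (src e') by rewrite -E1; apply: (svalP e).
have Pt : P (tgt e') by rewrite E2; apply: (svalP e).
by exists (full_edge Ps Pt); split; apply: full_composite.
Qed.

Program Definition fun_eval (X Y : sSet) (x : X 0) : smap (Fun X Y) Y :=
  @SMap (Fun X Y) Y (fun n h => h n (cst n x, simp_id n)) _.
Next Obligation. by rewrite -sm_nat /= simp_compI simp_compIl cst_act. Qed.

Lemma src_fun (X Y : sSet) (e : Fun X Y 1) x (u : smap X Y) : src e = fun_vertex u ->
  src (e 1 (cst 1 x, simp_id 1)) = u 0 x.
Proof.
move=> es; transitivity ((src e : smap _ _) 0 (x, simp_cst 0 ord0)); last by rewrite es.
rewrite [RHS]/= /src {1}/vertex -sm_nat; congr (e 0 (_, _)).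
by rewrite [LHS]/= cst_act cst0.
Qed.

Lemma tgt_fun (X Y : sSet) (e : Fun X Y 1) x (u : smap X Y) : tgt e = fun_vertex u ->
  tgt (e 1 (cst 1 x, simp_id 1)) = u 0 x.
Proof.
move=> es; transitivity ((tgt e : smap _ _) 0 (x, simp_cst 0 ord0)); last by rewrite es.
rewrite [RHS]/= /tgt {1}/vertex -sm_nat; congr (e 0 (_, _)).
by rewrite [LHS]/= cst_act cst0.
Qed.

(** * Conservativity, essential surjectivity and fullness of a restricted equivalence *)

Section Univ.
Variables (K D C Gm S S' : sSet) (r : smap K S) (q : smap D S) (r' : smap Gm S') (p : smap C S').
Variables (F : smap (FunOver r q) (FunOver r' p)).
Variables (P : FunOver r q 0 -> Prop) (Q : FunOver r' p 0 -> Prop).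
Hypotheses (qin : inner_fibration q) (Sq : quasicat S).
Hypotheses (pin : inner_fibration p) (S'q : quasicat S').
Hypothesis FPQ : restricts_to_equivalence F P Q.

Let Dq : quasicat D := quasicat_total qin Sq.

(** The homotopy from [g Phi] to the identity compares [t] with the image under [g] of [Phi t],
    which is invertible when [F t] is. *)
Lemma univ_conservative (t : FunOver r q 1) : P (src t) -> P (tgt t) ->
  (forall z, is_equiv (ftr (F 1 t) z)) -> forall k, is_equiv (ftr t k).
Proof.
move=> Ps Pt te k; case: FPQ => Phi [PhiF [g [[e [es et ee]] _]]].
have Pv i : P (vertex t i) by case: (ord2P i) => ->.
pose t' : full P 1 := exist _ t Pv.
have e1 : is_equiv (Phi 1 t').
  by apply: full_is_equiv; rewrite PhiF; apply: fun_is_equiv.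
have e2 := is_equiv_nat (feval r q k) (is_equiv_nat (sincl (@full_stable _ P)) (is_equiv_nat g e1)).
have ec x : is_equiv (feval r q k 1 (sval (e 1 (cst 1 x, simp_id 1)))).
  apply: (is_equiv_nat (feval r q k)); apply: (is_equiv_nat (sincl (@full_stable _ P))).
  exact: (is_equiv_nat (fun_eval (full P) x) ee).
have sq := square_nat (feval r q k) (square_nat (sincl (@full_stable _ P)) (nat_square e t')).
have E0 : e 1 (t', simp_cst 1 ord0) = g 1 (Phi 1 t').
  have := congr1 (fun h : Fun (full P) (full P) 0 => h 1 (t', simp_cst 1 ord0)) es.
  by move=> /= H; rewrite -[RHS]H; congr (e 1 (_, _)); apply: simp_eq.
have E1 : e 1 (t', simp_cst 1 ord_max) = t'.
  have := congr1 (fun h : Fun (full P) (full P) 0 => h 1 (t', simp_cst 1 ord0)) et.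
  by move=> /= H; rewrite -[RHS]H; congr (e 1 (_, _)); apply: simp_eq.
rewrite E0 E1 in sq.
by apply: (proj1 (square_equiv Dq sq _ _)); first exact: ec; first exact: ec.
Qed.

Lemma univ_exists (h : FunOver r' p 0) : Q h -> exists u (t : FunOver r' p 1),
  [/\ P u, src t = F 0 u, tgt t = h & forall z, is_equiv (ftr t z)].
Proof.
move=> Qh; case: FPQ => Phi [PhiF [g [_ [e [es et ee]]]]].
have Qv i : Q (vertex h i) by rewrite vertex0.
pose h' : full Q 0 := exist _ h Qv.
exists (sval (g 0 h')), (sval (e 1 (cst 1 h', simp_id 1))); split.
- by have := svalP (g 0 h') ord0; rewrite vertex0.
- have -> : src (sval (e 1 (cst 1 h', simp_id 1))) = sval (src (e 1 (cst 1 h', simp_id 1))) by [].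
  rewrite (src_fun _ es).
  by rewrite PhiF.
- have -> : tgt (sval (e 1 (cst 1 h', simp_id 1))) = sval (tgt (e 1 (cst 1 h', simp_id 1))) by [].
  by rewrite (tgt_fun _ et).
move=> z; apply: ftr_equiv; apply: (is_equiv_nat (sincl (@full_stable _ Q))).
exact: (is_equiv_nat (fun_eval (full Q) h') ee).
Qed.

Lemma univ_full (u v : FunOver r q 0) (t : FunOver r' p 1) : P u -> P v ->
  src t = F 0 u -> tgt t = F 0 v -> (forall z, is_equiv (ftr t z)) ->
  exists s : FunOver r q 1, [/\ src s = u, tgt s = v & forall k, is_equiv (ftr s k)].
Proof.
move=> Pu Pv ts tt te; case: FPQ => Phi [PhiF [g [[e [es et ee]] _]]].
have Pu' i : P (vertex u i) by rewrite vertex0.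
have Pv' i : P (vertex v i) by rewrite vertex0.
pose u' : full P 0 := exist _ u Pu'; pose v' : full P 0 := exist _ v Pv'.
have Qt i : Q (vertex t i).
  case: (ord2P i) => ->.
    rewrite -/(src t) ts -[u]/(sval u') -PhiF; have := svalP (Phi 0 u') ord0.
    by rewrite vertex0.
  rewrite -/(tgt t) tt -[v]/(sval v') -PhiF; have := svalP (Phi 0 v') ord0.
  by rewrite vertex0.
pose t' : full Q 1 := exist _ t Qt.
have t'e : is_equiv t' by apply: full_is_equiv; apply: fun_is_equiv.
pose ev (x : full P 0) : FunOver r q 1 := sval (e 1 (cst 1 x, simp_id 1)).
have eve x k : is_equiv (ftr (ev x) k).
  apply: ftr_equiv; apply: (is_equiv_nat (sincl (@full_stable _ P))).
  exact: (is_equiv_nat (fun_eval (full P) x) ee).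
have evs x : src (ev x) = sval (g 0 (Phi 0 x)).
  have -> : src (ev x) = sval (src (e 1 (cst 1 x, simp_id 1))) by [].
  by rewrite (src_fun _ es).
have evt x : tgt (ev x) = sval x.
  have -> : tgt (ev x) = sval (tgt (e 1 (cst 1 x, simp_id 1))) by [].
  by rewrite (tgt_fun _ et).
pose b : FunOver r q 1 := sval (g 1 t').
have be k : is_equiv (ftr b k).
  apply: ftr_equiv; apply: (is_equiv_nat (sincl (@full_stable _ P))).
  exact: is_equiv_nat.
have bs : src b = sval (g 0 (Phi 0 u')).
  have -> : src b = sval (src (g 1 t')) by [].
  rewrite -src_nat; congr (sval (g 0 _)); apply: sig_eq.
  by rewrite PhiF -ts.
have bt : tgt b = sval (g 0 (Phi 0 v')).
  have -> : tgt b = sval (tgt (g 1 t')) by [].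
  rewrite -tgt_nat; congr (sval (g 0 _)); apply: sig_eq.
  by rewrite PhiF -tt.
(* Here [d] goes from [u] to the image of [v] under [g Phi]. As composites exist only by factoring
   through a pointwise equivalence, [s] is found by factoring [ev v'] through the inverse [d'] of
   [d]. *)
have [|d cd] := fun_span qin Sq (eve u') (b := b); first by rewrite evs bs.
have de k : is_equiv (ftr d k).
  exact: is_equiv_right Dq _ _ _ (ftr_composite k cd) (eve _ _) (be _).
have [d' [c1 c2]] := fun_is_equiv qin Sq de.
have [ds1 ds2 ds3] := composite_ends cd.
have [E1 E2 E3] := composite_cst c1.
have d'e k : is_equiv (ftr d' k).
  have c1k := ftr_composite k c1.
  apply: is_equiv_right Dq _ _ _ c1k (de k) _.
  have -> : ftr (cst 1 (src d)) k = cst 1 (feval r q k 0 (src d)).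
    by rewrite -feval1 cst_nat.
  exact: is_equiv_cst.
have [|s cs] := fun_span qin Sq d'e (b := ev v').
  by rewrite -E1 -ds3 bt evs.
have [F1 F2 F3] := composite_ends cs.
exists s; split.
- by rewrite -F1 E3 -ds1 evt.
- by rewrite -F3 evt.
- by move=> k; apply: is_equiv_right Dq _ _ _ (ftr_composite k cs) (d'e k) (eve _ _).
Qed.

End Univ.

(** * Restriction of finite G-sets and of inert maps *)

Lemma nerve_inner_unique (B : category) n (k : 'I_n.+2) (t t' : nerve B n.+1) :
  0 < k < n.+1 -> (forall i, i != k -> sact (simp_face i) t = sact (simp_face i) t') ->
  t = t'.
Proof.
case: n k t t' => [|[|n]] k t t' kn tt.
- by exfalso; lia.
- by apply: nerve_tri_ext; rewrite /fc tt // -(inj_eq val_inj) /= inordK //; lia.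
apply: nerve_edge_ext => a b ab.
have [i [ik ia ib]] : exists i : 'I_n.+4, [/\ i != k, a != i & b != i].
  case: (boolP ((ord0 != k) && ((a != ord0) && (b != ord0)))) => [/and3P [? ? ?]|H0].
    by exists ord0.
  case: (boolP ((inord 1 != k) && ((a != inord 1) && (b != inord 1)))) => [/and3P [? ? ?]|H1].
    by exists (inord 1).
  case: (boolP ((inord 2 != k) && ((a != inord 2) && (b != inord 2)))) => [/and3P [? ? ?]|H2].
    by exists (inord 2).
  exists (inord 3); move: H0 H1 H2; rewrite -!(inj_eq val_inj) /= !inordK //; split; lia.
have [s es] := simp_factor (sedge_miss ia ib).
by rewrite /eg es !sact_comp tt.
Qed.

Lemma inner_over_nerve (X : sSet) (B : category) (p : smap X (nerve B)) :
  quasicat X -> inner_fibration p.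
Proof.
move=> /quasicat_fill Xq; apply/inner_fill => n k kn y t yc _ yt.
have [x xy] := Xq n k y kn yc; exists x; split=> //.
by apply: (nerve_inner_unique kn) => i ik; rewrite -sm_nat xy // yt.
Qed.

Lemma nmap_nedge (A B : category) (F : functor A B) a b (f : Hom a b) :
  nmap F 1 (nedge f : nerve A 1) = nedge (fm F f).
Proof. exact: nedge_eta. Qed.

Lemma nmap_nvert (A B : category) (F : functor A B) (a : A) :
  nmap F 0 (nvert a : nerve A 0) = nvert (F a).
Proof. exact: nvert_eta. Qed.

Lemma edge_nedge (A : category) (z : nerve A 1) (a b : A) :
  src z = nvert a -> tgt z = nvert b -> exists f : Hom a b, z = nedge f.
Proof.
move=> /(congr1 (fun w : nerve A 0 => fo w ord0)) ea /(congr1 (fun w : nerve A 0 => fo w ord0)) eb.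
exists (hcast (ea : fo z ord0 = a) (eb : fo z ord_max = b) (nhom z)).
exact: nedge_of_hom erefl.
Qed.

Lemma cocart1_of (A B : category) (F : functor A B) a a' (f : Hom a a') :
  cocartesian (nmap F) (nedge f : nerve A 1) -> cocart1 F f.
Proof.
move=> fc; split=> [a'' h b e|a'' k k' e Fe].
  have [||k [Fk ck]] := @cocart_factor _ _ (nmap F) (nedge f) (nedge h) (nedge b) fc.
  - by rewrite !src_nedge.
  - by rewrite !nmap_nedge -e; apply: nedge_composite.
  have [e1 e2 e3] := composite_ends ck.
  have [||k0 ek] := @edge_nedge _ k a' a''.
  - by rewrite -e1 tgt_nedge.
  - by rewrite -e3 tgt_nedge.
  subst k; exists k0; split.
    exact/nedge_inj/(nerve_composite (nedge_composite f k0) ck).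
  by apply: nedge_inj; rewrite -nmap_nedge.
apply: nedge_inj; apply: nerve_htpy.
apply: (cocart_unique fc (nedge_composite f k)).
  by rewrite e; apply: nedge_composite.
by rewrite !nmap_nedge Fe.
Qed.

Section Fin.
Variable G : finGroupType.
Implicit Types (V W : orbit G) (X Y Z : fobj G).

Section Restriction.
Variables (X : fobj G) (V : orbit G) (g : gmap V (fbase X)).

Definition pb_type := {z : X * V | ostr X z.1 == g z.2}.

Lemma pb_act_proof (z : pb_type) (a : G) :
  ostr X (gact X (val z).1 a) == g (gact V (val z).2 a).
Proof. by rewrite !gf_eq (eqP (valP z)). Qed.

Definition pb_act (z : pb_type) (a : G) : pb_type :=
  exist _ (gact X (val z).1 a, gact V (val z).2 a) (pb_act_proof z a).

Lemma pb_actP : is_action [set: G] pb_act.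
Proof.
apply: is_total_action => [z|z a b]; apply: val_inj => /=.
  by rewrite !act1 -surjective_pairing.
by rewrite !actM.
Qed.

Definition pb_gset : gset G := @GSet G pb_type (Action pb_actP).

Definition pb : over V := @Over G V pb_gset (@GMap G pb_gset V (fun z => (val z).2) (fun _ _ => erefl)).

(** The cocartesian lift of [g]: the span from [X] to the fibre product of [X] and [V], whose second
    leg is an identity. *)
Program Definition can : fhom X (FObj pb) :=
  @FHom G X (FObj pb) g (fun u v => insub (u, v)) _ _.
Next Obligation.
case: insubP => [w /= e ew|/= e]; case: insubP => [w' /= e' ew'|/= e'] //=.
- by congr Some; apply: val_inj; rewrite /= ew ew'.
- by case/negP: e'; move: e; rewrite !gf_eq => /eqP/act_inj ->.
- by case/negP: e; rewrite !gf_eq (eqP e').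
Qed.
Next Obligation.
by move: H; case: insubP => //= w' /eqP e ew [ew']; move: ew; rewrite ew' => -[_ ->].
Qed.

(** The guard makes the factorization lie over [b]: at [v] it is defined only on points of the
    pullback over [b v]. *)
Program Definition can_fac Z (b : gmap (fbase Z) V) (h : fhom X Z) : fhom (FObj pb) Z :=
  @FHom G (FObj pb) Z b
    (fun w v => if (val (w : pb_type)).2 == b v then fp h (val (w : pb_type)).1 v else None) _ _.
Next Obligation.
rewrite gf_eq (inj_eq (act_inj _ _)); case: ifP => // _; exact: fp_eq.
Qed.
Next Obligation.
by move: H; case: eqP => // e /fp_over [].
Qed.

Lemma can_facE Z (b : gmap (fbase Z) V) (h : fhom X Z) :
  gmap_comp g b = fb h -> fhom_comp (can_fac b h) can = h.
Proof.
move=> e; apply: fhom_ext => [v|u v] /=; first by rewrite -e.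
case: insubP => [w /= _ ew|/= ne]; first by rewrite ew eqxx.
case eh: (fp h u v) => [w|] //; have [e1 _] := fp_over eh.
by case/negP: ne; rewrite e1 -e.
Qed.

Lemma can_cocart1 : cocart1 (fin_base G) can.
Proof.
split=> [Z h b e|Z k k' e Fe].
  by exists (can_fac b h); split=> //; apply: can_facE.
apply: fhom_ext => [v|w v]; first by have := congr1 (fun f : gmap _ _ => f v) Fe.
have Fv : fb k v = fb k' v := congr1 (fun f : gmap _ _ => f v) Fe.
case: (eqVneq (val (w : pb_type)).2 (fb k v)) => [ew|ne].
  have := congr1 (fun f : fhom X Z => fp f (val (w : pb_type)).1 v) e => /=.
  rewrite -Fv -ew -surjective_pairing.
  by case: insubP => [w' _ /val_inj ->|] //=; rewrite (valP (w : pb_type)).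
case ek: (fp k w v) => [z|].
  by have [e1 _] := fp_over ek; rewrite -e1 eqxx in ne.
case ek': (fp k' w v) => [z|] //.
by have [e1 _] := fp_over ek'; rewrite Fv -e1 eqxx in ne.
Qed.

End Restriction.

Lemma can_cocart X V (g : gmap V (fbase X)) : cocartesian (fin_proj G) (fedge (can g)).
Proof. exact/nerve_cocartesian/can_cocart1. Qed.

Lemma can_proj X V (g : gmap V (fbase X)) : fin_proj G 1 (fedge (can g)) = oedge g.
Proof. exact: nmap_nedge. Qed.

Lemma src_fedge X Y (f : fhom X Y) : src (fedge f) = nvert (A := fin_cat G) X.
Proof. exact: src_nedge. Qed.

End Fin.

Lemma nmap_comp (A B C : category) (F : functor B C) (E : functor A B) :
  smap_comp (nmap F) (nmap E) = nmap (functor_comp F E).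
Proof. by apply: smap_eq => n x; apply: functor_eq. Qed.

(** * Restriction of inert arrows and G-categories over finite pointed G-sets *)

Section GCat.
Variable G : finGroupType.
Implicit Types (V W : orbit G) (X Y Z : fobj G).

Lemma gam_fb (x y : gamma G) (h : gam_hom x y) : fb (gbot h) = fb (gtop h).
Proof.
apply: gmap_ext => v; have := congr1 (fun f : fhom _ _ => fb f v) (gsq h).
by rewrite /= (proj1 (gam_inert x)) (proj1 (gam_inert y)).
Qed.

Lemma base_ev1 n (z : gam G n) : fin_proj G n (ev1 G n z) = fin_proj G n (ev0 G n z).
Proof. apply: (@functor_ext (op (orbit_cat G)) (ordcat n) (fin_proj G n (ev1 G n z))
  (fin_proj G n (ev0 G n z)) (fun i => erefl (gbase (fo z i)))) => i j l.
exact: gam_fb. Qed.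

(** Top and bottom are factored separately. The square between the factors commutes because it does
    so after the cocartesian top edge. *)
Lemma gam_cocart1 (x y : gamma G) (h : gam_hom x y) :
  cocart1 (fin_base G) (gtop h) -> cocart1 (fin_base G) (gbot h) ->
  cocart1 (functor_comp (fin_base G) (gam_ev0 G)) (h : Hom (x : gam_cat G) y).
Proof.
move=> [t1 t2] [b1 b2]; split=> [z f b e|z k k' e Fe].
  have [kt [ekt Fkt]] := t1 _ (gtop f) b e.
  have [|kb [ekb Fkb]] := b1 _ (gbot f) b.
    by rewrite /= !gam_fb.
  have sq : fhom_comp (garr z) kt = fhom_comp kb (garr y).
    apply: t2; last first.
      rewrite /= in Fkt Fkb *; apply: gmap_ext => v /=.
      by rewrite Fkt Fkb (proj1 (gam_inert z)) (proj1 (gam_inert y)).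
    rewrite /= in ekt ekb *; rewrite -!fhom_compA ekt (gsq h) fhom_compA ekb.
    exact: gsq.
  by exists (GamHom sq); split=> //; apply: gam_hom_ext.
apply: gam_hom_ext.
  by apply: t2 => //; apply: (congr1 (fun f : gam_hom _ _ => gtop f) e).
apply: b2; first exact: (congr1 (fun f : gam_hom _ _ => gbot f) e).
by rewrite /= !gam_fb.
Qed.

Lemma gam_cocart (z : gam G 1) : cocartesian (fin_proj G) (ev0 G 1 z) ->
  cocartesian (fin_proj G) (ev1 G 1 z) -> cocartesian (base_of (ev0 G)) z.
Proof.
rewrite [z]nedge_eta !nmap_nedge => /cocart1_of c0 /cocart1_of c1.
have -> : base_of (ev0 G) = nmap (functor_comp (fin_base G) (gam_ev0 G)) by exact: nmap_comp.
exact: nerve_cocartesian (gam_cocart1 c0 c1).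
Qed.

(** A cocartesian arrow is the canonical restriction followed by an isomorphism [k], and an
    invertible partial map has a bijective second leg. *)
Lemma cocart1_inert X Y (c : fhom X Y) (y : Y) : cocart1 (fin_base G) (c : Hom (X : fin_cat G) Y) ->
  exists! z : X * fbase Y, fp c z.1 z.2 = Some y.
Proof.
move=> [c1 c2]; have [d1 d2] := can_cocart1 (fb c).
have [|k [ek Fk]] := d1 Y c (gmap_id _); first exact: gmap_ext.
have [|k' [ek' Fk']] := c1 _ (can (fb c)) (gmap_id _); first exact: gmap_ext.
have kk' : fhom_comp k k' = fhom_id Y.
  apply: c2; first by rewrite /= -fhom_compA (ek' : fhom_comp k' c = _) fhom_idl.
  by rewrite /= (Fk : fb k = _) (Fk' : fb k' = _); apply: gmap_ext.
have k'k : fhom_comp k' k = fhom_id _.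
  apply: d2; first by rewrite /= -fhom_compA (ek : fhom_comp k _ = _) fhom_idl.
  by rewrite /= (Fk : fb k = _) (Fk' : fb k' = _); apply: gmap_ext.
have E t v : fp c t v = obind (fun w => fp k w v) (insub (t, v)).
  by have := congr1 (fun f : fhom X Y => fp f t v) ek; rewrite /= (Fk : fb k = _).
have := congr1 (fun f : fhom _ _ => fp f y (ostr Y y)) kk'; rewrite /= eqxx.
rewrite (Fk : fb k = _) /=; case ek1: (fp k' y _) => [w|] //= ekw.
have [_ ew] := fp_over ek1; rewrite /= in ew.
exists ((val (w : pb_type (fb c))).1, ostr Y y); split=> /=.
  by rewrite E -ew -surjective_pairing valK /= ew.
move=> [t v] /= ct; have [_ ev] := fp_over ct; rewrite -ev in ct *.
congr (_, _); move: ct; rewrite E; case: insubP => //= w' _ ew' kw'.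
have := congr1 (fun f : fhom (FObj (pb (fb c))) (FObj (pb (fb c))) => fp f (w' : FObj (pb (fb c))) (ostr Y y)) k'k.
rewrite /= (Fk' : fb k' = _) /= kw' /= ew' eqxx ek1 => -[->].
by rewrite ew'.
Qed.

Section GamRestrict.
Variables (x : gamma G) (Y : fobj G) (c : fhom (FObj (gtgt x)) Y).
Hypothesis cc : cocart1 (fin_base G) (c : Hom (FObj (gtgt x) : fin_cat G) Y).

(** The target is restricted to the prescribed [Y] and the source to the canonical pullback; the new
    arrow is the factorization of [c] after the old one through the latter. A strictly prescribed
    target is what [Gcat] asks of lifts along [ev1]. *)
Definition gam_res_arr : fhom (FObj (pb (X := FObj (gsrc x)) (fb c))) (FObj Y) :=
  can_fac (X := FObj (gsrc x)) (fb c) (gmap_id _) (fhom_comp c (garr x)).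

Lemma gam_res_inert : fibrewise_inert gam_res_arr.
Proof.
split=> // y; have [[t v] [/= cy yu]] := cocart1_inert y cc.
have [ev1 ev2] := fp_over cy.
have [[s b] [/= sy su]] := proj2 (gam_inert x) t.
have [eb1 eb2] := @fp_over _ _ _ (garr x) _ _ _ sy; rewrite /= in eb2.
have g1 := proj1 (gam_inert x).
have H : ostr (gsrc x) s == fb c v by rewrite (eb1) g1 -eb2 ev1.
exists ((exist _ (s, v) H : pb_type (X := FObj (gsrc x)) (fb c)), v); split=> /=.
  by rewrite eqxx -ev1 (_ : ostr _ t = b) ?sy.
move=> [[[s' v'] H'] v2] /=; case: eqP => // <-.
case es: (fp (garr x) s' (fb c v')) => [t'|] //= ct.
have [et ev] := yu (t', v') ct; subst t' v'.
have [e1 _] := su (s', _) es; subst s'.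
by congr (_, _); apply: val_inj.
Qed.

Definition gam_res : gamma G := Gamma gam_res_inert.

Lemma gam_res_sq : fhom_comp (garr gam_res) (can (X := FObj (gsrc x)) (fb c)) = fhom_comp c (garr x).
Proof.
by apply: can_facE; apply: gmap_ext => v /=; rewrite (proj1 (gam_inert x)).
Qed.

Definition gam_res_hom : gam_hom x gam_res := GamHom gam_res_sq.

End GamRestrict.

(* The lifts of cocartesian edges of Fin_*, rather than of edges of the orbit
   category only, make K -> Fin_* behave like an isofibration: restrictions of
   objects of K can be chosen over prescribed restrictions in Fin_*. *)
Definition Gcat (K : sSet) (r : smap K (fin G)) := quasicat K /\
  forall (k : K 0) (c : fin G 1), cocartesian (fin_proj G) c -> r 0 k = src c ->
  exists e, [/\ cocartesian (base_of r) e, src e = k & r 1 e = c].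

Lemma fin_quasicat : quasicat (fin G). Proof. exact: nerve_quasicat. Qed.

Lemma orbits_quasicat : quasicat (orbits_op G). Proof. exact: nerve_quasicat. Qed.

Lemma fin_lift (x : fin G 0) (f : orbits_op G 1) : fin_proj G 0 x = src f ->
  exists c, [/\ fin_proj G 1 c = f, src c = x & cocartesian (fin_proj G) c].
Proof.
rewrite [x]nvert_eta nmap_nvert => e.
have [|g eg] := @edge_nedge _ f (fbase (fo x ord0)) (fo (tgt f) ord0) _ (nvert_eta _).
  by rewrite -e.
exists (fedge (can (g : gmap _ _))); split; last exact: can_cocart.
  by rewrite can_proj; apply: esym eg.
exact: src_fedge.
Qed.

Section GcatTheory.
Variables (K : sSet) (r : smap K (fin G)).
Hypothesis Kr : Gcat r.

Lemma gcat_quasicat : quasicat K. Proof. by case: Kr. Qed.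

Lemma gcat_inner_fin : inner_fibration r. Proof. exact: inner_over_nerve gcat_quasicat. Qed.

Lemma gcat_inner : inner_fibration (base_of r). Proof. exact: inner_over_nerve gcat_quasicat. Qed.

Lemma gcat_fib : cocartesian_fibration (base_of r).
Proof.
split=> [|f x]; first exact: gcat_inner.
move=> /fin_lift [c [cf cx cc]]; have [e [ec ex er]] := (proj2 Kr) x c cc (esym cx).
by exists e; split; rewrite //= er.
Qed.

Lemma gcat_pres e : cocartesian (base_of r) e -> cocartesian (fin_proj G) (r 1 e).
Proof.
apply: (preserves_of_lifts gcat_inner (inner_over_nerve fin_quasicat)) => // f x.
move=> /fin_lift [c [cf cx cc]]; have [e' [ec ex er]] := (proj2 Kr) x c cc (esym cx).
by exists e'; split; rewrite //= er.
Qed.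

End GcatTheory.

Lemma gcat_id : Gcat (smap_id (fin G)).
Proof.
split=> [|k c cc ec]; first exact: fin_quasicat.
by exists c; split=> //; have -> : base_of (smap_id (fin G)) = fin_proj G by exact: smap_eq.
Qed.

Lemma gam_lift (k : gam G 0) (c : fin G 1) : cocartesian (fin_proj G) c -> ev1 G 0 k = src c ->
  exists z, [/\ cocartesian (fin_proj G) (ev0 G 1 z), src z = k & ev1 G 1 z = c].
Proof.
rewrite [k]nvert_eta nmap_nvert; set x := fo k ord0 => cc e.
have := nvert_eta (tgt c); move: (fo (tgt c) ord0) => y ty.
have [f ef] := @edge_nedge _ c _ _ (esym e) ty; subst c.
have fc := cocart1_of cc.
exists (nedge (gam_res_hom fc : Hom (x : gam_cat G) _)); rewrite src_nedge !nmap_nedge.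
by split=> //; apply: can_cocart.
Qed.

(** The pullback of [K] to Gamma, viewed over finite pointed G-sets through the target of the inert
    arrow. With this structure map, its own pullback to Gamma consists of composable pairs of inert
    arrows. *)
Definition pull_r (K : sSet) (r : smap K (fin G)) : smap (pullback r (ev0 G)) (fin G) :=
  smap_comp (ev1 G) (pr2 r (ev0 G)).

Section Pull.
Variables (K : sSet) (r : smap K (fin G)).
Hypothesis Kr : Gcat r.

Lemma pull_base : base_of (pull_r r) = gam_base r.
Proof. by apply: smap_eq => n [[a z] /= e]; apply: etrans (base_ev1 z) _; rewrite /base_of /= e. Qed.

Lemma pull_cocart (a : pullback r (ev0 G) 1) : cocartesian (base_of r) (sval a).1 ->
  cocartesian (fin_proj G) (pull_r r 1 a) -> cocartesian (gam_base r) a.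
Proof.
move=> ac zc; have rc := gcat_pres Kr ac.
apply: pullback_cocart => //; apply: gam_cocart => //.
by rewrite -(svalP a).
Qed.

Lemma gcat_pull : Gcat (pull_r r).
Proof.
split.
  apply: quasicat_total (gcat_quasicat Kr).
  exact/pullback_inner/inner_over_nerve/nerve_quasicat/(gcat_inner_fin Kr).
move=> k c cc ec; have [z [zc zk ezc]] := gam_lift cc ec.
have [||e [ee ek er]] := (proj2 Kr) (sval k).1 (ev0 G 1 z) => //.
  by rewrite -src_nat zk; apply: (svalP k).
have H : r 1 (e, z).1 = ev0 G 1 (e, z).2 by [].
exists (exist _ (e, z) H); split=> //.
  by rewrite pull_base; apply: pull_cocart => //; rewrite -[pull_r r 1 _]/(ev1 G 1 z) ezc.
by apply: sig_eq; transitivity (src e, src z) => //; rewrite ek zk; apply/esym/surjective_pairing.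
Qed.

Lemma pull_cocart_pr (a : pullback r (ev0 G) 1) : cocartesian (gam_base r) a ->
  cocartesian (base_of r) (sval a).1 /\ cocartesian (fin_proj G) (pull_r r 1 a).
Proof.
move=> ac; split; last by apply: (gcat_pres gcat_pull); rewrite pull_base.
have := ac; apply: (preserves_of_lifts (u := pr1 r (ev0 G))) => //.
- by rewrite -pull_base; apply: (gcat_inner gcat_pull).
- exact: gcat_inner.
move=> f x ex.
have [|c [cf cx cc]] := @fin_lift (pull_r r 0 x) f.
  by rewrite -ex -pull_base.
have [z [zc zk ezc]] := gam_lift cc (esym cx).
have [||e [ee ek er]] := (proj2 Kr) (sval x).1 (ev0 G 1 z) => //.
  by rewrite -src_nat zk; apply: (svalP x).
have H : r 1 (e, z).1 = ev0 G 1 (e, z).2 by [].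
exists (exist _ (e, z) H); split=> //.
- by rewrite -cf -ezc base_ev1 -er.
- by apply: sig_eq; transitivity (src e, src z) => //; rewrite ek zk; apply/esym/surjective_pairing.
- by apply: pull_cocart => //; rewrite -[pull_r r 1 _]/(ev1 G 1 z) ezc.
Qed.

End Pull.

End GCat.

(** * Composition of inert maps *)

(* A natural transformation as a map out of a cylinder: over a simplex of the
   cylinder, vertices over 0 go to F0 and vertices over 1 to F1. *)
Section NatTrans.
Variables (A B : category) (F0 F1 : functor A B) (al : forall a, Hom (F0 a) (F1 a)).
Hypothesis al_nat : forall a a' (f : Hom a a'), cmp (al a') (fm F0 f) = cmp (fm F1 f) (al a).

Definition nt_ob (b : bool) (a : A) : B := if b then F1 a else F0 a.

Definition nt_hom (b c : bool) : b <= c -> forall a a', Hom a a' -> Hom (nt_ob b a) (nt_ob c a') :=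
  match b, c return b <= c -> forall a a', Hom a a' -> Hom (nt_ob b a) (nt_ob c a') with
  | false, false => fun _ a a' f => fm F0 f
  | false, true => fun _ a a' f => cmp (al a') (fm F0 f)
  | true, true => fun _ a a' f => fm F1 f
  | true, false => fun l => match notF l with end
  end.

Lemma nt_hom_id (b : bool) (l : b <= b) a : nt_hom l (idc a) = idc (nt_ob b a).
Proof. by case: b l => l /=; rewrite fm_id. Qed.

Lemma nt_hom_cmp (b c d : bool) (l : b <= c) (l' : c <= d) (l'' : b <= d) x y z (g : Hom y z) (f : Hom x y) :
  nt_hom l'' (cmp g f) = cmp (nt_hom l' g) (nt_hom l f).
Proof.
case: b c d l l' l'' => -[] [] //= *; rewrite ?fm_cmp ?cmpA //.
by rewrite al_nat.
Qed.

Definition nt_bit n (s : simp n 1) (i : 'I_n.+1) : bool := 0 < s i.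

Lemma nt_bit_le n (s : simp n 1) (i j : 'I_n.+1) : i <= j -> nt_bit s i <= nt_bit s j.
Proof.
by move=> l; have := sf_mono s l; rewrite /nt_bit; case: (s i) (s j) => [[|i'] ?] [[|j'] ?].
Qed.

Program Definition nt_fun n (x : functor (ordcat n) A) (s : simp n 1) : functor (ordcat n) B :=
  @Functor (ordcat n) B (fun i => nt_ob (nt_bit s i) (x i))
    (fun i j l => nt_hom (nt_bit_le s l) (fm x l)) _ _.
Next Obligation. by rewrite [fm x _](fm_id x a) nt_hom_id. Qed.
Next Obligation.
rewrite -(nt_hom_cmp (nt_bit_le s f) (nt_bit_le s g) (nt_bit_le s (leq_trans f g))).
by rewrite -(fm_cmp x (g : @Hom (ordcat n) b c) (f : @Hom (ordcat n) a b)).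
Qed.

Lemma nt_hom_irr (b c : bool) (l l' : b <= c) a a' (f : Hom a a') : nt_hom l f = nt_hom l' f.
Proof. by rewrite (bool_irrelevance l l'). Qed.

Program Definition nt_map : smap (sprod (nerve A) (simplex 1)) (nerve B) :=
  @SMap (sprod (nerve A) (simplex 1)) (nerve B) (fun n z => nt_fun z.1 z.2) _.
Next Obligation.
apply: (@functor_ext _ _ (nt_fun (functor_comp f0 (simp_functor f)) (simp_comp s f))
  (functor_comp (nt_fun f0 s) (simp_functor f)) (fun=> erefl)) => i j l.
exact: nt_hom_irr.
Qed.

Lemma nt_map0 n (x : nerve A n) : nt_map n (x, simp_cst n ord0) = nmap F0 n x.
Proof.
apply: (@functor_ext _ _ (nt_fun x (simp_cst n ord0)) (functor_comp F0 x) (fun=> erefl)) => i j l.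
by rewrite hcast_id.
Qed.

Lemma nt_map1 n (x : nerve A n) : nt_map n (x, simp_cst n ord_max) = nmap F1 n x.
Proof.
apply: (@functor_ext _ _ (nt_fun x (simp_cst n ord_max)) (functor_comp F1 x) (fun=> erefl)) => i j l.
by rewrite hcast_id.
Qed.

Lemma nt_map_edge (a : A) : nt_map 1 (cst 1 (nvert a), simp_id 1) = nedge (al a).
Proof.
rewrite [LHS]nedge_eta; congr (nedge _).
by transitivity (cmp (al a) (fm F0 (idc a))) => //; rewrite fm_id cmp_idr.
Qed.

End NatTrans.

Section NatTransComp.
Variables (A B C : category) (F0 F1 : functor A B) (al : forall a, Hom (F0 a) (F1 a)).
Hypothesis al_nat : forall a a' (f : Hom a a'), cmp (al a') (fm F0 f) = cmp (fm F1 f) (al a).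
Variables (H : functor B C) (E : functor A C).

Lemma nt_map_cst n x s (e0 : forall a, H (F0 a) = E a) (e1 : forall a, H (F1 a) = E a) :
  (forall a a' (f : Hom a a'), hcast (e0 a) (e0 a') (fm H (fm F0 f)) = fm E f) ->
  (forall a a' (f : Hom a a'), hcast (e1 a) (e1 a') (fm H (fm F1 f)) = fm E f) ->
  (forall a, hcast (e0 a) (e1 a) (fm H (al a)) = idc (E a)) ->
  nmap H n (nt_map al_nat n (x, s)) = nmap E n x.
Proof.
move=> h0 h1 ha.
pose e (b : bool) (a : A) : H (nt_ob F0 F1 b a) = E a :=
  match b return H (nt_ob F0 F1 b a) = E a with true => e1 a | false => e0 a end.
have key (b c : bool) (l : b <= c) a a' (f : Hom a a') :
    hcast (e b a) (e c a') (fm H (nt_hom al l f)) = fm E f.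
  case: b c l => -[] //= _.
  by rewrite fm_cmp (hcast_cmp _ (e0 a')) ha h0 cmp_idl.
by apply: (@functor_ext _ _ (functor_comp H (nt_fun al_nat x s)) (functor_comp E x)
  (fun i => e (nt_bit s i) (fo x i))) => i j l; apply: key.
Qed.

Variables (F0' F1' : functor A B) (al' : forall a, Hom (F0' a) (F1' a)).
Hypothesis al_nat' : forall a a' (f : Hom a a'), cmp (al' a') (fm F0' f) = cmp (fm F1' f) (al' a).
Variable H' : functor B C.

Lemma nt_map_eq n x s (e0 : forall a, H (F0 a) = H' (F0' a)) (e1 : forall a, H (F1 a) = H' (F1' a)) :
  (forall a a' (f : Hom a a'), hcast (e0 a) (e0 a') (fm H (fm F0 f)) = fm H' (fm F0' f)) ->
  (forall a a' (f : Hom a a'), hcast (e1 a) (e1 a') (fm H (fm F1 f)) = fm H' (fm F1' f)) ->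
  (forall a, hcast (e0 a) (e1 a) (fm H (al a)) = fm H' (al' a)) ->
  nmap H n (nt_map al_nat n (x, s)) = nmap H' n (nt_map al_nat' n (x, s)).
Proof.
move=> h0 h1 ha.
pose e (b : bool) (a : A) : H (nt_ob F0 F1 b a) = H' (nt_ob F0' F1' b a) :=
  match b return H (nt_ob F0 F1 b a) = H' (nt_ob F0' F1' b a) with true => e1 a | false => e0 a end.
have key (b c : bool) (l : b <= c) a a' (f : Hom a a') :
    hcast (e b a) (e c a') (fm H (nt_hom al l f)) = fm H' (nt_hom al' l f).
  case: b c l => -[] //= _.
  by rewrite !fm_cmp (hcast_cmp _ (e0 a')) ha h0.
by apply: (@functor_ext _ _ (functor_comp H (nt_fun al_nat x s))
  (functor_comp H' (nt_fun al_nat' x s)) (fun i => e (nt_bit s i) (fo x i))) => i j l; apply: key.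
Qed.

End NatTransComp.

Section Gam.
Variable G : finGroupType.

Lemma diag_ev0 n (x : fin G n) : ev0 G n (diag G n x) = x.
Proof. by case: x => *; apply: functor_eq. Qed.

(** The unit of [ev1 -| diag]: the arrow itself, as a square onto the identity of its target.
    Dually, [nu_hom] below is the counit of [diag -| ev0], a square from the identity of the
    source. *)
Program Definition eta_hom (a : gamma G) : gam_hom a (gam_diag G (gam_ev1 G a)) :=
  @GamHom G a (gam_diag G (gam_ev1 G a)) (garr a) (fhom_id _) _.

Lemma eta_nat (a a' : gam_cat G) (f : Hom a a') :
  @cmp (gam_cat G) _ _ _ (eta_hom a') f = cmp (fm (gam_diag G) (fm (gam_ev1 G) f)) (eta_hom a).
Proof.
apply: gam_hom_ext; first exact: (gsq f).
by rewrite /= fhom_idl fhom_idr.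
Qed.

Program Definition nu_hom (a : gamma G) : gam_hom (gam_diag G (gam_ev0 G a)) a :=
  @GamHom G (gam_diag G (gam_ev0 G a)) a (fhom_id _) (garr a) _.

Lemma nu_nat (a a' : gam_cat G) (f : Hom a a') :
  @cmp (gam_cat G) _ _ _ (nu_hom a') (fm (gam_diag G) (fm (gam_ev0 G) f)) = cmp f (nu_hom a).
Proof.
apply: gam_hom_ext; last exact: (gsq f).
by rewrite /= fhom_idl fhom_idr.
Qed.

Definition idf (A : category) : functor A A :=
  @Functor A A (fun a => a) (fun _ _ f => f) (fun _ => erefl) (fun _ _ _ _ _ => erefl).

Lemma nmap_idf (A : category) n (x : nerve A n) : nmap (idf A) n x = x.
Proof. by case: x => *; apply: functor_eq. Qed.

Definition eta : smap (sprod (gam G) (simplex 1)) (gam G) :=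
  nt_map (F0 := idf _) (F1 := functor_comp (gam_diag G) (gam_ev1 G)) eta_nat.

Definition nu : smap (sprod (gam G) (simplex 1)) (gam G) :=
  nt_map (F0 := functor_comp (gam_diag G) (gam_ev0 G)) (F1 := idf _) nu_nat.

Lemma eta0 n x : eta n (x, simp_cst n ord0) = x.
Proof. by rewrite [LHS]nt_map0; apply: nmap_idf. Qed.

Lemma eta1 n x : eta n (x, simp_cst n ord_max) = diag G n (ev1 G n x).
Proof. by rewrite [LHS]nt_map1 -nmap_comp. Qed.

Lemma nu0 n x : nu n (x, simp_cst n ord0) = diag G n (ev0 G n x).
Proof. by rewrite [LHS]nt_map0 -nmap_comp. Qed.

Lemma nu1 n x : nu n (x, simp_cst n ord_max) = x.
Proof. by rewrite [LHS]nt_map1; apply: nmap_idf. Qed.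

Lemma eta_ev1 n x s : ev1 G n (eta n (x, s)) = ev1 G n x.
Proof. by apply: nt_map_cst; move=> *; rewrite hcast_id. Qed.

Lemma nu_ev0 n x s : ev0 G n (nu n (x, s)) = ev0 G n x.
Proof. by apply: nt_map_cst; move=> *; rewrite hcast_id. Qed.

(** Both sides are the inert arrow itself, seen as a path. So the paths [nu] and [eta] are
    composable at every time, which is what makes [what] below well defined. *)
Lemma nu_ev1 n x s : ev1 G n (nu n (x, s)) = ev0 G n (eta n (x, s)).
Proof.
apply: (@nt_map_eq _ _ _ (functor_comp (gam_diag G) (gam_ev0 G)) (idf _) _ (@nu_nat) (gam_ev1 G)
  (idf _) (functor_comp (gam_diag G) (gam_ev1 G)) _ (@eta_nat) (gam_ev0 G) n x s (fun=> erefl) (fun=> erefl)) => *;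
  by rewrite hcast_id.
Qed.

End Gam.

Lemma hcast_inj (A : category) (a a' b b' : A) (ea : a = a') (eb : b = b') (f g : Hom a b) :
  hcast ea eb f = hcast ea eb g -> f = g.
Proof. by case: _ / ea; case: _ / eb. Qed.

Lemma hcast_symK (A : category) (a a' b b' : A) (ea : a = a') (eb : b = b') (f : Hom a' b') :
  hcast ea eb (hcast (esym ea) (esym eb) f) = f.
Proof. by case: _ / ea f; case: _ / eb. Qed.

(** * Strict composition of simplices of inert arrows *)

Section Rho.
Variable G : finGroupType.

Notation hc := (@hcast (fin_cat G) _ _ _ _).

Lemma inert_comp (X Y Z : fobj G) (f : fhom X Y) (g : fhom Y Z) :
  inert f -> inert g -> inert (fhom_comp g f).
Proof.
move=> fi gi z; have [[y v] [/= gy gu]] := gi z; have [[x v'] [/= fx fu]] := fi y.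
have [e1 e2] := fp_over gy; have [e3 e4] := fp_over fx.
exists (x, v); split=> /=; first by rewrite -e1 e4 fx /= gy.
move=> [x2 v2] /=; case e: (fp f x2 _) => [y2|] //= gy2.
have [ey ev] := gu (y2, v2) gy2; subst y2 v2.
by have [ex _] := fu (x2, _) e; subst x2.
Qed.

(** Simplices with [ev1 x = ev0 y] have objects that agree only propositionally. The middle object
    is generalized to [Z] so that [E] can be eliminated, and the ends of the composite are in turn
    known up to equality. *)
Lemma gcomp_aux (x : gamma G) (Z : fobj G) (W : over (fbase Z)) (a : fhom Z (FObj W)) :
  fb a = gmap_id (fbase Z) -> inert a -> forall E : FObj (gtgt x) = Z,
  exists (z : gamma G) (Es : FObj (gsrc z) = FObj (gsrc x)) (Et : FObj (gtgt z) = FObj W),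
    hc Es Et (garr z) = fhom_comp a (hc erefl E (garr x)).
Proof.
move=> a1 a2 E; case: _ / E W a a1 a2 => W a a1 a2.
have zi : fibrewise_inert (fhom_comp a (garr x) : fhom (FObj (gsrc x)) (FObj W)).
  split; last exact: inert_comp (proj2 (gam_inert x)) a2.
  by apply: gmap_ext => v /=; rewrite a1 (proj1 (gam_inert x)).
by exists (Gamma zi), erefl, erefl.
Qed.

Lemma gcomp_ex (x y : gamma G) (E : FObj (gtgt x) = FObj (gsrc y)) :
  exists (z : gamma G) (Es : FObj (gsrc z) = FObj (gsrc x)) (Et : FObj (gtgt z) = FObj (gtgt y)),
    hc Es Et (garr z) = fhom_comp (garr y) (hc erefl E (garr x)).
Proof. exact: (@gcomp_aux x (FObj (gsrc y)) (gtgt y) (garr y) (proj1 (gam_inert y)) (proj2 (gam_inert y)) E). Qed.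

Definition gcomp (x y : gamma G) (E : FObj (gtgt x) = FObj (gsrc y)) : gamma G :=
  sval (cid (gcomp_ex E)).

Lemma gcomp_s (x y : gamma G) (E : FObj (gtgt x) = FObj (gsrc y)) :
  FObj (gsrc (gcomp E)) = FObj (gsrc x).
Proof. by have [Es _] := svalP (cid (gcomp_ex E)). Qed.

Lemma gcomp_t (x y : gamma G) (E : FObj (gtgt x) = FObj (gsrc y)) :
  FObj (gtgt (gcomp E)) = FObj (gtgt y).
Proof. by have [_ [Et _]] := svalP (cid (gcomp_ex E)). Qed.

Lemma gcomp_arr (x y : gamma G) (E : FObj (gtgt x) = FObj (gsrc y)) Es Et :
  hc Es Et (garr (gcomp E)) = fhom_comp (garr y) (hc erefl E (garr x)).
Proof.
have [Es' [Et' H]] := svalP (cid (gcomp_ex E)); rewrite -H.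
exact: (@hcast_irr (fin_cat G)).
Qed.

Lemma fobj_inj (V : orbit G) (U : over V) (Z : fobj G) (E : FObj U = Z) (eV : V = fbase Z) :
  eq_rect V (@over G) U (fbase Z) eV = ftot Z.
Proof. by case: _ / E eV => eV /=; rewrite (Prop_irrelevance eV erefl). Qed.

Lemma gamma_ext (x y : gamma G) (Es : FObj (gsrc x) = FObj (gsrc y))
    (Et : FObj (gtgt x) = FObj (gtgt y)) : hc Es Et (garr x) = garr y -> x = y.
Proof.
case: x y Es Et => V U W a ai [V' U' W' a' ai'] Es Et; rewrite /= in Es Et *.
have eV : V = V' := congr1 (@fbase G) Es.
have := fobj_inj Es eV; have := fobj_inj Et eV; rewrite /=.
case: _ / eV U' W' a' ai' Es Et => U' W' a' ai' Es Et /= eW eU; subst U' W'.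
rewrite hcast_id => ea; subst a'.
by rewrite (Prop_irrelevance ai ai').
Qed.

Lemma gcomp_eq (x y z : gamma G) (E : FObj (gtgt x) = FObj (gsrc y)) (Es : FObj (gsrc x) = FObj (gsrc z))
    (Et : FObj (gtgt y) = FObj (gtgt z)) :
  hc Es Et (fhom_comp (garr y) (hc erefl E (garr x))) = garr z -> gcomp E = z.
Proof.
rewrite -(@gcomp_arr x y E (gcomp_s E) (gcomp_t E)) [hcast _ _ _]hcast_comp => H.
exact: gamma_ext H.
Qed.

Section Hom.
Variables (x x' y y' : gamma G) (E : FObj (gtgt x) = FObj (gsrc y)) (E' : FObj (gtgt x') = FObj (gsrc y')).
Variables (f : gam_hom x x') (h : gam_hom y y').
Hypothesis fh : hc E E' (gbot f) = gtop h.

Lemma gcomp_sq :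
  fhom_comp (garr (gcomp E')) (hc (esym (gcomp_s E)) (esym (gcomp_s E')) (gtop f)) =
  fhom_comp (hc (esym (gcomp_t E)) (esym (gcomp_t E')) (gbot h)) (garr (gcomp E)).
Proof.
apply: (@hcast_inj (fin_cat G) _ _ _ _ (gcomp_s E) (gcomp_t E')).
rewrite [LHS](@hcast_cmp (fin_cat G) _ _ _ _ _ _ (gcomp_s E) (gcomp_s E') (gcomp_t E')).
rewrite [RHS](@hcast_cmp (fin_cat G) _ _ _ _ _ _ (gcomp_s E) (gcomp_t E) (gcomp_t E')).
rewrite !hcast_symK !gcomp_arr /= -fhom_compA.
have -> : fhom_comp (hc erefl E' (garr x')) (gtop f) = hc erefl E' (fhom_comp (garr x') (gtop f)).
  by rewrite [RHS](@hcast_cmp (fin_cat G) _ _ _ _ _ _ erefl erefl E').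
rewrite (gsq f) [hc erefl E' _](@hcast_cmp (fin_cat G) _ _ _ _ _ _ erefl E E') fh /=.
by rewrite fhom_compA (gsq h) -fhom_compA.
Qed.

Definition gcomp_hom : gam_hom (gcomp E) (gcomp E') := GamHom gcomp_sq.

End Hom.

Section Fun.
Variables (n : nat) (x y : gam G n) (P : ev1 G n x = ev0 G n y).

Definition rhoE (i : 'I_n.+1) : FObj (gtgt (fo x i)) = FObj (gsrc (fo y i)) :=
  congr1 (fun F : functor (ordcat n) (fin_cat G) => fo F i) P.

Program Definition rho_fun : gam G n :=
  @Functor (ordcat n) (gam_cat G) (fun i => gcomp (rhoE i))
    (fun i j l => gcomp_hom (functor_hcast P l (rhoE i) (rhoE j))) _ _.
Next Obligation.
apply: gam_hom_ext; rewrite /= [fm _ _](fm_id _ (a : ordcat n)) /=.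
  exact: (@hcast_idc (fin_cat G)).
exact: (@hcast_idc (fin_cat G)).
Qed.
Next Obligation.
have H (z : gam G n) : fm z (leq_trans f g : @Hom (ordcat n) a c) = cmp (fm z g) (fm z f) :=
  fm_cmp z (g : @Hom (ordcat n) b c) (f : @Hom (ordcat n) a b).
apply: gam_hom_ext; rewrite /= H /=.
  exact: (@hcast_cmp (fin_cat G)).
exact: (@hcast_cmp (fin_cat G)).
Qed.

Lemma rho_ev0_fun : ev0 G n rho_fun = ev0 G n x.
Proof.
apply: (@functor_ext _ _ (ev0 G n rho_fun) (ev0 G n x) (fun i => gcomp_s (rhoE i))) => i j l.
exact: hcast_symK.
Qed.

Lemma rho_ev1_fun : ev1 G n rho_fun = ev1 G n y.
Proof.
apply: (@functor_ext _ _ (ev1 G n rho_fun) (ev1 G n y) (fun i => gcomp_t (rhoE i))) => i j l.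
exact: hcast_symK.
Qed.

End Fun.

(** The maps [ev0] and [ev1] do not see the inert arrows themselves, so agreement of the objects is
    asked separately. *)
Lemma gam_ext n (x y : gam G n) : (forall i, fo x i = fo y i) -> ev0 G n x = ev0 G n y ->
  ev1 G n x = ev1 G n y -> x = y.
Proof.
move=> eo e0 e1; apply: (functor_ext (eo := eo)) => i j l; apply: gam_hom_ext.
  rewrite -[LHS]/(fm (gam_ev0 G) (hcast (eo i) (eo j) (fm x l))).
  rewrite (fm_hcast _ _ _ (congr1 (gam_ev0 G) (eo i)) (congr1 (gam_ev0 G) (eo j))).
  exact: (functor_hcast e0).
rewrite -[LHS]/(fm (gam_ev1 G) (hcast (eo i) (eo j) (fm x l))).
rewrite (fm_hcast _ _ _ (congr1 (gam_ev1 G) (eo i)) (congr1 (gam_ev1 G) (eo j))).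
exact: (functor_hcast e1).
Qed.

Lemma gcomp_irr (x y : gamma G) (E E' : FObj (gtgt x) = FObj (gsrc y)) : gcomp E = gcomp E'.
Proof. by rewrite (Prop_irrelevance E E'). Qed.

Program Definition rho : smap (pullback (ev1 G) (ev0 G)) (gam G) :=
  @SMap (pullback (ev1 G) (ev0 G)) (gam G)
    (fun n z => @rho_fun n (sval z).1 (sval z).2 (svalP z)) _.
Next Obligation.
apply: gam_ext => [i||].
- exact: gcomp_irr.
- transitivity (sact f (ev0 G n f0)); first exact: etrans (rho_ev0_fun _) (sm_nat (ev0 G) f f0).
  apply/esym; apply: etrans (sm_nat (ev0 G) f _) _; congr (sact f _); exact: rho_ev0_fun.
- transitivity (sact f (ev1 G n f1)); first exact: etrans (rho_ev1_fun _) (sm_nat (ev1 G) f f1).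
  apply/esym; apply: etrans (sm_nat (ev1 G) f _) _; congr (sact f _); exact: rho_ev1_fun.
Qed.

Lemma rho_ev0 n z : ev0 G n (rho n z) = ev0 G n (sval z).1.
Proof. exact: rho_ev0_fun. Qed.

Lemma rho_ev1 n z : ev1 G n (rho n z) = ev1 G n (sval z).2.
Proof. exact: rho_ev1_fun. Qed.

Lemma rho_diagl n (x : gam G n) z : sval z = (diag G n (ev0 G n x), x) -> rho n z = x.
Proof.
move=> ez; apply: gam_ext => [i||].
- case: z ez => -[a b] P [ea eb]; transitivity (gcomp (rhoE P i)); first exact: gcomp_irr.
  move: (rhoE P i); clear P; subst a b; rewrite /= => E.
  apply: (@gcomp_eq (gam_diag G (gam_ev0 G (fo x i))) (fo x i) (fo x i) E erefl erefl).
  by rewrite !hcast_id /= fhom_idr.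
- by rewrite rho_ev0 ez; apply: diag_ev0.
- by rewrite rho_ev1 ez.
Qed.

Lemma diag_ev1 n (x : fin G n) : ev1 G n (diag G n x) = x.
Proof. by case: x => *; apply: functor_eq. Qed.

Lemma rho_diagr n (x : gam G n) z : sval z = (x, diag G n (ev1 G n x)) -> rho n z = x.
Proof.
move=> ez; apply: gam_ext => [i||].
- case: z ez => -[a b] P [ea eb]; transitivity (gcomp (rhoE P i)); first exact: gcomp_irr.
  move: (rhoE P i); clear P; subst a b; rewrite /= => E.
  apply: (@gcomp_eq (fo x i) (gam_diag G (gam_ev1 G (fo x i))) (fo x i) E erefl erefl).
  by rewrite !hcast_id /= fhom_idl.
- by rewrite rho_ev0 ez.
- by rewrite rho_ev1 ez; apply: diag_ev1.
Qed.

Lemma hcast_idc_eq (A : category) (a b c : A) (e0 : a = c) (e1 : c = b) (u : Hom a b) :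
  hcast e0 (esym e1) u = idc c -> u = hcast erefl (etrans e0 e1) (idc a).
Proof. by case: _ / e1 u; case: _ / e0. Qed.

Lemma hcast_square (A : category) (X X' Y Y' : A) (E : X = X') (E' : Y = Y') (u : Hom X Y) (u' : Hom X' Y') :
  cmp u' (hcast erefl E (idc X)) = cmp (hcast erefl E' (idc Y)) u -> hcast E E' u = u'.
Proof. by case: _ / E u'; case: _ / E' => u' /=; rewrite cmp_idl cmp_idr. Qed.

Lemma nhom_cst (A : category) (z : nerve A 1) x : z = cst 1 x -> exists E : fo z ord0 = fo z ord_max,
  nhom z = hcast erefl E (idc (fo z ord0)).
Proof.
move=> H; have e0 : fo z ord0 = fo (cst 1 x) ord0 by rewrite {1}H.
have e1 : fo (cst 1 x) ord_max = fo z ord_max by rewrite {1}H.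
exists (etrans e0 e1); apply: hcast_idc_eq.
rewrite /nhom (functor_hcast H (le01 : @Hom (ordcat 1) ord0 ord_max) e0 (esym e1)).
by rewrite -(fm_id x ord0) /=; congr (fm x _); apply: bool_irrelevance.
Qed.

(** With constant top and bottom, the commutative square says that the final inert arrow is the
    transport of the initial one, so the two objects are equal and the edge is degenerate. *)
Lemma gam_cst (z : gam G 1) x y : ev0 G 1 z = cst 1 x -> ev1 G 1 z = cst 1 y -> z = cst 1 (src z).
Proof.
move=> H0 H1; have [E0 h0] := nhom_cst H0; have [E1 h1] := nhom_cst H1.
have eb : fo z ord0 = fo z ord_max.
  apply: (@gamma_ext (fo z ord0) (fo z ord_max) E0 E1); apply: hcast_square.
  have h0' : gtop (nhom z) = hc erefl E0 (fhom_id _) := h0.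
  have h1' : gbot (nhom z) = hc erefl E1 (fhom_id _) := h1.
  by rewrite -[X in _ = cmp X _]h1' -[X in cmp _ X = _]h0'; apply: (gsq (nhom z)).
apply: gam_ext => [i||].
- by case: (ord2P i) => ->.
- by rewrite cst_nat src_nat H0 src_cst.
- by rewrite cst_nat src_nat H1 src_cst.
Qed.

End Rho.

(** * Invariance of indexed products *)

Program Definition simplex_nerve n : smap (simplex n) (nerve (ordcat n)) :=
  @SMap (simplex n) (nerve (ordcat n)) (fun m f => simp_functor f) _.
Next Obligation. exact: functor_eq. Qed.

Program Definition nerve_simplex n : smap (nerve (ordcat n)) (simplex n) :=
  @SMap (nerve (ordcat n)) (simplex n)
    (fun m x => @Simp m n (fo x) (fun i j l => fm x (l : @Hom (ordcat m) i j))) _.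

Lemma simplex_quasicat n : quasicat (simplex n).
Proof.
have /quasicat_fill H := @nerve_quasicat (ordcat n).
apply/quasicat_fill => m k y km yc.
have [|x xy] := H m k (fun i => simplex_nerve n m (y i)) km.
  by move=> i j ik jk l f g E; rewrite -!sm_nat (yc i j ik jk l f g E).
exists (nerve_simplex n _ x) => i ik; rewrite -sm_nat xy //.
exact: simp_eq.
Qed.

Section PullComposite.
Variables (X Y : sSet) (A : category) (p : smap X (nerve A)) (z : smap Y (nerve A)).

Lemma pull_composite (a b c : pullback p z 1) :
  composite (sval a).1 (sval b).1 (sval c).1 ->
  composite (sval a).2 (sval b).2 (sval c).2 -> composite a b c.
Proof.
move=> /compositeE [s [s2 s0 s1]] /compositeE [t [t2 t0 t1]].
have H : p 2 (s, t).1 = z 2 (s, t).2.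
  by apply: nerve_tri_ext; rewrite /fc -!sm_nat -!/(fc _ _) /= ?s2 ?t2 ?s0 ?t0;
    [apply: (svalP a)|apply: (svalP b)].
apply/compositeE; exists (exist _ (s, t) H); split; apply: sig_eq.
- by transitivity (fc 2 s, fc 2 t) => //; rewrite s2 t2 -surjective_pairing.
- by transitivity (fc 0 s, fc 0 t) => //; rewrite s0 t0 -surjective_pairing.
- by transitivity (fc 1 s, fc 1 t) => //; rewrite s1 t1 -surjective_pairing.
Qed.

(** The two inverses lie over the same edge because both images are inverse to one edge of a nerve,
    where inverses are unique. *)
Lemma pull_is_equiv (a : pullback p z 1) :
  is_equiv (sval a).1 -> is_equiv (sval a).2 -> is_equiv a.
Proof.
case=> [x [x1 x2]] [y [y1 y2]].
have pa : p 1 (sval a).1 = z 1 (sval a).2 := svalP a.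
have H : p 1 (x, y).1 = z 1 (x, y).2.
  have e2 := composite_nat p x2; have f1 := composite_nat z y1.
  rewrite /= pa !cst_nat in e2 f1 *.
  have Aq := @nerve_quasicat A.
  exact: (nerve_htpy (idr_htpy (composite_inv Aq f1 e2))).
have pairE (u v : pullback p z 1) : (sval u).1 = (sval v).1 -> (sval u).2 = (sval v).2 -> u = v.
  by move=> e1 e2; apply: sig_eq; rewrite [LHS]surjective_pairing e1 e2 -surjective_pairing.
exists (exist _ (x, y) H); split; apply: pull_composite => //=.
Qed.

End PullComposite.

Section Fibre.
Variables (C : sSet) (A : category) (p : smap C (nerve A)).
Hypothesis pin : inner_fibration p.

Let Cq : quasicat C := quasicat_total pin (@nerve_quasicat A).

Lemma nerve_cst_tri (t : nerve A 2) s : fc 2 t = cst 1 s -> fc 0 t = cst 1 s -> t = cst 2 s.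
Proof. by move=> t2 t0; apply: nerve_tri_ext; rewrite ?t2 ?t0 /fc cst_act. Qed.

Lemma fibre_composite s (f g h : fibre p s 1) :
  composite (sval f) (sval g) (sval h) -> composite f g h.
Proof.
move=> /compositeE [t [t2 t0 t1]].
have H : p 2 t = cst 2 s.
  apply: nerve_cst_tri; rewrite /fc -sm_nat -/(fc _ _) ?t2 ?t0; [exact: (svalP f)|exact: (svalP g)].
by apply/compositeE; exists (exist _ t H); split; apply: sig_eq.
Qed.

Lemma inverse_over_cst (a a' : C 1) s y : p 1 a = cst 1 s -> composite a a' (cst 1 y) ->
  p 1 a' = cst 1 s.
Proof.
move=> pa c; have [e1 e2 e3] := composite_cst c; have := composite_nat p c.
have ey : p 0 y = s by rewrite -e2 src_nat pa src_cst.
by rewrite pa cst_nat ey => /(idl_htpy (@nerve_quasicat A)) /nerve_htpy.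
Qed.

Lemma fibre_is_equiv s (e : fibre p s 1) : is_equiv (sval e) -> is_equiv e.
Proof.
case=> e' [c1 c2]; have H := inverse_over_cst (svalP e) c1.
by exists (exist _ e' H); split; apply: fibre_composite.
Qed.

Section Transport.
Hypothesis cin : forall phi : nerve A 1, inner_fibration (pr2 p (yoneda phi)).

(** Postcomposition with an equivalence of the fibre: in the pullback along [p c] it becomes the
    edge [wb] over the constant edge at the end vertex. *)
Lemma counit_equiv (c b c' : C 1) : composite c b c' -> is_equiv b ->
  p 1 b = cst 1 (p 0 (src b)) -> counit_edge p c -> counit_edge p c' /\ p 1 c' = p 1 c.
Proof.
move=> cc be pb [w [ew wc]]; have [e1 e2 e3] := composite_ends cc.
have pc' : p 1 c' = p 1 c.
  apply: nerve_htpy; apply/(htpy_sym (@nerve_quasicat A)).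
  by have := composite_nat p cc; rewrite pb -e1 tgt_nat.
split=> //; rewrite /counit_edge pc'.
have Hb : p 1 (b, simp_cst 1 (@ord_max 1) : simplex 1 1).1 = yoneda (p 1 c) 1 (b, simp_cst 1 (@ord_max 1) : simplex 1 1).2.
  have es : simp_comp (simp_cst 0 (@ord_max 1)) (simp_cst 1 ord0) = simp_cst 1 ord_max by exact: simp_eq.
  by apply: etrans pb _; rewrite -e1 tgt_nat /cst /tgt /vertex -sact_comp es.
have Hc : p 1 (c', simp_id 1 : simplex 1 1).1 = yoneda (p 1 c) 1 (c', simp_id 1 : simplex 1 1).2.
  by apply: etrans pc' _; apply/esym/(sact_id (p 1 c)).
pose wb : pullback p (yoneda (p 1 c)) 1 := exist _ (b, _) Hb.
pose wc' : pullback p (yoneda (p 1 c)) 1 := exist _ (c', _) Hc.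
exists wc'; split=> //.
have be2 : is_equiv (simp_cst 1 (@ord_max 1) : simplex 1 1).
  have -> : (simp_cst 1 ord_max : simplex 1 1) = cst 1 (simp_cst 0 ord_max : simplex 1 0) by exact: simp_eq.
  exact: is_equiv_cst.
apply: (@cartesian_comp_equiv _ _ _ w wb wc') => //.
- exact: simplex_quasicat.
- apply: pull_composite; rewrite ew //=.
  have [a [a2 a0 a1 _]] := stri_ex (isT : @ord0 1 <= @ord_max 1) (leqnn (@ord_max 1)).
  exists a; rewrite /= a2 a0 a1 sedge_diag; split=> //; by rewrite [RHS]sedgeP.
- exact: pull_is_equiv.
Qed.

(** The product [P] and its projections are kept: the counits absorb the equivalences [b j], and the
    comparison [h] absorbs the inverse of [a]. *)
Lemma indexed_product_equiv n (X X' : C 0) (m m' : 'I_n -> C 1) (a : C 1) (b : 'I_n -> C 1) :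
  is_equiv a -> src a = X -> tgt a = X' -> p 1 a = cst 1 (p 0 X) ->
  (forall j, [/\ is_equiv (b j), p 1 (b j) = cst 1 (p 0 (src (b j))) & square (m j) a (b j) (m' j)]) ->
  indexed_product p X m -> indexed_product p X' m'.
Proof.
case=> a' [aa' a'a] sa ta pa bH [P [pi [c [g [h [Pc hX hP he H]]]]]].
have EX : p 0 X' = p 0 X by rewrite -ta tgt_nat pa tgt_cst.
have pa' := inverse_over_cst pa aa'.
have [E1 E2 E3] := composite_cst aa'.
rewrite /indexed_product EX; exists P, pi.
have [|h0 ch0] := composite_ex Cq (f := a') (g := sval h).
  exact: etrans E3 (etrans sa (esym hX)).
have ph0 : p 1 h0 = cst 1 (p 0 X).
  exact: nerve_cst_comp (composite_nat p ch0) pa' (svalP h).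
have cj j : exists c', composite (c j) (b j) c'.
  apply: (composite_ex Cq); have [_ _ _ cg _] := H j; have [_ _ [d [cd _]]] := bH j.
  by have [_ _ <-] := composite_ends cg; have [-> _ _] := composite_ends cd.
have [c' cc'] := choice cj.
have gj j : exists g' : fibre p (p 0 X) 1, composite a' (sval (g j)) (sval g').
  have [_ _ _ cg cp] := H j; have [_ es _] := composite_ends cp.
  have [|g0 cg0] := composite_ex Cq (f := a') (g := sval (g j)).
    exact: etrans E3 (etrans sa (etrans (esym hX) (esym (congr1 sval es)))).
  have pg0 : p 1 g0 = cst 1 (p 0 X) := nerve_cst_comp (composite_nat p cg0) pa' (svalP (g j)).
  by exists (exist _ g0 pg0).
have [g' cg'] := choice gj.
exists c', g', (exist _ h0 ph0); split=> //.
- transitivity (src h0) => //.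
  by have [_ -> _] := composite_ends ch0; rewrite -E1 ta.
- apply: sig_eq; transitivity (tgt h0) => //; rewrite -hP.
  by have [_ _ ->] := composite_ends ch0.
- apply: fibre_is_equiv; apply: (is_equiv_comp Cq ch0).
    by exists a; rewrite -E1 E3; split=> //; move: a'a aa'; rewrite ?ta ?E2.
  exact: (is_equiv_nat (sincl (@fibre_stable C _ p (p 0 X)))).
move=> j; have [ce pc tp cg cp] := H j; have [be pb [d [cd cd']]] := bH j.
have [ce' pce] := counit_equiv (cc' j) be pb ce.
have [k1 k2 k3] := composite_ends (cc' j).
split=> //.
- rewrite pce pc; apply/esym/nerve_htpy.
  have := composite_nat p cd'; rewrite pa => /(idl_htpy (@nerve_quasicat A)) h1.
  apply: (htpy_trans (@nerve_quasicat A) h1); apply: (htpy_sym (@nerve_quasicat A)).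
  have := composite_nat p cd; rewrite pb.
  by have [<- _ _] := composite_ends cd; rewrite tgt_nat.
- by rewrite tp k2.
- have c1 := assocL Cq cg (cc' j) cd.
  exact: (assocR Cq (cg' j) c1 (composite_inv Cq cd' a'a)).
- apply: fibre_composite.
  exact: (assocR Cq ch0 (composite_nat (sincl (@fibre_stable C _ p (p 0 X))) cp) (cg' j)).
Qed.

Lemma square_inv (m a b m' a' b' : C 1) x y : square m a b m' ->
  composite a' a (cst 1 x) -> composite b b' (cst 1 y) -> square m' a' b' m.
Proof.
move=> [d [c1 c2]] ia ib; have [e1 e2 e3] := composite_cst ia.
have [f1 f2 f3] := composite_cst ib.
have [g1 g2 g3] := composite_ends c1; have [k1 k2 k3] := composite_ends c2.
have [|k ck] := composite_ex Cq (f := a') (g := m).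
  by rewrite e1 -k2 g2.
exists k; split=> //.
have c3 : composite d b' m.
  apply: (assocR Cq c1 ib); rewrite -f2 -g1; exact: composite_idr.
exact: (assocR Cq (composite_inv Cq c2 ia) c3 ck).
Qed.

Lemma indexed_product_iff n (X X' : C 0) (m m' : 'I_n -> C 1) (a : C 1) (b : 'I_n -> C 1) :
  is_equiv a -> src a = X -> tgt a = X' -> p 1 a = cst 1 (p 0 X) ->
  (forall j, [/\ is_equiv (b j), p 1 (b j) = cst 1 (p 0 (src (b j))) & square (m j) a (b j) (m' j)]) ->
  indexed_product p X m <-> indexed_product p X' m'.
Proof.
move=> ae sa ta pa bH; split; first exact: indexed_product_equiv bH.
case: (ae) => a' [aa' a'a].
have [E1 E2 E3] := composite_cst aa'.
have bj j : exists b', composite (b j) b' (cst 1 (src (b j))) /\ composite b' (b j) (cst 1 (tgt (b j))).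
  by have [[b' [? ?]] _ _] := bH j; exists b'.
have [b' bb'] := choice bj.
apply: (@indexed_product_equiv _ _ _ _ _ a' b').
- by exists a; rewrite -E1 E3.
- by rewrite -E1.
- by rewrite E3.
- by rewrite (inverse_over_cst pa aa') -ta tgt_nat pa tgt_cst.
move=> j; have [_ pb sq] := bH j; have [b1 b2] := bb' j.
have [F1 F2 F3] := composite_cst b1.
split; last exact: square_inv sq a'a b1.
  by exists (b j); rewrite -F1 F3.
by rewrite (inverse_over_cst pb b1) -F1 tgt_nat pb tgt_cst.
Qed.

End Transport.
End Fibre.

(** * Cartesian objects of the cotensor *)

Section Setup.
Variables (G : finGroupType) (C : sSet) (p : smap C (orbits_op G)).
Hypotheses (C_gcat : cocartesian_fibration p) (C_prod : has_finite_indexed_products p).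
Variable D : cotensor p.

Notation q := (ctq D).

Lemma C_inner : inner_fibration p. Proof. by case: C_gcat. Qed.

Lemma C_quasicat : quasicat C. Proof. exact: quasicat_total C_inner (@orbits_quasicat G). Qed.

Lemma C_pullback_inner (phi : orbits_op G 1) : inner_fibration (pr2 p (yoneda phi)).
Proof. by case: C_prod => _ _ H _; case: (H phi). Qed.

Lemma D_inner : inner_fibration q. Proof. by case: (ct_cocart D). Qed.

Lemma D_quasicat : quasicat D. Proof. exact: quasicat_total D_inner (@fin_quasicat G). Qed.

Lemma D_gcat : Gcat q.
Proof.
split=> [|k c cc ec]; first exact: D_quasicat.
have [e [ec' ek ee]] := (proj2 (ct_cocart D)) c k ec.
by exists e; split=> //; apply: cocart_total => //; rewrite ec'.
Qed.

Lemma D_cocart (e : D 1) : cocartesian (base_of q) e -> cocartesian q e.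
Proof. by move=> ec; apply: cocart_cancel (ec) (gcat_pres D_gcat ec). Qed.

Definition apair n (d : D n) (g : gam G n) (e : q n d = ev0 G n g) : pullback q (ev0 G) n :=
  exist _ (d, g) e.

Definition evp n (d : D n) (g : gam G n) (e : q n d = ev0 G n g) : C n := ctev D n (apair e).

Lemma evp_over n (d : D n) (g : gam G n) (e : q n d = ev0 G n g) :
  p n (evp e) = fin_proj G n (q n d).
Proof. exact: ctev_over. Qed.

Lemma evp_src (d : D 1) (g : gam G 1) (e : q 1 d = ev0 G 1 g) z :
  sval z = (src d, src g) -> src (evp e) = ctev D 0 z.
Proof. by move=> ez; rewrite /evp -src_nat; congr (ctev D 0 _); apply: sig_eq; rewrite ez. Qed.

Lemma evp_tgt (d : D 1) (g : gam G 1) (e : q 1 d = ev0 G 1 g) z :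
  sval z = (tgt d, tgt g) -> tgt (evp e) = ctev D 0 z.
Proof. by move=> ez; rewrite /evp -tgt_nat; congr (ctev D 0 _); apply: sig_eq; rewrite ez. Qed.

Lemma evp_equiv (d : D 1) (g : gam G 1) (e : q 1 d = ev0 G 1 g) :
  is_equiv d -> is_equiv g -> is_equiv (evp e).
Proof. by move=> de ge; apply: is_equiv_nat; apply: pull_is_equiv. Qed.

Lemma evp_composite (d1 d2 d3 : D 1) (g1 g2 g3 : gam G 1) e1 e2 e3 :
  composite d1 d2 d3 -> composite g1 g2 g3 ->
  composite (@evp 1 d1 g1 e1) (@evp 1 d2 g2 e2) (@evp 1 d3 g3 e3).
Proof. by move=> cd cg; apply: composite_nat; apply: pull_composite. Qed.

Section Transfer.
Variables (K : sSet) (r : smap K (fin G)).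
Hypothesis Kr : Gcat r.

Lemma cotensor_univ : restricts_to_equivalence (ev_comp (ctev_over (c := D)) r)
  (preserves_cocartesian (base_of r) (base_of q)) (preserves_cocartesian (gam_base r) p).
Proof. by apply: ct_univ; [apply: gcat_fib | apply: gcat_pres]. Qed.

Lemma ev_comp_fapp (u : FunOver r q 0) n (a : pullback r (ev0 G) n)
    (e : q n (fapp u n (sval a).1) = ev0 G n (sval a).2) :
  fapp (ev_comp (ctev_over (c := D)) r 0 u) n a = evp e.
Proof. by congr (ctev D n _); apply: sig_eq. Qed.

(** The condition [cartesian_object] read in terms of a functor [F] on the pullback of [K] to Gamma,
    with restrictions taken in [K] instead of [D]. *)
Definition cart_condition (F : FunOver (gam_base r) p 0) (a : K 0) :=
  forall (e : K 1) (g : gamma G) (z : pullback r (ev0 G) 0) n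
         (V : 'I_n -> orbit G) (i : forall j, gmap (V j) (otot (gtgt g)))
         (dec : orbit_decomposition i) (zj : 'I_n -> pullback r (ev0 G) 1),
    src e = a -> cocartesian (base_of r) e ->
    sval z = (tgt e, nvert (A := gam_cat G) g) ->
    (forall j, [/\ src (zj j) = z, cocartesian (base_of r) (sval (zj j)).1 &
       ev1 G 1 (sval (zj j)).2 =
         fedge (chi (X := FObj (gtgt g)) (orbit_decomposition_inj dec (j := j)))]) ->
    indexed_product p (fapp F 0 z) (fun j => fapp F 1 (zj j)).

Variables (u : FunOver r q 0) (F : FunOver (gam_base r) p 0) (w : FunOver (gam_base r) p 1).
Hypotheses (uP : preserves_cocartesian (base_of r) (base_of q) u).
Hypotheses (ws : src w = ev_comp (ctev_over (c := D)) r 0 u) (wt : tgt w = F).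
Hypothesis we : forall z, is_equiv (ftr w z).

Lemma transfer_product n (z : pullback r (ev0 G) 0) (zj : 'I_n -> pullback r (ev0 G) 1) :
  (forall j, src (zj j) = z) ->
  indexed_product p (fapp (ev_comp (ctev_over (c := D)) r 0 u) 0 z)
    (fun j => fapp (ev_comp (ctev_over (c := D)) r 0 u) 1 (zj j)) <->
  indexed_product p (fapp F 0 z) (fun j => fapp F 1 (zj j)).
Proof.
move=> sz; apply: (@indexed_product_iff _ _ _ C_inner C_pullback_inner _ _ _ _ _ (ftr w z)
  (fun j => ftr w (tgt (zj j)))) => //.
- by rewrite src_ftr ws.
- by rewrite tgt_ftr wt.
- by rewrite ftr_over fapp_over.
move=> j; split=> //.
  by rewrite ftr_over src_ftr fapp_over.
by rewrite -ws -wt -(sz j); apply: ftr_square.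
Qed.

(* Restrictions of u a in D are compared with images of restrictions of a in K by
   uniqueness of cocartesian lifts. *)
Lemma cart_transfer a : cartesian_object (fapp u 0 a) <-> cart_condition F a.
Proof.
split=> H.
  move=> e g z n V i dec zj ea ec ez zH; apply/transfer_product.
    by move=> j; have [] := zH j.
  have E m (b : pullback r (ev0 G) m) : q m (fapp u m (sval b).1) = ev0 G m (sval b).2.
    by rewrite fapp_over (svalP b).
  have := H (fapp u 1 e) g (apair (E 0 z)) n V i dec (fun j => apair (E 1 (zj j))).
  have -> : ctev D 0 (apair (E 0 z)) = fapp (ev_comp (ctev_over (c := D)) r 0 u) 0 z.
    exact/esym/ev_comp_fapp.
  have -> : (fun j => ctev D 1 (apair (E 1 (zj j)))) =
      (fun j => fapp (ev_comp (ctev_over (c := D)) r 0 u) 1 (zj j)).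
    by apply/funext => j; exact/esym/ev_comp_fapp.
  apply.
  - by rewrite -src_nat ea.
  - exact: uP.
  - by transitivity (fapp u 0 (sval z).1, (sval z).2) => //; rewrite ez -tgt_nat.
  move=> j; have [zs zc z1] := zH j; split=> //; last exact: uP.
  apply: sig_eq; transitivity (fapp u 0 (src (sval (zj j)).1), src (sval (zj j)).2).
    by rewrite src_nat.
  by rewrite -zs.
move=> eD g z n V i dec zj ea ec ez zH.
have qin := D_inner; have Dg := D_gcat.
have rD : r 0 a = src (q 1 eD) by rewrite -src_nat ea fapp_over.
have [e [ee es er]] := (proj2 Kr) a (q 1 eD) (gcat_pres Dg ec) rD.
have uec : cocartesian (base_of q) (fapp u 1 e) := uP ee.
have [||k [ck ke qk]] := cocart_equiv_factor qin (D_cocart uec) (D_cocart ec).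
- by rewrite -src_nat es ea.
- by rewrite fapp_over er.
have [k1 k2 k3] := composite_ends ck.
have ez1 : (sval z).1 = tgt eD by rewrite ez.
have ez2 : (sval z).2 = nvert (A := gam_cat G) g by rewrite ez.
have ra' : r 0 (tgt e) = ev0 G 0 (nvert (A := gam_cat G) g).
  by rewrite tgt_nat er -tgt_nat -ez2 -(svalP z) ez1.
pose zK : pullback r (ev0 G) 0 := exist _ (tgt e, nvert (A := gam_cat G) g) ra'.
have szj1 j : src (sval (zj j)).1 = tgt eD.
  by have [zs _ _] := zH j; rewrite -ez1 -zs.
have szj2 j : src (sval (zj j)).2 = nvert (A := gam_cat G) g.
  by have [zs _ _] := zH j; rewrite -ez2 -zs.
have lj j : exists ej, [/\ cocartesian (base_of r) ej, src ej = tgt e & r 1 ej = q 1 (sval (zj j)).1].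
  have [_ zc _] := zH j; apply: ((proj2 Kr) (tgt e) _ (gcat_pres Dg zc)).
  by rewrite -src_nat szj1 tgt_nat er -tgt_nat.
have [ej Hej] := choice lj.
have rj j : r 1 (ej j) = ev0 G 1 (sval (zj j)).2.
  by have [_ _ ->] := Hej j; rewrite (svalP (zj j)).
pose zKj j : pullback r (ev0 G) 1 := exist _ (ej j, (sval (zj j)).2) (rj j).
have szKj j : src (zKj j) = zK.
  have [_ es2 _] := Hej j; apply: sig_eq.
  by transitivity (src (ej j), src (sval (zj j)).2) => //; rewrite es2 szj2.
have := H e g zK n V i dec zKj es ee erefl.
have HH j : [/\ src (zKj j) = zK, cocartesian (base_of r) (sval (zKj j)).1 &
    ev1 G 1 (sval (zKj j)).2 = fedge (chi (X := FObj (gtgt g)) (orbit_decomposition_inj dec (j := j)))].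
  by have [_ _ z1] := zH j; have [ejc _ _] := Hej j.
move=> /(_ HH) /(transfer_product szKj).
have E m (b : pullback r (ev0 G) m) : q m (fapp u m (sval b).1) = ev0 G m (sval b).2.
  by rewrite fapp_over (svalP b).
have mj j : exists kj m, [/\ composite k (sval (zj j)).1 m, composite (fapp u 1 (ej j)) kj m,
    is_equiv kj & q 1 kj = cst 1 (tgt (q 1 (fapp u 1 (ej j))))].
  have [ejc ejs ejr] := Hej j; have [_ zc _] := zH j.
  have [|m cm] := composite_ex D_quasicat (f := k) (g := (sval (zj j)).1).
    by rewrite szj1 k3.
  have [m1 m2 m3] := composite_ends cm.
  have mc : cocartesian (base_of q) m := cocart_precomp (gcat_inner Dg) zc ke cm.
  have [||kj [? ? ?]] := cocart_equiv_factor qin (D_cocart (uP ejc)) (D_cocart mc).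
  - transitivity (fapp u 0 (src (ej j))); first exact/esym/(src_nat (fapp u)).
    by rewrite ejs m2 -k1 tgt_nat.
  - transitivity (r 1 (ej j)); first exact: fapp_over.
    rewrite ejr; apply: nerve_htpy.
    have := composite_nat q cm; rewrite qk => /idl_htpy; apply; exact: nerve_quasicat.
  by exists kj, m.
have [kj Hkj] := choice mj.
have ek : q 1 k = ev0 G 1 (cst 1 (nvert (A := gam_cat G) g)).
  by rewrite qk cst_nat -ra' tgt_nat fapp_over.
have ekj j : q 1 (kj j) = ev0 G 1 (cst 1 (tgt (sval (zj j)).2)).
  by have [m [_ _ _ ->]] := Hkj j; rewrite fapp_over cst_nat tgt_nat rj.
move=> IP; apply: (iffLR (@indexed_product_iff _ _ _ C_inner C_pullback_inner _ _ _ _ _ (evp ek)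
  (fun j => evp (ekj j)) _ _ _ _ _) IP).
- apply: evp_equiv => //; exact: is_equiv_cst.
- rewrite (ev_comp_fapp (E 0 zK)); apply: evp_src.
  rewrite src_cst -k1 -[tgt (fapp u 1 e)](tgt_nat (fapp u)); by [].
- by apply: evp_tgt; rewrite tgt_cst ez -k3.
- by rewrite evp_over fapp_over ek !cst_nat -base_ev1 base_ev1 -ra'.
move=> j; have [m [cm cu kje qkj]] := Hkj j; split.
- apply: evp_equiv => //; exact: is_equiv_cst.
- by rewrite evp_over src_nat evp_over qkj !cst_nat src_cst.
have em : q 1 m = ev0 G 1 (sval (zj j)).2.
  rewrite -(svalP (zj j)); apply/esym/nerve_htpy.
  have := composite_nat q cm; rewrite qk => /idl_htpy; apply; exact: nerve_quasicat.
exists (evp em); rewrite (ev_comp_fapp (E 1 (zKj j))); split.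
  apply: evp_composite => //; exact: composite_idr.
have -> : ctev D 1 (zj j) = evp (svalP (zj j)).
  by congr (ctev D 1 _); apply: sig_eq; rewrite /= -surjective_pairing.
apply: evp_composite => //; rewrite -(szj2 j); exact: composite_idl.
Qed.

End Transfer.

Lemma cart_cocart (x : D 0) e : cartesian_object x -> src e = x -> cocartesian (base_of q) e ->
  cartesian_object (tgt e).
Proof.
move=> xc es ec e2 g z n V i dec zj se2 e2c ez zH.
have [|h ch] := composite_ex D_quasicat (f := e) (g := e2); first by rewrite se2.
have [h1 h2 h3] := composite_ends ch.
apply: (xc h g z n V i dec zj) => //.
- by rewrite h2.
- exact: (cocartesian_comp (gcat_inner D_gcat) (@orbits_quasicat G) ch).
- by rewrite h3.
Qed.

End Setup.

(** * Pushforward along inert maps *)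

Section Precompose.
Variables (A A' B S : sSet) (r : smap A S) (q : smap B S) (r' : smap A' S) (j : smap A' A).
Hypothesis rj : forall n a, r n (j n a) = r' n a.

Program Definition fpre : smap (FunOver r q) (FunOver r' q) :=
  @SMap (FunOver r q) (FunOver r' q) (fun n h => exist _
    (@SMap (sprod A' (simplex n)) B (fun m x => sval h m (j m x.1, x.2)) _) _) _.
Next Obligation. by rewrite -[RHS](sm_nat h); congr (sm h (_, _)); apply: sm_nat. Qed.
Next Obligation. by rewrite H /= rj. Qed.
Next Obligation. by apply: sig_eq; apply: smap_eq. Qed.

Lemma fpre_ftr (t : FunOver r q 1) a : ftr (fpre 1 t) a = ftr t (j 0 a).
Proof. by rewrite /ftr /= cst_nat. Qed.

End Precompose.

Section NuEta.
Variable G : finGroupType.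

Definition eta_at (g : gam G 0) : gam G 1 := eta G 1 (cst 1 g, simp_id 1).
Definition nu_at (g : gam G 0) : gam G 1 := nu G 1 (cst 1 g, simp_id 1).

Lemma src_pair (X : sSet) (T : smap (sprod X (simplex 1)) X) x :
  src (T 1 (cst 1 x, simp_id 1)) = T 0 (x, simp_cst 0 ord0).
Proof. by rewrite -src_nat; congr (T 0 (_, _)); try exact: simp_eq; exact: src_cst. Qed.

Lemma tgt_pair (X : sSet) (T : smap (sprod X (simplex 1)) X) x :
  tgt (T 1 (cst 1 x, simp_id 1)) = T 0 (x, simp_cst 0 ord_max).
Proof. by rewrite -tgt_nat; congr (T 0 (_, _)); try exact: simp_eq; exact: tgt_cst. Qed.

Lemma src_eta g : src (eta_at g) = g. Proof. by rewrite src_pair eta0. Qed.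
Lemma tgt_eta g : tgt (eta_at g) = diag G 0 (ev1 G 0 g). Proof. by rewrite tgt_pair eta1. Qed.

Lemma ev1_eta g : ev1 G 1 (eta_at g) = cst 1 (ev1 G 0 g).
Proof. by rewrite eta_ev1 cst_nat. Qed.
Lemma ev0_nu g : ev0 G 1 (nu_at g) = cst 1 (ev0 G 0 g).
Proof. by rewrite nu_ev0 cst_nat. Qed.
Lemma ev1_nu g : ev1 G 1 (nu_at g) = ev0 G 1 (eta_at g).
Proof. exact: nu_ev1. Qed.

Lemma eta_nedge (x : gamma G) : eta_at (nvert (A := gam_cat G) x) = nedge (eta_hom x : Hom (x : gam_cat G) _).
Proof. exact: nt_map_edge. Qed.
Lemma nu_nedge (x : gamma G) : nu_at (nvert (A := gam_cat G) x) = nedge (nu_hom x : Hom (_ : gam_cat G) x).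
Proof. exact: nt_map_edge. Qed.

Lemma ev0_eta (x : gamma G) : ev0 G 1 (eta_at (nvert (A := gam_cat G) x)) = fedge (garr x).
Proof. by rewrite eta_nedge; apply: nmap_nedge. Qed.

Lemma nu_eta_composite g : composite (nu_at g) (eta_at g) (diag G 1 (ev0 G 1 (eta_at g))).
Proof.
rewrite [g]nvert_eta; move: (fo g ord0) => x; rewrite ev0_eta nu_nedge eta_nedge.
have -> : diag G 1 (fedge (garr x)) = nedge (fm (gam_diag G) (garr x : Hom (_ : fin_cat G) _)).
  exact: nmap_nedge.
have := nedge_composite (nu_hom x : Hom (_ : gam_cat G) x) (eta_hom x : Hom (x : gam_cat G) _).
congr (composite _ _ (nedge _)); apply: gam_hom_ext => /=; first exact: fhom_idr.
exact: fhom_idl.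
Qed.

Definition rpair n (f g : gam G n) (e : ev1 G n f = ev0 G n g) : pullback (ev1 G) (ev0 G) n :=
  exist _ (f, g) e.

End NuEta.

Section Main.
Variables (G : finGroupType) (C : sSet) (p : smap C (orbits_op G)).
Hypotheses (C_gcat : cocartesian_fibration p) (C_prod : has_finite_indexed_products p).
Variable D : cotensor p.

Notation q := (ctq D).
Notation AD := (pullback q (ev0 G)).

Let Dg : Gcat q := D_gcat D.
Let Ag : Gcat (pull_r q) := gcat_pull Dg.
Let qin : inner_fibration q := @D_inner G C p D.
Let Dq : quasicat D := @D_quasicat G C p D.
Let Cq : quasicat C := C_quasicat C_gcat.

Definition rho_of n (z : pullback (pull_r q) (ev0 G) n) : gam G n :=
  rho G n (@rpair G n (sval (sval z).1).2 (sval z).2 (svalP z)).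

Lemma rho_of_ev0 n (z : pullback (pull_r q) (ev0 G) n) :
  q n (sval (sval z).1).1 = ev0 G n (rho_of z).
Proof. by rewrite /rho_of rho_ev0; apply: (svalP (sval z).1). Qed.

Lemma rho_of_nat m n (f : simp m n) (z : pullback (pull_r q) (ev0 G) n) :
  rho_of (sact f z) = sact f (rho_of z).
Proof. by rewrite -[RHS](sm_nat (rho G)); congr (rho G m _); apply: sig_eq. Qed.

Lemma apair_eq n (d d' : D n) (g g' : gam G n) (e : q n d = ev0 G n g) (e' : q n d' = ev0 G n g') :
  d = d' -> g = g' -> apair e = apair e'.
Proof. by move=> ed eg; apply: sig_eq; rewrite /= ed eg. Qed.

Definition rho_hat : smap (pullback (pull_r q) (ev0 G)) AD :=
  @SMap (pullback (pull_r q) (ev0 G)) AD (fun n z => apair (rho_of_ev0 z))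
    (fun m n f z => apair_eq _ _ erefl (rho_of_nat f z)).

Lemma rho_hat_over n (z : pullback (pull_r q) (ev0 G) n) :
  p n (smap_comp (ctev D) rho_hat n z) = gam_base (pull_r q) n z.
Proof.
rewrite [LHS]ctev_over /=; apply/esym; apply: etrans (base_ev1 _) _.
by congr (fin_proj G n _); apply/esym/(svalP (sval z).1).
Qed.

(* ((d, f), gamma) |-> d (gamma o f); the functor y representing it sends (d, f)
   to the pushforward of d along f. *)
Definition h_rho : FunOver (gam_base (pull_r q)) p 0 := fver rho_hat_over.

Lemma h_rho_cocart : preserves_cocartesian (gam_base (pull_r q)) p h_rho.
Proof.
move=> z zc; have [zc1 zc2] := pull_cocart_pr Ag zc.
rewrite pull_base in zc1; have [dc fc] := pull_cocart_pr Dg zc1.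
apply: (@ctev_G _ _ _ D (rho_hat 1 z)); apply: (pull_cocart Dg) => //.
by rewrite [pull_r _ _ _]rho_ev1.
Qed.

Lemma y_exists : exists (y : FunOver (pull_r q) q 0) (th : FunOver (gam_base (pull_r q)) p 1),
  [/\ preserves_cocartesian (base_of (pull_r q)) (base_of q) y,
      src th = ev_comp (ctev_over (c := D)) (pull_r q) 0 y, tgt th = h_rho &
      forall z, is_equiv (ftr th z)].
Proof.
exact: (univ_exists (cotensor_univ D Ag) h_rho_cocart).
Qed.

(** * Properties of the pushforward functor *)

Section WithY.
Variables (y : FunOver (pull_r q) q 0) (th : FunOver (gam_base (pull_r q)) p 1).
Hypotheses (yP : preserves_cocartesian (base_of (pull_r q)) (base_of q) y).
Hypotheses (ths : src th = ev_comp (ctev_over (c := D)) (pull_r q) 0 y) (tht : tgt th = h_rho).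
Hypothesis the : forall z, is_equiv (ftr th z).

Notation Y := (fapp y).

Lemma Y_over n (a : AD n) : q n (Y n a) = ev1 G n (sval a).2.
Proof. exact: fapp_over. Qed.

Lemma Y_cocart (a : AD 1) : cocartesian (base_of q) (sval a).1 ->
  cocartesian (fin_proj G) (ev1 G 1 (sval a).2) -> cocartesian (base_of q) (Y 1 a).
Proof. by move=> dc fc; apply: yP; rewrite pull_base; apply: pull_cocart. Qed.

(** The rule for computing with [y]: evaluating a pushed forward edge at an arrow is, up to the
    invertible components of [th], evaluating the original edge at the composite arrow. *)
Lemma Y_equiv (a : AD 1) (g : gam G 1) (e : ev1 G 1 (sval a).2 = ev0 G 1 g)
    (e1 : q 1 (Y 1 a) = ev0 G 1 g) (e2 : q 1 (sval a).1 = ev0 G 1 (rho G 1 (rpair e))) :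
  is_equiv (evp e1) <-> is_equiv (evp e2).
Proof.
pose k : pullback (pull_r q) (ev0 G) 1 := exist _ (a, g) e.
have := ftr_square th k; rewrite ths tht (@ev_comp_fapp _ _ _ D _ _ y 1 k e1).
have -> : fapp h_rho 1 k = evp e2.
  by congr (ctev D 1 _); apply: sig_eq; congr (_, _); congr (rho G 1 _); apply: sig_eq.
by move=> sq; apply: (square_equiv Cq sq).
Qed.

Lemma iD_proof n (d : D n) : q n d = ev0 G n (diag G n (q n d)).
Proof. by rewrite diag_ev0. Qed.

Lemma iD_nat m n (f : simp m n) (d : D n) : diag G m (q m (sact f d)) = sact f (diag G n (q n d)).
Proof. by rewrite !sm_nat. Qed.

Definition iD : smap D AD :=
  @SMap D AD (fun n d => apair (iD_proof d)) (fun m n f d => apair_eq _ _ erefl (iD_nat f d)).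

Lemma jD_proof n (a : AD n) : pull_r q n (iD n (sval a).1) = ev0 G n (sval a).2.
Proof. exact: etrans (diag_ev1 _) (svalP a). Qed.

Definition kpair n (a : AD n) (g : gam G n) (e : pull_r q n a = ev0 G n g) :
    pullback (pull_r q) (ev0 G) n := exist _ (a, g) e.

Lemma kpair_eq n (a a' : AD n) (g g' : gam G n) (e : pull_r q n a = ev0 G n g)
    (e' : pull_r q n a' = ev0 G n g') : a = a' -> g = g' -> kpair e = kpair e'.
Proof. by move=> ea eg; apply: sig_eq; rewrite /= ea eg. Qed.

Definition jD : smap AD (pullback (pull_r q) (ev0 G)) :=
  @SMap AD (pullback (pull_r q) (ev0 G)) (fun n a => kpair (jD_proof a))
    (fun m n f a => kpair_eq _ _ (sm_nat iD f (sval a).1) erefl).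

Lemma jD_over n (a : AD n) : gam_base (pull_r q) n (jD n a) = gam_base q n a.
Proof. by rewrite /= -[X in _ = X]/(fin_proj G n (q n (sval a).1)); congr (fin_proj G n _); apply: diag_ev1. Qed.

Lemma YiD_over n (d : D n) : q n (smap_comp Y iD n d) = q n d.
Proof. by rewrite [LHS]Y_over; apply: diag_ev1. Qed.

Lemma smap_id_over n (d : D n) : q n (smap_id D n d) = q n d. Proof. by []. Qed.

(** Composition with an identity arrow is strict ([rho_diagl]), so [th] restricted along [jD] leads
    from the evaluation of [y (d, id)] to that of [d] itself; fullness turns it into a
    transformation in [D]. *)
Lemma YiD_equiv : exists s : FunOver q q 1, [/\ forall n d, fapp (src s) n d = Y n (iD n d),
  forall n d, fapp (tgt s) n d = d & forall d, is_equiv (ftr s d)].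
Proof.
pose t := fpre p jD_over 1 th.
have [|||||s [ss st se]] := @univ_full _ _ _ _ _ _ _ _ _ _ _ _ _ qin (@fin_quasicat G) (C_inner C_gcat)
  (@orbits_quasicat G) (cotensor_univ D Dg) (fver YiD_over) (fver smap_id_over) t.
- move=> e ec; apply: Y_cocart => //.
  have -> : ev1 G 1 (sval (iD 1 e)).2 = q 1 e by exact: diag_ev1.
  exact: (gcat_pres Dg ec).
- by [].
- rewrite -src_nat ths; apply: FunOver0_ext => n a.
  by congr (ctev D n _); apply: sig_eq.
- rewrite -tgt_nat tht; apply: FunOver0_ext => n a.
  congr (ctev D n _); apply: sig_eq; rewrite [RHS]surjective_pairing; congr (_, _).
  by apply: rho_diagl; rewrite /= (svalP a).
- by move=> z; rewrite fpre_ftr.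
- by exists s; split=> // n d; rewrite ?ss ?st.
Qed.

Lemma YiD_square (e : D 1) : exists k k', [/\ square (Y 1 (iD 1 e)) k k' e, is_equiv k & is_equiv k'].
Proof.
have [s [ss st se]] := YiD_equiv.
by exists (ftr s (src e)), (ftr s (tgt e)); split=> //; rewrite -ss -[e in X in square _ _ _ X]st; apply: ftr_square.
Qed.

Lemma YiD_is_equiv (e : D 1) : is_equiv (Y 1 (iD 1 e)) <-> is_equiv e.
Proof. by have [k [k' [sq ke ke']]] := YiD_square e; apply: (square_equiv Dq sq). Qed.

Lemma YiD_cocart (e : D 1) : cocartesian q (Y 1 (iD 1 e)) <-> cocartesian q e.
Proof.
have [k [k' [sq ke ke']]] := YiD_square e; split; first exact: (cocart_conj qin sq).
have [i [i1 i2]] := ke; have [i' [i1' i2']] := ke'.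
apply: (cocart_conj qin (square_inv qin sq i2 i1')).
  by exists k; have [_ -> _] := composite_cst i2; have [_ _ ->] := composite_cst i1.
by exists k'; have [_ -> _] := composite_cst i2'; have [_ _ ->] := composite_cst i1'.
Qed.

Lemma nuhat_proof n (z : sprod AD (simplex 1) n) :
  q n (sval z.1).1 = ev0 G n (nu G n ((sval z.1).2, z.2)).
Proof. by rewrite nu_ev0; apply: (svalP z.1). Qed.

Definition nuhat : smap (sprod AD (simplex 1)) AD :=
  @SMap (sprod AD (simplex 1)) AD (fun n z => apair (nuhat_proof z))
    (fun m n f z => apair_eq _ _ erefl (sm_nat (nu G) f ((sval z.1).2, z.2))).

Lemma what_proof n (z : sprod AD (simplex 1) n) :
  q n (Y n (nuhat n z)) = ev0 G n (eta G n ((sval z.1).2, z.2)).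
Proof. by rewrite Y_over; apply: nu_ev1. Qed.

Definition what : smap (sprod AD (simplex 1)) AD :=
  @SMap (sprod AD (simplex 1)) AD (fun n z => apair (what_proof z))
    (fun m n f z => apair_eq _ _ (sm_nat (smap_comp Y nuhat) f z) (sm_nat (eta G) f ((sval z.1).2, z.2))).

Definition v_at (a : AD 0) : AD 1 := nuhat 1 (cst 1 a, simp_id 1).
Definition w_at (a : AD 0) : AD 1 := what 1 (cst 1 a, simp_id 1).

Lemma what_over n (z : sprod AD (simplex 1) n) : q n (Y n (what n z)) = pull_r q n z.1.
Proof. by rewrite [LHS]Y_over; apply: eta_ev1. Qed.

Definition w_trans : FunOver (pull_r q) q 1 := exist _ (smap_comp Y what) what_over.

(* Here w_at (d, f) : (y (d, id), f) -> (y (d, f), id): pushing forward y (d, id)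
   along f again gives y (d, f). *)
Lemma Yw_equiv a : is_equiv (Y 1 (w_at a)).
Proof.
apply: (@univ_conservative _ _ _ _ _ _ _ _ _ _ _ _ _ qin (@fin_quasicat G) (C_inner C_gcat)
  (@orbits_quasicat G) (cotensor_univ D Ag) w_trans).
- move=> e; rewrite pull_base => ec; have [dc fc] := pull_cocart_pr Dg ec.
  have -> : app (src w_trans) e = sval w_trans 1 (e, simp_cst 1 ord0) := fapp_src w_trans e.
  apply: Y_cocart; last by rewrite [ev1 _ _ _]eta_ev1.
  apply: Y_cocart => //.
  have -> : ev1 G 1 (sval (nuhat 1 (e, simp_cst 1 ord0))).2 = ev0 G 1 (sval e).2.
    by rewrite [LHS](congr1 (ev1 G 1) (nu0 _)); apply: diag_ev1.
  by rewrite -(svalP e); apply: (gcat_pres Dg dc).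
- move=> e; rewrite pull_base => ec; have [dc fc] := pull_cocart_pr Dg ec.
  have -> : app (tgt w_trans) e = sval w_trans 1 (e, simp_cst 1 ord_max) := fapp_tgt w_trans e.
  apply: Y_cocart; last by rewrite [ev1 _ _ _]eta_ev1.
  apply: Y_cocart => //.
  by rewrite [ev1 _ _ _](congr1 (ev1 G 1) (nu1 _)).
move=> z {a}; pose a := (sval z).1; pose g := (sval z).2.
have zg : ev1 G 0 (sval a).2 = ev0 G 0 g := svalP z.
have E1 : q 1 (Y 1 (w_at a)) = ev0 G 1 (cst 1 g).
  by rewrite Y_over [ev1 _ _ _]ev1_eta cst_nat -zg.
have -> : ftr (ev_comp (ctev_over (c := D)) (pull_r q) 1 w_trans) z = evp E1.
  by congr (ctev D 1 _); apply: sig_eq.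
have E2 : ev1 G 1 (sval (w_at a)).2 = ev0 G 1 (cst 1 g).
  by rewrite [LHS]ev1_eta cst_nat -zg.
have E3 : q 1 (sval (w_at a)).1 = ev0 G 1 (rho G 1 (rpair E2)).
  by rewrite rho_ev0; apply: (svalP (w_at a)).
(* Two applications of [Y_equiv] replace the pushforwards by composition of arrows: what remains is
   [d] evaluated along the composite of the paths [nu] and [eta] with the arrow [g]. *)
apply/(Y_equiv E1 E3).
have E4 : ev1 G 1 (sval (v_at a)).2 = ev0 G 1 (rho G 1 (rpair E2)).
  by rewrite rho_ev0 [LHS]ev1_nu.
have E5 : q 1 (sval (v_at a)).1 = ev0 G 1 (rho G 1 (rpair E4)).
  by rewrite rho_ev0; apply: (svalP (v_at a)).
apply/(Y_equiv (E3 : q 1 (Y 1 (v_at a)) = _) E5).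
apply: evp_equiv; first exact: is_equiv_cst.
(* The source and the target of this composite path do not move, so the path is degenerate. *)
have e0 : ev0 G 1 (rho G 1 (rpair E4)) = cst 1 (ev0 G 0 (sval a).2).
  by rewrite rho_ev0; apply: ev0_nu.
have e1 : ev1 G 1 (rho G 1 (rpair E4)) = cst 1 (ev1 G 0 g).
  rewrite rho_ev1 -cst_nat; exact: (rho_ev1 (rpair E2)).
by rewrite (gam_cst e0 e1); apply: is_equiv_cst.
Qed.

Lemma v_src a : src (v_at a) = iD 0 (sval a).1.
Proof.
rewrite src_pair; apply: sig_eq; congr (_, _); apply: etrans (nu0 _) _.
by rewrite (svalP a).
Qed.

Lemma v_tgt a : tgt (v_at a) = a.
Proof.
by rewrite tgt_pair; apply: sig_eq; rewrite [RHS]surjective_pairing; congr (_, _); apply: nu1.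
Qed.

(* A path through the identity of the target: (d, id) -> (d, f) -> (d', id). *)
Lemma v_composite (a : AD 0) (b : AD 1) : src (sval b).1 = (sval a).1 ->
  (sval b).2 = eta_at (sval a).2 -> composite (v_at a) b (iD 1 (sval b).1).
Proof.
move=> sb eb; apply: pull_composite.
  by have := composite_idl (sval b).1; rewrite sb; apply.
by rewrite [(sval (iD 1 _)).2](congr1 (diag G 1) (svalP b)) eb; apply: nu_eta_composite.
Qed.

(* If e' : y (d, id) -> x is a cocartesian lift of f and al : x -> y (d, f) the
   factorization of y v through it, then y w' followed by y (iD al) is y w, which
   is an equivalence; so y (iD al) has a right inverse be, and be is also a left
   inverse because both sides agree after the cocartesian edge y (iD e'). *)
Lemma Yv_cocart a : cocartesian q (Y 1 (v_at a)).
Proof.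
pose f := (sval a).2; pose yv := Y 1 (v_at a).
have qyv : q 1 yv = ev0 G 1 (eta_at f) by rewrite [LHS]Y_over; apply: ev1_nu.
have [|e' [qe' se' ec']] := (proj2 (ct_cocart D)) (q 1 yv) (src yv); first exact: src_nat.
have [||al [qal cal]] := cocart_factor (b := cst 1 (tgt (q 1 e'))) ec' (h := yv); first by [].
  by rewrite -qe'; apply: composite_idr.
have fev : ev0 G 0 f = q 0 (src yv).
  by rewrite src_nat qyv -src_nat src_eta.
pose a2 : AD 0 := apair (esym fev).
pose w' : AD 1 := apair (etrans qe' qyv : q 1 e' = ev0 G 1 (eta_at f)).
have cw : composite w' (iD 1 al) (w_at a).
  apply: pull_composite => //; rewrite [(sval (iD 1 al)).2](congr1 (diag G 1) qal) cst_nat.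
  have -> : diag G 0 (tgt (q 1 e')) = tgt (eta_at f).
    by rewrite qe' qyv -tgt_nat tgt_eta; congr (diag G 0 _); apply: diag_ev0.
  exact: composite_idr.
have cYw := composite_nat Y cw.
have [u [wu uw]] := Yw_equiv a.
have [u1 u2 u3] := composite_cst uw.
have [y1 y2 y3] := composite_ends cYw.
have [|be cbe] := composite_ex Dq (f := u) (g := Y 1 w'); first by rewrite u1 y2.
have rinv := assocR Dq cbe cYw uw.
have cV : composite (Y 1 (v_at a2)) (Y 1 (w_at a)) (Y 1 (iD 1 yv)).
  exact/composite_nat/v_composite.
have cE : composite (Y 1 (v_at a2)) (Y 1 w') (Y 1 (iD 1 e')).
  by apply/composite_nat/v_composite.
have cM : composite (Y 1 (iD 1 e')) (Y 1 (iD 1 al)) (Y 1 (iD 1 yv)).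
  exact: (composite_nat Y (composite_nat iD cal)).
have cMu : composite (Y 1 (iD 1 yv)) u (Y 1 (v_at a2)).
  apply: (assocR Dq cV wu); have [<- _ _] := composite_ends cV; exact: composite_idr.
have cMb := assocL Dq cMu cbe cE.
have [m1 m2 m3] := composite_ends cM.
have [b1 b2 b3] := composite_ends cbe.
have [|de cde] := composite_ex Dq (f := Y 1 (iD 1 al)) (g := be).
  by rewrite b2 u2 -y3.
have cEd := assocL Dq cM cde cMb.
have qw : q 1 (Y 1 (w_at a)) = cst 1 (ev1 G 0 f) by rewrite Y_over; apply: ev1_eta.
have qw' : q 1 (Y 1 w') = cst 1 (ev1 G 0 f) by rewrite Y_over; apply: ev1_eta.
have qu : q 1 u = cst 1 (ev1 G 0 f) := inverse_over_cst qw wu.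
have qbe : q 1 be = cst 1 (ev1 G 0 f) := nerve_cst_comp (composite_nat q cbe) qu qw'.
have qa : q 1 (Y 1 (iD 1 al)) = cst 1 (tgt (q 1 e')) by rewrite [LHS]YiD_over.
have qde := nerve_cst_comp (composite_nat q cde) qa qbe.
have dh : htpy de (cst 1 (tgt (Y 1 (iD 1 e')))).
  apply: (cocart_unique _ cEd (composite_idr _)); first exact/YiD_cocart/ec'.
  by rewrite qde cst_nat; congr (cst 1 _); rewrite tgt_nat YiD_over.
have linv := htpy_comp Dq dh cde.
have ale : is_equiv al by apply/YiD_is_equiv; apply: equiv_of_lr Dq _ _ _ _ _ rinv linv.
exact: (cocart_postcomp qin ec' ale cal).
Qed.

(** The target of a composite formed by [rho] equals the target of the second arrow only
    propositionally, so the orbit decomposition is allowed to live on an equal object [X]. *)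
Lemma cartesian_object_gen (x : D 0) (e : D 1) (g : gamma G) (X : fobj G) (EX : FObj (gtgt g) = X)
    (z : AD 0) n (V : 'I_n -> orbit G) (i : forall j, gmap (V j) X)
    (dec : orbit_decomposition i) (zj : 'I_n -> AD 1) :
  cartesian_object x -> src e = x -> cocartesian (base_of q) e ->
  sval z = (tgt e, nvert (A := gam_cat G) g) ->
  (forall j, [/\ src (zj j) = z, cocartesian (base_of q) (sval (zj j)).1 &
     ev1 G 1 (sval (zj j)).2 = fedge (chi (orbit_decomposition_inj dec (j := j)))]) ->
  indexed_product p (ctev D 0 z) (fun j => ctev D 1 (zj j)).
Proof. by case: _ / EX i dec => i dec xc; apply: xc. Qed.

(** The values of y (d, f) are those of [d] at arrows composed with f. Composition does not change
    the target, so the comparison maps of y (d, f) are among those of [d]. *)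
Lemma Y_cartesian (a : AD 0) : cartesian_object (sval a).1 -> cartesian_object (Y 0 a).
Proof.
move=> ac; apply/(cart_transfer C_gcat C_prod Ag yP ths tht the).
move=> e g z n V i dec zj ea ec ez zH; rewrite pull_base in ec.
have [dc _] := pull_cocart_pr Dg ec.
have R1 : ctev D 0 (rho_hat 0 z) = fapp h_rho 0 z by [].
rewrite -R1.
have R2 : (fun j => ctev D 1 (rho_hat 1 (zj j))) = (fun j => fapp h_rho 1 (zj j)) by [].
rewrite -R2.
pose g' := fo (sval (rho_hat 0 z)).2 ord0.
have Eg : FObj (gtgt g') = FObj (gtgt g).
  have ez2 : (sval z).2 = nvert (A := gam_cat G) g by rewrite ez.
  apply: etrans (congr1 (fun h : gam G 0 => FObj (gtgt (fo h ord0))) ez2).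
  have H := rho_ev1 (@rpair G 0 (sval (sval z).1).2 (sval z).2 (svalP z)).
  exact: (congr1 (fun F : fin G 0 => fo F ord0) H).
apply: (@cartesian_object_gen (sval a).1 (sval e).1 g' _ Eg (rho_hat 0 z) n V i dec (fun j => rho_hat 1 (zj j)) ac _ dc).
- by rewrite -ea.
- rewrite [LHS]surjective_pairing; congr (_, _); last exact: nvert_eta.
  by rewrite /= ez.
move=> j; have [zs zc z1] := zH j; rewrite pull_base in zc; split.
- by rewrite -src_nat zs.
- by have [] := pull_cocart_pr Dg zc.
- by rewrite [LHS]rho_ev1.
Qed.

End WithY.
End Main.

(** * Sections of the cotensor *)

Lemma full_square (X : sSet) (P : X 0 -> Prop) (f g g' f' : full P 1) :
  square (sval f) (sval g) (sval g') (sval f') -> square f g g' f'.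
Proof.
case=> d [c c']; have [e1 e2 e3] := composite_ends c.
have Ps : P (src d) by rewrite e2; apply: (svalP f).
have Pt : P (tgt d) by rewrite e3; apply: (svalP g').
by exists (full_edge Ps Pt); split; apply: full_composite.
Qed.

Section Main.
Variables (G : finGroupType) (C : sSet) (p : smap C (orbits_op G)).
Hypotheses (C_gcat : cocartesian_fibration p) (C_prod : has_finite_indexed_products p).
Variable D : cotensor p.

Notation q := (ctq D).
Notation AD := (pullback q (ev0 G)).
Notation PG := (pullback (smap_id (fin G)) (ev0 G)).
Notation idr := (smap_id (fin G)).

Let Dg : Gcat q := D_gcat D.
Let qin : inner_fibration q := @D_inner G C p D.
Let Dq : quasicat D := @D_quasicat G C p D.
Let Cq : quasicat C := C_quasicat C_gcat.

Lemma base_of_id : base_of idr = fin_proj G. Proof. exact: smap_eq. Qed.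

Section Sections.
Variable s : FunOver idr q 0.
Hypothesis sP : preserves_cocartesian (fin_proj G) (base_of q) s.

Lemma sphat_proof n (z : gam G n) : q n (fapp s n (ev0 G n z)) = ev0 G n z.
Proof. exact: fapp_over. Qed.

Definition sphat : smap (gam G) AD :=
  @SMap (gam G) AD (fun n z => apair (sphat_proof z))
    (fun m n f z => apair_eq _ _ (sm_nat (smap_comp (fapp s) (ev0 G)) f z) erefl).

Definition ev_s : smap (gam G) C := smap_comp (ctev D) sphat.

Lemma ev_s_over n (z : gam G n) : p n (ev_s n z) = fin_proj G n (ev1 G n z).
Proof. by rewrite [LHS]ctev_over base_ev1; congr (fin_proj G n _); apply: sphat_proof. Qed.

Lemma ev_s_fapp n (z : PG n) : fapp (ev_comp (ctev_over (c := D)) idr 0 s) n z = ev_s n (sval z).2.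
Proof. by congr (ctev D n _); apply: sig_eq; congr (_, _); congr (app s _); apply: (svalP z). Qed.

Section Tau.
Variables (y : FunOver (pull_r q) q 0) (th : FunOver (gam_base (pull_r q)) p 1).
Hypotheses (yP : preserves_cocartesian (base_of (pull_r q)) (base_of q) y).
Hypotheses (ths : src th = ev_comp (ctev_over (c := D)) (pull_r q) 0 y) (tht : tgt th = h_rho D).
Hypothesis the : forall z, is_equiv (ftr th z).

Notation Y := (fapp y).

Definition tau (g : gam G 0) : D 1 := Y 1 (sphat 1 (eta_at g)).

Lemma tau_over g : q 1 (tau g) = cst 1 (ev1 G 0 g).
Proof. by rewrite [LHS]Y_over; apply: ev1_eta. Qed.

Lemma tau_composite g :
  composite (Y 1 (v_at (sphat 0 g))) (tau g) (Y 1 (iD D 1 (fapp s 1 (ev0 G 1 (eta_at g))))).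
Proof.
apply: composite_nat; apply: (v_composite (a := sphat 0 g) (b := sphat 1 (eta_at g))) => //.
by rewrite -[LHS]src_nat -[in RHS](src_eta g) -src_nat.
Qed.

Definition etahat : smap (sprod PG (simplex 1)) (gam G) :=
  @SMap (sprod PG (simplex 1)) (gam G) (fun n z => eta G n ((sval z.1).2, z.2))
    (fun m n f z => sm_nat (eta G) f ((sval z.1).2, z.2)).

Lemma tau_trans_over n (z : sprod PG (simplex 1) n) :
  q n (smap_comp (fapp y) (smap_comp sphat etahat) n z) = pull_r idr n z.1.
Proof. by rewrite [LHS]Y_over; apply: eta_ev1. Qed.

Definition tau_trans : FunOver (pull_r idr) q 1 := exist _ _ tau_trans_over.

(** Conservativity for the pullback of Gamma itself, applied to all [tau] at once as the
    transformation [tau_trans]. Evaluated at an inert arrow they become values of [ev_s] at edges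
    whose target does not move. *)
Lemma tau_equiv : (forall z x, ev1 G 1 z = cst 1 x -> is_equiv (ev_s 1 z)) ->
  forall g, is_equiv (tau g).
Proof.
move=> H g; have idg := gcat_id G.
have Hg : idr 0 (ev0 G 0 g) = ev0 G 0 g by [].
have := @univ_conservative _ _ _ _ _ _ _ _ _ _ _ _ _ qin (@fin_quasicat G) (C_inner C_gcat)
  (@orbits_quasicat G) (cotensor_univ D (gcat_pull idg)) tau_trans.
have pc (e : PG 1) (z : gam G 1) : cocartesian (base_of (pull_r idr)) e ->
    (ev0 G 1 z = ev0 G 1 (sval e).2 \/ ev0 G 1 z = ev1 G 1 (sval e).2) ->
    ev1 G 1 z = ev1 G 1 (sval e).2 -> cocartesian (base_of q) (Y 1 (sphat 1 z)).
  rewrite pull_base => ec z0 z1; have [dc fc] := pull_cocart_pr idg ec.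
  apply: (Y_cocart yP); last by rewrite z1.
  apply: sP; case: z0 => ->; last exact: fc.
  by rewrite base_of_id in dc; have := svalP e => /= <-.
move=> /(_ _ _ _ (exist _ (ev0 G 0 g, g) Hg)) K; apply: K.
- move=> e ec; have -> : app (src tau_trans) e = sval tau_trans 1 (e, simp_cst 1 ord0) := fapp_src tau_trans e.
  apply: (pc e (eta G 1 ((sval e).2, simp_cst 1 ord0)) ec); last exact: eta_ev1.
  by left; rewrite eta0.
- move=> e ec; have -> : app (tgt tau_trans) e = sval tau_trans 1 (e, simp_cst 1 ord_max) := fapp_tgt tau_trans e.
  apply: (pc e (eta G 1 ((sval e).2, simp_cst 1 ord_max)) ec); last exact: eta_ev1.
  by right; rewrite eta1; apply: diag_ev0.
move=> z; pose g1 := (sval (sval z).1).2; pose g2 := (sval z).2.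
have zg : ev1 G 0 g1 = ev0 G 0 g2 := svalP z.
have E1 : q 1 (tau g1) = ev0 G 1 (cst 1 g2) by rewrite tau_over zg cst_nat.
have -> : ftr (ev_comp (ctev_over (c := D)) (pull_r idr) 1 tau_trans) z = evp E1.
  by congr (ctev D 1 _); apply: sig_eq.
have E2 : ev1 G 1 (sval (sphat 1 (eta_at g1))).2 = ev0 G 1 (cst 1 g2).
  by rewrite [LHS]ev1_eta cst_nat zg.
have E3 : q 1 (sval (sphat 1 (eta_at g1))).1 = ev0 G 1 (rho G 1 (rpair E2)).
  by rewrite rho_ev0; apply: (svalP (sphat 1 (eta_at g1))).
apply/(Y_equiv C_gcat ths tht the E1 E3).
have -> : evp E3 = ev_s 1 (rho G 1 (rpair E2)).
  by congr (ctev D 1 _); apply: sig_eq; congr (_, _); congr (app s _); apply/esym/rho_ev0.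
by apply: (H _ (ev1 G 0 g2)); rewrite rho_ev1 cst_nat.
Qed.

Lemma section_inert : (forall g, is_equiv (tau g)) ->
  forall x : gamma G, cocartesian q (fapp s 1 (fedge (garr x))).
Proof.
move=> te x; apply/(YiD_cocart C_gcat yP ths tht the); rewrite -ev0_eta.
exact: (cocart_postcomp qin (Yv_cocart C_gcat yP ths tht the (a := _)) (te _) (tau_composite (nvert (A := gam_cat G) x))).
Qed.

End Tau.
End Sections.

Definition cart_incl : smap (cart D) D := sincl (@full_stable D (@cartesian_object G C p D)).

Lemma fincl_proof n (h : FunOver idr (cartq D) n) m x : q m (smap_comp cart_incl (sval h) m x) = idr m x.1.
Proof. exact: (svalP h m x). Qed.

Program Definition fincl : smap (FunOver idr (cartq D)) (FunOver idr q) :=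
  @SMap (FunOver idr (cartq D)) (FunOver idr q)
    (fun n h => exist _ (smap_comp cart_incl (sval h)) (@fincl_proof n h)) _.
Next Obligation. by apply: sig_eq; apply: smap_eq. Qed.

Lemma cartq_inner : inner_fibration (cartq D).
Proof. exact: full_inner. Qed.

(** Restrictions of cartesian objects are cartesian, so the cocartesian lifts taken in [D] stay
    inside the full subcategory. *)
Lemma cart_gcat : Gcat (cartq D).
Proof.
split=> [|k c cc ec]; first exact: quasicat_total cartq_inner (@fin_quasicat G).
have [e [ec' ek ee]] := (proj2 Dg) (sval k) c cc ec.
have Ps : cartesian_object (src e) by rewrite ek; have := svalP k ord0; rewrite vertex0.
have Pt : cartesian_object (tgt e) by exact: (cart_cocart Ps erefl ec').
exists (full_edge Ps Pt); split=> //; last exact: sig_eq.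
have -> : base_of (cartq D) = smap_comp (base_of q) cart_incl.
  exact: smap_eq.
exact: full_cocart.
Qed.

Lemma cart_incl_cocart (e : cart D 1) : cocartesian (base_of (cartq D)) e ->
  cocartesian (base_of q) (sval e).
Proof.
apply: (preserves_of_lifts (gcat_inner cart_gcat) (gcat_inner Dg)
  (u := cart_incl)) => // f x /fin_lift [c [cf cx cc]].
have [e0 [ec' ek ee]] := (proj2 Dg) (sval x) c cc (esym cx).
have Ps : cartesian_object (src e0) by rewrite ek; have := svalP x ord0; rewrite vertex0.
have Pt : cartesian_object (tgt e0) by exact: (cart_cocart Ps erefl ec').
exists (full_edge Ps Pt); split=> //.
- by rewrite -cf -ee.
- exact: sig_eq.
have -> : base_of (cartq D) = smap_comp (base_of q) cart_incl.
  exact: smap_eq.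
exact: full_cocart.
Qed.

(** * From algebras to monoids *)

Section Algebra.
Variable sc : FunOver idr (cartq D) 0.
Hypothesis scP : preserves_cocartesian (fin_proj G) (base_of (cartq D)) sc.
Hypothesis sci : inert_to_cocartesian sc.

Let s : FunOver idr q 0 := fincl 0 sc.

Lemma fincl_P : preserves_cocartesian (fin_proj G) (base_of q) s.
Proof. by move=> e ec; apply: (cart_incl_cocart (scP ec)). Qed.

Lemma fincl_cart x : cartesian_object (fapp s 0 x).
Proof. by have := svalP (app sc x) ord0; rewrite vertex0. Qed.

(** [E1] is cocartesian already in [D], and [E2] is equivalent to the given lift [es]. In [cart D]
    both are cocartesian over the same inert map with the same source, so [tau], which leads from
    one to the other, is invertible; its value at the identity of the target is the claim. *)
Lemma ev_s_eta (x : gamma G) : is_equiv (ev_s s 1 (eta_at (nvert (A := gam_cat G) x))).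
Proof.
have [y [th [yP ths tht the]]] := y_exists D.
set g := nvert (A := gam_cat G) x; pose es := app sc (fedge (garr x)).
have sE : sval es = fapp s 1 (ev0 G 1 (eta_at g)) by rewrite ev0_eta.
have esc : cocartesian (cartq D) es by apply: sci; apply: gam_inert.
pose a := sphat s 0 g.
have Ya d : cartesian_object d -> cartesian_object (fapp y 0 (iD D 0 d)).
  by move=> dc; apply: (Y_cartesian C_gcat C_prod yP ths tht the).
have ca : cartesian_object (fapp y 0 a).
  by apply: (Y_cartesian C_gcat C_prod yP ths tht the); apply: fincl_cart.
pose E1 := fapp y 1 (v_at a).
have E1s : cartesian_object (src E1).
  by rewrite -src_nat v_src; apply: Ya; apply: fincl_cart.
have E1t : cartesian_object (tgt E1) by rewrite -tgt_nat v_tgt.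
have E1c : cocartesian (cartq D) (full_edge E1s E1t).
  by apply: full_cocart; apply: (Yv_cocart C_gcat yP ths tht the).
pose E2 := fapp y 1 (iD D 1 (sval es)).
have [k [k' [sq ke ke']]] := YiD_square C_gcat yP ths tht the (sval es).
have [d [cd cd']] := sq; have [d1 d2 d3] := composite_ends cd; have [d4 d5 d6] := composite_ends cd'.
have ess : cartesian_object (src (sval es)) by apply: (svalP es).
have est : cartesian_object (tgt (sval es)) by apply: (svalP es).
have E2s : cartesian_object (src E2) by rewrite -src_nat -src_nat; apply: Ya.
have E2t : cartesian_object (tgt E2) by rewrite -tgt_nat -tgt_nat; apply: Ya.
have ks : cartesian_object (src k) by rewrite -d5 d2.
have kt : cartesian_object (tgt k) by rewrite d4.
have k's : cartesian_object (src k') by rewrite -d1.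
have k't : cartesian_object (tgt k') by rewrite -d3 d6.
have csq : square (full_edge E2s E2t : cart D 1) (full_edge ks kt) (full_edge k's k't) es.
  exact: full_square.
have kce : is_equiv (full_edge ks kt : cart D 1) by exact: full_is_equiv.
have kce' : is_equiv (full_edge k's k't : cart D 1) by exact: full_is_equiv.
(* The hypothesis on [es] concerns [cart D] only, so the conjugation by equivalences takes place
   there. *)
have E2c : cocartesian (cartq D) (full_edge E2s E2t).
  have [i [i1 i2]] := kce; have [i' [i1' i2']] := kce'.
  apply: (cocart_conj cartq_inner (square_inv cartq_inner csq i2 i1')) => //.
    by exists (full_edge ks kt); have [_ -> _] := composite_cst i2; have [_ _ ->] := composite_cst i1.
  by exists (full_edge k's k't); have [_ -> _] := composite_cst i2'; have [_ _ ->] := composite_cst i1'.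
have ct := tau_composite s y g; rewrite -sE -/E1 -/E2 in ct.
have [t1 t2 t3] := composite_ends ct.
have ts : cartesian_object (src (tau s y g)) by rewrite -t1.
have tt : cartesian_object (tgt (tau s y g)) by rewrite -t3.
have ctc : composite (full_edge E1s E1t : cart D 1) (full_edge ts tt) (full_edge E2s E2t).
  exact: full_composite.
have qE1 : q 1 E1 = ev0 G 1 (eta_at g) by rewrite [LHS]Y_over; apply: ev1_nu.
have qE2 : q 1 E2 = ev0 G 1 (eta_at g).
  by rewrite [LHS]YiD_over sE; apply: sphat_proof.
have [||k0 [ck0 k0e qk0]] := cocart_equiv_factor cartq_inner E1c E2c.
- by apply: sig_eq; apply/esym/t2.
- by rewrite -[LHS]/(q 1 E1) -[RHS]/(q 1 E2) qE1 qE2.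
have te : is_equiv (tau s y g).
  apply: (is_equiv_nat cart_incl (e := full_edge ts tt)).
  apply: (is_equiv_htpy (quasicat_total cartq_inner (@fin_quasicat G)) _ k0e).
  apply: (cocart_unique E1c ck0 ctc).
  rewrite qk0 -[RHS]/(q 1 (tau s y g)) tau_over -[cartq D 1 _]/(q 1 E1) qE1 -tgt_nat tgt_eta.
  by congr (cst 1 _); apply: diag_ev0.
(* Evaluation of [tau] at an identity arrow: composition with identities is strict, so [Y_equiv]
   leads to the value of [ev_s] at the unit. *)
have e : ev1 G 1 (sval (sphat s 1 (eta_at g))).2 = ev0 G 1 (cst 1 (diag G 0 (ev1 G 0 g))).
  by rewrite [LHS]ev1_eta cst_nat; congr (cst 1 _); apply/esym/diag_ev0.
have e1 : q 1 (tau s y g) = ev0 G 1 (cst 1 (diag G 0 (ev1 G 0 g))).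
  by rewrite tau_over -e [RHS]ev1_eta.
have e2 : q 1 (sval (sphat s 1 (eta_at g))).1 = ev0 G 1 (rho G 1 (rpair e)).
  by rewrite rho_ev0; apply: (svalP (sphat s 1 (eta_at g))).
have -> : ev_s s 1 (eta_at g) = evp e2.
  congr (ctev D 1 _); apply: sig_eq; congr (_, _); apply/esym/rho_diagr.
  by transitivity (eta_at g, cst 1 (diag G 0 (ev1 G 0 g))) => //; rewrite ev1_eta cst_nat.
apply/(Y_equiv C_gcat ths tht the e1 e2).
by apply: evp_equiv => //; apply: is_equiv_cst.
Qed.

Lemma underlying_fapp n x : fapp (underlying D 0 sc) n x = ev_s s n (diag G n x).
Proof.
congr (ctev D n _); apply: sig_eq; congr (_, _); rewrite -[in LHS](diag_ev0 x); by [].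
Qed.

Lemma underlying_cocart : preserves_cocartesian (fin_proj G) p (underlying D 0 sc).
Proof.
move=> e ec; have -> : app (underlying D 0 sc) e = ev_s s 1 (diag G 1 e) := underlying_fapp e.
apply: (@ctev_G _ _ _ D (sphat s 1 (diag G 1 e))); apply: (pull_cocart Dg).
  by apply: fincl_P; rewrite diag_ev0.
by rewrite [pull_r _ _ _]diag_ev1.
Qed.

Section Segal.
Variables (X : fobj G) (U : orbit G) (i : gmap U X) (i_inj : injective i).

(** A characteristic map is a restriction to the orbit followed by a fibrewise inert map [chi_arr].
    In the cartesian condition at the identity of [X], the restriction acts on the object and
    [chi_arr] is the resulting arrow; the unit then compares its value with that at the identity of
    the orbit. *)
Definition chi_can : fhom X (FObj (pb (gmap_comp (ostr X) i))) := can (gmap_comp (ostr X) i).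

Definition chi_arr : fhom (FObj (pb (gmap_comp (ostr X) i))) (fobj1 U) :=
  can_fac (Z := fobj1 U) (gmap_comp (ostr X) i) (gmap_id U) (chi i_inj).

Lemma chi_arr_inert : fibrewise_inert (chi_arr : fhom (FObj (pb (X := X) _)) (FObj (Over (gmap_id U)))).
Proof.
split=> // w; have H : ostr X (i w) == ostr X (i w) by [].
exists (exist _ (i w, w) H : pb_type (gmap_comp (ostr X) i), w); split=> /=.
  by rewrite !eqxx.
move=> [[[u v] H'] v2] /=; case: eqP => // ev; subst v2; case: eqP => // eu [ew]; subst v u.
by congr (_, _); apply: val_inj.
Qed.

Definition chi_gam : gamma G := Gamma chi_arr_inert.

Lemma chi_gam_sq : fhom_comp chi_arr chi_can = fhom_comp (chi i_inj) (fhom_id X).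
Proof. by rewrite fhom_idr; apply: can_facE; apply: gmap_ext. Qed.

Definition chi_hom : gam_hom (gam_diag G X) chi_gam :=
  @GamHom G (gam_diag G X) chi_gam chi_can (chi i_inj) chi_gam_sq.

Lemma chi_hom_eta :
  composite (nedge (chi_hom : Hom (gam_diag G X) (chi_gam : gam_cat G)))
    (eta_at (nvert (A := gam_cat G) chi_gam)) (diag G 1 (fedge (chi i_inj))).
Proof.
rewrite eta_nedge.
have -> : diag G 1 (fedge (chi i_inj)) = nedge (fm (gam_diag G) (chi i_inj : Hom (_ : fin_cat G) _)).
  exact: nmap_nedge.
have := nedge_composite (chi_hom : Hom (_ : gam_cat G) _) (eta_hom chi_gam : Hom (_ : gam_cat G) _).
congr (composite _ _ (nedge _)); apply: gam_hom_ext => /=; last exact: fhom_idl.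
by apply: can_facE; apply: gmap_ext.
Qed.

End Segal.

Lemma underlying_segal : segal (underlying D 0 sc).
Proof.
move=> X n U i dec; pose g := gam_diag G X.
pose z := sphat s 0 (nvert (A := gam_cat G) g).
pose zj j := sphat s 1 (nedge (chi_hom (orbit_decomposition_inj dec (j := j)) : Hom (g : gam_cat G) _)).
have xc := @fincl_cart (ev0 G 0 (nvert (A := gam_cat G) g)).
(* The cartesian condition of [s X] at the identity arrow of [X], for the trivial restriction
   [cst]. *)
have IP : indexed_product p (ctev D 0 z) (fun j => ctev D 1 (zj j)).
  apply: (xc (cst 1 (fapp s 0 (ev0 G 0 (nvert (A := gam_cat G) g)))) g z n U i dec zj).
  - exact: src_cst.
  - exact: (equiv_cocartesian (gcat_inner Dg) (@orbits_quasicat G) (is_equiv_cst _)).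
  - by rewrite tgt_cst.
  move=> j; split.
  - by rewrite -src_nat src_nedge.
  - apply: fincl_P; rewrite nmap_nedge; exact: can_cocart.
  - by rewrite nmap_nedge.
have E0 : app (underlying D 0 sc) (nvert (A := fin_cat G) X) = ctev D 0 z.
  apply: etrans (underlying_fapp _) _; congr (ev_s s 0 _); exact: nmap_nvert.
rewrite E0.
(* The components are corrected by the units at the arrows [chi_gam], invertible by [ev_s_eta]; the
   source is left alone. *)
apply: (iffLR (@indexed_product_iff _ _ _ (C_inner C_gcat) (C_pullback_inner C_prod) _ _ _ _ _
  (cst 1 (ctev D 0 z)) (fun j => ev_s s 1 (eta_at (nvert (A := gam_cat G)
     (chi_gam (orbit_decomposition_inj dec (j := j)))))) _ _ _ _ _) IP).
- exact: is_equiv_cst.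
- exact: src_cst.
- exact: tgt_cst.
- exact: cst_nat.
move=> j; have c := chi_hom_eta (orbit_decomposition_inj dec (j := j)).
have cc := composite_nat (ev_s s) c; split; first exact: ev_s_eta.
  by rewrite src_nat !ev_s_over ev1_eta !cst_nat src_cst.
exists (ev_s s 1 (diag G 1 (fedge (chi (orbit_decomposition_inj dec (j := j)))))); split=> //.
have -> : app (underlying D 0 sc) (fedge (chi (orbit_decomposition_inj dec (j:=j)))) =
  ev_s s 1 (diag G 1 (fedge (chi (orbit_decomposition_inj dec (j := j))))) := underlying_fapp _.
have [_ e2 _] := composite_ends cc.
have -> : ctev D 0 z = src (ev_s s 1 (diag G 1 (fedge (chi (orbit_decomposition_inj dec (j := j)))))).
  by rewrite e2 -src_nat src_nedge.
exact: composite_idl.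
Qed.

End Algebra.

(** * From monoids to algebras *)

Section Monoid.
Variables (N : FunOver (fin_proj G) p 0) (s : FunOver idr q 0) (om : FunOver (gam_base idr) p 1).
Hypotheses (N_segal : segal N) (sP : preserves_cocartesian (fin_proj G) (base_of q) s).

Lemma ev1_over n (z : PG n) : fin_proj G n (smap_comp (ev1 G) (pr2 idr (ev0 G)) n z) = gam_base idr n z.
Proof. by rewrite [LHS]base_ev1 /=; congr (functor_comp _ _); apply/esym/(svalP z). Qed.

Hypotheses (oms : src om = ev_comp (ctev_over (c := D)) idr 0 s) (omt : tgt om = fpre p ev1_over 0 N).
Hypothesis ome : forall z, is_equiv (ftr om z).

(** Up to [om] the functor of [s] is [N] after [ev1], which depends only on the target of an inert
    arrow; so the cartesian condition is the Segal condition of [N] at that target. *)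
Lemma monoid_cart x : cartesian_object (fapp s 0 x).
Proof.
have sP' : preserves_cocartesian (base_of idr) (base_of q) s by rewrite base_of_id.
apply/(cart_transfer C_gcat C_prod (gcat_id G) sP' oms omt ome).
move=> e g z n V i dec zj _ _ ez zH.
have := N_segal (X := FObj (gtgt g)) dec.
have -> : fapp (fpre p ev1_over 0 N) 0 z = app N (nvert (A := fin_cat G) (FObj (gtgt g))).
  rewrite -[LHS]/(app N (ev1 G 0 (sval z).2)) ez; congr (app N _); exact: nmap_nvert.
congr (indexed_product p _ _); apply/funext => j; have [_ _ zj1] := zH j.
by rewrite -zj1.
Qed.

(** An edge of Gamma that [ev1] makes constant goes to a constant edge under [N] after [ev1], hence
    to an invertible one under [ev_s], as [tau_equiv] asks. *)
Lemma monoid_inert (x : gamma G) : cocartesian q (fapp s 1 (fedge (garr x))).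
Proof.
have [y [th [yP ths tht the]]] := y_exists D.
apply: (section_inert yP ths tht the); apply: (tau_equiv sP yP ths tht the) => z x' z1.
pose zz : PG 1 := exist _ (ev0 G 1 z, z) erefl.
have := ftr_square om zz; rewrite oms omt ev_s_fapp => sq.
apply/(square_equiv Cq sq) => //.
have -> : fapp (fpre p ev1_over 0 N) 1 zz = fapp N 1 (cst 1 x') by rewrite -z1.
by rewrite cst_nat; apply: is_equiv_cst.
Qed.

End Monoid.
End Main.

(** * Families of functors *)

Section IntoFull.
Variables (X Y : sSet) (u : smap X Y) (Q : Y 0 -> Prop).
Hypothesis uQ : forall x, Q (u 0 x).

Lemma into_full_proof n (x : X n) i : Q (vertex (u n x) i).
Proof. by rewrite -vertex_nat. Qed.

Program Definition into_full : smap X (full Q) :=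
  @SMap X (full Q) (fun n x => exist _ (u n x) (into_full_proof x)) _.
Next Obligation. by apply: sig_eq; apply: sm_nat. Qed.

End IntoFull.

Section FunFull.
Variables (Z Y : sSet) (P : Y 0 -> Prop).

Definition fun_in (h : Fun Z Y 0) := forall z, P (h 0 (z, simp_cst 0 ord0)).

Lemma fun_full_proof n (h : full fun_in n) m (w : sprod Z (simplex n) m) i : P (vertex (sval h m w) i).
Proof.
have := svalP h (w.2 i) (vertex w.1 i); congr (P _).
rewrite -[RHS]vertex_nat /=; congr (sval h 0 (_, _)); exact: simp_eq.
Qed.

Definition fun_full_map n (h : full fun_in n) : Fun Z (full P) n.
exists (fun m w => exist _ (sval h m w) (fun_full_proof h w)).
by move=> m k f w; apply: sig_eq; apply: (sm_nat (sval h)).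
Defined.

Program Definition fun_full : smap (full fun_in) (Fun Z (full P)) :=
  @SMap (full fun_in) (Fun Z (full P)) fun_full_map _.
Next Obligation. by apply: smap_eq => k w; apply: sig_eq. Qed.

End FunFull.

Section FunOverFull.
Variables (A B S : sSet) (r : smap A S) (q : smap B S) (P : B 0 -> Prop).
Let qP := smap_comp q (sincl (@full_stable B P)).

Definition fover_in (h : FunOver r q 0) := forall a, P (fapp h 0 a).

Lemma fover_full_proof n (h : full fover_in n) m (w : sprod A (simplex n) m) i :
  P (vertex (sval (sval h) m w) i).
Proof.
have := svalP h (w.2 i) (vertex w.1 i); congr (P _).
rewrite -[RHS]vertex_nat; congr (sval (sval h) 0 (_, _)); exact: simp_eq.
Qed.

Definition fover_full_map n (h : full fover_in n) : FunOver r qP n.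
unshelve refine (exist _ _ _).
  exists (fun m w => exist _ (sval (sval h) m w) (fover_full_proof h w)).
  by move=> m k f w; apply: sig_eq; apply: (sm_nat (sval (sval h))).
exact: (svalP (sval h)).
Defined.

Lemma fover_incl_inj n (h h' : FunOver r qP n) :
  (forall m w, sval (sval h m w) = sval (sval h' m w)) -> h = h'.
Proof. by move=> H; apply: sig_eq; apply: smap_eq => m w; apply: sig_eq. Qed.

Program Definition fover_full : smap (full fover_in) (FunOver r qP) :=
  @SMap (full fover_in) (FunOver r qP) fover_full_map _.
Next Obligation. exact: fover_incl_inj. Qed.

End FunOverFull.

(** * Currying of functors over a base *)

Section Curry.
Variables (Z A B S : sSet) (r : smap A S) (q : smap B S).

Program Definition rZ : smap (sprod Z A) S := @SMap (sprod Z A) S (fun n w => r n w.2) _.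
Next Obligation. exact: sm_nat. Qed.

Definition curry_at n (t : FunOver rZ q n) m (w : sprod Z (simplex n) m) : FunOver r q m.
unshelve refine (exist _ _ _).
  exists (fun k (a : sprod A (simplex m) k) => sval t k ((sact a.2 w.1, a.1), simp_comp w.2 a.2)).
  move=> k l f a /=; rewrite -sm_nat /= -sact_comp; congr (sval t _ (_, _)); exact: simp_eq.
by move=> k a; apply: (svalP t).
Defined.

Definition curry_map n (t : FunOver rZ q n) : Fun Z (FunOver r q) n.
exists (fun m w => curry_at t w).
move=> m k f w; apply: sig_eq; apply: smap_eq => l a /=.
by rewrite sact_comp; congr (sval t _ (_, _)); apply: simp_eq.
Defined.

Program Definition curry : smap (FunOver rZ q) (Fun Z (FunOver r q)) :=
  @SMap (FunOver rZ q) (Fun Z (FunOver r q)) curry_map _.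
Next Obligation.
apply: smap_eq => k w; apply: sig_eq; apply: smap_eq => l a /=.
congr (x l (_, _)); exact: simp_eq.
Qed.

Definition uncurry_map n (E : Fun Z (FunOver r q) n) : FunOver rZ q n.
unshelve refine (exist _ _ _).
  exists (fun k (a : sprod (sprod Z A) (simplex n) k) => sval (E k (a.1.1, a.2)) k (a.1.2, simp_id k)).
  move=> k l f a; rewrite -[RHS]sm_nat.
  have -> : E k ((sact f a).1.1, (sact f a).2) = sact f (E l (a.1.1, a.2)) by rewrite -[RHS](sm_nat E).
  congr (sval (E l (a.1.1, a.2)) k (_, _)); exact: simp_eq.
by move=> k a; apply: (svalP (E k (a.1.1, a.2))).
Defined.

Program Definition uncurry : smap (Fun Z (FunOver r q)) (FunOver rZ q) :=
  @SMap (Fun Z (FunOver r q)) (FunOver rZ q) uncurry_map _.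
Next Obligation. by apply: sig_eq; apply: smap_eq. Qed.

Lemma uncurryK n (E : Fun Z (FunOver r q) n) : curry n (uncurry n E) = E.
Proof.
apply: smap_eq => m w; apply: sig_eq; apply: smap_eq => k a /=.
have -> : E k (sact a.2 w.1, simp_comp w.2 a.2) = sact a.2 (E m w) by rewrite -[RHS](sm_nat E).
case: a => a s; congr (sval (E m w) k (_, _)); exact: simp_eq.
Qed.

Lemma uncurry_ftr (E : Fun Z (FunOver r q) 1) z a :
  ftr (uncurry 1 E) (z, a) = ftr (E 1 (cst 1 z, simp_id 1)) a.
Proof. by []. Qed.

Lemma curry_ftr (t : FunOver rZ q 1) z a : ftr (curry 1 t 1 (cst 1 z, simp_id 1)) a = ftr t (z, a).
Proof.
transitivity (sval t 1 ((sact (simp_id 1) (cst 1 z), cst 1 a), simp_comp (simp_id 1) (simp_id 1))) => //.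
by rewrite sact_id simp_compI.
Qed.

Hypotheses (qin : inner_fibration q) (Sq : quasicat S).

(** A transformation between families indexed by [Z] is uncurried to one between functors on the
    product of [Z] and [A], where invertibility is pointwise. Fullness of [P] leaves only the two
    ends to be checked. *)
Lemma natural_equiv (P : FunOver r q 0 -> Prop) (a b : smap Z (full P)) (E : Fun Z (FunOver r q) 1) :
  src E = fun_vertex (smap_comp (sincl (@full_stable _ P)) a) ->
  tgt E = fun_vertex (smap_comp (sincl (@full_stable _ P)) b) ->
  (forall z x, is_equiv (ftr (E 1 (cst 1 z, simp_id 1)) x)) ->
  exists e : Fun Z (full P) 1, [/\ src e = fun_vertex a, tgt e = fun_vertex b & is_equiv e].
Proof.
move=> Es Et Ee.
have Eq : is_equiv E.
  rewrite -[E]uncurryK; apply: is_equiv_nat; apply: (fun_is_equiv qin Sq) => -[z x].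
  by rewrite uncurry_ftr.
have in0 (c : smap Z (full P)) : fun_in P (fun_vertex (smap_comp (sincl (@full_stable _ P)) c)).
  by move=> z; have := svalP (c 0 z) ord0; rewrite vertex0.
have Ps : fun_in P (src E) by rewrite Es.
have Pt : fun_in P (tgt E) by rewrite Et.
exists (fun_full Z P 1 (full_edge Ps Pt)); split.
- apply: smap_eq => n w; apply: sig_eq.
  exact: (congr1 (fun h : Fun Z (FunOver r q) 0 => h n w) Es).
- apply: smap_eq => n w; apply: sig_eq.
  exact: (congr1 (fun h : Fun Z (FunOver r q) 0 => h n w) Et).
- by apply: is_equiv_nat; apply: full_is_equiv.
Qed.

End Curry.

Section PreHomotopy.
Variables (A A' B S : sSet) (r : smap A S) (q : smap B S) (r' : smap A' S).
Variable T : smap (sprod A' (simplex 1)) A.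
Hypothesis rT : forall n w, r n (T n w) = r' n w.1.

Lemma fpre_htpy_over n (w : sprod (FunOver r q) (simplex 1) n) k (a : sprod A' (simplex n) k) :
  q k (sval w.1 k (T k (a.1, simp_comp w.2 a.2), a.2)) = r' k a.1.
Proof.
apply: etrans (rT (a.1, simp_comp w.2 a.2 : simplex 1 k)).
exact: (svalP w.1 k (T k (a.1, simp_comp w.2 a.2), a.2)).
Qed.

Definition fpre_htpy_at n (w : sprod (FunOver r q) (simplex 1) n) : FunOver r' q n.
unshelve refine (exist _ _ _).
  exists (fun k (a : sprod A' (simplex n) k) => sval w.1 k (T k (a.1, simp_comp w.2 a.2), a.2)).
  move=> k l f a; rewrite -[RHS]sm_nat; congr (sval w.1 k (_, _)).
  by rewrite -[RHS]sm_nat; congr (T k (_, _)); apply: simp_eq.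
exact: fpre_htpy_over.
Defined.

(** A homotopy [T] that is constant over the base induces a path from precomposition with its start
    to precomposition with its end, on all simplices of [FunOver] at once. *)
Program Definition fpre_htpy : smap (sprod (FunOver r q) (simplex 1)) (FunOver r' q) :=
  @SMap (sprod (FunOver r q) (simplex 1)) (FunOver r' q) fpre_htpy_at _.
Next Obligation.
apply: sig_eq; apply: smap_eq => k a /=; congr (s k (T k (_, _), _)); exact: simp_eq.
Qed.

End PreHomotopy.

(** * The equivalence *)

Section Final.
Variables (G : finGroupType) (C : sSet) (p : smap C (orbits_op G)).
Hypotheses (C_gcat : cocartesian_fibration p) (C_prod : has_finite_indexed_products p).
Variable D : cotensor p.

Notation q := (ctq D).
Notation PG := (pullback (smap_id (fin G)) (ev0 G)).
Notation idr := (smap_id (fin G)).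

Let Dg : Gcat q := D_gcat D.
Let qin : inner_fibration q := @D_inner G C p D.
Let Dq : quasicat D := @D_quasicat G C p D.
Let Cq : quasicat C := C_quasicat C_gcat.

Definition isA (s : FunOver idr (cartq D) 0) :=
  preserves_cocartesian (fin_proj G) (base_of (cartq D)) s /\ inert_to_cocartesian s.
Definition isM (F : FunOver (fin_proj G) p 0) := preserves_cocartesian (fin_proj G) p F /\ segal F.
Definition isE (s : FunOver idr q 0) := preserves_cocartesian (base_of idr) (base_of q) s.
Definition isQ (h : FunOver (gam_base idr) p 0) := preserves_cocartesian (gam_base idr) p h.

Lemma isE_fin (s : FunOver idr q 0) :
  isE s <-> preserves_cocartesian (fin_proj G) (base_of q) s.
Proof. by rewrite /isE base_of_id. Qed.

Lemma comparison_proof (s : CAlg D 0) : isM (smap_comp (underlying D) (sincl (@full_stable _ isA)) 0 s).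
Proof.
have [sP si] : isA (sval s) by have := svalP s ord0; rewrite vertex0.
by split; [exact: underlying_cocart | exact: underlying_segal].
Qed.

Definition comparison : smap (CAlg D) (CMon p) := into_full comparison_proof.

Definition ev1_pre : smap (FunOver (fin_proj G) p) (FunOver (gam_base idr) p) := fpre p (@ev1_over G).

Definition dpair n (x : fin G n) : PG n := exist _ (x, diag G n x) (esym (diag_ev0 x)).

Definition dmap : smap (fin G) PG.
exists dpair; move=> m n f x; apply: sig_eq; congr (_, _); exact: sm_nat.
Defined.

Lemma dmap_over n (x : fin G n) : gam_base idr n (dmap n x) = fin_proj G n x.
Proof. by []. Qed.

Definition diag_pre : smap (FunOver (gam_base idr) p) (FunOver (fin_proj G) p) := fpre p dmap_over.

Lemma ev1_pre_proof (N : CMon p 0) : isQ (smap_comp ev1_pre (sincl (@full_stable _ isM)) 0 N).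
Proof.
have [NP _] : isM (sval N) by have := svalP N ord0; rewrite vertex0.
by move=> e ec; have [_ fc] := pull_cocart_pr (gcat_id G) ec; apply: (NP _ fc).
Qed.

Definition ev1_monoids : smap (CMon p) (full isQ) := into_full ev1_pre_proof.

Lemma algebra_sections_proof (s : CAlg D 0) : isE (smap_comp (fincl D) (sincl (@full_stable _ isA)) 0 s).
Proof.
have [sP si] : isA (sval s) by have := svalP s ord0; rewrite vertex0.
by apply/isE_fin; apply: fincl_P.
Qed.

Definition algebra_sections : smap (CAlg D) (full isE) := into_full algebra_sections_proof.

Definition eta_pair n (w : sprod PG (simplex 1) n) : PG n :=
  exist _ (ev0 G n (eta G n ((sval w.1).2, w.2)), eta G n ((sval w.1).2, w.2)) erefl.

Definition eta_map : smap (sprod PG (simplex 1)) PG.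
exists eta_pair; move=> m n f w; apply: sig_eq.
have H := sm_nat (eta G) f ((sval w.1).2, w.2).
congr (_, _); last exact: H.
by rewrite -[RHS]sm_nat; congr (ev0 G m _); apply: H.
Defined.

Lemma eta_map_over n (w : sprod PG (simplex 1) n) : gam_base idr n (eta_map n w) = gam_base idr n w.1.
Proof.
rewrite -[LHS]/(fin_proj G n (ev0 G n (eta G n ((sval w.1).2, w.2)))) -base_ev1 eta_ev1 base_ev1.
by rewrite -(svalP w.1).
Qed.

Definition eta_pre : smap (sprod (FunOver (gam_base idr) p) (simplex 1)) (FunOver (gam_base idr) p) :=
  fpre_htpy p eta_map_over.

Lemma eta_pre0 n (h : FunOver (gam_base idr) p n) : eta_pre n (h, simp_cst n ord0) = h.
Proof.
apply: sig_eq; apply: smap_eq => k [z t]; congr (sval h k (_, _)); apply: sig_eq.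
rewrite [RHS]surjective_pairing.
have E : eta G k ((sval z).2, simp_comp (simp_cst n ord0) t) = (sval z).2.
  by rewrite -[RHS]eta0; congr (eta G k (_, _)); apply: simp_eq.
transitivity (ev0 G k (eta G k ((sval z).2, simp_comp (simp_cst n ord0) t)),
  eta G k ((sval z).2, simp_comp (simp_cst n ord0) t)) => //.
rewrite E; congr (_, _); exact/esym/(svalP z).
Qed.

Lemma eta_pre1 n (h : FunOver (gam_base idr) p n) :
  eta_pre n (h, simp_cst n ord_max) = ev1_pre n (diag_pre n h).
Proof.
apply: sig_eq; apply: smap_eq => k [z t]; congr (sval h k (_, _)); apply: sig_eq.
have E : eta G k ((sval z).2, simp_comp (simp_cst n ord_max) t) = diag G k (ev1 G k (sval z).2).
  by rewrite -[RHS]eta1; congr (eta G k (_, _)); apply: simp_eq.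
transitivity (ev0 G k (eta G k ((sval z).2, simp_comp (simp_cst n ord_max) t)),
  eta G k ((sval z).2, simp_comp (simp_cst n ord_max) t)) => //.
rewrite E; congr (_, _); exact: diag_ev0.
Qed.

Lemma underlying_diag n (s : FunOver idr (cartq D) n) :
  underlying D n s = diag_pre n (ev_comp (ctev_over (c := D)) idr n (fincl D n s)).
Proof.
apply: sig_eq; apply: smap_eq => k [x t]; congr (ctev D k _); exact: sig_eq.
Qed.

(** * The inverse functor and the two homotopies *)

Section Inverse.
Variable psi : smap (full isE) (full isQ).
Hypothesis psiE : forall n x, sval (psi n x) = ev_comp (ctev_over (c := D)) idr n (sval x).
Variable psi' : smap (full isQ) (full isE).
Variable e1 : Fun (full isE) (full isE) 1.
Hypotheses (e1s : src e1 = fun_vertex (smap_comp psi' psi)) (e1t : tgt e1 = fun_vertex (smap_id _)).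
Hypothesis e1e : is_equiv e1.
Variable e2 : Fun (full isQ) (full isQ) 1.
Hypotheses (e2s : src e2 = fun_vertex (smap_comp psi psi')) (e2t : tgt e2 = fun_vertex (smap_id _)).
Hypothesis e2e : is_equiv e2.

(** The section whose functor is [N] after [ev1], found through the quasi-inverse [psi'] of the
    universal equivalence, for all simplices of the category of monoids at once. *)
Definition monoid_sections : smap (CMon p) (FunOver idr q) :=
  smap_comp (sincl (@full_stable _ isE)) (smap_comp psi' ev1_monoids).

Lemma monoid_sections_cocart (N : CMon p 0) : preserves_cocartesian (fin_proj G) (base_of q) (monoid_sections 0 N).
Proof. by apply/isE_fin; have := svalP (psi' 0 (ev1_monoids 0 N)) ord0; rewrite vertex0. Qed.

Definition monoid_section_trans (N : CMon p 0) : FunOver (gam_base idr) p 1 := sval (e2 1 (cst 1 (ev1_monoids 0 N), simp_id 1)).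

Lemma src_monoid_section_trans N : src (monoid_section_trans N) = ev_comp (ctev_over (c := D)) idr 0 (monoid_sections 0 N).
Proof.
have -> : src (monoid_section_trans N) = sval (src (e2 1 (cst 1 (ev1_monoids 0 N), simp_id 1))) by [].
by rewrite (src_fun _ e2s) psiE.
Qed.

Lemma tgt_monoid_section_trans N : tgt (monoid_section_trans N) = ev1_pre 0 (sval N).
Proof.
have -> : tgt (monoid_section_trans N) = sval (tgt (e2 1 (cst 1 (ev1_monoids 0 N), simp_id 1))) by [].
by rewrite (tgt_fun _ e2t).
Qed.

Lemma monoid_section_trans_equiv N z : is_equiv (ftr (monoid_section_trans N) z).
Proof.
apply: ftr_equiv; apply: (is_equiv_nat (sincl (@full_stable _ isQ))).
exact: (is_equiv_nat (fun_eval (full isQ) (ev1_monoids 0 N)) e2e).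
Qed.

Lemma monoid_sections_cartesian (N : CMon p 0) : fover_in (@cartesian_object G C p D) (monoid_sections 0 N).
Proof.
have [_ NS] : isM (sval N) by have := svalP N ord0; rewrite vertex0.
move=> x; apply: (monoid_cart C_gcat C_prod NS (@monoid_sections_cocart N) (src_monoid_section_trans N) (tgt_monoid_section_trans N)).
exact: monoid_section_trans_equiv.
Qed.

Definition monoid_cart_sections : smap (CMon p) (FunOver idr (cartq D)) :=
  smap_comp (fover_full idr q (@cartesian_object G C p D)) (into_full monoid_sections_cartesian).

Lemma monoid_cart_sections_algebra (N : CMon p 0) : isA (monoid_cart_sections 0 N).
Proof.
have [_ NS] : isM (sval N) by have := svalP N ord0; rewrite vertex0.
split=> [e ec|V U W f fi].
  have -> : base_of (cartq D) = smap_comp (base_of q) (cart_incl D) by exact: smap_eq.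
  by apply: full_cocart; apply: (@monoid_sections_cocart N).
apply: full_cocart.
exact: (monoid_inert C_gcat (@monoid_sections_cocart N) (src_monoid_section_trans N) (tgt_monoid_section_trans N) (@monoid_section_trans_equiv N) (x := Gamma fi)).
Qed.

Definition monoid_algebra : smap (CMon p) (CAlg D) := into_full monoid_cart_sections_algebra.

Lemma comparison_monoid_algebra n (N : CMon p n) : sval (comparison n (monoid_algebra n N)) =
  diag_pre n (ev_comp (ctev_over (c := D)) idr n (monoid_sections n N)).
Proof.
rewrite -[LHS]/(underlying D n (monoid_cart_sections n N)) underlying_diag; congr (diag_pre n (ev_comp _ _ n _)).
by apply: sig_eq; apply: smap_eq.
Qed.

Lemma diag_ev1_pre n (F : FunOver (fin_proj G) p n) : diag_pre n (ev1_pre n F) = F.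
Proof.
apply: sig_eq; apply: smap_eq => k [x t]; congr (sval F k (_, _)); exact: diag_ev1.
Qed.

(** The homotopy [e2] restricted to the diagonal. It ends at the identity because restricting [N]
    after [ev1] to the diagonal gives [N] on the nose. *)
Definition monoid_trans : Fun (CMon p) (FunOver (fin_proj G) p) 1.
exists (fun n w => diag_pre n (sval (e2 n (ev1_monoids n w.1, w.2)))).
move=> m n f w; rewrite -[RHS](sm_nat diag_pre); congr (diag_pre m _).
rewrite -[RHS]/(sval (sact f (e2 n (ev1_monoids n w.1, w.2)))) -(sm_nat e2); congr (sval (e2 m (_, _))).
exact: (sm_nat ev1_monoids).
Defined.

Lemma comparison_monoid_algebra_equiv : exists e : Fun (CMon p) (CMon p) 1,
  [/\ src e = fun_vertex (smap_comp comparison monoid_algebra), tgt e = fun_vertex (smap_id _) & is_equiv e].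
Proof.
apply: (natural_equiv (C_inner C_gcat) (@orbits_quasicat G) (E := monoid_trans)).
- apply: smap_eq => n [N t]; rewrite -[RHS]/(sval (comparison n (monoid_algebra n N))) comparison_monoid_algebra.
  transitivity (diag_pre n (sval ((src e2 : smap _ _) n (ev1_monoids n N, t)))).
    by [].
  by rewrite e2s; congr (diag_pre n _); apply: psiE.
- apply: smap_eq => n [N t].
  transitivity (diag_pre n (sval ((tgt e2 : smap _ _) n (ev1_monoids n N, t)))).
    by [].
  by rewrite e2t; apply: diag_ev1_pre.
move=> N x; have := monoid_section_trans_equiv N (dmap 0 x); rewrite -(fpre_ftr dmap_over) => H.
have -> : monoid_trans 1 (cst 1 N, simp_id 1) = diag_pre 1 (monoid_section_trans N).
  by congr (diag_pre 1 (sval (e2 1 (_, _)))); apply: cst_nat.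
exact: H.
Qed.

Lemma psi_diag n (s : CAlg D n) : diag_pre n (sval (psi n (algebra_sections n s))) = sval (comparison n s).
Proof. by rewrite psiE -[RHS]/(underlying D n (sval s)) underlying_diag. Qed.

(** The path induced by the unit [eta], from the functor of an algebra to [N] after [ev1] for its
    underlying monoid [N]. *)
Definition etaA : smap (sprod (CAlg D) (simplex 1)) (FunOver (gam_base idr) p).
exists (fun n w => eta_pre n (sval (psi n (algebra_sections n w.1)), w.2)).
move=> m n f w; rewrite -[RHS](sm_nat eta_pre); congr (eta_pre m (_, _)).
exact: (sm_nat (smap_comp (sincl (@full_stable _ isQ)) (smap_comp psi algebra_sections)) f w.1).
Defined.

Lemma etaA0 n (s : CAlg D n) : etaA n (s, simp_cst n ord0) = sval (psi n (algebra_sections n s)).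
Proof. exact: eta_pre0. Qed.

Lemma etaA1 n (s : CAlg D n) : etaA n (s, simp_cst n ord_max) = ev1_pre n (sval (comparison n s)).
Proof. by rewrite [LHS]eta_pre1 psi_diag. Qed.

Lemma etaA_in w : isQ (etaA 0 w).
Proof.
case: w => s t; have := etaA0 s; have := etaA1 s.
have : t = simp_cst 0 ord0 \/ t = simp_cst 0 ord_max.
  by case: (ord2P (t ord0)) => et; [left|right]; apply: simp_eq => i; rewrite (ord1 i) et.
case=> -> E1 E0; rewrite ?E0 ?E1; first by have := svalP (psi 0 (algebra_sections 0 s)) ord0; rewrite vertex0.
exact: ev1_pre_proof.
Qed.

Definition etaQ : smap (sprod (CAlg D) (simplex 1)) (full isQ) := into_full etaA_in.

(** With [counit_trans] this forms a span out of [psi' psi s]: one leg leads to the section rebuilt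
    from the underlying monoid, the other, given by [e1], to [s] itself. Both are pointwise
    invertible. *)
Definition unit_trans : Fun (CAlg D) (FunOver idr q) 1 :=
  smap_comp (sincl (@full_stable _ isE)) (smap_comp psi' etaQ).

Definition counit_trans : Fun (CAlg D) (FunOver idr q) 1.
exists (fun n w => sval (e1 n (algebra_sections n w.1, w.2))).
move=> m n f w; rewrite -[RHS]/(sval (sact f (e1 n (algebra_sections n w.1, w.2)))) -(sm_nat e1).
congr (sval (e1 m (_, _))); exact: (sm_nat algebra_sections).
Defined.

Lemma src_unit_trans : src unit_trans = src counit_trans.
Proof.
apply: smap_eq => n [s t].
transitivity (sval ((src e1 : smap _ _) n (algebra_sections n s, t))); last by [].
rewrite e1s; congr (sval (psi' n _)); apply: sig_eq.
rewrite -[LHS]/(etaA n (s, simp_comp (simp_cst 0 ord0) t)).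
have -> : simp_comp (simp_cst 0 ord0) t = simp_cst n ord0 :> simplex 1 n by exact: simp_eq.
exact: etaA0.
Qed.

Lemma tgt_unit_trans : tgt unit_trans = fun_vertex (smap_comp monoid_sections comparison).
Proof.
apply: smap_eq => n [s t]; congr (sval (psi' n _)); apply: sig_eq.
rewrite -[LHS]/(etaA n (s, simp_comp (simp_cst 0 ord_max) t)).
have -> : simp_comp (simp_cst 0 ord_max) t = simp_cst n ord_max :> simplex 1 n by exact: simp_eq.
exact: etaA1.
Qed.

Lemma tgt_counit_trans : tgt counit_trans = fun_vertex (smap_comp (fincl D) (sincl (@full_stable _ isA))).
Proof.
apply: smap_eq => n [s t].
transitivity (sval ((tgt e1 : smap _ _) n (algebra_sections n s, t))); first by [].
by rewrite e1t.
Qed.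

Lemma unit_trans_equiv s x : is_equiv (ftr (unit_trans 1 (cst 1 s, simp_id 1)) x).
Proof.
have [sP si] : isA (sval s) by have := svalP s ord0; rewrite vertex0.
apply: ftr_equiv; apply: (is_equiv_nat (sincl (@full_stable _ isE))); apply: (is_equiv_nat psi').
apply: full_is_equiv; apply: (fun_is_equiv (C_inner C_gcat) (@orbits_quasicat G)) => z.
have H := ev_s_eta C_gcat C_prod si (fo (sval z).2 ord0).
have -> : ftr (etaA 1 (cst 1 s, simp_id 1)) z =
    ev_s (fincl D 0 (sval s)) 1 (eta_at (nvert (A := gam_cat G) (fo (sval z).2 ord0))).
  rewrite -[nvert _](nvert_eta (sval z).2).
  have es : algebra_sections 1 (cst 1 s) = cst 1 (algebra_sections 0 s) by exact: cst_nat.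
  transitivity (ftr (eta_pre 1 (sval (psi 1 (algebra_sections 1 (cst 1 s))), simp_id 1)) z) => //; rewrite psiE es.
  by congr (ctev D 1 _); apply: sig_eq.
exact: H.
Qed.

Lemma counit_trans_equiv s x : is_equiv (ftr (counit_trans 1 (cst 1 s, simp_id 1)) x).
Proof.
apply: ftr_equiv; apply: (is_equiv_nat (sincl (@full_stable _ isE))).
have -> : algebra_sections 1 (cst 1 s) = cst 1 (algebra_sections 0 s) by exact: cst_nat.
exact: (is_equiv_nat (fun_eval (full isE) (algebra_sections 0 s)) e1e).
Qed.

Lemma monoid_algebra_comparison_equiv : exists e : Fun (CAlg D) (CAlg D) 1,
  [/\ src e = fun_vertex (smap_comp monoid_algebra comparison), tgt e = fun_vertex (smap_id _) & is_equiv e].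
Proof.
pose a := uncurry _ _ _ 1 unit_trans; pose b := uncurry _ _ _ 1 counit_trans.
have ae x : is_equiv (ftr a x) by case: x => s x; exact: (unit_trans_equiv s x).
have be x : is_equiv (ftr b x) by case: x => s x; exact: (counit_trans_equiv s x).
(* Closing the span gives a transformation from the rebuilt section to [s]. *)
have [|c cc] := fun_span qin (@fin_quasicat G) ae (b := b).
  by rewrite -!src_nat src_unit_trans.
have ce x : is_equiv (ftr c x) := is_equiv_right Dq (ftr_composite x cc) (ae x) (be x).
have [c1 c2 c3] := composite_ends cc.
have cs : curry _ _ _ 0 (src c) = fun_vertex (smap_comp monoid_sections comparison).
  by rewrite -c1 -tgt_nat uncurryK tgt_unit_trans.
have ct : curry _ _ _ 0 (tgt c) = fun_vertex (smap_comp (fincl D) (sincl (@full_stable _ isA))).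
  by rewrite -c3 -tgt_nat uncurryK tgt_counit_trans.
have csP : fover_in (@cartesian_object G C p D) (src c).
  move=> [s x]; rewrite -c1 -tgt_nat tgt_unit_trans.
  have H := @monoid_sections_cartesian (comparison 0 s) x.
  have -> : fapp (uncurry (CAlg D) idr q 0 (fun_vertex (smap_comp monoid_sections comparison))) 0 (s, x) = fapp (monoid_sections 0 (comparison 0 s)) 0 x.
    by congr (sval (monoid_sections 0 (comparison 0 s)) 0 (_, _)); apply: simp0_eq.
  exact: H.
have ctP : fover_in (@cartesian_object G C p D) (tgt c).
  move=> [s x]; rewrite -c3 -tgt_nat tgt_counit_trans.
  have H := @fincl_cart _ _ _ _ (sval s) x.
  have -> : fapp (uncurry (CAlg D) idr q 0 (fun_vertex (smap_comp (fincl D) (sincl (@full_stable _ isA))))) 0 (s, x) =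
      fapp (fincl D 0 (sval s)) 0 x.
    by congr (sval (fincl D 0 (sval s)) 0 (_, _)); apply: simp0_eq.
  exact: H.
(* The closing edge was found among sections of [D]; since both its ends are cartesian, it is an
   edge of sections of [cart D]. *)
pose cl : FunOver (rZ (CAlg D) idr) (cartq D) 1 :=
  fover_full (rZ (CAlg D) idr) q (@cartesian_object G C p D) 1 (full_edge csP ctP).
apply: (natural_equiv (@cartq_inner G C p D) (@fin_quasicat G) (E := curry _ _ _ 1 cl)).
- apply: smap_eq => n [s t]; apply: fover_incl_inj => m w.
  exact: (congr1 (fun h : Fun (CAlg D) (FunOver idr q) 0 => sval (h n (s, t)) m w) cs).
- apply: smap_eq => n [s t]; apply: fover_incl_inj => m w.
  exact: (congr1 (fun h : Fun (CAlg D) (FunOver idr q) 0 => sval (h n (s, t)) m w) ct).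
move=> s x; rewrite curry_ftr; apply: full_is_equiv; exact: (ce (s, x)).
Qed.

End Inverse.
Lemma comparison_equivalence : cat_equivalence comparison.
Proof.
have [psi [psiE [psi' [[e1 [e1s e1t e1e]] [e2 [e2s e2t e2e]]]]]] := cotensor_univ D (gcat_id G).
exists (monoid_algebra psiE e2s e2t e2e); split.
  exact: (monoid_algebra_comparison_equiv psiE e1s e1t e1e e2s e2t e2e).
exact: comparison_monoid_algebra_equiv.
Qed.

End Final.

(* The canonical equivalence is stated for the comparison functor [underlying],
   which evaluates a section s at the identity arrows: U |-> (s U) (id_U). *)
Theorem propositionA23 (G : finGroupType) (C : sSet)
    (p : smap C (orbits_op G)) (C_gcat : cocartesian_fibration p)
    (C_prod : has_finite_indexed_products p) (D : cotensor p) :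
  exists Phi : smap (CAlg D) (CMon p),
    (forall n (s : CAlg D n), sval (Phi n s) = underlying D n (sval s)) /\
    cat_equivalence Phi.
Proof.
exists (comparison C_gcat C_prod D); split=> //.
exact: comparison_equivalence.
Qed.
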